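(* Let $\beta>0$ and let $(\lambda_k)_{k\in\mathbb Z}$ be the points of the $\operatorname{Sine}_\beta$ process. Then almost surely the principal value sum $\lim_{r\to\infty}\sum_{|\lambda_k|\le r}\lambda_k^{-1}$ exists, and it has the Cauchy distribution with density $\frac{1}{2\pi(x^2+1/4)}$, $x\in\mathbb R$.
   Context: The $\operatorname{Sine}_\beta$ process is the point process on $\mathbb R$ obtained as the bulk scaling limit of $\beta$-ensembles; equivalently the $n\to\infty$ distributional limit of $\{n\theta_j\}$ where $e^{i\theta_j}$ ($\theta_j\in(-\pi,\pi]$) are the points of the size-$n$ circular $\beta$-ensemble (joint density proportional to $\prod_{j<k}|z_j-z_k|^\beta$ on the unit circle). It is translation invariant, symmetric in law under $x\mapsto -x$, and has intensity $1/(2\pi)$. *)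

(* Defs.v *)
From HB Require Import structures.
From mathcomp Require Import all_boot all_order all_algebra.
From mathcomp Require Import all_classical all_reals all_analysis.
Set Implicit Arguments. Unset Strict Implicit. Unset Printing Implicit Defensive.
Import Order.TTheory GRing.Theory Num.Theory.
Import numFieldNormedType.Exports.
Local Open Scope classical_set_scope.
Local Open Scope ring_scope.

Definition circ_dist {R : realType} (a b : R) : R :=
  Num.sqrt ((cos a - cos b) ^+ 2 + (sin a - sin b) ^+ 2).

Definition circ_dom {R : realType} : set R := `]-pi, pi].

(* iterated Lebesgue integral over (-pi, pi]^n of a nonnegative function of
   (theta_1, ..., theta_n) given as a list; by Tonelli this is the integral
   w.r.t. n-dimensional Lebesgue measure on (-pi,pi]^n *)
Fixpoint cube_integral {R : realType} (n : nat) (g : seq R -> \bar R) : \bar R :=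
  match n with
  | 0 => g [::]
  | n'.+1 => (\int[@lebesgue_measure R]_(x in circ_dom) cube_integral n' (fun s => g (x :: s)))%E
  end.

Fixpoint cbe_weight {R : realType} (beta : R) (s : seq R) : R :=
  match s with
  | [::] => 1
  | x :: s' => (\prod_(y <- s') (circ_dist x y) `^ beta) * cbe_weight beta s'
  end.

Definition cbe_laplace {R : realType} (beta : R) (n : nat) (f : R -> R) : R :=
  fine (cube_integral n (fun s =>
          (expR (- \sum_(t <- s) f (n%:R * t)) * cbe_weight beta s)%:E))
  / fine (cube_integral n (fun s => (cbe_weight beta s)%:E)).

Definition Cc_plus {R : realType} (f : R -> R) : Prop :=
  continuous f /\ (forall x, 0 <= f x) /\
  exists M : R, forall x, M < `|x| -> f x = 0.

(* lam : Omega -> (int -> R) is (a labelling of) the Sine_beta process: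
   the counting measure sum_k delta_{lam_k} is the distributional (vague) limit of
   the point process {n theta_j} of the size-n circular beta ensemble, expressed
   through convergence of Laplace functionals on C_c^+ test functions. *)
Definition is_Sine_beta {R : realType} {d : measure_display} {Omega : measurableType d}
  (P : probability Omega R) (beta : R) (lam : int -> Omega -> R) : Prop :=
  (forall k, measurable_fun setT (lam k)) /\
  forall f : R -> R, Cc_plus f ->
    ((cbe_laplace beta n f)%:E @[n --> \oo] -->
      (\int[P]_w expeR (- \esum_(k in [set: int]) (f (lam k w))%:E))%E).

Definition cauchy_half_density {R : realType} (x : R) : R :=
  1 / (2 * pi * (x ^+ 2 + 1 / 4)).

Definition pv_partial {R : realType} {Omega : Type} (lam : int -> Omega -> R)
  (w : Omega) (r : R) : R :=
  (\sum_(k \in [set k | `|lam k w| <= r]) (lam k w)^-1)%R.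

(* Main.v *)
(** For the circular ensemble put U + iV = (1/2n) sum_j (1 + z e^{-i theta_j}) / (1 - z e^{-i theta_j}).
    This is a holomorphic function of z with the deterministic value 1/2 at z = 0, so by rotation
    invariance E[1 / (w + U + iV)] = 1 / (w + 1/2) for every z in the disc and Re w > 0. At
    z = 1 - y/n, as n tends to infinity and then y to 0, the nonnegative U tends to 0 in probability
    and V approximates sum_j 1/(n theta_j) up to sign. Hence the principal value L satisfies
    E[a / (a^2 + (L - b)^2)] = (a + 1/2) / ((a + 1/2)^2 + b^2), which characterises the Cauchy law.

    The error terms are controlled by the energy bound E sum_k (1 - 1/n)^k |p_k|^2 / k <= C n for
    the power sums p_k, obtained by comparing the Vandermonde weight with truncations of
    ln |1 - r e^{it}|^2. It bounds the discrepancy of the number of points in an interval of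
    length x by C sqrt x in L^1, uniformly in n. Convergence of Laplace functionals, with Bernstein
    polynomials in e^{-N f}, gives convergence of the laws of linear statistics, so these bounds
    pass to the limit, where summation by parts yields the almost sure convergence. *)
Require Import Defs.
From HB Require Import structures.
From mathcomp Require Import all_boot all_order all_algebra.
From mathcomp Require Import all_classical all_reals all_analysis.
From mathcomp Require Import perm complex measurable_realfun.
From mathcomp Require Import ring lra zify.
Set Implicit Arguments.
Unset Strict Implicit.
Unset Printing Implicit Defensive.
Import Order.TTheory GRing.Theory Num.Theory.
Import numFieldNormedType.Exports.
Local Open Scope classical_set_scope.
Local Open Scope ring_scope.

(** * Real and trigonometric inequalities *)

Section Calculus.
Context {R : realType}.
Implicit Types (a b x u : R).

(** The limit process is accessible only through Laplace functionals of nonnegative compactly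
    supported functions, so neither 1/x nor a moment of the limit can be used directly. Every
    estimate is proved for the finite ensembles with constants independent of n, then carried over
    through bounded Lipschitz functions of linear statistics.

    Holomorphy survives inversion because U >= 0 keeps w + U + iV away from 0. As U has mean 1/2 at
    every radius, it tends to 0 in probability but not in mean; hence the truncations at 1.

    The slow tail of 1/x is removed by subtracting the conjugate kernel at a large scale r: the
    difference decays like |x|^{-3}, and the subtracted statistic is O(r^{-1/2}) in mean absolute
    value.

    The energy bound needs the partition function only up to factors e^{O(n)}. These come from the
    weight with beta = 2, whose integral (2 pi)^n n! is computed exactly, and from elementary power
    inequalities. *)

Lemma ge0_derive_le (f f' : R -> R) a b : a <= b ->
  (forall x, a <= x <= b -> is_derive x 1 f (f' x)) ->
  (forall x, a <= x <= b -> 0 <= f' x) -> f a <= f b.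
Proof.
move=> ab df f0.
have cf : {within `[a, b], continuous f}.
  apply: derivable_within_continuous => x; rewrite in_itv/= => xab.
  exact: (@ex_derive _ _ _ _ _ _ _ (df x xab)).
have [c] := @MVT_segment R f f' a b ab (fun x hx => df x (subset_itv_oo_cc hx)) cf.
rewrite in_itv/= => cab e.
by rewrite -subr_ge0 e mulr_ge0 ?f0 ?subr_ge0.
Qed.

Lemma sin_le x : 0 <= x -> sin x <= x.
Proof.
move=> x0.
have := @ge0_derive_le (fun t => t - sin t) (fun t => 1 - cos t) 0 x x0.
rewrite sin0 subrr subr_ge0; apply.
by move=> t _; rewrite subr_ge0 cos_le1.
Qed.

Lemma cos_ge x : 1 - x ^+ 2 / 2 <= cos x.
Proof.
wlog x0 : x / 0 <= x => [H|].
  have [|/ltW x0] := leP 0 x; first exact: H.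
  by rewrite -cosN -sqrrN; apply: H; rewrite oppr_ge0.
have := @ge0_derive_le (fun t => cos t - 1 + t ^+ 2 / 2) (fun t => t - sin t) 0 x x0.
rewrite cos0 subrr expr0n mul0r addr0 => H.
have : 0 <= cos x - 1 + x ^+ 2 / 2.
  apply: H => t /andP[t0 _]; last by rewrite subr_ge0 sin_le.
  apply: is_derive_eq; rewrite /GRing.scale/= ; lra.
lra.
Qed.

Lemma sin_ge x : 0 <= x -> x - x ^+ 3 / 6 <= sin x.
Proof.
move=> x0.
have := @ge0_derive_le (fun t => sin t - t + t ^+ 3 / 6) (fun t => cos t - 1 + t ^+ 2 / 2) 0 x x0.
rewrite sin0 subrr expr0n mul0r addr0 => H.
have : 0 <= sin x - x + x ^+ 3 / 6.
  apply: H => t /andP[t0 _]; last by have := cos_ge t; lra.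
  apply: is_derive_eq; rewrite /GRing.scale/= ; lra.
lra.
Qed.

Lemma cos_le x : cos x <= 1 - x ^+ 2 / 2 + x ^+ 4 / 24.
Proof.
wlog x0 : x / 0 <= x => [H|].
  have [|/ltW x0] := leP 0 x; first exact: H.
  have := H (- x); rewrite cosN oppr_ge0 => /(_ x0).
  by rewrite sqrrN (exprM _ 2 2) sqrrN -exprM.
have := @ge0_derive_le (fun t => 1 - t ^+ 2 / 2 + t ^+ 4 / 24 - cos t)
  (fun t => sin t - (t - t ^+ 3 / 6)) 0 x x0.
rewrite cos0 !expr0n/= !mul0r subr0 addr0 subrr subr_ge0; apply.
  move=> t /andP[t0 _]; apply: is_derive_eq; rewrite /GRing.scale/= ; lra.
by move=> t /andP[t0 _]; rewrite subr_ge0 sin_ge.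
Qed.

Lemma norm_sin_le x : `|sin x| <= `|x|.
Proof.
have [x0|x0] := leP 0 x.
  rewrite [`|x|]ger0_norm// ler_norml; have := sin_le x0.
  have := sin_ge x0; have := sin_geN1 x => h1 h2 h3.
  apply/andP; split=> //.
  have [x1|x1] := leP x 1; last by lra.
  nra.
rewrite -normrN -sinN [`|x|]ltr0_norm// ler_norml.
have y0 : 0 <= - x by lra.
move: (- x) y0 => y y0.
have := sin_le y0.
have := sin_ge y0; have := sin_geN1 y => h1 h2 h3.
apply/andP; split=> //.
have [x1|x1] := leP y 1; last by lra.
nra.
Qed.

Lemma norm_sinB_le x : `|sin x - x| <= `|x| ^+ 3 / 6.
Proof.
wlog x0 : x / 0 <= x => [H|].
  have [|/ltW x0] := leP 0 x; first exact: H.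
  by have := H (- x); rewrite oppr_ge0 => /(_ x0); rewrite sinN normrN -opprD !normrN.
rewrite [`|x|]ger0_norm// ler_norml; have := sin_le x0; have := sin_ge x0.
have : 0 <= x ^+ 3 by rewrite exprn_ge0.
by move=> *; apply/andP; split; lra.
Qed.

Lemma norm_chord2B_le x : `|2 - 2 * cos x - x ^+ 2| <= x ^+ 4 / 12.
Proof.
have := cos_ge x; have := cos_le x => h1 h2.
have : 0 <= x ^+ 4 by rewrite (exprM _ 2 2) sqr_ge0.
by move=> ?; rewrite ler_norml; apply/andP; split; lra.
Qed.

Lemma chord2_le x : 2 - 2 * cos x <= x ^+ 2.
Proof. by have := cos_ge x; lra. Qed.

Lemma chord2_half x : 2 - 2 * cos x = 4 * sin (x / 2) ^+ 2.
Proof.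
have -> : cos x = cos (x / 2 + x / 2) by rewrite -splitr.
rewrite cosD sin2cos2; have := cos2Dsin2 (x / 2).
set c := cos _; set s := sin _ => e.
have -> : s * s = 1 - c ^+ 2 by rewrite -e; ring.
ring.
Qed.

(** The constant 9 reflects sin u >= u - u^3/6 >= u/3 for 0 <= u <= 2, used at u = x/2; pi/2 < 2 is
    the only information on pi. *)
Lemma chord2_ge x : `|x| <= pi -> x ^+ 2 / 9 <= 2 - 2 * cos x.
Proof.
wlog x0 : x / 0 <= x => [H|].
  have [|/ltW x0] := leP 0 x; first exact: H.
  move=> h; rewrite -cosN -sqrrN; apply: H; first by rewrite oppr_ge0.
  by rewrite normrN.
rewrite ger0_norm// => xpi.
rewrite chord2_half.
have u0 : 0 <= x / 2 by lra.
have u2 : x / 2 <= 2 by have := @pihalf_lt2 R; lra.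
have -> : x ^+ 2 / 9 = 4 * (x / 2 / 3) ^+ 2 by field.
move: (x / 2) u0 u2 => u u0 u2.
rewrite ler_pM2l//.
have := sin_ge u0 => h.
have h2 : u / 3 <= sin u by nra.
by rewrite ler_pXn2r// ?nnegrE; lra.
Qed.

Lemma chord2_ge0 x : 0 <= 2 - 2 * cos x.
Proof. by have := cos_le1 x; lra. Qed.

End Calculus.

(** * Fejer and Poisson kernels as finite trigonometric sums *)

Section TrigSums.
Context {R : realType}.
Implicit Types (a b x u t : R).

Lemma is_derive_bigsum (I : Type) (r : seq I) (P : pred I) (h : I -> R -> R) (dh : I -> R) x :
  (forall i, P i -> is_derive x 1 (h i) (dh i)) ->
  is_derive x 1 (fun y => \sum_(i <- r | P i) h i y) (\sum_(i <- r | P i) dh i).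
Proof.
move=> H; elim: r => [|i r IH].
  rewrite big_nil (_ : (fun y => _) = cst 0); first exact: is_derive_cst.
  by apply/funext => y; rewrite big_nil.
rewrite big_cons; have [Pi|nPi] := ifPn; last first.
  rewrite (_ : (fun y => _) = (fun y => \sum_(i <- r | P i) h i y)) //.
  by apply/funext => y; rewrite big_cons (negbTE nPi).
rewrite (_ : (fun y => _) = h i + (fun y => \sum_(i <- r | P i) h i y)).
  by have Hi := H _ Pi; apply: is_deriveD.
by apply/funext => y; rewrite big_cons Pi.
Qed.

Lemma is_derive_pow n x : is_derive x 1 (fun y : R => y ^+ n.+1) (n.+1%:R * x ^+ n).
Proof.
elim: n => [|n IH]; first by rewrite expr0 mulr1; exact: is_derive_id.
rewrite (_ : (fun y => _) = (fun y : R => y * y ^+ n.+1)); last first.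
  by apply/funext => y; rewrite exprS.
apply: is_derive_eq; rewrite /GRing.scale/= -[n.+2%:R]natr1 exprS; ring.
Qed.

(** Multiplying by 1 - cos u instead of dividing avoids case distinctions at multiples of 2 pi. *)
Lemma dirichlet_cos u n :
  (1 - cos u) * (1 + 2 * \sum_(1 <= k < n.+1) cos (k%:R * u)) =
  cos (n%:R * u) - cos (n.+1%:R * u).
Proof.
elim: n => [|n IH]; first by rewrite big_geq// mul0r cos0 mul1r; ring.
rewrite big_nat_recr//=.
set B := \sum_(_ <= _ < _) _ in IH *.
have -> : (1 - cos u) * (1 + 2 * (B + cos (n.+1%:R * u))) =
  (1 - cos u) * (1 + 2 * B) + (1 - cos u) * (2 * cos (n.+1%:R * u)) by ring.
rewrite IH.
have -> : cos (n.+2%:R * u) = 2 * cos (n.+1%:R * u) * cos u - cos (n%:R * u).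
  have -> : n.+2%:R * u = n.+1%:R * u + u by rewrite [in RHS]mulrSr -natr1; ring.
  have -> : n%:R * u = n.+1%:R * u - u by rewrite -natr1; ring.
  by rewrite cosB cosD; ring.
ring.
Qed.

Definition fejer n u : R := 1 + 2 * \sum_(1 <= k < n) (1 - k%:R / n%:R) * cos (k%:R * u).

(** Passing from n to n + 1 adds a Dirichlet kernel to n times the Fejer kernel, and by
    [dirichlet_cos] the right-hand sides telescope. *)
Lemma fejerM n u : (0 < n)%N ->
  (1 - cos u) * (n%:R * fejer n u) = 1 - cos (n%:R * u).
Proof.
move=> n0.
have -> : n%:R * fejer n u =
    n%:R + 2 * \sum_(1 <= k < n) (n%:R - k%:R) * cos (k%:R * u).
  rewrite /fejer mulrDr mulr1 [n%:R * (2 * _)]mulrCA; congr (_ + 2 * _).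
  rewrite mulr_sumr.
  apply: eq_bigr => k _; rewrite mulrA; congr (_ * _).
  by rewrite mulrBr mulr1 mulrCA divff ?mulr1// pnatr_eq0 -lt0n.
elim: n n0 => // -[|n] IH _.
  by rewrite big_geq// !mul1r; ring.
rewrite big_nat_recr//=.
have -> : \sum_(1 <= i < n.+1) (n.+2%:R - i%:R) * cos (i%:R * u) =
  \sum_(1 <= i < n.+1) (n.+1%:R - i%:R) * cos (i%:R * u) +
  \sum_(1 <= i < n.+1) cos (i%:R * u).
  by rewrite -big_split/=; apply: eq_bigr => k _; rewrite -[n.+2%:R]natr1; ring.
set A := \sum_(1 <= i < _) (_ * _); set B := \sum_(1 <= i < _) _.
have := dirichlet_cos u n.+1; rewrite big_nat_recr//= -/B => e.
have := IH isT; rewrite -/A => e2.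
transitivity ((1 - cos u) * (n.+1%:R + 2 * A) +
    (1 - cos u) * (1 + 2 * (B + cos (n.+1%:R * u)))).
  by rewrite -[n.+2%:R]natr1; ring.
by rewrite e e2; ring.
Qed.

Lemma cos_natM_eq1 u k : cos u = 1 -> cos (k%:R * u) = 1.
Proof.
move=> c1; have s1 : sin u = 0 by apply: cos1sin0; rewrite c1 normr1.
suff : cos (k%:R * u) = 1 /\ sin (k%:R * u) = 0 by case.
elim: k => [|k [IH1 IH2]]; first by rewrite mul0r cos0 sin0.
by rewrite -natr1 mulrDl mul1r cosD sinD IH1 IH2 c1 s1; split; ring.
Qed.

Lemma fejer_ge0 n u : (0 < n)%N -> 0 <= fejer n u.
Proof.
move=> n0; have n0' : (0 : R) < n%:R by rewrite ltr0n.
have [c1|c1] := eqVneq (cos u) 1.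
  rewrite /fejer addr_ge0// mulr_ge0// big_nat_cond sumr_ge0// => k.
  rewrite andbT => /andP[_ kn].
  by rewrite cos_natM_eq1// mulr1 subr_ge0 ler_pdivrMr// mul1r ler_nat ltnW.
have c0 : 0 < 1 - cos u by rewrite subr_gt0 lt_neqAle c1 cos_le1.
by rewrite -(pmulr_rge0 _ n0') -(pmulr_rge0 _ c0) fejerM// subr_ge0 cos_le1.
Qed.

(** Combine n F (1 - cos u) <= 2 with [chord2_ge]; this gives 36 = 2 * 2 * 9. *)
Lemma fejer_le n u : (0 < n)%N -> 0 < u -> u <= pi -> fejer n u <= 36 / (n%:R * u ^+ 2).
Proof.
move=> n0 u0 upi; have n0' : (0 : R) < n%:R by rewrite ltr0n.
have := @chord2_ge _ u; rewrite gtr0_norm// => /(_ upi) h.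
rewrite ler_pdivlMr ?mulr_gt0 ?exprn_gt0//.
have := fejerM u n0; have := cos_geN1 (n%:R * u); have := fejer_ge0 u n0.
move: (cos _) => c f0 h1 e.
have : n%:R * fejer n u * (u ^+ 2 / 9) <= n%:R * fejer n u * (2 - 2 * cos u).
  by rewrite ler_wpM2l// mulr_ge0// ltW.
have -> : n%:R * fejer n u * (2 - 2 * cos u) = 2 * (1 - c) by rewrite -e; ring.
by move=> h2; have -> : fejer n u * (n%:R * u ^+ 2) = 9 * (n%:R * fejer n u * (u ^+ 2 / 9)); [field|lra].
Qed.

(** The primitive of the Fejer kernel vanishing at 0. On [-pi, pi] it is an increasing smooth
    approximation of pi times the sign, so differences of its translates approximate indicators of
    arcs. *)
Definition fejerI n u : R :=
  u + 2 * \sum_(1 <= k < n) (1 - k%:R / n%:R) * (sin (k%:R * u) / k%:R).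

Lemma is_derive_fejerI n u : is_derive u 1 (fejerI n) (fejer n u).
Proof.
pose h k y : R := (1 - k%:R / n%:R) * (sin (k%:R * y) / k%:R).
pose dh k : R := (1 - k%:R / n%:R) * cos (k%:R * u).
have H : is_derive u 1 (fun y => \sum_(1 <= k < n) h k y) (\sum_(1 <= k < n) dh k).
  rewrite (_ : (fun y => _) = (fun y => \sum_(1 <= k < n | (0 < k)%N) h k y)); last first.
    apply/funext => y; rewrite big_nat_cond [RHS]big_nat_cond; apply: eq_bigl => k.
    by case: k.
  rewrite (_ : \sum_(_ <= _ < _) _ = \sum_(1 <= k < n | (0 < k)%N) dh k); last first.
    rewrite big_nat_cond [RHS]big_nat_cond; apply: eq_bigl => k.
    by case: k.
  apply: is_derive_bigsum => k k0.
  have k0' : k%:R != 0 :> R by rewrite pnatr_eq0 -lt0n.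
  rewrite /h /dh; apply: is_derive_eq; rewrite /GRing.scale/=.
  by rewrite !mulr0 add0r mulr1 [cos _ * _]mulrC mulKf.
rewrite /fejerI /fejer -/(h _ _).
apply: is_derive_eq; rewrite /GRing.scale/=; ring.
Qed.

Lemma fejerI_nondecr n u t : (0 < n)%N -> u <= t -> fejerI n u <= fejerI n t.
Proof.
move=> n0 ut; apply: (@ge0_derive_le _ _ (fejer n)) => // x _.
  exact: is_derive_fejerI.
exact: fejer_ge0.
Qed.

Lemma fejerIN n u : fejerI n (- u) = - fejerI n u.
Proof.
rewrite /fejerI opprD -mulrN -sumrN; congr (_ + _ * _); apply: eq_bigr => k _.
by rewrite mulrN sinN; ring.
Qed.

Lemma sin_natM_pi k : sin (k%:R * pi) = 0 :> R.
Proof.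
suff : sin (k%:R * pi) = 0 :> R /\ `|cos (k%:R * pi)| = 1 :> R by case.
elim: k => [|k [IH1 IH2]]; first by rewrite mul0r sin0 cos0 normr1.
by rewrite -natr1 mulrDl mul1r sinDpi cosDpi IH1 oppr0 normrN.
Qed.

Lemma fejerI_pi n : fejerI n pi = pi :> R.
Proof.
rewrite /fejerI big1 ?mulr0 ?addr0// => k _.
by rewrite sin_natM_pi mul0r mulr0.
Qed.

(** The value at pi is exactly pi, and integrating the bound 36/(n t^2) on the derivative back from
    pi to u loses at most 36/(n u). *)
Lemma fejerI_ge n u : (0 < n)%N -> 0 < u -> u <= pi ->
  pi - 36 / (n%:R * u) <= fejerI n u.
Proof.
move=> n0 u0 upi; have n0' : (0 : R) < n%:R by rewrite ltr0n.
have := @ge0_derive_le _ (fun t => - (36 / n%:R) * t^-1 - fejerI n t)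
   (fun t => 36 / (n%:R * t ^+ 2) - fejer n t) u pi upi.
rewrite fejerI_pi => H.
have {}H : - (36 / n%:R) / u - fejerI n u <= - (36 / n%:R) / pi - pi.
  apply: H => t /andP[ut tpi]; last first.
    by rewrite subr_ge0 fejer_le// (lt_le_trans u0).
  have t0 : t != 0 by rewrite gt_eqF// (lt_le_trans u0).
  apply: is_deriveB; last exact: is_derive_fejerI.
  have -> : 36 / (n%:R * t ^+ 2) = - (36 / n%:R) *: (- t ^- 2 *: 1) :> R.
    by rewrite /GRing.scale/=; field; rewrite t0 gt_eqF.
  by apply: is_deriveZ; exact: is_deriveV.
have h2 : 0 <= 36 / n%:R / pi :> R by rewrite !divr_ge0// pi_ge0.
have -> : 36 / (n%:R * u) = 36 / n%:R / u by rewrite invfM mulrA.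
move: H; rewrite !mulNr; lra.
Qed.

(** Real part of the geometric sum of r^k e^{i(k+1)t}, cleared of its denominator |1 - r
    e^{it}|^2. *)
Lemma geom_cos_sum (r t : R) K :
  (\sum_(0 <= k < K) r ^+ k * cos (k.+1%:R * t)) * (1 - 2 * r * cos t + r ^+ 2) =
  cos t - r - r ^+ K * cos (K.+1%:R * t) + r ^+ K.+1 * cos (K%:R * t).
Proof.
elim: K => [|K IH].
  by rewrite big_geq// !mul0r !mul1r cos0 expr1; ring.
rewrite big_nat_recr//= mulrDl IH.
have -> : cos (K.+2%:R * t) = 2 * cos (K.+1%:R * t) * cos t - cos (K%:R * t).
  have -> : K.+2%:R * t = K.+1%:R * t + t by rewrite [in RHS]mulrSr -natr1; ring.
  have -> : K%:R * t = K.+1%:R * t - t by rewrite -natr1; ring.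
  by rewrite cosB cosD; ring.
by rewrite !exprS; ring.
Qed.

Lemma poisson_den_ge (r t : R) : 0 <= r -> (1 - r) ^+ 2 <= 1 - 2 * r * cos t + r ^+ 2.
Proof.
move=> r0; have : r * cos t <= r by rewrite ler_piMr// cos_le1.
by move=> h; have -> : (1 - r) ^+ 2 = 1 - 2 * r + r ^+ 2; [ring|lra].
Qed.

(** The truncated Fourier expansion of ln |1 - r e^{it}|^2. Its derivative in the radius is compared
    with a finite geometric sum and integrated from 0 to r, so no infinite series has to be
    handled. *)
Lemma ln_poisson_den_le (r t : R) K : 0 <= r < 1 ->
  ln (1 - 2 * r * cos t + r ^+ 2) <=
  - 2 * (\sum_(0 <= k < K) r ^+ k.+1 * cos (k.+1%:R * t) / k.+1%:R) + 4 * r ^+ K / (1 - r) ^+ 2.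
Proof.
move=> /andP[r0 r1].
pose q (s : R) : R := 1 - 2 * s * cos t + s ^+ 2.
pose c := 4 * r ^+ K / (1 - r) ^+ 2.
have c0 : 0 <= c by rewrite /c divr_ge0 ?sqr_ge0// mulr_ge0 ?exprn_ge0.
have qge (s : R) : 0 <= s -> s <= r -> (1 - r) ^+ 2 <= q s.
  move=> s0 sr; apply: le_trans (poisson_den_ge t s0).
  by rewrite ler_pXn2r// ?nnegrE; lra.
have r2 : 0 < (1 - r) ^+ 2 by rewrite exprn_gt0// subr_gt0.
have q0 (s : R) : 0 <= s -> s <= r -> 0 < q s by move=> s0 sr; rewrite (lt_le_trans r2)// qge.
pose S (s : R) : R := \sum_(0 <= k < K) s ^+ k.+1 * cos (k.+1%:R * t) / k.+1%:R.
pose dS (s : R) : R := \sum_(0 <= k < K) s ^+ k * cos (k.+1%:R * t).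
have dSP (s : R) : is_derive s 1 S (dS s).
  apply: is_derive_bigsum => k _.
  have k0 : k.+1%:R != 0 :> R by rewrite pnatr_eq0.
  have -> : s ^+ k * cos (k.+1%:R * t) =
      (cos (k.+1%:R * t) / k.+1%:R) *: (k.+1%:R * s ^+ k).
    by rewrite /GRing.scale/=; field.
  rewrite (_ : (fun y => _) = (cos (k.+1%:R * t) / k.+1%:R) \*: (fun y => y ^+ k.+1)); last first.
    by apply/funext => y /=; rewrite /GRing.scale/=; ring.
  by have Hp := is_derive_pow k s; apply: is_deriveZ.
have := @ge0_derive_le _ (fun s => (c * s - 2 * S s) - ln (q s))
  (fun s => (c - 2 * dS s) - (2 * s - 2 * cos t) / q s) 0 r r0.
have -> : S 0 = 0 by rewrite /S big1// => k _; rewrite exprS !mul0r.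
rewrite /q expr0n !(mulr0,mul0r,subr0,addr0) ln1 subr0 -/(q r) => H.
have : 0 <= c * r - 2 * S r - ln (q r).
  apply: H => s /andP[s0 sr].
    apply: is_deriveB; first by apply: is_derive_eq; rewrite /GRing.scale/=; ring.
    have Hl := is_derive1_ln (q0 _ s0 sr).
    have Hq : is_derive s 1 q (2 * s - 2 * cos t).
      rewrite /q; apply: is_derive_eq; rewrite /GRing.scale/=; ring.
    have -> : (2 * s - 2 * cos t) / (1 - 2 * s * cos t + s ^+ 2) = (q s)^-1 * (2 * s - 2 * cos t) by rewrite mulrC.
    exact: (@is_derive1_comp _ _ _ _ _ _ Hl Hq).
  rewrite -/(q s); have gq := q0 _ s0 sr.
  have e := geom_cos_sum s t K; rewrite -/(q s) -/(dS s) in e.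
  have -> : c - 2 * dS s - (2 * s - 2 * cos t) / q s =
     c + 2 * s ^+ K * (cos (K.+1%:R * t) - s * cos (K%:R * t)) / q s.
    have -> : dS s = dS s * q s / q s by rewrite mulfK ?gt_eqF.
    by rewrite e exprS; ring.
  have h1 : - (4 * s ^+ K) <= 2 * s ^+ K * (cos (K.+1%:R * t) - s * cos (K%:R * t)).
    have sK : 0 <= s ^+ K by rewrite exprn_ge0.
    have h2 := cos_geN1 (K.+1%:R * t); have h3 := cos_le1 (K%:R * t).
    have h4 := cos_geN1 (K%:R * t).
    have h5 : s * cos (K%:R * t) <= 1 by nra.
    nra.
  have h2 : 4 * s ^+ K / q s <= c.
    rewrite /c ler_pM ?mulr_ge0 ?exprn_ge0 ?invr_ge0 ?(ltW gq)//.
      by rewrite ler_pM2l// lerXn2r ?nnegrE.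
    by rewrite lef_pV2 ?posrE ?qge.
  have : - (4 * s ^+ K) / q s <= 2 * s ^+ K * (cos (K.+1%:R * t) - s * cos (K%:R * t)) / q s.
    by rewrite ler_pM2r ?invr_gt0.
  rewrite mulNr; lra.
rewrite -/(S r) -/c mulNr => h.
have : c * r <= c by rewrite ler_piMr// ltW.
lra.
Qed.

End TrigSums.

(** * Iterated integrals over the torus *)

Section UniformContinuity.
Context {R : realType}.
Implicit Types (g h : seq R -> R) (s : seq R).

Lemma continuous_unif_itv (h : R -> R) (M e : R) : continuous h -> 0 < e ->
  exists2 d : R, 0 < d & forall x y : R, `|x| <= M -> `|x - y| < d -> `|h x - h y| < e.
Proof.
move=> ch e0.
have /compact_near_coveringP/(_ R (0^'+) _) : compact `[- M, M]%classic by exact: segment_compact.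
move=> /(_ (fun d x => forall y, `|x - y| < d -> `|h x - h y| < e)) H.
have : \forall d \near 0^'+, `[- M, M]%classic `<=` (fun x => forall y, `|x - y| < d -> `|h x - h y| < e).
  apply: H => x _.
  have e20 : 0 < e / 2 by rewrite divr_gt0.
  have /cvgrPdist_lt /(_ _ e20) := ch x.
  move=> /nbhs_ballP[r /= r0 hr].
  exists (ball x (r / 2), [set d | d < r / 2]); first split => /=.
  - by apply: nbhsx_ballx; rewrite divr_gt0.
  - by apply: nbhs_right_lt; rewrite divr_gt0.
  move=> [x' d] /= [xx' dr] y xy.
  have hx' : `|h x - h x'| < e / 2.
    by apply: hr; apply: (le_ball _ xx'); lra.
  have hy : `|h x - h y| < e / 2.
    apply: hr; rewrite /ball/= (splitr r) -(subrKA x').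
    by rewrite (le_lt_trans (ler_normD _ _))// ltrD// (lt_trans xy).
  rewrite -(subrKA (h x)) (le_lt_trans (ler_normD _ _))// [e]splitr ltrD//.
  by rewrite distrC.
move=> /nbhs_ballP [d /= d0 hd].
exists (d / 2); first by rewrite divr_gt0.
move=> x y xM xy; apply: (hd (d / 2)) => //=.
- rewrite /ball/= sub0r normrN gtr0_norm ?divr_gt0//.
  lra.
- by rewrite divr_gt0.
- by rewrite in_itv/= -ler_norml.
Qed.

(* This class is stable under partial integration. *)
Definition buc (n : nat) g : Prop :=
  (exists M : R, forall s, size s = n -> `|g s| <= M) /\
  (forall e : R, 0 < e -> exists2 d : R, 0 < d & forall s s', size s = n -> size s' = n ->
     (forall i, (i < n)%N -> `|s`_i - s'`_i| < d) -> `|g s - g s'| < e).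

Lemma eq_buc n g h : (forall s, size s = n -> g s = h s) -> buc n g -> buc n h.
Proof.
move=> gh [[M HM] H]; split; first by exists M => s sn; rewrite -gh// HM.
move=> e /H[d d0 Hd]; exists d => // s s' sn s'n ss'.
by rewrite -!gh// Hd.
Qed.

Lemma buc_cst n c : buc n (fun=> c).
Proof.
split; first by exists `|c|.
by move=> e e0; exists 1 => // s s' _ _ _; rewrite subrr normr0.
Qed.

Lemma buc_add n g h : buc n g -> buc n h -> buc n (fun s => g s + h s).
Proof.
move=> [[M HM] H] [[N HN] H']; split.
  exists (M + N) => s sn.
  by rewrite (le_trans (ler_normD _ _))// lerD ?HM ?HN.
move=> e e0; have e20 : 0 < e / 2 by rewrite divr_gt0.
have [d d0 Hd] := H _ e20; have [d' d'0 Hd'] := H' _ e20.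
exists (Num.min d d'); first by rewrite lt_min d0.
move=> s s' sn s'n ss'.
have -> : g s + h s - (g s' + h s') = (g s - g s') + (h s - h s') by ring.
rewrite (le_lt_trans (ler_normD _ _))// [e]splitr ltrD//.
  by apply: Hd => // i /ss'; rewrite lt_min => /andP[].
by apply: Hd' => // i /ss'; rewrite lt_min => /andP[].
Qed.

Lemma buc_comp n g (h : R -> R) : continuous h -> buc n g -> buc n (fun s => h (g s)).
Proof.
move=> ch [[M HM] H]; split.
  have [d d0 Hd] := @continuous_unif_itv h M 1 ch ltr01.
  have : compact (h @` `[- M, M]%classic).
    apply: continuous_compact; last exact: segment_compact.
    exact: continuous_subspaceT.
  move=> /compact_bounded[N [_ HN]]; exists (`|N| + 1) => s sn.
  apply: HN; first by rewrite (le_lt_trans (ler_norm _))// ltrDl.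
  by exists (g s) => //=; rewrite in_itv/= -ler_norml HM.
move=> e e0; have [d d0 Hd] := @continuous_unif_itv h M e ch e0.
have [d' d'0 Hd'] := H _ d0; exists d' => // s s' sn s'n ss'.
by apply: Hd; [exact: HM|exact: Hd'].
Qed.

Lemma buc_opp n g : buc n g -> buc n (fun s => - g s).
Proof. by move=> bg; apply: (@buc_comp n g -%R) => // x; exact: opp_continuous. Qed.

Lemma buc_sub n g h : buc n g -> buc n h -> buc n (fun s => g s - h s).
Proof. by move=> bg bh; apply: buc_add => //; exact: buc_opp. Qed.

Lemma buc_sqr n g : buc n g -> buc n (fun s => g s ^+ 2).
Proof. by move=> bg; apply: (@buc_comp n g (fun x => x ^+ 2)) => //; exact: exprn_continuous. Qed.

Lemma buc_scale n c g : buc n g -> buc n (fun s => c * g s).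
Proof. by move=> bg; apply: (@buc_comp n g ( *%R c)) => //; exact: mulrl_continuous. Qed.

(** Polarisation, 4 g h = (g + h)^2 - (g - h)^2, reduces products to sums and to composition with
    the square. *)
Lemma buc_mul n g h : buc n g -> buc n h -> buc n (fun s => g s * h s).
Proof.
move=> bg bh; have := buc_scale 4^-1 (buc_sub (buc_sqr (buc_add bg bh)) (buc_sqr (buc_sub bg bh))).
by apply: eq_buc => s _; field.
Qed.

Lemma buc_sum n (I : Type) (r : seq I) (P : pred I) (G : I -> seq R -> R) :
  (forall i, P i -> buc n (G i)) -> buc n (fun s => \sum_(i <- r | P i) G i s).
Proof.
move=> H; elim: r => [|i r IH].
  by apply: eq_buc (buc_cst n 0) => s _; rewrite big_nil.
have [Pi|nPi] := boolP (P i).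
  by apply: eq_buc (buc_add (H i Pi) IH) => s _; rewrite big_cons Pi.
by apply: eq_buc IH => s _; rewrite big_cons (negbTE nPi).
Qed.

Lemma buc_prod n (I : Type) (r : seq I) (P : pred I) (G : I -> seq R -> R) :
  (forall i, P i -> buc n (G i)) -> buc n (fun s => \prod_(i <- r | P i) G i s).
Proof.
move=> H; elim: r => [|i r IH].
  by apply: eq_buc (buc_cst n 1) => s _; rewrite big_nil.
have [Pi|nPi] := boolP (P i).
  by apply: eq_buc (buc_mul (H i Pi) IH) => s _; rewrite big_cons Pi.
by apply: eq_buc IH => s _; rewrite big_cons (negbTE nPi).
Qed.

Definition unif_cont (h : R -> R) := (exists M : R, forall x, `|h x| <= M) /\
  forall e : R, 0 < e -> exists2 d : R, 0 < d & forall x y : R, `|x - y| < d -> `|h x - h y| < e.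

Lemma lipschitz_unif_cont (h : R -> R) M L : (forall x, `|h x| <= M) ->
  (forall x y, `|h x - h y| <= L * `|x - y|) -> unif_cont h.
Proof.
move=> hM hL; split; first by exists M.
move=> e e0; exists (e / (`|L| + 1)); first by rewrite divr_gt0// ltr_wpDl.
move=> x y; rewrite ltr_pdivlMr ?ltr_wpDl// => xy.
rewrite (le_lt_trans (hL _ _))// (le_lt_trans _ xy)// mulrC ler_wpM2l//.
by rewrite (le_trans (ler_norm _))// lerDl.
Qed.

Lemma buc_coord n (h : R -> R) i : unif_cont h -> (i < n)%N -> buc n (fun s => h s`_i).
Proof.
move=> [[M HM] H] ni; split; first by exists M.
move=> e /H[d d0 Hd]; exists d => // s s' _ _ ss'.
by apply: Hd; exact: ss'.
Qed.

Lemma sum_seq_nth (f : R -> R) s n : size s = n -> \sum_(t <- s) f t = \sum_(0 <= i < n) f s`_i.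
Proof. by move=> <-; rewrite (big_nth 0). Qed.

Lemma buc_linstat n (h : R -> R) : unif_cont h -> buc n (fun s => \sum_(t <- s) h t).
Proof.
move=> uh; apply: (@eq_buc n (fun s => \sum_(i < n) h s`_i)) => [s sn|].
  by rewrite (sum_seq_nth _ sn) big_mkord.
by apply: buc_sum => i _; exact: buc_coord.
Qed.

Lemma unif_cont_continuous (h : R -> R) : unif_cont h -> continuous h.
Proof.
move=> [_ H] x; apply/cvgrPdist_lt => e /H[d d0 Hd].
by apply/nbhs_ballP; exists d => //= y xy; exact: Hd.
Qed.

Lemma unif_cont_comp (h k : R -> R) : continuous k -> unif_cont h -> unif_cont (fun x => k (h x)).
Proof.
move=> ck uh.
have [[M HM] H] := buc_comp ck (@buc_coord 1 h 0 uh isT); split.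
  by exists M => x; exact: (HM [:: x]).
move=> e /H[d d0 Hd]; exists d => // x y xy.
by apply: (Hd [:: x] [:: y]) => // -[|].
Qed.

Lemma unif_cont_cos (k c : R) : unif_cont (fun x => cos (k * x + c)).
Proof.
apply: (@lipschitz_unif_cont _ 1 `|k|) => [x|x y]; first exact: cos_max.
have H (u v : R) : `|cos u - cos v| <= `|u - v|.
  have e : cos u - cos v = - 2 * sin ((u + v) / 2) * sin ((u - v) / 2).
    transitivity (cos ((u + v) / 2 + (u - v) / 2) - cos ((u + v) / 2 - (u - v) / 2)).
      by congr (cos _ - cos _); field.
    by rewrite cosD cosB; ring.
  rewrite e !normrM normrN (ger0_norm (ler0n _ 2)).
  have h1 := sin_max ((u + v) / 2); have h2 := norm_sin_le ((u - v) / 2).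
  rewrite [in X in _ <= X](_ : u - v = 2 * ((u - v) / 2)); last by field.
  rewrite [leRHS]normrM (ger0_norm (ler0n _ 2)) -mulrA ler_pM2l//.
  by rewrite -[leRHS]mul1r ler_pM.
by rewrite (le_trans (H _ _))// -normrM mulrBr opprD addrACA subrr addr0.
Qed.

Lemma unif_cont_sin (k c : R) : unif_cont (fun x => sin (k * x + c)).
Proof.
rewrite (_ : (fun x => _) = (fun x => cos (k * x + (c - pi / 2)))).
  exact: unif_cont_cos.
by apply/funext => x; rewrite addrA cosBpihalf.
Qed.

Lemma buc_cons n g x : buc n.+1 g -> buc n (fun s => g (x :: s)).
Proof.
move=> [[M HM] H]; split; first by exists M => s sn; rewrite HM//= sn.
move=> e /H[d d0 Hd]; exists d => // s s' sn s'n ss'.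
apply: Hd; rewrite /= ?sn ?s'n// => -[|i] /= ni; last exact: ss'.
by rewrite subrr normr0.
Qed.

Lemma buc_map_shift n g c : buc n g -> buc n (fun s => g [seq t + c | t <- s]).
Proof.
move=> [[M HM] H]; split; first by exists M => s sn; rewrite HM// size_map.
move=> e /H[d d0 Hd]; exists d => // s s' sn s'n ss'.
apply: Hd; rewrite ?size_map// => i ni; rewrite !(nth_map 0) ?sn ?s'n//.
by rewrite opprD addrACA subrr addr0 ss'.
Qed.

End UniformContinuity.

(** * The real-valued iterated integral and its invariance under rotation *)

Section IteratedIntegral.
Context {R : realType}.
Implicit Types (g h : seq R -> R) (s : seq R) (n : nat).
Local Notation mu := (@lebesgue_measure R).

Definition in_circ s := forall t, t \in s -> @circ_dom R t.

Lemma measurable_circ_dom : measurable (@circ_dom R).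
Proof. by rewrite /circ_dom; exact: measurable_itv. Qed.

Lemma mu_circ_dom : mu (@circ_dom R) = (2 * pi)%:E.
Proof.
rewrite /circ_dom lebesgue_measure_itv/= lte_fin.
have p0 := pi_gt0 R.
by rewrite ifT -?EFinB; [congr (_%:E); ring|lra].
Qed.

Lemma integrable_circ_dom (h : R -> R) : continuous h ->
  mu.-integrable (@circ_dom R) (EFin \o h).
Proof.
move=> ch; apply: (@integrableS _ _ _ mu `[-pi, pi]%classic) => //.
- exact: measurable_circ_dom.
- by rewrite /circ_dom; apply: subset_itv_oc_cc.
- apply: continuous_compact_integrable; first exact: segment_compact.
  exact: continuous_subspaceT.
Qed.

(** Real-valued counterpart of [cube_integral]. The two agree on [buc] functions by
    [cube_integral_buc], after which finiteness never has to be discussed again. *)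
Fixpoint J n g : R :=
  match n with
  | 0 => g [::]
  | n'.+1 => \int[mu]_(x in circ_dom) J n' (fun s => g (x :: s))
  end.

(** The five properties form one induction: linearity and monotonicity of [J n.+1] require the
    partial integral to be integrable in the first variable, which follows from its uniform
    continuity, and this in turn rests on linearity and monotonicity of [J n]. *)
Lemma J_theory n :
  [/\ forall g h, buc n g -> buc n h -> J n (fun s => g s + h s) = J n g + J n h,
      forall c g, buc n g -> J n (fun s => c * g s) = c * J n g,
      forall g h, buc n g -> buc n h ->
        (forall s, size s = n -> in_circ s -> g s <= h s) -> J n g <= J n h,
      forall c, J n (fun=> c) = (2 * pi) ^+ n * c &
      forall g, buc n.+1 g -> unif_cont (fun x => J n (fun s => g (x :: s)))].
Proof.
have lip m : (forall g h, buc m g -> buc m h -> J m (fun s => g s + h s) = J m g + J m h) ->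
   (forall c g, buc m g -> J m (fun s => c * g s) = c * J m g) ->
   (forall g h, buc m g -> buc m h ->
        (forall s, size s = m -> in_circ s -> g s <= h s) -> J m g <= J m h) ->
   (forall c, J m (fun=> c) = (2 * pi) ^+ m * c) ->
   forall g, buc m.+1 g -> unif_cont (fun x => J m (fun s => g (x :: s))).
  move=> JD JZ Jle Jc g bg.
  have C0 : 0 < (2 * pi) ^+ m :> R by rewrite exprn_gt0// mulr_gt0// pi_gt0.
  have bd h c : buc m h -> (forall s, size s = m -> `|h s| <= c) -> `|J m h| <= (2 * pi) ^+ m * c.
    move=> bh hc; rewrite ler_norml; apply/andP; split.
      rewrite -mulrN -Jc; apply: Jle => //; first exact: buc_cst.
      by move=> s /hc; rewrite ler_norml => /andP[].
    rewrite -Jc; apply: Jle => //; first exact: buc_cst.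
    by move=> s /hc; rewrite ler_norml => /andP[].
  have [[M HM] H] := bg; split.
    exists ((2 * pi) ^+ m * M) => x; apply: bd; first exact: buc_cons.
    by move=> s sm; apply: HM => /=; rewrite sm.
  move=> e e0; have e1 : 0 < e / 2 / (2 * pi) ^+ m by rewrite divr_gt0// divr_gt0.
  have [d d0 Hd] := H _ e1; exists d => // x y xy.
  have bx := buc_cons x bg; have by_ := buc_cons y bg.
  have -> : J m (fun s => g (x :: s)) - J m (fun s => g (y :: s)) =
      J m (fun s => g (x :: s) + -1 * g (y :: s)).
    rewrite (JD _ (fun s => -1 * g (y :: s)))// ?JZ//; last exact: buc_scale.
    by rewrite mulN1r.
  have : `|J m (fun s => g (x :: s) + -1 * g (y :: s))| <= (2 * pi) ^+ m * (e / 2 / (2 * pi) ^+ m).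
    apply: bd; first by apply: buc_add => //; exact: buc_scale.
    move=> s sm; rewrite mulN1r ltW// Hd/= ?sm// => -[|i] im //=.
    by rewrite subrr normr0.
  move=> /le_lt_trans; apply.
  by rewrite mulrC divfK ?gt_eqF//; lra.
elim: n => [|n [JD JZ Jle Jc Ju]].
  have H1 : forall g h, buc 0 g -> buc 0 h -> J 0 (fun s => g s + h s) = J 0 g + J 0 h by [].
  have H2 : forall c g, buc 0 g -> J 0 (fun s => c * g s) = c * J 0 g by [].
  have H3 : forall g h, buc 0 g -> buc 0 h ->
        (forall s, size s = 0%N -> in_circ s -> g s <= h s) -> J 0 g <= J 0 h.
    by move=> g h _ _ /= gh; apply: gh.
  have H4 : forall c, J 0 (fun=> c) = (2 * pi) ^+ 0 * c by move=> c /=; rewrite mul1r.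
  by split => //; exact: lip.
have ig g : buc n.+1 g -> mu.-integrable circ_dom (EFin \o (fun x => J n (fun s => g (x :: s)))).
  by move=> bg; apply: integrable_circ_dom; apply: unif_cont_continuous; exact: Ju.
have mc := measurable_circ_dom.
have H1 : forall g h, buc n.+1 g -> buc n.+1 h -> J n.+1 (fun s => g s + h s) = J n.+1 g + J n.+1 h.
  move=> g h bg bh /=; rewrite -RintegralD//; try exact: ig.
  by apply: eq_Rintegral => x _; rewrite JD//; exact: buc_cons.
have H2 : forall c g, buc n.+1 g -> J n.+1 (fun s => c * g s) = c * J n.+1 g.
  move=> c g bg /=; rewrite -RintegralZl//; last exact: ig.
  by apply: eq_Rintegral => x _; rewrite JZ//; exact: buc_cons.
have H3 : forall g h, buc n.+1 g -> buc n.+1 h ->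
        (forall s, size s = n.+1 -> in_circ s -> g s <= h s) -> J n.+1 g <= J n.+1 h.
  move=> g h bg bh gh /=; apply: le_Rintegral => //; try exact: ig.
  move=> x xc; apply: Jle; try exact: buc_cons.
  move=> s sn sc; apply: gh; first by rewrite /= sn.
  by move=> t; rewrite inE => /predU1P[->//|/sc].
have H4 : forall c, J n.+1 (fun=> c) = (2 * pi) ^+ n.+1 * c.
  move=> c /=; under eq_Rintegral do rewrite Jc.
  rewrite Rintegral_cst// [X in fine X](_ : _ = (2 * pi)%:E); last exact: mu_circ_dom.
  by rewrite /= exprS; ring.
by split => //; exact: lip.
Qed.

Lemma J_add n g h : buc n g -> buc n h -> J n (fun s => g s + h s) = J n g + J n h.
Proof. by have [H _ _ _ _] := J_theory n; exact: H. Qed.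

Lemma J_scale n c g : buc n g -> J n (fun s => c * g s) = c * J n g.
Proof. by have [_ H _ _ _] := J_theory n; exact: H. Qed.

Lemma J_le n g h : buc n g -> buc n h ->
  (forall s, size s = n -> in_circ s -> g s <= h s) -> J n g <= J n h.
Proof. by have [_ _ H _ _] := J_theory n; exact: H. Qed.

Lemma J_cst n c : J n (fun=> c) = (2 * pi) ^+ n * c.
Proof. by have [_ _ _ H _] := J_theory n. Qed.

Lemma J_cons_unif_cont n g : buc n.+1 g -> unif_cont (fun x => J n (fun s => g (x :: s))).
Proof. by have [_ _ _ _ H] := J_theory n; exact: H. Qed.

Lemma eq_J n g h : (forall s, size s = n -> g s = h s) -> J n g = J n h.
Proof.
elim: n g h => [|n IH] g h gh /=; first exact: gh.
by apply: eq_Rintegral => x _; apply: IH => s sn; apply: gh; rewrite /= sn.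
Qed.

Lemma cube_integral_buc n g : buc n g ->
  cube_integral n (fun s => (g s)%:E) = (J n g)%:E.
Proof.
elim: n g => [|n IH] g bg //=.
under eq_integral do rewrite (IH (fun s => g (_ :: s)) (buc_cons _ bg)).
rewrite /Rintegral fineK//; apply: integrable_fin_num; first exact: measurable_circ_dom.
apply: integrable_circ_dom; apply: unif_cont_continuous; exact: J_cons_unif_cont.
Qed.

(** Periodicity in all coordinates at once, phrased through the points on the circle so that no
    multiples of 2 pi have to be tracked. *)
Definition trig_inv n g := forall s s', size s = n -> size s' = n ->
  (forall i, (i < n)%N -> cos s`_i = cos s'`_i /\ sin s`_i = sin s'`_i) -> g s = g s'.

Lemma Rintegral_FTC (h F : R -> R) (a b : R) : continuous h -> a < b ->
  (forall x, a <= x <= b -> is_derive x 1 F (h x)) ->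
  \int[mu]_(x in `]a, b]) h x = F b - F a.
Proof.
move=> ch ab dF.
have ci : mu.-integrable `[a, b]%classic (EFin \o h).
  apply: continuous_compact_integrable; first exact: segment_compact.
  exact: continuous_subspaceT.
have dc (x : R) : a <= x <= b -> {for x, continuous F}.
  move=> xab; apply: differentiable_continuous; apply/derivable1_diffP.
  exact: (@ex_derive _ _ _ _ _ _ _ (dF x xab)).
rewrite Rintegral_itv_obnd_cbnd; last first.
  by apply: integrableS ci => //; exact: subset_itv_oc_cc.
rewrite /Rintegral (@continuous_FTC2 _ h F)//=.
- exact: continuous_subspaceT.
- split.
  + move=> x; rewrite in_itv/= => /andP[xa xb].
    by apply: (@ex_derive _ _ _ _ _ _ _ (dF x _)); rewrite !ltW.
  + by apply: cvg_at_right_filter; apply: dc; rewrite lexx ltW.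
  + by apply: cvg_at_left_filter; apply: dc; rewrite lexx ltW.
- move=> x; rewrite in_itv/= => /andP[xa xb].
  by rewrite derive1E; apply: (@derive_val _ _ _ _ _ _ _ (dF x _)); rewrite !ltW.
Qed.

(** With a primitive F of h, the integral over the window centred at x is F(x + pi) - F(x - pi),
    whose derivative h(x + pi) - h(x - pi) vanishes by periodicity. *)
Lemma Rintegral_circ_shift (h : R -> R) c : continuous h ->
  (forall x, h (x + 2 * pi) = h x) ->
  \int[mu]_(x in circ_dom) h (x + c) = \int[mu]_(x in circ_dom) h x.
Proof.
move=> ch hp.
have ci (a b : R) : mu.-integrable `[a, b]%classic (EFin \o h).
  apply: continuous_compact_integrable; first exact: segment_compact.
  exact: continuous_subspaceT.
(* F must be differentiable on every window of half-width pi centred between 0 and c; 20 is a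
   generous margin over pi < 4. *)
pose B := `|c| + 20 : R.
have p4 : (pi : R) < 4 by have := @pihalf_lt2 R; lra.
have p0 := pi_gt0 R.
pose F (x : R) := \int[mu]_(t in `[(- B), x]) h t.
have cB : `|c| = B - 20 by rewrite /B addrK.
have c1 := ler_norm c; have c2 := ler_norm (- c); rewrite normrN in c2.
have dF (x : R) : - B < x -> x < B -> is_derive x 1 F (h x).
  move=> Bx xB.
  have [d1 d2] := @continuous_FTC1_closed _ h (- B) x B xB (ci _ _) Bx (ch x).
  apply: DeriveDef; first exact: d1.
  by rewrite -derive1E; exact: d2.
have e1 : \int[mu]_(x in circ_dom) h (x + c) = F (pi + c) - F (- pi + c).
  apply: (@Rintegral_FTC (fun x => h (x + c)) (fun x => F (x + c)) (- pi) pi).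
  - move=> x; apply: continuous_comp; last exact: ch.
    exact: (cvgD cvg_id (cvg_cst _)).
  - by lra.
  - move=> x /andP[x1 x2].
    have H : is_derive (x + c) 1 F (h (x + c)) by apply: dF; lra.
    have H2 : is_derive x 1 (fun y : R => y + c) 1 by apply: is_derive_eq; rewrite addr0.
    by have := @is_derive1_comp _ F (fun y => y + c) x _ _ H H2; rewrite mulr1.
have e2 : \int[mu]_(x in circ_dom) h x = F pi - F (- pi).
  apply: (@Rintegral_FTC h F (- pi) pi ch); first by lra.
  by move=> x /andP[x1 x2]; apply: dF; lra.
pose D (x : R) := F (x + pi) - F (x + - pi).
have dD (x : R) : `|x| <= `|c| -> is_derive x 1 D 0.
  rewrite ler_norml => /andP[x1 x2].
  have H : is_derive (x + pi) 1 F (h (x + pi)) by apply: dF; lra.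
  have H' : is_derive (x + - pi) 1 F (h (x + pi)).
    have -> : h (x + pi) = h (x + - pi) by rewrite -[RHS]hp; congr h; ring.
    by apply: dF; lra.
  have H2 (a : R) : is_derive x 1 (fun y : R => y + a) 1 by apply: is_derive_eq; rewrite addr0.
  have D1 := @is_derive1_comp _ F (fun y => y + pi) x _ _ H (H2 pi).
  have D2 := @is_derive1_comp _ F (fun y => y + - pi) x _ _ H' (H2 (- pi)).
  have := is_deriveB D1 D2; rewrite subrr.
  by move=> H3; exact: H3.
have D0 : D c = D 0.
  apply/eqP; rewrite eq_le.
  have [c0|/ltW c0] := leP 0 c.
    have hx (x : R) : 0 <= x <= c -> `|x| <= `|c| by move=> /andP[x0 xc]; rewrite !ger0_norm.
    apply/andP; split; last by apply: (@ge0_derive_le _ D (fun=> 0)) => // x /hx; exact: dD.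
    rewrite -lerN2; apply: (@ge0_derive_le _ (fun x => - D x) (fun=> 0)) => // x /hx /dD H.
    by rewrite -oppr0; apply: is_deriveN.
  have hx (x : R) : c <= x <= 0 -> `|x| <= `|c| by move=> /andP[x0 xc]; rewrite !ler0_norm//; lra.
  apply/andP; split; first by apply: (@ge0_derive_le _ D (fun=> 0)) => // x /hx; exact: dD.
  rewrite -lerN2; apply: (@ge0_derive_le _ (fun x => - D x) (fun=> 0)) => // x /hx /dD H.
  by rewrite -oppr0; apply: is_deriveN.
by rewrite e1 e2; move: D0; rewrite /D !add0r [pi + c]addrC [- pi + c]addrC.
Qed.

Lemma J_shift n g c : buc n g -> trig_inv n g ->
  J n (fun s => g [seq t + c | t <- s]) = J n g.
Proof.
elim: n g => [|n IH] g bg tg //=.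
have H x : J n (fun s => g (x + c :: [seq t + c | t <- s])) = J n (fun s => g (x + c :: s)).
  apply: (IH (fun s => g (x + c :: s))); first exact: buc_cons.
  move=> s s' sn s'n ss'; apply: tg => /=; rewrite ?sn ?s'n// => -[|i] //= ni.
  exact: ss'.
under eq_Rintegral do rewrite H.
apply: (Rintegral_circ_shift (h := fun y => J n (fun s => g (y :: s)))).
  by apply: unif_cont_continuous; exact: J_cons_unif_cont.
move=> x; apply: eq_J => s sn; apply: tg; rewrite /= ?sn// => -[|i] //= _.
by rewrite mulrC mulr_natr cosD2pi sinD2pi.
Qed.

End IteratedIntegral.

(** * The circular ensemble: partition function and power sums *)

Section CbePartition.
Context {R : realType}.
Implicit Types (s : seq R) (n : nat).
Local Notation mu := (@lebesgue_measure R).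

Definition cis (t : R) : R[i] := Complex (cos t) (sin t).

Lemma cisD a b : cis (a + b) = cis a * cis b.
Proof. by apply/eqP; rewrite eq_complex/= cosD sinD; apply/andP; split; apply/eqP; ring. Qed.

Lemma cis0 : cis 0 = 1.
Proof. by rewrite /cis cos0 sin0. Qed.

Lemma cisN a : cis (- a) = (cis a)^*%C.
Proof. by rewrite /cis cosN sinN. Qed.

Lemma cisX a k : cis a ^+ k = cis (k%:R * a).
Proof.
elim: k => [|k IH]; first by rewrite expr0 mul0r cis0.
by rewrite exprS IH -cisD -natr1; congr cis; ring.
Qed.

Lemma cis_sum (I : Type) (r : seq I) (f : I -> R) :
  \prod_(i <- r) cis (f i) = cis (\sum_(i <- r) f i).
Proof.
elim: r => [|i r IH]; first by rewrite !big_nil cis0.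
by rewrite !big_cons IH cisD.
Qed.

Definition chord2 (a b : R) : R := 2 - 2 * cos (a - b).

Lemma circ_distE a b : circ_dist a b = Num.sqrt (chord2 a b).
Proof.
rewrite /circ_dist; congr Num.sqrt; rewrite /chord2 cosB.
have := cos2Dsin2 a; have := cos2Dsin2 b => h1 h2.
have -> : (2 : R) = 1 + 1 by ring.
rewrite -{1}h1 -{1}h2; ring.
Qed.

Lemma chord2_ge0' a b : 0 <= chord2 a b.
Proof. exact: chord2_ge0. Qed.

Lemma chord2_cis a b : (chord2 a b)%:C%C = (cis b - cis a) * (cis b - cis a)^*%C.
Proof.
apply/eqP; rewrite eq_complex/=; apply/andP; split; apply/eqP; last by ring.
rewrite /chord2 cosB.
have := cos2Dsin2 a; have := cos2Dsin2 b => h1 h2.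
have -> : (2 : R) = 1 + 1 by ring.
rewrite -{1}h1 -{1}h2; ring.
Qed.

(** The squared modulus of the Vandermonde determinant of the points e^{i theta_j}, that is, the
    weight for beta = 2; the general weight is its power beta/2 by [cbe_weightE]. *)
Definition vdm2 n s : R := \prod_(i < n) \prod_(j < n | (i < j)%N) chord2 s`_i s`_j.

Lemma vdm2_ge0 n s : 0 <= vdm2 n s.
Proof. by apply: prodr_ge0 => i _; apply: prodr_ge0 => j _; exact: chord2_ge0'. Qed.

Lemma buc_chord2 n i j : (i < n)%N -> (j < n)%N -> buc n (fun s : seq R => chord2 s`_i s`_j).
Proof.
move=> ni nj; pose c (k : R) := buc_coord (unif_cont_cos 1 0) ni.
have C k : (k < n)%N -> buc n (fun s : seq R => cos s`_k).
  move=> nk; apply: eq_buc (buc_coord (unif_cont_cos 1 0) nk) => s _.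
  by rewrite mul1r addr0.
have S k : (k < n)%N -> buc n (fun s : seq R => sin s`_k).
  move=> nk; apply: eq_buc (buc_coord (unif_cont_sin 1 0) nk) => s _.
  by rewrite mul1r addr0.
have H := buc_add (buc_mul (C i ni) (C j nj)) (buc_mul (S i ni) (S j nj)).
apply: eq_buc (buc_sub (buc_cst n 2) (buc_scale 2 H)) => s _.
by rewrite /chord2 cosB.
Qed.

Lemma buc_vdm2 n : buc n (vdm2 n).
Proof.
by apply: buc_prod => i _; apply: buc_prod => j _; apply: buc_chord2.
Qed.

(** Leibniz expansion of the Vandermonde determinant and of its conjugate; real parts are taken at
    the end. *)
Lemma vdm2E n s : vdm2 n s =
  \sum_(u : 'S_n) \sum_(v : 'S_n) ((-1) ^+ u * (-1) ^+ v) *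
    cos (\sum_(i < n) ((u i)%:R - (v i)%:R) * s`_i).
Proof.
pose a : 'rV[R[i]]_n := \row_i cis s`_i.
have e1 : (vdm2 n s)%:C%C = \det (Vandermonde n a) * (\det (Vandermonde n a))^*%C.
  rewrite det_Vandermonde !rmorph_prod -big_split/=; apply: eq_bigr => i _.
  rewrite !rmorph_prod -big_split/=; apply: eq_bigr => j _.
  by rewrite !mxE chord2_cis.
have e2 : \det (Vandermonde n a) = \sum_(u : 'S_n) (-1) ^+ u * cis (\sum_(i < n) (u i)%:R * s`_i).
  rewrite -det_tr /determinant; apply: eq_bigr => u _; congr (_ * _).
  by rewrite -cis_sum; apply: eq_bigr => i _; rewrite !mxE cisX.
have e3 : (\det (Vandermonde n a))^*%C = \sum_(v : 'S_n) (-1) ^+ v * cis (- \sum_(i < n) (v i)%:R * s`_i).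
  rewrite e2 rmorph_sum; apply: eq_bigr => v _.
  by rewrite rmorphM rmorphXn rmorphN rmorph1 cisN.
have -> : vdm2 n s = complex.Re ((vdm2 n s)%:C%C) by [].
rewrite e1 e3 e2 mulr_suml raddf_sum; apply: eq_bigr => u _.
rewrite mulr_sumr raddf_sum; apply: eq_bigr => v _.
rewrite mulrACA -cisD -sumrN -big_split/=.
under eq_bigr do rewrite -mulrBl.
by case: (odd_perm u); case: (odd_perm v); rewrite ?expr0 ?expr1 ?mulrN1 ?mulN1r ?opprK ?mul1r.
Qed.

(** Orthogonality of characters of the torus. Exponents are functions on [nat], not on ordinals, so
    that the induction can shift them, and the phase c absorbs the coordinate already split off. *)
Lemma J_cos n (a b : nat -> nat) (c : R) :
  J n (fun s => cos (c + \sum_(0 <= i < n) ((a i)%:R - (b i)%:R) * s`_i)) =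
  if all (fun i => a i == b i) (iota 0 n) then (2 * pi) ^+ n * cos c else 0.
Proof.
elim: n a b c => [|n IH] a b c /=; first by rewrite big_geq// addr0 mul1r.
under eq_Rintegral.
  move=> x _.
  rewrite (_ : (fun s => _) = (fun s => cos ((c + ((a 0%N)%:R - (b 0%N)%:R) * x) +
     \sum_(0 <= i < n) ((a i.+1)%:R - (b i.+1)%:R) * s`_i))); last first.
    by apply/funext => s; rewrite big_nat_recl//= addrA.
  rewrite IH; over.
rewrite -[iota 1 n]/(iota (1 + 0) n) iotaDl all_map.
rewrite [all (preim _ _) _](_ : _ = all (fun i => a i.+1 == b i.+1) (iota 0 n))//.
have p0 := pi_gt0 R.
case: (all _ _); last first.
  by rewrite andbF Rintegral_cst ?mul0r//; exact: measurable_circ_dom.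
rewrite andbT; have [->|ab] := eqVneq (a 0%N) (b 0%N).
  rewrite subrr; under eq_Rintegral do rewrite mul0r addr0.
  rewrite Rintegral_cst; last exact: measurable_circ_dom.
  rewrite [X in fine X](_ : _ = (2 * pi)%:E); last exact: mu_circ_dom.
  by rewrite /= exprS; ring.
set k : R := (a 0%N)%:R - (b 0%N)%:R.
have k0 : k != 0 by rewrite subr_eq0 eqr_nat.
have spi : sin (k * pi) = 0 by rewrite /k mulrBl sinB !sin_natM_pi; ring.
pose F (x : R) := (2 * pi) ^+ n * (sin (c + k * x) / k).
transitivity (F pi - F (- pi)); last first.
  by rewrite /F mulrN sinB sinD spi; ring.
apply: (@Rintegral_FTC _ (fun x => (2 * pi) ^+ n * cos (c + k * x))).
- move=> x; apply: cvgMr; apply: continuous_comp; last exact: continuous_cos.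
  by apply: cvgD; [exact: cvg_cst|apply: cvgMr; exact: cvg_id].
- by lra.
- move=> x _; rewrite /F; apply: is_derive_eq; rewrite /GRing.scale/=.
  by rewrite mulr0 !add0r mul1r mulr1 [cos _ * k]mulrC mulKf.
Qed.

Lemma J_bigsum n (I : Type) (r : seq I) (P : pred I) (G : I -> seq R -> R) :
  (forall i, P i -> buc n (G i)) ->
  J n (fun s => \sum_(i <- r | P i) G i s) = \sum_(i <- r | P i) J n (G i).
Proof.
move=> bG; elim: r => [|i r IH].
  rewrite big_nil; under eq_J do rewrite big_nil.
  by rewrite J_cst mulr0.
rewrite big_cons; case: ifPn => Pi.
  rewrite -IH -J_add; [|exact: bG|exact: buc_sum].
  by apply: eq_J => s _; rewrite big_cons Pi.
by rewrite -IH; apply: eq_J => s _; rewrite big_cons (negbTE Pi).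
Qed.

Lemma buc_cos_lin n (k : nat -> R) (c : R) :
  buc n (fun s => cos (c + \sum_(0 <= i < n) k i * s`_i)).
Proof.
suff H m : (m <= n)%N -> buc n (fun s => cos (c + \sum_(0 <= i < m) k i * s`_i)) /\
    buc n (fun s => sin (c + \sum_(0 <= i < m) k i * s`_i)) by have [] := H n (leqnn n).
elim: m => [|m IH] mn.
  split; [apply: eq_buc (buc_cst n (cos c))|apply: eq_buc (buc_cst n (sin c))];
    by move=> s _; rewrite big_geq// addr0.
have [bc bs] := IH (ltnW mn).
have bc' := buc_coord (unif_cont_cos (k m) 0) mn.
have bs' := buc_coord (unif_cont_sin (k m) 0) mn.
split.
  apply: eq_buc (buc_sub (buc_mul bc bc') (buc_mul bs bs')) => s _.
  by rewrite big_nat_recr//= addrA [RHS]cosD !addr0.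
apply: eq_buc (buc_add (buc_mul bs bc') (buc_mul bc bs')) => s _.
by rewrite big_nat_recr//= addrA [RHS]sinD !addr0.
Qed.

(** By orthogonality only the diagonal pairs u = v of permutations survive, each contributing (2
    pi)^n with sign 1. *)
Lemma J_vdm2 n : J n (vdm2 n) = (2 * pi) ^+ n * n`!%:R.
Proof.
pose au (u : 'S_n) (i : nat) : nat := if (insub i : option 'I_n) is Some j then u j else 0%N.
have auE (u : 'S_n) (i : 'I_n) : au u i = u i by rewrite /au valK.
have sumE (u v : 'S_n) (s : seq R) : \sum_(i < n) ((u i)%:R - (v i)%:R) * s`_i =
    0 + \sum_(0 <= i < n) ((au u i)%:R - (au v i)%:R) * s`_i.
  by rewrite add0r big_mkord; apply: eq_bigr => i _; rewrite !auE.
have bT (u v : 'S_n) : buc n (fun s : seq R => cos (\sum_(i < n) ((u i)%:R - (v i)%:R) * s`_i)).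
  apply: eq_buc (buc_cos_lin n (fun i => (au u i)%:R - (au v i)%:R) 0) => s _.
  by rewrite sumE.
have JT (u v : 'S_n) : J n (fun s : seq R => cos (\sum_(i < n) ((u i)%:R - (v i)%:R) * s`_i)) =
    if u == v then (2 * pi) ^+ n else 0.
  under eq_J do rewrite sumE.
  rewrite J_cos cos0 mulr1; congr (if _ then _ else _).
  apply/idP/eqP => [/allP H|->]; last by apply/allP => i _.
  apply/permP => i; apply: val_inj; have := H i.
  by rewrite mem_iota/= ltn_ord => /(_ isT); rewrite !auE => /eqP.
under eq_J do rewrite vdm2E.
rewrite J_bigsum; last first.
  by move=> u _; apply: buc_sum => v _; exact: buc_scale.
rewrite (eq_bigr (fun=> (2 * pi) ^+ n)) => [|u _].
  by rewrite sumr_const card_Sn mulr_natr.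
rewrite J_bigsum; last by move=> v _; exact: buc_scale.
rewrite (eq_bigr (fun v : 'S_n => (-1) ^+ u * (-1) ^+ v * (if u == v then (2 * pi) ^+ n else 0))).
  rewrite (bigD1 u)//= eqxx -signr_addb addbb mul1r big1 ?addr0// => v vu.
  by rewrite eq_sym (negbTE vu) mulr0.
by move=> v _; rewrite J_scale// JT.
Qed.

Definition pk2 k s : R :=
  (\sum_(t <- s) cos (k%:R * t)) ^+ 2 + (\sum_(t <- s) sin (k%:R * t)) ^+ 2.

Lemma pk2_ge0 k s : 0 <= pk2 k s.
Proof. by rewrite addr_ge0// sqr_ge0. Qed.

Lemma pk2E k n s : size s = n ->
  pk2 k s = n%:R + 2 * \sum_(i < n) \sum_(j < n | (i < j)%N) cos (k%:R * (s`_i - s`_j)).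
Proof.
move=> sn; rewrite /pk2 !(sum_seq_nth _ sn) !big_mkord.
pose C i := cos (k%:R * s`_i); pose S i := sin (k%:R * s`_i).
pose X i j := cos (k%:R * (s`_i - s`_j)).
have XE i j : X i j = C i * C j + S i * S j by rewrite /X mulrBr cosB.
have X1 i : X i i = 1 by rewrite /X subrr mulr0 cos0.
have XC i j : X i j = X j i by rewrite !XE; ring.
have -> : (\sum_(i < n) C i) ^+ 2 + (\sum_(i < n) S i) ^+ 2 = \sum_(i < n) \sum_(j < n) X i j.
  rewrite !expr2 !mulr_suml -big_split/=; apply: eq_bigr => i _.
  by rewrite !mulr_sumr -big_split/=; apply: eq_bigr => j _; rewrite XE.
have H : \sum_(i < n) \sum_(j < n | (j < i)%N) X i j = \sum_(i < n) \sum_(j < n | (i < j)%N) X i j.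
  rewrite (exchange_big_dep predT)//=; apply: eq_bigr => i _.
  by apply: eq_bigr => j _; rewrite XC.
rewrite mulr_natl mulr2n -{1}H -big_split/=.
have -> : n%:R = \sum_(i < n) 1 :> R by rewrite sumr_const card_ord.
rewrite -big_split/=; apply: eq_bigr => i _.
rewrite (bigID (fun j : 'I_n => (j < i)%N))/= addrCA; congr (_ + _).
rewrite (bigD1 i) ?ltnn//= X1; congr (1 + _).
by apply: eq_bigl => j; rewrite -leqNgt [RHS]ltn_neqAle andbC eq_sym.
Qed.

(** Abel regularisation, at radius 1 - 1/n, of the logarithmic energy sum_k |p_k|^2 / k. The cut at
    K keeps it a trigonometric polynomial; the bounds derived from it do not depend on K. *)
Definition energy K n s : R :=
  \sum_(0 <= k < K) (1 - n%:R^-1) ^+ k.+1 / k.+1%:R * pk2 k.+1 s.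

Lemma energy_ge0 K n s : (0 < n)%N -> 0 <= energy K n s.
Proof.
move=> n0; apply: sumr_ge0 => k _; apply: mulr_ge0; last exact: pk2_ge0.
apply: divr_ge0 => //; apply: exprn_ge0.
by rewrite subr_ge0 invf_le1 ?ltr0n// ler1n.
Qed.


(** The case t = 0 of [ln_poisson_den_le], where 1 - r = 1/n. It prices the diagonal terms of the
    energy at ln n per point. *)
Lemma sum_inv_pow_le n K : (0 < n)%N ->
  \sum_(0 <= k < K) (1 - n%:R^-1) ^+ k.+1 / k.+1%:R <=
  ln n%:R + 2 * (1 - n%:R^-1) ^+ K * n%:R ^+ 2 :> R.
Proof.
move=> n0; have n0' : (0 : R) < n%:R by rewrite ltr0n.
have r0 : 0 <= 1 - n%:R^-1 :> R /\ 1 - n%:R^-1 < 1 :> R.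
  by rewrite subr_ge0 invf_le1// ler1n n0 ltrBlDr ltrDl invr_gt0.
have := @ln_poisson_den_le R (1 - n%:R^-1) 0 K; rewrite r0.1 r0.2 => /(_ isT); rewrite cos0.
have -> : 1 - 2 * (1 - n%:R^-1) * 1 + (1 - n%:R^-1) ^+ 2 = n%:R ^- 2 :> R.
  by rewrite -exprVn; ring.
rewrite lnV ?posrE ?exprn_gt0// lnXn//.
under eq_bigr do rewrite mulr0 cos0 mulr1.
have -> : (1 - (1 - n%:R^-1)) ^+ 2 = n%:R ^- 2 :> R by rewrite -exprVn; ring.
by rewrite invrK; lra.
Qed.

Lemma ler_geom_small (r e : R) : 0 <= r < 1 -> 0 < e -> exists K0, forall K, (K0 <= K)%N -> r ^+ K <= e.
Proof.
move=> /andP[r0 r1] e0.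
have : r ^+ K @[K --> \oo] --> (0 : R) by apply: cvg_expr; rewrite ger0_norm.
move=> /cvgrPdist_le /(_ _ e0) [K0 _ H]; exists K0 => K KK.
by have := H K KK; rewrite sub0r normrN ger0_norm// exprn_ge0.
Qed.

(** Each factor |1 - e^{it}|^2 is at most (1 + 1/n)^2 |1 - r e^{it}|^2 with r = 1 - 1/n, and the
    logarithm of the latter is expanded by [ln_poisson_den_le]. Summed over pairs, the cosines
    assemble into |p_k|^2 through [pk2E]. The diagonal costs n ln n + n, and the n^2 pairwise errors
    of size at most 3/n cost 3 n. *)
Lemma vdm2_le_energy n : (0 < n)%N -> exists K0, forall K s, (K0 <= K)%N -> size s = n ->
  vdm2 n s <= expR (n%:R * ln n%:R + 4 * n%:R - energy K n s).
Proof.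
move=> n0; have n0' : (0 : R) < n%:R by rewrite ltr0n.
have n1 : (1 : R) <= n%:R by rewrite ler1n.
pose r : R := 1 - n%:R^-1.
have vn1 : n%:R^-1 <= 1 :> R by rewrite invf_le1.
have vn0 : 0 < n%:R^-1 :> R by rewrite invr_gt0.
have r0 : 0 <= r < 1 by rewrite /r; lra.
have e0 : 0 < (4 * n%:R ^+ 3)^-1 :> R by rewrite invr_gt0 mulr_gt0// exprn_gt0.
have [K0 HK] := ler_geom_small r0 e0; exists K0 => K s KK sn.
pose err : R := 4 * r ^+ K / (1 - r) ^+ 2.
have errE : err = 4 * r ^+ K * n%:R ^+ 2.
  by rewrite /err /r subKr exprVn invrK.
have err1 : err <= n%:R^-1.
  rewrite errE; apply: (@le_trans _ _ (4 * (4 * n%:R ^+ 3)^-1 * n%:R ^+ 2)).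
    by rewrite ler_pM2r ?exprn_gt0// ler_pM2l// HK.
  by rewrite le_eqVlt; apply/orP; left; apply/eqP; field; rewrite gt_eqF.
have err0 : 0 <= err by rewrite errE !mulr_ge0 ?exprn_ge0//; case/andP: r0.
pose D i j := s`_i - s`_j.
pose T t := \sum_(0 <= k < K) r ^+ k.+1 * cos (k.+1%:R * t) / k.+1%:R.
have fac i j : chord2 s`_i s`_j <= expR (2 / n%:R + err - 2 * T (D i j)).
  have h1 : chord2 s`_i s`_j <= (1 + n%:R^-1) ^+ 2 * (1 - 2 * r * cos (D i j) + r ^+ 2).
    rewrite /chord2 -/(D i j) /r; have := cos_le1 (D i j); have := cos_geN1 (D i j).
    move: (cos _) (n%:R^-1) vn1 vn0 => c v v1 v0 c1 c2.
    (* The difference is affine in c, so it interpolates its values at c = 1 and c = -1, and both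
       are nonnegative. *)
    rewrite -subr_ge0 (_ : _ - _ = (1 + c) / 2 * ((1 + v) * v) ^+ 2 +
      (1 - c) / 2 * (v * (1 - v) * (4 + (v - v * v)))); last by field.
    have h3 : v * v <= v by nra.
    by rewrite addr_ge0// mulr_ge0 ?sqr_ge0 ?mulr_ge0//; lra.
  have q0 : 0 < 1 - 2 * r * cos (D i j) + r ^+ 2.
    apply: lt_le_trans (poisson_den_ge (D i j) _); last by case/andP: r0.
    by rewrite exprn_gt0// /r subKr.
  apply: (le_trans h1).
  rewrite -[X in _ * X](@lnK R)// (_ : 2 / n%:R + err - 2 * T (D i j) = n%:R^-1 * 2%:R + (err - 2 * T (D i j))); last by ring.
  rewrite expRD ler_pM ?expR_ge0 ?sqr_ge0//.
    by rewrite expRM_natr; rewrite lerXn2r ?nnegrE ?expR_ge0 ?expR_ge1Dx// addr_ge0// ltW.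
  rewrite ler_expR (le_trans (ln_poisson_den_le _ K r0))//.
  by rewrite -/(T _) -/err; lra.
have : vdm2 n s <= \prod_(i < n) \prod_(j < n | (i < j)%N) expR (2 / n%:R + err - 2 * T (D i j)).
  apply: ler_prod => i _; rewrite prodr_ge0/=; last by move=> j _; exact: chord2_ge0'.
  by apply: ler_prod => j _; rewrite chord2_ge0' fac.
move=> /le_trans; apply.
under eq_bigr do rewrite -expR_sum.
rewrite -expR_sum ler_expR.
have sT : \sum_(i < n) \sum_(j < n | (i < j)%N) 2 * T (D i j) =
    energy K n s - n%:R * \sum_(0 <= k < K) r ^+ k.+1 / k.+1%:R.
  rewrite /energy mulr_sumr -sumrB.
  transitivity (\sum_(0 <= k < K) \sum_(i < n) \sum_(j < n | (i < j)%N)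
      2 * (r ^+ k.+1 * cos (k.+1%:R * D i j) / k.+1%:R)).
    rewrite exchange_big/=; apply: eq_bigr => i _.
    rewrite exchange_big/=; apply: eq_bigr => j _.
    by rewrite /T mulr_sumr.
  apply: eq_bigr => k _; rewrite (pk2E _ sn) -/r.
  rewrite (_ : _ / _ * (_ + _) - _ = 2 * (r ^+ k.+1 / k.+1%:R) *
    (\sum_(i < n) \sum_(j < n | (i < j)%N) cos (k.+1%:R * D i j))); last by rewrite /D; ring.
  rewrite mulr_sumr; apply: eq_bigr => i _; rewrite mulr_sumr; apply: eq_bigr => j _.
  by ring.
have -> : \sum_(i < n) \sum_(j < n | (i < j)%N) (2 / n%:R + err - 2 * T (D i j)) =
   \sum_(i < n) \sum_(j < n | (i < j)%N) (2 / n%:R + err) -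
   \sum_(i < n) \sum_(j < n | (i < j)%N) 2 * T (D i j).
  by rewrite -sumrB; apply: eq_bigr => i _; rewrite -sumrB.
rewrite sT.
have c0 : 0 <= 2 / n%:R + err by rewrite addr_ge0// divr_ge0.
have hc : \sum_(i < n) \sum_(j < n | (i < j)%N) (2 / n%:R + err) <= 3 * n%:R.
  apply: (@le_trans _ _ (\sum_(i < n) \sum_(j < n) (2 / n%:R + err))).
    apply: ler_sum => i _; rewrite [leRHS](bigID (fun j : 'I_n => (i < j)%N))/= lerDl.
    exact: sumr_ge0.
  have S (c : R) : \sum_(i < n) c = n%:R * c by rewrite sumr_const card_ord mulr_natl.
  under eq_bigr do rewrite S.
  rewrite S.
  have h : n%:R * err <= 1 by rewrite -[leRHS](@mulfV _ (n%:R : R)) ?gt_eqF// ler_pM2l.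
  have e1 : n%:R * (2 / n%:R) = 2 :> R by rewrite mulrC divfK ?gt_eqF.
  by rewrite [leRHS]mulrC ler_pM2l// mulrDr e1; lra.
have := sum_inv_pow_le K n0; rewrite -/r => h.
have h2 : 2 * r ^+ K * n%:R ^+ 2 <= 1.
  have : 2 * r ^+ K * n%:R ^+ 2 = err / 2 by rewrite errE; field.
  by move=> ->; rewrite ler_pdivrMr// mul1r (le_trans err1)//; lra.
have : n%:R * \sum_(0 <= k < K) r ^+ k.+1 / k.+1%:R <= n%:R * (ln n%:R + 1).
  by rewrite ler_pM2l//; lra.
rewrite mulrDr mulr1; lra.
Qed.

(** [buc_comp] asks for continuity on the whole line; with the absolute value the power qualifies,
    and it is unchanged on the nonnegative values of [vdm2]. *)
Lemma powR_norm_continuous (r : R) : 0 < r -> continuous (fun x : R => `|x| `^ r).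
Proof.
move=> r0 x; rewrite /continuous_at; have [->|x0] := eqVneq x 0.
  rewrite normr0 powR0 ?gt_eqF//; apply/cvgrPdist_lt => e e0.
  have d0 : 0 < e `^ (r^-1) by rewrite powR_gt0.
  apply/nbhs_ballP; exists (e `^ (r^-1)) => //= y; rewrite /ball/= sub0r normrN => yd.
  rewrite sub0r normrN ger0_norm ?powR_ge0//.
  have -> : e = (e `^ r^-1) `^ r by rewrite -powRrM mulVf ?gt_eqF// powRr1 ?ltW.
  by rewrite gt0_ltr_powR// nnegrE// ltW.
have : {near nbhs x, (fun y : R => expR (r * ln `|y|)) =1 (fun y : R => `|y| `^ r)}.
  have : \forall y \near x, y != 0.
    apply/nbhs_ballP; exists `|x|; rewrite /= ?normr_gt0// => y; rewrite /ball/=.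
    by apply: contraTneq => ->; rewrite subr0 ltxx.
  apply: filterS => y y0; rewrite /powR normr_eq0 (negbTE y0)//.
move=> /near_eq_cvg/cvg_trans; apply.
rewrite /powR normr_eq0 (negbTE x0).
have cl : (ln `|y| : R) @[y --> x] --> ln `|x|.
  apply: (@continuous_comp _ _ _ (fun y : R => `|y|) (@ln R)); first exact: norm_continuous.
  by apply: continuous_ln; rewrite normr_gt0.
apply: (@continuous_comp _ _ _ (fun y : R => r * ln `|y|) (@expR R)); last exact: continuous_expR.
exact: cvgMr.
Qed.

Lemma buc_vdm2_powR n (r : R) : 0 < r -> buc n (fun s => vdm2 n s `^ r).
Proof.
move=> r0; apply: eq_buc (buc_comp (powR_norm_continuous r0) (buc_vdm2 n)) => s _.
by rewrite ger0_norm// vdm2_ge0.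
Qed.

(** One term of the exponential series suffices: n^n / n! <= e^n. *)
Lemma fact_ge n : (0 < n)%N -> expR (n%:R * ln n%:R - n%:R) <= n`!%:R :> R.
Proof.
case: n => // n _; have n0' : (0 : R) < n.+1%:R by rewrite ltr0n.
have f0 : (0 : R) < n.+1`!%:R by rewrite ltr0n fact_gt0.
rewrite expRD expRN ler_pdivrMr ?expR_gt0//.
have -> : expR (n.+1%:R * ln n.+1%:R) = n.+1%:R ^+ n.+1 :> R.
  by rewrite mulrC expRM_natr lnK.
rewrite -ler_pdivrMl// mulrC.
apply: le_trans (expR_ge1Dxn n (ltW n0')).
by rewrite lerDr.
Qed.

(** A lower bound for the partition function from the first moment of [vdm2] alone. For r >= 1 small
    values are discarded; for r < 1 a pointwise upper bound is used, since v^r = v^(r-1) v and the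
    power r - 1 is decreasing. *)
Lemma J_vdm2_powR_ge n (r : R) : (0 < n)%N -> 0 < r ->
  (2 * pi) ^+ n * expR (r * (n%:R * ln n%:R) - (5 + 2 * r) * n%:R) <=
  J n (fun s => vdm2 n s `^ r).
Proof.
move=> n0 r0; have n0' : (0 : R) < n%:R by rewrite ltr0n.
have n1 : (1 : R) <= n%:R by rewrite ler1n.
have p0 : 0 < (2 * pi) ^+ n :> R by rewrite exprn_gt0// mulr_gt0// pi_gt0.
have br := buc_vdm2_powR n r0.
have fg := fact_ge n0.
have f0 : (0 : R) < n`!%:R by rewrite ltr0n fact_gt0.
have [r1|r1] := leP 1 r.
  (* A is half the mean n! of [vdm2], so subtracting A still leaves half of the mean. *)
  pose A : R := n`!%:R / 2.
  have A0 : 0 < A by rewrite divr_gt0.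
  have : J n (fun s => A `^ (r - 1) * (vdm2 n s - A)) <= J n (fun s => vdm2 n s `^ r).
    apply: J_le => //.
      by apply: buc_scale; apply: buc_sub; [exact: buc_vdm2|exact: buc_cst].
    move=> s _ _; have v0 := vdm2_ge0 n s.
    have [vA|Av] := leP (vdm2 n s) A.
      apply: (@le_trans _ _ 0); last exact: powR_ge0.
      by rewrite mulr_ge0_le0 ?powR_ge0// subr_le0.
    apply: (@le_trans _ _ (A `^ (r - 1) * vdm2 n s)).
      by rewrite ler_wpM2l ?powR_ge0// gerBl ltW.
    have v1 : 0 < vdm2 n s by rewrite (lt_trans A0).
    have -> : vdm2 n s `^ r = vdm2 n s `^ (r - 1) * vdm2 n s.
      rewrite -[X in _ = _ * X]powRr1// -powRD ?subrK//.
      by rewrite (gt_eqF v1) implybT.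
    by rewrite ler_pM2r// ge0_ler_powR ?nnegrE ?subr_ge0// ltW.
  rewrite J_scale; last by apply: buc_sub; [exact: buc_vdm2|exact: buc_cst].
  rewrite (J_add (buc_vdm2 n) (buc_cst n (- A))) J_cst J_vdm2.
  apply: le_trans; rewrite -mulrDr [leRHS]mulrCA ler_pM2l//.
  have -> : n`!%:R - A = A by rewrite /A; field.
  have -> : A `^ (r - 1) * A = A `^ r.
    rewrite -[X in _ * X]powRr1 ?ltW// -powRD ?subrK//.
    by rewrite (gt_eqF A0) implybT.
  rewrite /powR gt_eqF// ler_expR.
  have hA : n%:R * ln n%:R - n%:R - 1 <= ln A.
    rewrite -ler_expR lnK ?posrE// expRD /A ler_pM ?expR_ge0// expRN lef_pV2 ?posrE ?expR_gt0//.
    by have := @expR_ge1Dx R 1; lra.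
  have : r * (n%:R * ln n%:R - n%:R - 1) <= r * ln A by rewrite ler_pM2l.
  have : r <= r * n%:R by rewrite ler_peMr// ltW.
  lra.
(* The uniform upper bound for [vdm2] obtained from [vdm2_le_energy] by dropping the nonnegative
   energy. *)
pose B : R := expR (n%:R * ln n%:R + 4 * n%:R).
have B0 : 0 < B by exact: expR_gt0.
have [K0 HK] := vdm2_le_energy n0.
have vB s : size s = n -> vdm2 n s <= B.
  move=> sn; apply: le_trans (HK K0 s (leqnn _) sn) _.
  by rewrite ler_expR gerBl energy_ge0.
have : J n (fun s => B `^ (r - 1) * vdm2 n s) <= J n (fun s => vdm2 n s `^ r).
  apply: J_le => //; first by apply: buc_scale; exact: buc_vdm2.
  move=> s sn _; have := vdm2_ge0 n s; rewrite le_eqVlt => /predU1P[<-|v0].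
    by rewrite mulr0 powR_ge0.
  have -> : vdm2 n s `^ r = vdm2 n s `^ (r - 1) * vdm2 n s.
    rewrite -[X in _ = _ * X]powRr1 ?ltW// -powRD ?subrK//.
    by rewrite (gt_eqF v0) implybT.
  rewrite ler_pM2r// -(opprB 1 r) !powRN lef_pV2 ?posrE ?powR_gt0//.
  apply: ge0_ler_powR; rewrite ?nnegrE ?vB ?(ltW v0) ?(ltW B0)//.
  by rewrite subr_ge0 ltW.
rewrite J_scale; last exact: buc_vdm2.
rewrite J_vdm2; apply: le_trans; rewrite [leRHS]mulrCA ler_pM2l//.
apply: (@le_trans _ _ (B `^ (r - 1) * expR (n%:R * ln n%:R - n%:R))).
  rewrite /powR gt_eqF// /B expRK -expRD ler_expR.
  have : 0 <= r * n%:R by rewrite mulr_ge0// ltW.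
  lra.
by rewrite ler_pM2l// powR_gt0.
Qed.

End CbePartition.

(** * Expectations in the circular ensemble and the energy bound *)

Section CbeExpectation.
Context {R : realType}.
Implicit Types (s : seq R) (n : nat) (g h : seq R -> R).

Lemma cbe_weightE (beta : R) n s : size s = n ->
  cbe_weight beta s = vdm2 n s `^ (beta / 2).
Proof.
elim: s n => [|x s IH] n /= <-.
  by rewrite /vdm2 big_ord0 powR1.
rewrite (IH (size s))// /vdm2 big_ord_recl powRM; last 2 first.
- by apply: prodr_ge0 => j _; exact: chord2_ge0'.
- by apply: prodr_ge0 => i _; apply: prodr_ge0 => j _; exact: chord2_ge0'.
congr (_ * _).
  rewrite (big_nth 0) big_mkord [in RHS]big_mkcond big_ord_recl/= mul1r.
  have -> : \prod_(i < size s) (if (0 < bump 0 i)%N then chord2 x s`_i else 1) =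
     \prod_(i < size s) chord2 x s`_i by apply: eq_bigr.
  elim: (size s) => [|m IHm]; first by rewrite !big_ord0 powR1.
  rewrite !big_ord_recr/= powRM ?IHm ?chord2_ge0'//; last first.
    by apply: prodr_ge0 => j _; exact: chord2_ge0'.
  congr (_ * _); rewrite circ_distE -powR12_sqrt ?chord2_ge0'// -powRrM.
  by congr (_ `^ _); rewrite mulrC.
congr (_ `^ _); apply: eq_bigr => i _.
rewrite [RHS]big_mkcond big_ord_recl/= mul1r [LHS]big_mkcond.
by apply: eq_bigr => j _.
Qed.

Definition cbeE (beta : R) n g : R :=
  J n (fun s => g s * cbe_weight beta s) / J n (cbe_weight beta).

Context (beta : R) (beta0 : 0 < beta).

Let r0 : 0 < beta / 2. Proof. by rewrite divr_gt0. Qed.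

Lemma buc_weight n : buc n (cbe_weight beta).
Proof.
by apply: eq_buc (buc_vdm2_powR n r0) => s sn; rewrite (cbe_weightE _ sn).
Qed.

Lemma J_weight_gt0 n : 0 < J n (cbe_weight beta).
Proof.
case: n => [|n]; first by rewrite /= ltr01.
rewrite (@eq_J _ _ _ (fun s => vdm2 n.+1 s `^ (beta / 2))); last first.
  by move=> s sn; rewrite (cbe_weightE _ sn).
apply: lt_le_trans (J_vdm2_powR_ge _ r0) => //.
by rewrite mulr_gt0 ?expR_gt0// exprn_gt0// mulr_gt0// pi_gt0.
Qed.

Lemma cbe_weight_ge0 s : 0 <= cbe_weight beta s.
Proof. by rewrite (cbe_weightE _ erefl) powR_ge0. Qed.

Lemma cbe_laplaceE n (f : R -> R) : unif_cont f ->
  cbe_laplace beta n f = cbeE beta n (fun s => expR (- \sum_(t <- s) f (n%:R * t))).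
Proof.
move=> uf; rewrite /cbe_laplace /cbeE; congr (_ / _).
  rewrite cube_integral_buc//; apply: buc_mul; last exact: buc_weight.
  apply: (buc_comp (h := expR)); first exact: continuous_expR.
  apply: buc_opp; apply: buc_linstat.
  have [[M HM] H] := uf; split; first by exists M.
  move=> e /H[d d0 Hd]; exists (d / n.+1%:R); first by rewrite divr_gt0// ltr0n.
  move=> x y xy; apply: Hd; rewrite -mulrBr normrM ger0_norm//.
  apply: (@le_lt_trans _ _ (n.+1%:R * `|x - y|)).
    by rewrite ler_wpM2r// ler_nat.
  by rewrite mulrC -ltr_pdivlMr ?ltr0n.
by rewrite cube_integral_buc//; exact: buc_weight.
Qed.

Lemma cbeE_add n g h : buc n g -> buc n h ->
  cbeE beta n (fun s => g s + h s) = cbeE beta n g + cbeE beta n h.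
Proof.
move=> bg bh; rewrite /cbeE -mulrDl; congr (_ / _).
have bw := buc_weight n; rewrite -J_add; try exact: buc_mul.
by apply: eq_J => s _; rewrite mulrDl.
Qed.

Lemma cbeE_scale n c g : buc n g -> cbeE beta n (fun s => c * g s) = c * cbeE beta n g.
Proof.
move=> bg; rewrite /cbeE mulrA; congr (_ / _).
have bw := buc_weight n; rewrite -J_scale; last exact: buc_mul.
by apply: eq_J => s _; rewrite mulrA.
Qed.

Lemma cbeE_cst n c : cbeE beta n (fun=> c) = c.
Proof.
rewrite /cbeE (@J_scale _ n c (cbe_weight beta) (buc_weight n)).
by rewrite mulfK// gt_eqF// J_weight_gt0.
Qed.

Lemma cbeE_le n g h : buc n g -> buc n h ->
  (forall s, size s = n -> in_circ s -> g s <= h s) -> cbeE beta n g <= cbeE beta n h.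
Proof.
move=> bg bh gh; rewrite /cbeE ler_pM2r ?invr_gt0 ?J_weight_gt0//.
have bw := buc_weight n; apply: J_le; try exact: buc_mul.
by move=> s sn sc; rewrite ler_wpM2r ?gh ?cbe_weight_ge0.
Qed.

Lemma eq_cbeE n g h : (forall s, size s = n -> g s = h s) -> cbeE beta n g = cbeE beta n h.
Proof. by move=> gh; rewrite /cbeE; congr (_ / _); apply: eq_J => s sn; rewrite gh. Qed.

Lemma cbeE_opp n g : buc n g -> cbeE beta n (fun s => - g s) = - cbeE beta n g.
Proof.
move=> bg; rewrite -mulN1r -cbeE_scale//; apply: eq_cbeE => s _.
by rewrite mulN1r.
Qed.

Lemma cbeE_sub n g h : buc n g -> buc n h ->
  cbeE beta n (fun s => g s - h s) = cbeE beta n g - cbeE beta n h.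
Proof.
by move=> bg bh; rewrite (@cbeE_add n g (fun s => - h s))// ?cbeE_opp//; exact: buc_opp.
Qed.

Lemma cbeE_ge0 n g : buc n g -> (forall s, size s = n -> in_circ s -> 0 <= g s) ->
  0 <= cbeE beta n g.
Proof. by move=> bg g0; rewrite -(cbeE_cst n 0); apply: cbeE_le => //; exact: buc_cst. Qed.

Lemma cbeE_norm_le n g h : buc n g -> buc n h ->
  (forall s, size s = n -> in_circ s -> `|g s| <= h s) -> `|cbeE beta n g| <= cbeE beta n h.
Proof.
move=> bg bh gh; rewrite ler_norml -cbeE_opp//; apply/andP; split.
  apply: cbeE_le => //; first exact: buc_opp.
  by move=> s sn /(gh s sn); rewrite ler_norml => /andP[].
by apply: cbeE_le => // s sn /(gh s sn); rewrite ler_norml => /andP[].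
Qed.

Lemma cbeE_bigsum n (I : Type) (r : seq I) (P : pred I) (G : I -> seq R -> R) :
  (forall i, P i -> buc n (G i)) ->
  cbeE beta n (fun s => \sum_(i <- r | P i) G i s) = \sum_(i <- r | P i) cbeE beta n (G i).
Proof.
move=> bG; elim: r => [|i r IH].
  rewrite big_nil (_ : (fun s => _) = fun=> 0) ?cbeE_cst//.
  by apply/funext => s; rewrite big_nil.
rewrite big_cons (_ : (fun s => _) = fun s => (if P i then G i s + \sum_(i <- r | P i) G i s else \sum_(i <- r | P i) G i s)).
  case: ifPn => Pi; last exact: IH.
  by rewrite cbeE_add ?IH//; [exact: bG|exact: buc_sum].
by apply/funext => s; rewrite big_cons.
Qed.

Lemma trig_inv_weight n : trig_inv n (cbe_weight beta).
Proof.
move=> s s' sn s'n ss'; rewrite !(@cbe_weightE _ n)// /vdm2; congr (_ `^ _).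
apply: eq_bigr => i _; apply: eq_bigr => j _.
by rewrite /chord2 !cosB (ss' i _).1// (ss' i _).2// (ss' j _).1// (ss' j _).2.
Qed.

Lemma cbe_weight_shift s c : cbe_weight beta [seq t + c | t <- s] = cbe_weight beta s.
Proof.
rewrite !(@cbe_weightE _ (size s)) ?size_map// /vdm2; congr (_ `^ _).
apply: eq_bigr => i _; apply: eq_bigr => j _; rewrite !(nth_map 0)//.
by rewrite /chord2 opprD addrACA subrr addr0.
Qed.

Lemma cbeE_shift n g c : buc n g -> trig_inv n g ->
  cbeE beta n (fun s => g [seq t + c | t <- s]) = cbeE beta n g.
Proof.
move=> bg tg; rewrite /cbeE; congr (_ / _).
rewrite -(@J_shift _ n (fun s => g s * cbe_weight beta s) c).
- by apply: eq_J => s _; rewrite cbe_weight_shift.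
- by apply: buc_mul => //; exact: buc_weight.
- move=> s s' sn s'n ss'; rewrite (tg s s')//; congr (_ * _).
  exact: (@trig_inv_weight n).
Qed.

Lemma buc_cos_linstat n k c : buc n (fun s : seq R => \sum_(t <- s) cos (k * t + c)).
Proof. exact: buc_linstat (unif_cont_cos k c). Qed.

Lemma buc_sin_linstat n k c : buc n (fun s : seq R => \sum_(t <- s) sin (k * t + c)).
Proof. exact: buc_linstat (unif_cont_sin k c). Qed.

Lemma buc_pk2 n k : buc n (@pk2 R k).
Proof.
apply: eq_buc (buc_add (buc_sqr (buc_cos_linstat n k%:R 0)) (buc_sqr (buc_sin_linstat n k%:R 0))) => s _.
by rewrite /pk2; congr (_ ^+ 2 + _ ^+ 2); apply: eq_bigr => t _; rewrite addr0.
Qed.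

Lemma buc_energy K n m : buc m (@energy R K n).
Proof. by apply: buc_sum => k _; apply: buc_scale; exact: buc_pk2. Qed.

(** With r = beta/2 the proof below yields ((5 + 6 r) n + 1) / r <= (6 + 6 r) n / r = (12/beta + 6)
    n. *)
Definition energyC : R := 12 / beta + 6.

(** Apply x <= a + e^{x - a} to x = (beta/2) times the energy. The exponential cancels the energy in
    the bound of the weight by [vdm2_le_energy], and what is left is compared with the lower bound
    of the partition function. *)
Lemma cbeE_energy_le n K : (0 < n)%N -> cbeE beta n (energy K n) <= energyC * n%:R.
Proof.
move=> n0; have n0' : (0 : R) < n%:R by rewrite ltr0n.
have n1 : (1 : R) <= n%:R by rewrite ler1n.
have [K0 HK] := @vdm2_le_energy R _ n0.
wlog KK : K / (K0 <= K)%N => [H|].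
  apply: le_trans (H (maxn K K0) (leq_maxr _ _)).
  apply: cbeE_le; [exact: buc_energy|exact: buc_energy|move=> s _ _].
  rewrite /energy (@big_cat_nat _ _ _ K 0 (maxn K K0))//= ?leq_maxl// lerDl.
  apply: sumr_ge0 => k _; rewrite mulr_ge0 ?pk2_ge0// divr_ge0// exprn_ge0//.
  by rewrite subr_ge0 invf_le1.
(* This a makes r (n ln n + 4 n) - a equal to the exponent r n ln n - (5 + 2 r) n of
   [J_vdm2_powR_ge], so the exponential term contributes at most 1. *)
pose r := beta / 2; pose a : R := (5 + 6 * r) * n%:R.
have Z0 := J_weight_gt0 n.
have bw := buc_weight n; have be := buc_energy K n n.
have H : J n (fun s => (r * energy K n s) * cbe_weight beta s) <=
    J n (fun s => a * cbe_weight beta s + expR (r * (n%:R * ln n%:R + 4 * n%:R) - a)).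
  apply: J_le.
  - by apply: buc_mul => //; exact: buc_scale.
  - by apply: buc_add; [exact: buc_scale|exact: buc_cst].
  - move=> s sn _; have w0 := cbe_weight_ge0 s.
    have h1 : r * energy K n s <= a + expR (r * energy K n s - a).
      by have := expR_ge1Dx (r * energy K n s - a); lra.
    apply: (le_trans (ler_wpM2r w0 h1)); rewrite mulrDl lerD2l.
    rewrite (@cbe_weightE _ n)//.
    apply: (@le_trans _ _ (expR (r * energy K n s - a) * expR (r * (n%:R * ln n%:R + 4 * n%:R - energy K n s)))).
      rewrite ler_pM2l ?expR_gt0// -/r.
      have -> : expR (r * (n%:R * ln n%:R + 4 * n%:R - energy K n s)) =
         expR (n%:R * ln n%:R + 4 * n%:R - energy K n s) `^ r.
        by rewrite /powR gt_eqF ?expR_gt0// expRK.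
      by rewrite ge0_ler_powR ?nnegrE ?vdm2_ge0 ?expR_ge0 ?HK// ltW.
    by rewrite -expRD ler_expR; lra.
rewrite (J_add (buc_scale a bw) (buc_cst n _)) J_scale// J_cst in H.
have H2 : (2 * pi) ^+ n * expR (r * (n%:R * ln n%:R + 4 * n%:R) - a) <= J n (cbe_weight beta).
  rewrite (@eq_J _ n _ (fun s => vdm2 n s `^ r)); last first.
    by move=> s sn; rewrite (cbe_weightE _ sn).
  apply: le_trans (J_vdm2_powR_ge n0 r0).
  rewrite ler_pM2l; last by rewrite exprn_gt0// mulr_gt0// pi_gt0.
  by rewrite ler_expR /a /r; lra.
have : cbeE beta n (fun s => r * energy K n s) <= a + 1.
  by rewrite /cbeE ler_pdivrMr// mulrDl mul1r (le_trans H)// lerD2l.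
rewrite cbeE_scale// => h.
have {h} : cbeE beta n (energy K n) <= (a + 1) / r by rewrite ler_pdivlMr// mulrC.
move=> /le_trans; apply; rewrite ler_pdivrMr// /a /energyC /r.
have -> : (12 / beta + 6) * n%:R * (beta / 2) = (6 + 3 * beta) * n%:R by field; rewrite gt_eqF.
lra.
Qed.

Lemma one_sub_inv_pow_ge n k : (1 < n)%N ->
  expR (- (2 * k%:R / n%:R)) <= (1 - n%:R^-1) ^+ k :> R.
Proof.
move=> n2; have n0' : (0 : R) < n%:R by rewrite ltr0n ltnW.
have v0 : 0 < n%:R^-1 :> R by rewrite invr_gt0.
have v1 : n%:R^-1 <= 2^-1 :> R by rewrite lef_pV2 ?posrE// ler_nat.
have -> : - (2 * k%:R / n%:R) = - (2 / n%:R) * k%:R :> R by ring.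
rewrite expRM_natr; apply: lerXn2r; rewrite ?nnegrE ?expR_ge0//; first by lra.
rewrite expRN -[leRHS]invrK lef_pV2 ?posrE ?expR_gt0 ?invr_gt0//; last by lra.
apply: le_trans (expR_ge1Dx _); rewrite -div1r ler_pdivrMr; last by lra.
move: (n%:R^-1) v0 v1 => v v0 v1.
have : 0 <= v * (1 - 2 * v) by rewrite mulr_ge0; lra.
lra.
Qed.

(** For k < n the damping (1 - 1/n)^k is at least e^{-2} >= 1/16, the latter because e^{-1/2} >=
    1/2. *)
Lemma cbeE_pk2_sum_le n : (1 < n)%N ->
  \sum_(1 <= k < n) cbeE beta n (pk2 k) / k%:R <= 16 * energyC * n%:R.
Proof.
move=> n2; have n0 : (0 < n)%N by rewrite ltnW.
have n0' : (0 : R) < n%:R by rewrite ltr0n.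
have := cbeE_energy_le n.-1 n0.
rewrite /energy cbeE_bigsum; last by move=> k _; apply: buc_scale; exact: buc_pk2.
move=> h; rewrite -mulrA; apply: le_trans (ler_wpM2l (ler0n _ 16) h).
rewrite mulr_sumr big_add1 !big_nat; apply: ler_sum => k /= kn.
rewrite cbeE_scale; last exact: buc_pk2.
rewrite mulrA [leLHS]mulrC ler_wpM2r//.
  by apply: cbeE_ge0; [exact: buc_pk2|move=> s _ _; exact: pk2_ge0].
rewrite mulrA -[leLHS]mul1r ler_pM2r ?invr_gt0 ?ltr0n//.
have := one_sub_inv_pow_ge k.+1 n2.
have h1 : expR (- (2^-1 * 4%:R)) <= expR (- (2 * k.+1%:R / n%:R)) :> R.
  rewrite ler_expR lerN2 ler_pdivrMr//.
  have : k.+1%:R <= n%:R :> R.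
    by rewrite ler_nat; move: kn; rewrite -ltnS prednK// => /ltnW.
  lra.
have h2 : 16^-1 <= expR (- (2^-1 * 4%:R)) :> R.
  rewrite -mulNr expRM_natr.
  have : 2^-1 <= expR (- 2^-1) :> R by apply: le_trans (expR_ge1Dx _); lra.
  move=> /(lerXn2r 4); rewrite !nnegrE expR_ge0 invr_ge0 ler0n => /(_ isT isT).
  by apply: le_trans; rewrite exprVn lef_pV2 ?posrE//; lra.
lra.
Qed.

End CbeExpectation.

(** * Orthogonality of power sums of different frequencies *)

Section Rotation.
Context {R : realType} (beta : R) (beta0 : 0 < beta).
Implicit Types (s : seq R) (n : nat).

Definition lcos (k : nat) s : R := \sum_(t <- s) cos (k%:R * t).
Definition lsin (k : nat) s : R := \sum_(t <- s) sin (k%:R * t).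

Lemma buc_lcos n k : buc n (lcos k).
Proof.
apply: eq_buc (buc_cos_linstat n k%:R 0) => s _.
by apply: eq_bigr => t _; rewrite addr0.
Qed.

Lemma buc_lsin n k : buc n (lsin k).
Proof.
apply: eq_buc (buc_sin_linstat n k%:R 0) => s _.
by apply: eq_bigr => t _; rewrite addr0.
Qed.

Lemma lcos_shift k s c :
  lcos k [seq t + c | t <- s] = cos (k%:R * c) * lcos k s - sin (k%:R * c) * lsin k s.
Proof.
rewrite /lcos /lsin big_map !mulr_sumr -sumrB; apply: eq_bigr => t _.
by rewrite mulrDr cosD; ring.
Qed.

Lemma lsin_shift k s c :
  lsin k [seq t + c | t <- s] = cos (k%:R * c) * lsin k s + sin (k%:R * c) * lcos k s.
Proof.
rewrite /lcos /lsin big_map !mulr_sumr -big_split/=; apply: eq_bigr => t _.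
by rewrite mulrDr sinD; ring.
Qed.

Lemma cos_sin_natM (k : nat) (a b : R) : cos a = cos b -> sin a = sin b ->
  cos (k%:R * a) = cos (k%:R * b) /\ sin (k%:R * a) = sin (k%:R * b).
Proof.
move=> ec es; elim: k => [|k [IH1 IH2]]; first by rewrite !mul0r.
by rewrite -natr1 !mulrDl !mul1r !cosD !sinD IH1 IH2 ec es.
Qed.

Lemma trig_inv_linstat n (h : R -> R) :
  (forall a b, cos a = cos b -> sin a = sin b -> h a = h b) ->
  trig_inv n (fun s => \sum_(t <- s) h t).
Proof.
move=> hab s s' sn s'n ss'; rewrite !(sum_seq_nth _ (n := n))// !big_mkord.
by apply: eq_bigr => i _; have [H1 H2] := ss' i (ltn_ord i); exact: hab.
Qed.

Lemma trig_inv_lcos n k : trig_inv n (lcos k).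
Proof.
by apply: trig_inv_linstat => a b ec es; have [-> _] := cos_sin_natM k ec es.
Qed.

Lemma trig_inv_lsin n k : trig_inv n (lsin k).
Proof.
by apply: trig_inv_linstat => a b ec es; have [_ ->] := cos_sin_natM k ec es.
Qed.

Lemma cbeE_shift_opp n g c : buc n g -> trig_inv n g ->
  (forall s, g [seq t + c | t <- s] = - g s) -> cbeE beta n g = 0.
Proof.
move=> bg tg gN; have := cbeE_shift beta0 c bg tg.
rewrite (@eq_cbeE _ _ _ _ (fun s => - g s)) // cbeE_opp// => h; lra.
Qed.

Lemma trig_inv_mul n (g h : seq R -> R) : trig_inv n g -> trig_inv n h ->
  trig_inv n (fun s => g s * h s).
Proof. by move=> tg th s s' sn s'n ss'; rewrite (tg s s')// (th s s'). Qed.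

Lemma trig_inv_add n (g h : seq R -> R) : trig_inv n g -> trig_inv n h ->
  trig_inv n (fun s => g s + h s).
Proof. by move=> tg th s s' sn s'n ss'; rewrite (tg s s')// (th s s'). Qed.

Lemma trig_inv_opp n (g : seq R -> R) : trig_inv n g -> trig_inv n (fun s => - g s).
Proof. by move=> tg s s' sn s'n ss'; rewrite (tg s s'). Qed.

(* Rotating by pi/(k+l), resp. pi/(k-l), changes the sign of p_k p_l, resp. of
   p_k times the conjugate of p_l. *)
Lemma cbeE_cross n (k l : nat) (a b a' b' : R) : (0 < k)%N -> (0 < l)%N -> k != l ->
  cbeE beta n (fun s => (a * lcos k s + b * lsin k s) * (a' * lcos l s + b' * lsin l s)) = 0.
Proof.
move=> k0 l0 kl.
pose A s := lcos k s * lcos l s - lsin k s * lsin l s.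
pose B s := lcos k s * lsin l s + lsin k s * lcos l s.
pose A' s := lcos k s * lcos l s + lsin k s * lsin l s.
pose B' s := lsin k s * lcos l s - lcos k s * lsin l s.
have bck := buc_lcos n k; have bcl := buc_lcos n l.
have bsk := buc_lsin n k; have bsl := buc_lsin n l.
have tck := @trig_inv_lcos n k; have tcl := @trig_inv_lcos n l.
have tsk := @trig_inv_lsin n k; have tsl := @trig_inv_lsin n l.
have bA : buc n A by apply: buc_sub; exact: buc_mul.
have bB : buc n B by apply: buc_add; exact: buc_mul.
have bA' : buc n A' by apply: buc_add; exact: buc_mul.
have bB' : buc n B' by apply: buc_sub; exact: buc_mul.
have tA : trig_inv n A.
  by apply: trig_inv_add; [|apply: trig_inv_opp]; exact: trig_inv_mul.
have tB : trig_inv n B by apply: trig_inv_add; exact: trig_inv_mul.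
have tA' : trig_inv n A' by apply: trig_inv_add; exact: trig_inv_mul.
have tB' : trig_inv n B'.
  by apply: trig_inv_add; [|apply: trig_inv_opp]; exact: trig_inv_mul.
have kl0 : (k%:R + l%:R : R) != 0 by rewrite -natrD pnatr_eq0 -lt0n addn_gt0 k0.
have kl1 : (k%:R - l%:R : R) != 0 by rewrite subr_eq0 eqr_nat.
pose f : R := pi / (k%:R + l%:R); pose f' : R := pi / (k%:R - l%:R).
have e1 : cos (k%:R * f + l%:R * f) = -1 by rewrite -mulrDl mulrC divfK// cospi.
have e2 : sin (k%:R * f + l%:R * f) = 0 by rewrite -mulrDl mulrC divfK// sinpi.
have e3 : cos (k%:R * f' - l%:R * f') = -1 by rewrite -mulrBl mulrC divfK// cospi.
have e4 : sin (k%:R * f' - l%:R * f') = 0 by rewrite -mulrBl mulrC divfK// sinpi.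
rewrite cosD in e1; rewrite sinD in e2; rewrite cosB in e3; rewrite sinB in e4.
have EA : cbeE beta n A = 0.
  apply: (@cbeE_shift_opp _ _ f) => // s; rewrite /A !lcos_shift !lsin_shift.
  set c := cos _ in e1 e2 *; set d := sin _ in e1 e2 *.
  set c' := cos (l%:R * f) in e1 e2 *; set d' := sin (l%:R * f) in e1 e2 *.
  transitivity ((c * c' - d * d') * (lcos k s * lcos l s - lsin k s * lsin l s) -
    (d * c' + c * d') * (lcos k s * lsin l s + lsin k s * lcos l s)); first by ring.
  by rewrite e1 e2; ring.
have EB : cbeE beta n B = 0.
  apply: (@cbeE_shift_opp _ _ f) => // s; rewrite /B !lcos_shift !lsin_shift.
  set c := cos _ in e1 e2 *; set d := sin _ in e1 e2 *.
  set c' := cos (l%:R * f) in e1 e2 *; set d' := sin (l%:R * f) in e1 e2 *.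
  transitivity ((c * c' - d * d') * (lcos k s * lsin l s + lsin k s * lcos l s) +
    (d * c' + c * d') * (lcos k s * lcos l s - lsin k s * lsin l s)); first by ring.
  by rewrite e1 e2; ring.
have EA' : cbeE beta n A' = 0.
  apply: (@cbeE_shift_opp _ _ f') => // s; rewrite /A' !lcos_shift !lsin_shift.
  set c := cos _ in e3 e4 *; set d := sin _ in e3 e4 *.
  set c' := cos (l%:R * f') in e3 e4 *; set d' := sin (l%:R * f') in e3 e4 *.
  transitivity ((c * c' + d * d') * (lcos k s * lcos l s + lsin k s * lsin l s) -
    (d * c' - c * d') * (lsin k s * lcos l s - lcos k s * lsin l s)); first by ring.
  by rewrite e3 e4; ring.
have EB' : cbeE beta n B' = 0.
  apply: (@cbeE_shift_opp _ _ f') => // s; rewrite /B' !lcos_shift !lsin_shift.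
  set c := cos _ in e3 e4 *; set d := sin _ in e3 e4 *.
  set c' := cos (l%:R * f') in e3 e4 *; set d' := sin (l%:R * f') in e3 e4 *.
  transitivity ((c * c' + d * d') * (lsin k s * lcos l s - lcos k s * lsin l s) +
    (d * c' - c * d') * (lcos k s * lcos l s + lsin k s * lsin l s)); first by ring.
  by rewrite e3 e4; ring.
rewrite (@eq_cbeE _ _ _ _ (fun s =>
   ((a * a' - b * b') / 2 * A s + (a * b' + b * a') / 2 * B s) +
   ((a * a' + b * b') / 2 * A' s + (b * a' - a * b') / 2 * B' s))); last first.
  by move=> s _; rewrite /A /B /A' /B'; field.
rewrite !cbeE_add ?cbeE_scale ?EA ?EB ?EA' ?EB' ?mulr0 ?addr0//; repeat (apply: buc_add || apply: buc_scale) => //.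
Qed.

(** [cbeE_cross] removes all products of distinct frequencies; on the diagonal the Cauchy-Schwarz
    inequality bounds the square by (a_k^2 + b_k^2) |p_k|^2. *)
Lemma cbeE_trigpoly_sqr_le n K (a b : nat -> R) :
  cbeE beta n (fun s => (\sum_(k < K) (a k * lcos k.+1 s + b k * lsin k.+1 s)) ^+ 2) <=
  \sum_(k < K) (a k ^+ 2 + b k ^+ 2) * cbeE beta n (pk2 k.+1).
Proof.
pose X k s := a k * lcos k.+1 s + b k * lsin k.+1 s.
have bX k : buc n (X k).
  by apply: buc_add; apply: buc_scale; [exact: buc_lcos|exact: buc_lsin].
rewrite (@eq_cbeE _ _ _ _ (fun s => \sum_(k < K) \sum_(l < K) X k s * X l s)); last first.
  by move=> s _; rewrite expr2 mulr_suml; apply: eq_bigr => k _; rewrite mulr_sumr.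
rewrite cbeE_bigsum//; last by move=> k _; apply: buc_sum => l _; exact: buc_mul.
apply: ler_sum => k _; rewrite cbeE_bigsum//; last by move=> l _; exact: buc_mul.
rewrite (bigD1 k)//= big1 ?addr0; last first.
  by move=> l lk; apply: cbeE_cross => //; rewrite eqSS eq_sym.
rewrite -cbeE_scale//; last exact: buc_pk2.
apply: cbeE_le => //; first exact: buc_mul.
  by apply: buc_scale; exact: buc_pk2.
move=> s _ _; rewrite /X /pk2 -/(lcos _ _) -/(lsin _ _).
have := sqr_ge0 (a k * lsin k.+1 s - b k * lcos k.+1 s).
lra.
Qed.

End Rotation.

(** * Discrepancy of the counting function *)

Section Discrepancy.
Context {R : realType} (beta : R) (beta0 : 0 < beta).
Implicit Types (s : seq R) (n : nat).

(** A trapezoid with slopes of size 1, supported in [a, b] and equal to 1 on [a + 1, b - 1]: a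
    Lipschitz stand-in for the indicator of a window, admissible as a test function. *)
Definition trap (a b x : R) : R := Num.max 0 (Num.min 1 (Num.min (x - a) (b - x))).

Lemma trap_ge0 a b x : 0 <= trap a b x.
Proof. by rewrite /trap le_max lexx. Qed.

Lemma trap_le1 a b x : trap a b x <= 1.
Proof. by rewrite /trap ge_max ler01 ge_min lexx. Qed.

Lemma trap_out a b x : x <= a \/ b <= x -> trap a b x = 0.
Proof.
move=> h; apply/eqP; rewrite eq_le trap_ge0 andbT /trap ge_max lexx/= !ge_min.
by case: h => h; apply/orP; right; apply/orP; [left|right]; rewrite subr_le0.
Qed.

Lemma trap_in a b x : a + 1 <= x -> x <= b - 1 -> trap a b x = 1.
Proof.
move=> ax xb; apply/eqP; rewrite eq_le trap_le1/= /trap le_max !le_min lexx/=.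
by apply/orP; right; apply/andP; split; lra.
Qed.

Lemma max_lip (a x y e : R) : `|x - y| <= e -> `|Num.max a x - Num.max a y| <= e.
Proof.
by rewrite !ler_norml => /andP[h1 h2]; rewrite /Num.max; case: ltP => h3; case: ltP => h4;
  apply/andP; split; lra.
Qed.

Lemma min_lip (a b x y e : R) : `|x - y| <= e -> `|a - b| <= e -> `|Num.min a x - Num.min b y| <= e.
Proof.
by rewrite !ler_norml => /andP[h1 h2] /andP[h5 h6]; rewrite /Num.min; case: ltP => h3; case: ltP => h4;
  apply/andP; split; lra.
Qed.

Lemma trap_lip a b x y : `|trap a b x - trap a b y| <= `|x - y|.
Proof.
apply: max_lip; apply: min_lip; last by rewrite subrr normr0.
apply: min_lip; last by rewrite opprB addrA subrK.
by rewrite opprB addrC addrA subrK distrC.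
Qed.

Lemma unif_cont_trap a b : unif_cont (trap a b).
Proof.
apply: (@lipschitz_unif_cont _ _ 1 1) => [x|x y].
  by rewrite ger0_norm ?trap_ge0 ?trap_le1.
by rewrite mul1r trap_lip.
Qed.

Lemma unif_cont_scale (f : R -> R) (k : R) : unif_cont f -> unif_cont (fun x => f (k * x)).
Proof.
move=> [[M HM] H]; split; first by exists M.
move=> e /H[d d0 Hd]; exists (d / (`|k| + 1)); first by rewrite divr_gt0// ltr_wpDl.
move=> x y; rewrite ltr_pdivlMr ?ltr_wpDl// => xy; apply: Hd.
rewrite -mulrBr normrM (le_lt_trans _ xy)// mulrC ler_wpM2l//.
by rewrite lerDl.
Qed.

Definition linst n (f : R -> R) s : R := \sum_(t <- s) f (n%:R * t).

Lemma buc_linst n m (f : R -> R) : unif_cont f -> buc n (linst m f).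
Proof. by move=> uf; apply: buc_linstat; exact: unif_cont_scale. Qed.

(** The indicator of the arc [A, B] convolved with the Fejer kernel. It is a nonnegative
    trigonometric polynomial of degree below n, so its statistic involves only the power sums
    controlled by [cbeE_pk2_sum_le]. *)
Definition smooth_arc n (A B t : R) : R := (fejerI n (t - A) - fejerI n (t - B)) / (2 * pi).

Lemma smooth_arc_ge0 n A B t : (0 < n)%N -> A <= B -> 0 <= smooth_arc n A B t.
Proof.
move=> n0 AB; rewrite divr_ge0//; last by rewrite mulr_ge0// pi_ge0.
by rewrite subr_ge0 fejerI_nondecr// lerB.
Qed.

Lemma smooth_arc_ge n A B t eta : (0 < n)%N -> 0 < eta -> eta <= pi ->
  A + eta <= t -> t <= B - eta -> 1 - 36 / (n%:R * eta) / pi <= smooth_arc n A B t.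
Proof.
move=> n0 e0 epi At tB; have p0 := pi_gt0 R.
rewrite /smooth_arc ler_pdivlMr ?mulr_gt0//.
have -> : (1 - 36 / (n%:R * eta) / pi) * (2 * pi) = 2 * (pi - 36 / (n%:R * eta)).
  by rewrite mulrBl mul1r mulrBr [_ / pi * _]mulrCA divfK ?gt_eqF.
have h := fejerI_ge n0 e0 epi.
have h1 : fejerI n eta <= fejerI n (t - A) by apply: fejerI_nondecr => //; lra.
have h2 : fejerI n eta <= - fejerI n (t - B).
  by rewrite -fejerIN; apply: fejerI_nondecr => //; lra.
lra.
Qed.

Definition arc_coef n (A B : R) (k : nat) : R :=
  (1 - k.+1%:R / n%:R) / k.+1%:R / pi.

Lemma sum_smooth_arc n A B s : size s = n -> (0 < n)%N ->
  \sum_(t <- s) smooth_arc n A B t = n%:R * (B - A) / (2 * pi) +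
   \sum_(k < n.-1) (arc_coef n A B k * (sin (k.+1%:R * B) - sin (k.+1%:R * A)) * lcos k.+1 s +
      arc_coef n A B k * (cos (k.+1%:R * A) - cos (k.+1%:R * B)) * lsin k.+1 s).
Proof.
move=> sn n0; have p0 : (pi : R) != 0 by rewrite gt_eqF// pi_gt0.
have e1 t : smooth_arc n A B t = (B - A) / (2 * pi) +
    \sum_(k < n.-1) (arc_coef n A B k * (sin (k.+1%:R * B) - sin (k.+1%:R * A)) * cos (k.+1%:R * t) +
      arc_coef n A B k * (cos (k.+1%:R * A) - cos (k.+1%:R * B)) * sin (k.+1%:R * t)).
  rewrite /smooth_arc /fejerI !big_add1 !big_mkord.
  rewrite (_ : _ - _ = (B - A) + 2 * (\sum_(i < n.-1) (1 - i.+1%:R / n%:R) * (sin (i.+1%:R * (t - A)) / i.+1%:R) -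
     \sum_(i < n.-1) (1 - i.+1%:R / n%:R) * (sin (i.+1%:R * (t - B)) / i.+1%:R))); last by ring.
  rewrite -sumrB mulrDl; congr (_ + _).
  rewrite invfM mulrA -[2 * _ * 2^-1]mulrA mulrCA -mulrA mulrCA !mulrA divff// mul1r mulr_suml.
  apply: eq_bigr => k _; rewrite !mulrBr !sinB /arc_coef.
  by ring.
under eq_bigr do rewrite e1.
rewrite big_split/= big_const_seq count_predT sn iter_addr_0 -[_ *+ n]mulr_natl mulrA; congr (_ + _).
rewrite exchange_big/=; apply: eq_bigr => k _.
by rewrite big_split/= /lcos /lsin !mulr_sumr.
Qed.

(** The squared coefficient of frequency k is at most (2 - 2 cos y) / (2k)^2 with y = k (B - A). The
    bound 2 - 2 cos y <= 2 y turns this into (B - A) / (2k), which matches the weight 1/k of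
    [cbeE_pk2_sum_le]. *)
Lemma cbeE_smooth_arc_le n A B : (1 < n)%N -> A <= B ->
  cbeE beta n (fun s => (\sum_(t <- s) smooth_arc n A B t - n%:R * (B - A) / (2 * pi)) ^+ 2)
  <= 8 * energyC beta * (n%:R * (B - A)).
Proof.
move=> n1 AB; have n0 : (0 < n)%N by exact: ltnW.
rewrite (@eq_cbeE _ _ _ _ (fun s => (\sum_(k < n.-1) (arc_coef n A B k * (sin (k.+1%:R * B) - sin (k.+1%:R * A)) * lcos k.+1 s +
      arc_coef n A B k * (cos (k.+1%:R * A) - cos (k.+1%:R * B)) * lsin k.+1 s)) ^+ 2)); last first.
  by move=> s sn; rewrite sum_smooth_arc// addrC addKr.
apply: (le_trans (@cbeE_trigpoly_sqr_le _ _ beta0 n n.-1 (fun k => arc_coef n A B k * (sin (k.+1%:R * B) - sin (k.+1%:R * A)))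
   (fun k => arc_coef n A B k * (cos (k.+1%:R * A) - cos (k.+1%:R * B))))).
have -> : 8 * energyC beta * (n%:R * (B - A)) = (B - A) / 2 * (16 * energyC beta * n%:R) by field.
have AB2 : 0 <= (B - A) / 2 by rewrite divr_ge0// subr_ge0.
apply: le_trans (ler_wpM2l AB2 (cbeE_pk2_sum_le beta0 n1)).
rewrite mulr_sumr big_add1 big_mkord; apply: ler_sum => k _.
rewrite [leRHS]mulrA [leRHS]mulrAC; apply: ler_wpM2r.
  by apply: cbeE_ge0 => //; [exact: buc_pk2|move=> s _ _; exact: pk2_ge0].
have k0 : (0 : R) < k.+1%:R by rewrite ltr0n.
have n0' : (0 : R) < n%:R by rewrite ltr0n.
set c := arc_coef _ _ _ _.
have -> : (c * (sin (k.+1%:R * B) - sin (k.+1%:R * A))) ^+ 2 + (c * (cos (k.+1%:R * A) - cos (k.+1%:R * B))) ^+ 2 =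
   c ^+ 2 * (2 - 2 * cos (k.+1%:R * (B - A))).
  have h1 := cos2Dsin2 (k.+1%:R * A); have h2 := cos2Dsin2 (k.+1%:R * B).
  rewrite [_ * (B - A)]mulrBr cosB.
  move: (k.+1%:R * A) (k.+1%:R * B) h1 h2 => u w h1 h2.
  transitivity (c ^+ 2 * ((cos u ^+ 2 + sin u ^+ 2) + (cos w ^+ 2 + sin w ^+ 2) -
    2 * (cos w * cos u + sin w * sin u))); first by ring.
  by rewrite h1 h2.
have c0 : 0 <= c.
  rewrite /c /arc_coef !divr_ge0 ?pi_ge0 ?(ltW k0)// subr_ge0 ler_pdivrMr// mul1r ler_nat.
  by rewrite (leq_trans (ltn_ord k))// leq_pred.
have c1 : c <= k.+1%:R^-1 / 2.
  rewrite /c /arc_coef ler_pM//.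
  - by rewrite divr_ge0 ?(ltW k0)// subr_ge0 ler_pdivrMr// mul1r ler_nat (leq_trans (ltn_ord k))// leq_pred.
  - by rewrite invr_ge0 pi_ge0.
  - by rewrite ler_pdivrMr// mulVf ?gt_eqF// gerBl divr_ge0// ltW.
  - by rewrite lef_pV2 ?posrE ?pi_gt0// pi_ge2.
set y := k.+1%:R * (B - A).
have y0 : 0 <= y by rewrite mulr_ge0 ?subr_ge0// ltW.
have h1 : 2 - 2 * cos y <= 2 * y.
  have := chord2_le y; have := cos_geN1 y => h1 h2.
  by have [y2|y2] := leP y 2; nra.
have -> : (B - A) / 2 / k.+1%:R = (k.+1%:R^-1 / 2) ^+ 2 * (2 * y).
  by rewrite /y; field; rewrite gt_eqF.
apply: ler_pM => //; rewrite ?sqr_ge0 ?chord2_ge0//.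
by apply: lerXn2r; rewrite ?nnegrE// (le_trans c0).
Qed.

Definition discC : R := 100 + 1200 * energyC beta.

Lemma energyC_ge0 : 0 <= energyC beta.
Proof. by rewrite /energyC addr_ge0// divr_ge0// ltW. Qed.

(** With x = b - a, the trapezoid is dominated by a multiple of [smooth_arc] on a slightly wider
    arc. The widening changes the mean by O(sqrt x), and the variance O(x) of the arc statistic
    contributes the same order. Only an excess is controlled this way, hence the positive part. *)
Lemma cbeE_count_excess_le (a b : R) : 1 <= b - a -> exists n0, forall n, (n0 <= n)%N ->
  cbeE beta n (fun s => Num.max 0 (linst n (trap a b) s - (b - a) / (2 * pi))) <= discC * Num.sqrt (b - a).
Proof.
move=> ab; set x := b - a in ab *; pose y := Num.sqrt x.
have x0 : 0 <= x by lra.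
have y2 : y ^+ 2 = x by rewrite sqr_sqrtr.
have y1 : 1 <= y by rewrite -[leLHS](@sqrtr1 R) ler_sqrt// ltr01.
have y0 : 0 < y by lra.
have p2 := pi_ge2 R; have p0 := pi_gt0 R.
have C0 := energyC_ge0.
exists (Num.bound (18 * y)).+2 => n nn.
have n2 : (1 < n)%N by apply: leq_trans nn.
have n0 : (0 < n)%N by exact: ltnW.
have n0' : (0 : R) < n%:R by rewrite ltr0n.
have ny : 18 * y <= n%:R.
  apply: ltW; apply: lt_le_trans (archi_boundP _) _; first by lra.
  by rewrite ler_nat (leq_trans _ nn)// leqW// leqnSn.
(* With this margin the defect in [smooth_arc_ge] is v / pi for v = 1/y, a relative error x^{-1/2},
   while the rescaled window grows by only 36 y on each side. The condition 18 y <= n gives eta <= 2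
   <= pi. *)
pose eta := 36 * y / n%:R.
have eta0 : 0 < eta by rewrite divr_gt0//; lra.
have etapi : eta <= pi by rewrite /eta ler_pdivrMr//; nra.
pose A := a / n%:R - eta; pose B := b / n%:R + eta.
have AB : A <= B.
  have : a / n%:R <= b / n%:R by rewrite ler_pM2r ?invr_gt0// -subr_ge0.
  by rewrite /A /B; lra.
have nBA : n%:R * (B - A) = x + 72 * y.
  by rewrite /A /B /eta /x; field; rewrite gt_eqF.
pose G s := \sum_(t <- s) smooth_arc n A B t.
pose err s := G s - n%:R * (B - A) / (2 * pi).
pose v := y^-1.
have v0 : 0 < v by rewrite invr_gt0.
have yv : y * v = 1 by rewrite divff// gt_eqF.
have v1 : v <= 1 by rewrite invf_le1.
have point t : trap a b (n%:R * t) <= (1 + v) * smooth_arc n A B t.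
  have [/andP[h1 h2]|h] := boolP ((a <= n%:R * t) && (n%:R * t <= b)); last first.
    rewrite trap_out; first by rewrite mulr_ge0 ?smooth_arc_ge0//; lra.
    by move: h; rewrite negb_and -!ltNge => /orP[h|h]; [left|right]; rewrite ltW.
  apply: (le_trans (trap_le1 _ _ _)).
  have At : A + eta <= t by rewrite /A subrK ler_pdivrMr// mulrC.
  have tB : t <= B - eta by rewrite /B addrK ler_pdivlMr// mulrC.
  have := smooth_arc_ge n0 eta0 etapi At tB.
  have -> : 36 / (n%:R * eta) / pi = v / pi.
    have ne : n%:R * eta = 36 * y by rewrite /eta mulrC divfK ?gt_eqF.
    by rewrite ne [_ / (36 * y)](_ : _ = v)// invfM mulrA divff ?mul1r// pnatr_eq0.
  have : v / pi <= v / 2 by rewrite ler_pM2l// lef_pV2 ?posrE.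
  move=> h3 h4; have h5 : 1 - v / 2 <= smooth_arc n A B t by lra.
  have : (1 + v) * (1 - v / 2) <= (1 + v) * smooth_arc n A B t by rewrite ler_pM2l//; lra.
  nra.
have bG : buc n G.
  apply: (@eq_buc _ n (fun s => _ + \sum_(k < n.-1) (_ * lcos k.+1 s + _ * lsin k.+1 s))).
    by move=> s sn; rewrite /G (sum_smooth_arc _ _ sn n0).
  apply: buc_add; first exact: buc_cst.
  by apply: buc_sum => k _; apply: buc_add; apply: buc_scale; [exact: buc_lcos|exact: buc_lsin].
have berr : buc n err by apply: buc_sub => //; exact: buc_cst.
have bN := buc_linst n n (unif_cont_trap a b).
have main s : Num.max 0 (linst n (trap a b) s - x / (2 * pi)) <= 90 * y + 2 * v * err s ^+ 2.
  have h1 : linst n (trap a b) s <= (1 + v) * G s.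
    by rewrite /linst /G mulr_sumr; apply: ler_sum => t _; exact: point.
  have hG : G s = (x + 72 * y) / (2 * pi) + err s by rewrite /err nBA; ring.
  (* The arithmetic-geometric inequality at scale y, which converts the second moment into a first
     moment bound of order y. *)
  have h2 : 2 * err s <= y + v * err s ^+ 2.
    have : 0 <= v * (y - err s) ^+ 2 by rewrite mulr_ge0 ?sqr_ge0 ?ltW.
    have -> : v * (y - err s) ^+ 2 = y * v * y - 2 * (y * v) * err s + v * err s ^+ 2 by ring.
    by rewrite yv; lra.
  have e2 : 0 <= err s ^+ 2 by exact: sqr_ge0.
  have vv : v * v <= v by nra.
  have ve := mulr_ge0 (ltW v0) e2.
  rewrite ge_max; apply/andP; split; first by lra.
  pose q : R := (2 * pi)^-1.
  have q0 : 0 < q by rewrite invr_gt0 mulr_gt0.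
  have q1 : q <= 4^-1 by rewrite lef_pV2 ?posrE ?mulr_gt0//; clear -p2; lra.
  have h3 : (1 + v) * G s - x / (2 * pi) = q * (73 * y + 72 * (y * v)) + (1 + v) * err s + q * y * (y * v - 1).
    by rewrite hG -y2 -/q; ring.
  rewrite yv subrr mulr0 addr0 mulr1 in h3.
  have h4 : q * (73 * y + 72) <= 4^-1 * (145 * y) by apply: ler_pM => //; move: y0 y1 q0; clear; lra.
  have h5 : (1 + v) * err s <= y + v * err s ^+ 2.
    have [e0|e0] := leP 0 (err s).
      apply: le_trans h2; rewrite ler_wpM2r//; clear -v1; lra.
    have : (1 + v) * err s <= 0 by rewrite pmulr_rle0 ?(ltW e0)// addr_gt0.
    by move: ve y0; clear; lra.
  by move: h1 h3 h4 h5 ve (ltW y0); clear; lra.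
have bmax : buc n (fun s => Num.max 0 (linst n (trap a b) s - x / (2 * pi))).
  apply: (buc_comp (h := fun z => Num.max 0 z)); last by apply: buc_sub => //; exact: buc_cst.
  by move=> z; apply: continuous_max; [exact: cst_continuous|exact: cvg_id].
apply: (le_trans (cbeE_le beta0 bmax _ (fun s _ _ => main s))).
  by apply: buc_add; [exact: buc_cst|apply: buc_scale; exact: buc_sqr].
rewrite cbeE_add ?cbeE_cst ?cbeE_scale//; [|exact: buc_sqr|exact: buc_cst|by apply: buc_scale; exact: buc_sqr].
have h6 : cbeE beta n (fun s => err s ^+ 2) <= 8 * energyC beta * (x + 72 * y).
  by rewrite -nBA; exact: cbeE_smooth_arc_le.
have h7 : 2 * v * cbeE beta n (fun s => err s ^+ 2) <= 2 * v * (8 * energyC beta * (x + 72 * y)).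
  by rewrite ler_pM2l// mulr_gt0.
have -> : discC * y = 100 * y + 1200 * energyC beta * y by rewrite /discC; ring.
have e3 : 2 * v * (8 * energyC beta * (x + 72 * y)) = 16 * energyC beta * (y * v * (y + 72)) by rewrite -y2; ring.
rewrite e3 yv mul1r in h7.
have : 16 * energyC beta * (y + 72) <= 1200 * energyC beta * y by nra.
lra.
Qed.

End Discrepancy.

(** * Lower bound for the mean number of points in a window *)

Section MeanLower.
Context {R : realType} (beta : R) (beta0 : 0 < beta).
Implicit Types (s : seq R) (n : nat).

Lemma cosD2pi_int (x : R) (k : int) : cos (x + k%:~R * (2 * pi)) = cos x.
Proof.
rewrite [2 * pi]mulr_natl.
have H (m : nat) (y : R) : cos (y + m%:R * (pi *+ 2)) = cos y.
  elim: m y => [|m IH] y; first by rewrite mul0r addr0.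
  by rewrite -natr1 mulrDl mul1r addrA cosD2pi IH.
case: k => m; first exact: H.
by rewrite NegzE mulrNz mulNr -{2}[x](subrK (m.+1%:R * (pi *+ 2))) H.
Qed.

Lemma cos_ge_of_norm_le (y l : R) : `|y| <= l -> l <= pi -> cos l <= cos y.
Proof.
move=> yl lpi; rewrite -(cos_norm y); have y0 := normr_ge0 y.
rewrite le_eqVlt; have := yl; rewrite le_eqVlt => /predU1P[->|yl']; first by rewrite eqxx.
by rewrite ltr_cos ?yl' ?orbT// in_itv/=; apply/andP; split; lra.
Qed.

(** The M rotations by multiples of 2 pi / M of an arc of half-width l >= pi / M cover the
    circle. *)
Lemma rotation_cover (t l : R) M : (0 < M)%N -> pi / M%:R <= l -> l <= pi ->
  exists2 i, (i < M)%N & cos l <= cos (t + i%:R * (2 * pi / M%:R)).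
Proof.
move=> M0 Ml lpi; have M0' : (0 : R) < M%:R by rewrite ltr0n.
have p0 := pi_gt0 R.
(* The floor k of u is an integer nearest to -t M / (2 pi): k steps bring t within half a step of 0.
   Reducing k modulo M changes the angle by a multiple of 2 pi. *)
pose u := - t * M%:R / (2 * pi) + 2^-1.
pose k : int := Num.floor u.
have /andP[k1 k2] := mem_rg1_floor u; rewrite -/k in k1 k2.
have hM : (M%:Z != 0) by rewrite -lt0n in M0 *; case: M M0 {Ml M0' u k k1 k2}.
have kE := divz_eq k M%:Z.
have m0 := modz_ge0 k hM.
have m1 : (k %% M%:Z < M%:Z)%Z by apply: ltz_pmod; rewrite ltz_nat.
exists `|(k %% M%:Z)%Z|%N; first by rewrite -ltz_nat gez0_abs.
have e1 : (`|(k %% M%:Z)%Z|%N)%:R = (k %% M%:Z)%Z%:~R :> R.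
  by rewrite -[in RHS](gez0_abs m0).
rewrite e1 -[leRHS](cosD2pi_int _ (k %/ M%:Z)%Z).
have -> : t + (k %% M%:Z)%Z%:~R * (2 * pi / M%:R) + (k %/ M%:Z)%Z%:~R * (2 * pi) =
   t + k%:~R * (2 * pi / M%:R).
  have kE' : k%:~R = (k %/ M%:Z)%Z%:~R * M%:R + (k %% M%:Z)%Z%:~R :> R.
    by rewrite {1}kE intrD intrM.
  rewrite kE'; field; rewrite gt_eqF//.
apply: cos_ge_of_norm_le => //; apply: le_trans Ml.
have -> : t + k%:~R * (2 * pi / M%:R) = (2 * pi / M%:R) * (k%:~R - (u - 2^-1)).
  rewrite /u addrK.
  have H (p m z w : R) : 0 < p -> 0 < m -> z + w * (2 * p / m) = 2 * p / m * (w - - z * m / (2 * p)).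
    by move=> ? ?; field; rewrite !gt_eqF.
  exact: H.
rewrite normrM gtr0_norm ?divr_gt0 ?mulr_gt0//.
have h : `|k%:~R - (u - 2^-1)| <= 2^-1.
  by rewrite ler_norml; apply/andP; split; lra.
apply: (@le_trans _ _ (2 * pi / M%:R * 2^-1)).
  by rewrite ler_pM2l ?divr_gt0 ?mulr_gt0.
rewrite -[2 * pi / _]mulrA; lra.
Qed.

(** A continuous bump around c on the circle, 1 at angular distance up to l' and 0 beyond l. Being a
    function of cos (t - c), it is periodic by construction. *)
Definition cap (l l' c t : R) : R :=
  Num.max 0 (Num.min 1 ((cos (t - c) - cos l) / (cos l' - cos l))).

Lemma unif_cont_cap (l l' c : R) : unif_cont (cap l l' c).
Proof.
have H : continuous (fun z : R => Num.max 0 (Num.min 1 ((z - cos l) / (cos l' - cos l)))).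
  move=> z; apply: (@continuous_max _ _ (fun=> 0) (fun z => Num.min 1 ((z - cos l) / (cos l' - cos l)))).
    exact: cst_continuous.
  apply: (@continuous_min _ _ (fun=> 1) (fun z => (z - cos l) / (cos l' - cos l))).
    exact: cst_continuous.
  by apply: cvgMl; apply: cvgB; [exact: cvg_id|exact: cvg_cst].
have := unif_cont_comp H (unif_cont_cos 1 (- c)).
by rewrite /cap; under eq_fun do rewrite mul1r.
Qed.

(** M rotated copies of the bump sum to at least 1 everywhere, so their statistics sum to at least
    n; by rotation invariance all copies have the same mean. *)
Lemma cbeE_cap_ge n M (l l' c : R) : (0 < n)%N -> (0 < M)%N -> pi / M%:R <= l' -> l' <= pi ->
  0 < cos l' - cos l ->
  n%:R / M%:R <= cbeE beta n (fun s => \sum_(t <- s) cap l l' c t).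
Proof.
move=> n0 M0 Ml lpi cl; have M0' : (0 : R) < M%:R by rewrite ltr0n.
pose g s := \sum_(t <- s) cap l l' c t.
have bg : buc n g by apply: buc_linstat; exact: unif_cont_cap.
have tg : trig_inv n g.
  by apply: trig_inv_linstat => a b ec es; rewrite /cap !cosB ec es.
pose h i s := g [seq t + i%:R * (2 * pi / M%:R) | t <- s].
have bh (i : nat) : buc n (h i) by exact: buc_map_shift.
have Eh : cbeE beta n (fun s => \sum_(0 <= i < M) h i s) = M%:R * cbeE beta n g.
  rewrite cbeE_bigsum// (eq_bigr (fun=> cbeE beta n g)).
    by rewrite big_const_nat subn0 iter_addr_0 mulr_natl.
  by move=> i _; rewrite /h (cbeE_shift beta0 _ bg tg).
rewrite ler_pdivrMr// mulrC -Eh -(cbeE_cst beta0 n n%:R).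
apply: cbeE_le => //; [exact: buc_cst|exact: buc_sum|].
move=> s sn _.
have cap0 t : 0 <= cap l l' c t by rewrite /cap le_max lexx.
have H t : 1 <= \sum_(0 <= i < M) cap l l' c (t + i%:R * (2 * pi / M%:R)).
  have [i iM hi] := rotation_cover (t - c) M0 Ml lpi.
  rewrite big_mkord (bigD1 (Ordinal iM))//= -[leLHS]addr0 lerD//; last exact: sumr_ge0.
  rewrite /cap le_max le_min lexx/= ler_pdivlMr// mul1r lerD2r.
  by rewrite addrAC hi orbT.
rewrite /h /g.
under eq_bigr do rewrite big_map.
rewrite exchange_big/= -sn -[leLHS]mulr_natl mulr1 -sum1_size natr_sum.
by apply: ler_sum => t _; exact: H.
Qed.

(** In rescaled length, 4 of the loss of 5 comes from the inner window of half-width (b - a)/2 - 2,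
    and the remaining 1 from rounding the number M of rotations up to an integer. *)
Lemma cbeE_count_ge (a b : R) : 5 <= b - a -> exists n0, forall n, (n0 <= n)%N ->
  (b - a - 5) / (2 * pi) <= cbeE beta n (linst n (trap a b)).
Proof.
move=> ab; have p0 := pi_gt0 R; have p2 := pi_ge2 R.
pose m := (b - a - 4) / (2 * pi).
have m0 : 0 < m by rewrite divr_gt0 ?mulr_gt0//; lra.
(* The term 8 m^2 makes the rounding of M cost at most 1/(2 pi), using 1/8 <= 1/(2 pi); the other
   terms keep the window in [-n, n] and its angular size below 1. *)
exists (Num.bound (`|a| + `|b| + 8 * (m * m) + b - a)).+1 => n nn.
have n0 : (0 < n)%N by apply: leq_trans nn.
have n0' : (0 : R) < n%:R by rewrite ltr0n.
have nB : `|a| + `|b| + 8 * (m * m) + b - a <= n%:R.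
  apply: ltW; apply: lt_le_trans (archi_boundP _) _.
    by have := normr_ge0 a; have := normr_ge0 b; have := mulr_gt0 m0 m0; clear -ab; lra.
  by rewrite ler_nat (leq_trans _ nn)// leqnSn.
pose l := ((b - a) / 2 - 1) / n%:R; pose l' := ((b - a) / 2 - 2) / n%:R.
pose c := (a + b) / 2 / n%:R.
have nA : - n%:R <= a by have := ler_norm (- a); rewrite normrN; have := normr_ge0 b; have := mulr_gt0 m0 m0; lra.
have nB' : b <= n%:R by have := ler_norm b; have := normr_ge0 a; have := mulr_gt0 m0 m0; lra.
have l'0 : 0 < l' by rewrite divr_gt0//; lra.
have ll' : l' < l by rewrite /l /l' ltr_pM2r ?invr_gt0//; lra.
have lpi : l <= pi.
  rewrite /l ler_pdivrMr//; nra.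
have cl : 0 < cos l' - cos l.
  by rewrite subr_gt0 ltr_cos// in_itv/=; apply/andP; split; clear -l'0 ll' lpi; lra.
pose M := (Num.truncn (pi / l')).+1.
have M0 : (0 < M)%N by [].
have M0' : (0 : R) < M%:R by rewrite ltr0n.
have pl0 : 0 <= pi / l' by rewrite divr_ge0// ltW.
have M2 : pi / l' < M%:R by rewrite /M; have /andP[] := truncn_itv pl0.
have M1 : M%:R <= pi / l' + 1 by rewrite /M -natr1 lerD2r; have /andP[] := truncn_itv pl0.
have Ml : pi / M%:R <= l'.
  by rewrite ler_pdivrMr// mulrC -ler_pdivrMr// ltW.
have l'pi : l' <= pi by lra.
have bcap : buc n (fun s => \sum_(t <- s) cap l l' c t).
  by apply: buc_linstat; exact: unif_cont_cap.
have h1 : n%:R / M%:R <= cbeE beta n (linst n (trap a b)).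
  apply: le_trans (cbeE_cap_ge c n0 M0 Ml l'pi cl) _.
  apply: cbeE_le => //; first by apply: buc_linst; exact: unif_cont_trap.
  move=> s _ sc; rewrite /linst !big_seq; apply: ler_sum => t /sc.
  rewrite /circ_dom/= in_itv/= => /andP[t1 t2].
  have [h|h] := leP (cos (t - c)) (cos l).
    rewrite {1}/cap (_ : Num.max _ _ = 0) ?trap_ge0//; apply/eqP.
    rewrite eq_le le_max lexx ge_max lexx/= ge_min andbT; apply/orP; right.
    by rewrite mulr_le0_ge0 ?subr_le0// invr_ge0 ltW.
  suff -> : trap a b (n%:R * t) = 1 by rewrite /cap ge_max ler01 ge_min lexx.
  (* The bump is periodic but the trapezoid is not, so points close to c only modulo 2 pi must be
     excluded. Since |c| <= 1 and l <= 1, a distance |t - c| > pi is at most pi + 1 and leaves an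
     angular distance of at least pi - 1 >= l. *)
  have hl : `|t - c| < l.
    rewrite ltNge; apply/negP => lt.
    have hc : `|c| <= 1.
      rewrite /c normrM [`|n%:R^-1|]gtr0_norm ?invr_gt0// ler_pdivrMr// mul1r.
      by clear -ab nA nB'; rewrite ler_norml; apply/andP; split; lra.
    have l0 : 0 <= l by apply/ltW/(lt_trans l'0).
    have [tp|tp] := leP `|t - c| pi.
      have : cos (t - c) <= cos l.
        by rewrite -(cos_norm (t - c)); apply: cos_ge_of_norm_le; rewrite ?(ger0_norm l0)//; clear -lt tp; lra.
      by move=> /(lt_le_trans h); rewrite ltxx.
    have hq : cos (t - c) = cos (2 * pi - `|t - c|).
      by rewrite -(cos_norm (t - c)) -[RHS]cosN opprB -[RHS](cosD2pi_int _ 1) mul1r subrK.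
    have hl2 : l <= 1.
      rewrite /l ler_pdivrMr// mul1r; have := normr_ge0 a; have := normr_ge0 b; have := mulr_gt0 m0 m0; clear -nB ab; lra.
    have ht : `|t - c| <= pi + 1.
      rewrite (le_trans (ler_normB _ _))// lerD// ler_norml; clear -t1 t2; apply/andP; split; lra.
    have : cos (2 * pi - `|t - c|) <= cos l.
      by apply: cos_ge_of_norm_le; rewrite ?(ger0_norm l0)//; clear -ht hl2 p2 tp lt; lra.
    by rewrite -hq => /(lt_le_trans h); rewrite ltxx.
  move: hl; rewrite ltr_norml => /andP[h2 h3].
  have e3 : n%:R * c = (a + b) / 2 by rewrite /c mulrC divfK ?gt_eqF.
  have e4 : n%:R * l = (b - a) / 2 - 1 by rewrite /l mulrC divfK ?gt_eqF.
  have h4 : n%:R * (- l) < n%:R * (t - c) by rewrite ltr_pM2l.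
  have h5 : n%:R * (t - c) < n%:R * l by rewrite ltr_pM2l.
  rewrite mulrN mulrBr e3 e4 in h4; rewrite mulrBr e3 e4 in h5.
  by apply: trap_in; clear -h4 h5; lra.
apply: le_trans h1.
have e5 : pi / l' = n%:R / m.
  rewrite /l' /m; have q0 : 0 < b - a - 4 by lra.
  have H (p q k z : R) : 0 < k -> 0 < p -> 0 < q -> z = q / 2 -> p / (z / k) = k / (q / (2 * p)).
    by move=> ? ? ? ->; field; rewrite !gt_eqF.
  by apply: H => //; lra.
rewrite e5 in M1.
have e6 : (b - a - 5) / (2 * pi) = m - (2 * pi)^-1 by rewrite /m; move: (2 * pi)^-1 => w; ring.
have h6 : 8^-1 <= (2 * pi)^-1 :> R.
  by rewrite lef_pV2 ?posrE ?mulr_gt0//; have := @pihalf_lt2 R; clear -p0; lra.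
pose q : R := (2 * pi)^-1.
rewrite e6 ler_pdivlMr// -/q.
have [mq|mq] := leP m q.
  by apply: (@le_trans _ _ 0) => //; rewrite pmulr_lle0// subr_le0.
apply: (@le_trans _ _ ((m - q) * (n%:R / m + 1))).
  by rewrite ler_pM2l// subr_gt0.
have h8 : m <= q * (n%:R / m).
  apply: (@le_trans _ _ (8^-1 * (n%:R / m))); last first.
    by rewrite ler_pM2r// divr_gt0.
  rewrite mulrA ler_pdivlMr//.
  have := normr_ge0 a; have := normr_ge0 b; clear -nB ab; lra.
have -> : (m - q) * (n%:R / m + 1) = n%:R / m * m - (q * (n%:R / m) - m) - q by ring.
rewrite divfK ?gt_eqF//.
have : 0 < q by rewrite invr_gt0 mulr_gt0.
lra.
Qed.

(** A negative part is the positive part minus the variable itself, so the excess bound together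
    with the lower bound on the mean controls the deficit. *)
Lemma cbeE_count_deficit_le (a b : R) : 5 <= b - a -> exists n0, forall n, (n0 <= n)%N ->
  cbeE beta n (fun s => Num.max 0 ((b - a) / (2 * pi) - linst n (trap a b) s))
   <= (discC beta + 2) * Num.sqrt (b - a).
Proof.
move=> ab; have [n1 H1] := cbeE_count_ge ab.
have [|n2 H2] := @cbeE_count_excess_le _ _ beta0 a b; first by lra.
exists (maxn n1 n2) => n; rewrite geq_max => /andP[/H1 h1 /H2 h2].
set x := (b - a) / (2 * pi) in h2 *.
have bN := buc_linst n n (unif_cont_trap a b).
have bmax (g : seq R -> R) : buc n g -> buc n (fun s => Num.max 0 (g s)).
  move=> bg; apply: (buc_comp (h := fun z => Num.max 0 z)) => //.
  by move=> z; apply: continuous_max; [exact: cst_continuous|exact: cvg_id].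
have bx := buc_cst n x.
have b1 := bmax _ (buc_sub bN bx).
rewrite (@eq_cbeE _ _ _ _ (fun s => Num.max 0 (linst n (trap a b) s - x) + (x - linst n (trap a b) s))); last first.
  by move=> s _; rewrite /Num.max; case: ltP => u1; case: ltP => u2; lra.
rewrite cbeE_add//; last exact: buc_sub.
rewrite cbeE_sub// cbeE_cst//.
have : x - (b - a - 5) / (2 * pi) <= 2 * Num.sqrt (b - a).
  rewrite /x -mulrBl (_ : b - a - (b - a - 5) = 5); last by ring.
  have s1 : 1 <= Num.sqrt (b - a) by rewrite -[leLHS](@sqrtr1 R) ler_sqrt//; lra.
  rewrite ler_pdivrMr ?mulr_gt0 ?pi_gt0//; have := pi_ge2 R; nra.
lra.
Qed.

End MeanLower.

(** * The resolvent of the Herglotz transform *)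

Section ComplexMeanValue.
Context {R : realType} (beta : R) (beta0 : 0 < beta).
Implicit Types (s : seq R) (n : nat) (z : R[i]).
Local Open Scope complex_scope.

(** The modulus as an element of [R]; the norm of [R[i]] takes its values in [R[i]]. *)
Definition cnorm z : R := Normc.normc z.

Lemma cnormE z : cnorm z = Num.sqrt (complex.Re z ^+ 2 + complex.Im z ^+ 2).
Proof. by case: z. Qed.

Lemma cnorm_ge0 z : 0 <= cnorm z.
Proof. by rewrite cnormE sqrtr_ge0. Qed.

Lemma cnorm_sqr z : cnorm z ^+ 2 = complex.Re z ^+ 2 + complex.Im z ^+ 2.
Proof. by rewrite cnormE sqr_sqrtr// addr_ge0// sqr_ge0. Qed.

Lemma cnormM (x y : R[i]) : cnorm (x * y) = cnorm x * cnorm y.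
Proof. exact: Normc.normcM. Qed.

Lemma cnormD_le (x y : R[i]) : cnorm (x + y) <= cnorm x + cnorm y.
Proof. exact: le_normcD. Qed.

Lemma cnormN z : cnorm (- z) = cnorm z.
Proof. exact: normcN. Qed.

Lemma cnormV z : cnorm z^-1 = (cnorm z)^-1.
Proof. exact: Normc.normcV. Qed.

Lemma Re_le_cnorm z : `|complex.Re z| <= cnorm z.
Proof.
by rewrite -sqrtr_sqr cnormE ler_sqrt ?lerDl ?sqr_ge0// addr_ge0 ?sqr_ge0.
Qed.

Lemma Im_le_cnorm z : `|complex.Im z| <= cnorm z.
Proof.
by rewrite -sqrtr_sqr cnormE ler_sqrt ?lerDr ?sqr_ge0// addr_ge0 ?sqr_ge0.
Qed.

Lemma cnorm_real (x : R) : cnorm x%:C = `|x|.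
Proof. by rewrite cnormE/= expr0n addr0 sqrtr_sqr. Qed.

Lemma cnorm0 : cnorm 0 = 0.
Proof. exact: Normc.normc0. Qed.

Lemma cnorm1 : cnorm 1 = 1.
Proof. exact: Normc.normc1. Qed.

Lemma cnorm_eq0 z : cnorm z = 0 -> z = 0.
Proof. exact: Normc.eq0_normc. Qed.

Lemma cnorm_le_ReIm z : cnorm z <= `|complex.Re z| + `|complex.Im z|.
Proof.
have -> : z = Complex (complex.Re z) 0 + Complex 0 (complex.Im z).
  by case: z => a b; apply/eqP; rewrite eq_complex/= addr0 add0r !eqxx.
rewrite (le_trans (cnormD_le _ _))// !cnormE/= !expr0n add0r !addr0 !sqrtr_sqr add0r.
by [].
Qed.

Lemma cnorm_cis (t : R) : cnorm (cis t) = 1.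
Proof. by rewrite cnormE/= cos2Dsin2 sqrtr1. Qed.

Lemma cnorm_cisB1 (t : R) : cnorm (cis t - 1) ^+ 2 = 2 - 2 * cos t.
Proof.
rewrite cnorm_sqr/= subr0.
transitivity (cos t ^+ 2 + sin t ^+ 2 + 1 - 2 * cos t); first by ring.
by rewrite cos2Dsin2; ring.
Qed.

Lemma cnorm_sum (I : Type) (r : seq I) (P : pred I) (f : I -> R[i]) :
  cnorm (\sum_(i <- r | P i) f i) <= \sum_(i <- r | P i) cnorm (f i).
Proof.
elim/big_rec2: _ => [|i x y _ h]; first by rewrite cnorm0.
by rewrite (le_trans (cnormD_le _ _))// lerD2l.
Qed.

Definition bucC n (g : seq R -> R[i]) :=
  buc n (fun s => complex.Re (g s)) /\ buc n (fun s => complex.Im (g s)).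

Lemma bucC_cst n z : bucC n (fun=> z).
Proof. by split; exact: buc_cst. Qed.

Lemma bucC_add n (g h : seq R -> R[i]) : bucC n g -> bucC n h -> bucC n (fun s => g s + h s).
Proof.
move=> [g1 g2] [h1 h2]; split.
  by apply: eq_buc (buc_add g1 h1) => s _; case: (g s) (h s) => a b [c e].
by apply: eq_buc (buc_add g2 h2) => s _; case: (g s) (h s) => a b [c e].
Qed.

Lemma bucC_opp n (g : seq R -> R[i]) : bucC n g -> bucC n (fun s => - g s).
Proof.
move=> [g1 g2]; split.
  by apply: eq_buc (buc_opp g1) => s _; case: (g s) => a b.
by apply: eq_buc (buc_opp g2) => s _; case: (g s) => a b.
Qed.

Lemma bucC_mul n (g h : seq R -> R[i]) : bucC n g -> bucC n h -> bucC n (fun s => g s * h s).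
Proof.
move=> [g1 g2] [h1 h2]; split.
  by apply: eq_buc (buc_sub (buc_mul g1 h1) (buc_mul g2 h2)) => s _; case: (g s) (h s) => a b [c e].
by apply: eq_buc (buc_add (buc_mul g1 h2) (buc_mul g2 h1)) => s _; case: (g s) (h s) => a b [c e].
Qed.

Lemma eq_bucC n (g h : seq R -> R[i]) : (forall s, size s = n -> g s = h s) -> bucC n g -> bucC n h.
Proof.
by move=> gh [g1 g2]; split; [apply: eq_buc g1|apply: eq_buc g2] => s sn; rewrite gh.
Qed.

Lemma bucC_sum n (I : Type) (r : seq I) (G : I -> seq R -> R[i]) :
  (forall i, bucC n (G i)) -> bucC n (fun s => \sum_(i <- r) G i s).
Proof.
move=> H; elim: r => [|i r IH].
  by apply: eq_bucC (bucC_cst n 0) => s _; rewrite big_nil.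
by apply: eq_bucC (bucC_add (H i) IH) => s _; rewrite big_cons.
Qed.

(** The lower bound on |g| allows |g|^2 to be replaced by its maximum with m^2, whose inverse is
    continuous on the whole line. *)
Lemma bucC_inv n (g : seq R -> R[i]) (m : R) : 0 < m -> bucC n g ->
  (forall s, size s = n -> m <= cnorm (g s)) -> bucC n (fun s => (g s)^-1).
Proof.
move=> m0 [g1 g2] gm.
have b2 := buc_add (buc_sqr g1) (buc_sqr g2).
have m2 : 0 < m ^+ 2 by rewrite exprn_gt0.
have bi : buc n (fun s => (complex.Re (g s) ^+ 2 + complex.Im (g s) ^+ 2)^-1).
  have cm : continuous (fun x : R => Num.max (m ^+ 2) x).
    move=> x; apply: (@continuous_max _ _ (fun=> m ^+ 2) (fun y : R => y)).
      exact: cst_continuous.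
    exact: cvg_id.
  have ci : continuous (fun x : R => (Num.max (m ^+ 2) x)^-1).
    by move=> x; apply: cvgV; [rewrite gt_eqF// lt_max m2|exact: cm].
  apply: eq_buc (buc_comp ci b2) => s sn; congr (_^-1); apply/max_idPr.
  by rewrite -cnorm_sqr lerXn2r ?nnegrE ?cnorm_ge0 ?gm// ltW.
split.
  by apply: eq_buc (buc_mul g1 bi) => s _; case: (g s).
by apply: eq_buc (buc_mul (buc_opp g2) bi) => s _; case: (g s) => a b /=; rewrite mulNr.
Qed.

Definition cbeEC n (g : seq R -> R[i]) : R[i] :=
  Complex (cbeE beta n (fun s => complex.Re (g s))) (cbeE beta n (fun s => complex.Im (g s))).

Lemma cbeEC_add n (g h : seq R -> R[i]) : bucC n g -> bucC n h ->
  cbeEC n (fun s => g s + h s) = cbeEC n g + cbeEC n h.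
Proof.
move=> [g1 g2] [h1 h2]; apply/eqP; rewrite eq_complex/=; apply/andP; split; apply/eqP.
  by rewrite -cbeE_add//; apply: eq_cbeE => s _; case: (g s) (h s) => a b [c e].
by rewrite -cbeE_add//; apply: eq_cbeE => s _; case: (g s) (h s) => a b [c e].
Qed.

Lemma cbeEC_scale n z (g : seq R -> R[i]) : bucC n g ->
  cbeEC n (fun s => z * g s) = z * cbeEC n g.
Proof.
move=> [g1 g2]; case: z => a b; apply/eqP; rewrite eq_complex/=; apply/andP; split; apply/eqP.
  rewrite -!cbeE_scale// -cbeE_sub; [|exact: beta0|exact: buc_scale|exact: buc_scale].
  by apply: eq_cbeE => s _; case: (g s) => c e.
rewrite -!cbeE_scale// -cbeE_add; [|exact: beta0|exact: buc_scale|exact: buc_scale].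
by apply: eq_cbeE => s _; case: (g s) => c e.
Qed.

Lemma cbeEC_sub n (g h : seq R -> R[i]) : bucC n g -> bucC n h ->
  cbeEC n (fun s => g s - h s) = cbeEC n g - cbeEC n h.
Proof.
move=> bg bh; rewrite -mulN1r -cbeEC_scale// -cbeEC_add//; last first.
  by apply: bucC_mul => //; exact: bucC_cst.
by congr (cbeEC n _); apply/funext => s; rewrite mulN1r.
Qed.

Lemma cbeEC_norm_le n (g : seq R -> R[i]) (M : R) : bucC n g ->
  (forall s, size s = n -> cnorm (g s) <= M) -> cnorm (cbeEC n g) <= 2 * M.
Proof.
move=> [g1 g2] gM; rewrite (le_trans (cnorm_le_ReIm _))//=.
have H (f : seq R -> R) : buc n f -> (forall s, size s = n -> `|f s| <= M) -> `|cbeE beta n f| <= M.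
  move=> bf fM; rewrite -[leRHS](cbeE_cst beta0 n M).
  by apply: cbeE_norm_le => //; [exact: buc_cst|move=> s sn _; exact: fM].
rewrite mulr_natl mulr2n lerD//; apply: H => // s sn; apply: le_trans (gM s sn).
  exact: Re_le_cnorm.
exact: Im_le_cnorm.
Qed.

Lemma le0_of_linear (x c : R) : 0 <= c -> (forall e, 0 < e -> e <= 1 -> x <= c * e) -> x <= 0.
Proof.
move=> c0 H; rewrite leNgt; apply/negP => x0.
pose e := Num.min 1 (x / (2 * (c + 1))).
have e0 : 0 < e by rewrite lt_min ltr01 divr_gt0// mulr_gt0//; lra.
have e1 : e <= 1 by rewrite ge_min lexx.
have := H e e0 e1; have : e <= x / (2 * (c + 1)) by rewrite ge_min lexx orbT.
rewrite ler_pdivlMr; last by rewrite mulr_gt0//; lra.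
nra.
Qed.

(* Rotation invariance makes the expectation of the derivative [G1 z] vanish. *)
Lemma cbeEC_mean_value n (G G1 : R[i] -> seq R -> R[i]) (r0 C : R) : 0 < r0 -> 0 <= C ->
  (forall z, cnorm z <= r0 -> bucC n (G z)) ->
  (forall z, cnorm z <= r0 -> bucC n (G1 z)) ->
  (forall z p s, size s = n -> cnorm z <= r0 -> G (z * cis p) s = G z [seq t - p | t <- s]) ->
  (forall z, cnorm z <= r0 -> trig_inv n (fun s => complex.Re (G z s)) /\
     trig_inv n (fun s => complex.Im (G z s))) ->
  (forall z z' s, size s = n -> cnorm z <= r0 -> cnorm z' <= r0 ->
     cnorm (G z' s - G z s - (z' - z) * G1 z s) <= C * cnorm (z' - z) ^+ 2) ->
  cbeEC n (G r0%:C) = cbeEC n (G 0).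
Proof.
move=> r00 C0 bG bG1 Grot Gtrig GT.
have ET z z' : cnorm z <= r0 -> cnorm z' <= r0 ->
    cnorm (cbeEC n (G z') - cbeEC n (G z) - (z' - z) * cbeEC n (G1 z)) <= 2 * (C * cnorm (z' - z) ^+ 2).
  move=> zr z'r; rewrite -cbeEC_scale; last exact: bG1.
  rewrite -(cbeEC_sub (bG _ z'r) (bG _ zr)) -cbeEC_sub.
  - apply: cbeEC_norm_le; last by move=> s sn; exact: GT.
    apply: bucC_add; first by apply: bucC_add; [exact: bG|apply: bucC_opp; exact: bG].
    by apply: bucC_opp; apply: bucC_mul; [exact: bucC_cst|exact: bG1].
  - by apply: bucC_add; [exact: bG|apply: bucC_opp; exact: bG].
  - by apply: bucC_mul; [exact: bucC_cst|exact: bG1].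
have Erot z p : cnorm z <= r0 -> cbeEC n (G (z * cis p)) = cbeEC n (G z).
  move=> zr; have [t1 t2] := Gtrig z zr; have [b1 b2] := bG z zr.
  apply/eqP; rewrite eq_complex/=; apply/andP; split; apply/eqP.
    rewrite -[RHS](cbeE_shift beta0 (- p) b1 t1).
    by apply: eq_cbeE => s sn; rewrite Grot.
  rewrite -[RHS](cbeE_shift beta0 (- p) b2 t2).
  by apply: eq_cbeE => s sn; rewrite Grot.
(* Rotating r by a small angle e leaves the expectation of G unchanged but moves the point by r d,
   where d is the chord of e. The Taylor bound becomes r d |E G1| = O(r^2 d^2), and e tends to 0. *)
have E1 (r : R) : 0 < r -> r <= r0 -> cbeEC n (G1 r%:C) = 0.
  move=> r1 r2; have nr : cnorm r%:C = r by rewrite cnorm_real gtr0_norm.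
  apply: cnorm_eq0; apply/eqP; rewrite eq_le cnorm_ge0 andbT.
  apply: (@le0_of_linear _ (2 * (C * r))); first by rewrite !mulr_ge0// ltW.
  move=> e e0 e1.
  have zr : cnorm r%:C <= r0 by rewrite nr.
  have z'r : cnorm (r%:C * cis e) <= r0 by rewrite cnormM nr cnorm_cis mulr1.
  have := ET _ _ zr z'r; rewrite Erot// subrr sub0r cnormN.
  have -> : r%:C * cis e - r%:C = r%:C * (cis e - 1) by ring.
  set d := cnorm (cis e - 1).
  have d2 : d ^+ 2 = 2 - 2 * cos e by rewrite /d cnorm_cisB1.
  have d0 : 0 <= d by exact: cnorm_ge0.
  have de : d <= e.
    rewrite -(@ler_pXn2r _ 2) ?nnegrE//; last by rewrite ltW.
    by rewrite d2 chord2_le.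
  have dp : 0 < d.
    rewrite lt_neqAle d0 andbT eq_sym; apply/eqP => d00.
    have : e ^+ 2 / 9 <= 0.
      have -> : (0 : R) = d ^+ 2 by rewrite d00 expr0n.
      rewrite d2; apply: chord2_ge; rewrite gtr0_norm//.
      by have := pi_ge2 R; lra.
    by rewrite leNgt divr_gt0// exprn_gt0.
  rewrite !cnormM nr -/d => h.
  have {}h : r * d * cnorm (cbeEC n (G1 r%:C)) <= r * d * (2 * (C * r) * d).
    by apply: le_trans h _; rewrite le_eqVlt; apply/orP; left; apply/eqP; ring.
  rewrite ler_pM2l ?mulr_gt0// in h.
  by apply: (le_trans h); rewrite ler_wpM2l// !mulr_ge0// ltW.
pose h (r : R) := cbeEC n (G r%:C).
(* The base point r is positive, as the derivative was shown to vanish only there. The subdivision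
   of [0, r0] therefore uses each step backwards, from its right end, and m quadratic increments add
   up to order 1/m. *)
have hstep (r r' : R) : 0 < r -> r <= r0 -> 0 <= r' -> r' <= r0 ->
   cnorm (h r' - h r) <= 2 * C * (r' - r) ^+ 2.
  move=> r1 r2 r3 r4.
  have zr : cnorm r%:C <= r0 by rewrite cnorm_real gtr0_norm.
  have z'r : cnorm r'%:C <= r0 by rewrite cnorm_real ger0_norm.
  have := ET _ _ zr z'r; rewrite E1// mulr0 subr0.
  by rewrite -rmorphB cnorm_real real_normK ?num_real// mulrA.
have htel m : (0 < m)%N -> cnorm (h r0 - h 0) <= 2 * C * r0 ^+ 2 / m%:R.
  move=> m0; have m0' : (0 : R) < m%:R by rewrite ltr0n.
  suff H k : (k <= m)%N -> cnorm (h (k%:R * (r0 / m%:R)) - h 0) <= k%:R * (2 * C * (r0 / m%:R) ^+ 2).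
    have := H m (leqnn m); rewrite [m%:R * (r0 / m%:R)]mulrC divfK ?gt_eqF//.
    move=> /le_trans; apply; rewrite le_eqVlt; apply/orP; left; apply/eqP.
    by field; rewrite gt_eqF.
  elim: k => [|k IH] km; first by rewrite !mul0r subrr cnorm0.
  have -> : h (k.+1%:R * (r0 / m%:R)) - h 0 = - (h (k%:R * (r0 / m%:R)) - h (k.+1%:R * (r0 / m%:R))) + (h (k%:R * (r0 / m%:R)) - h 0) by ring.
  apply: (le_trans (cnormD_le _ _)); rewrite cnormN.
  have -> : k.+1%:R * (2 * C * (r0 / m%:R) ^+ 2) =
      2 * C * (r0 / m%:R) ^+ 2 + k%:R * (2 * C * (r0 / m%:R) ^+ 2).
    by rewrite -natr1 mulrDl mul1r addrC.
  apply: lerD; last by apply: IH; exact: ltnW.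
  have q0 : 0 < r0 / m%:R by rewrite divr_gt0.
  have le1 (i : nat) : (i <= m)%N -> i%:R * (r0 / m%:R) <= r0.
    by move=> im; rewrite mulrCA ler_piMr ?(ltW r00)// ler_pdivrMr// mul1r ler_nat.
  apply: le_trans (hstep _ _ _ _ _ _) _.
  - by rewrite mulr_gt0.
  - by rewrite le1.
  - by rewrite mulr_ge0// ltW.
  - by rewrite le1// ltnW.
  rewrite le_eqVlt; apply/orP; left; apply/eqP; rewrite -natr1; ring.
apply/eqP; rewrite -subr_eq0; apply/eqP; apply: cnorm_eq0; apply/eqP.
rewrite eq_le cnorm_ge0 andbT.
apply: (@le0_of_linear _ (2 * C * r0 ^+ 2)); first by rewrite mulr_ge0 ?sqr_ge0// mulr_ge0.
move=> e e0 e1.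
pose m := (Num.truncn e^-1).+1.
have m1 : e^-1 < m%:R.
  have ei : 0 <= e^-1 by rewrite invr_ge0 ltW.
  by rewrite /m; have /andP[] := truncn_itv ei.
apply: (le_trans (htel m isT)); rewrite ler_wpM2l//; first by rewrite mulr_ge0 ?sqr_ge0// mulr_ge0.
by rewrite -[e]invrK lef_pV2 ?posrE ?invr_gt0// ltW.
Qed.

End ComplexMeanValue.

(** * The averaged Herglotz kernel and the exact resolvent identity *)

Section Herglotz.
Context {R : realType} (beta : R) (beta0 : 0 < beta).
Implicit Types (s : seq R) (n : nat) (z : R[i]).
Local Open Scope complex_scope.

Definition herg z (t : R) : R[i] := (1 + z * cis (- t)) / (1 - z * cis (- t)).
Definition herg' z (t : R) : R[i] := 2 * cis (- t) / (1 - z * cis (- t)) ^+ 2.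

Lemma herg_den (r : R) z t : cnorm z <= r -> 1 - r <= cnorm (1 - z * cis (- t)).
Proof.
move=> zr; rewrite lerBlDr -(@cnorm1 R).
rewrite -{1}[1](subrK (z * cis (- t))) (le_trans (cnormD_le _ _))// lerD2l.
by rewrite cnormM cnorm_cis mulr1.
Qed.

Lemma herg_den_neq0 (r : R) z t : r < 1 -> cnorm z <= r -> 1 - z * cis (- t) != 0.
Proof.
move=> r1 zr; apply/eqP => e; have := herg_den t zr.
by rewrite e cnorm0 leNgt subr_gt0 r1.
Qed.

Lemma cnorm2 : cnorm (2 : R[i]) = 2.
Proof.
have -> : (2 : R[i]) = (2 : R)%:C by rewrite rmorph_nat.
by rewrite cnorm_real ger0_norm.
Qed.

Section Bounds.
Variables (r : R).
Hypothesis (r1 : r < 1).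
Let d := 1 - r.
Let d0 : 0 < d. Proof. by rewrite subr_gt0. Qed.

Lemma cnorm_den_inv z t : cnorm z <= r -> cnorm (1 - z * cis (- t))^-1 <= d^-1.
Proof.
move=> zr; have := herg_den t zr => h; rewrite cnormV lef_pV2 ?posrE//.
exact: lt_le_trans h.
Qed.

Lemma herg_sub z z' t : cnorm z <= r -> cnorm z' <= r ->
  cnorm (herg z' t - herg z t) <= 2 / d ^+ 2 * cnorm (z' - z).
Proof.
move=> zr z'r; have n1 := herg_den_neq0 t r1 zr; have n2 := herg_den_neq0 t r1 z'r.
have -> : herg z' t - herg z t =
    2 * cis (- t) * (z' - z) * ((1 - z * cis (- t))^-1 * (1 - z' * cis (- t))^-1).
  by rewrite /herg; field; rewrite n1 n2.
rewrite !cnormM cnorm2 cnorm_cis mulr1 mulrAC ler_wpM2r ?cnorm_ge0//.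
rewrite ler_pM2l// expr2 invfM ler_pM ?cnorm_ge0 ?cnorm_den_inv//.
Qed.

Lemma herg'_le z t : cnorm z <= r -> cnorm (herg' z t) <= 2 / d ^+ 2.
Proof.
move=> zr; have n1 := herg_den_neq0 t r1 zr.
have -> : herg' z t = 2 * cis (- t) * ((1 - z * cis (- t))^-1 * (1 - z * cis (- t))^-1).
  by rewrite /herg'; field.
rewrite !cnormM cnorm2 cnorm_cis mulr1 ler_pM2l// expr2 invfM ler_pM ?cnorm_ge0 ?cnorm_den_inv//.
Qed.

Lemma herg_taylor z z' t : cnorm z <= r -> cnorm z' <= r ->
  cnorm (herg z' t - herg z t - (z' - z) * herg' z t) <= 2 / d ^+ 3 * cnorm (z' - z) ^+ 2.
Proof.
move=> zr z'r; have n1 := herg_den_neq0 t r1 zr; have n2 := herg_den_neq0 t r1 z'r.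
have -> : herg z' t - herg z t - (z' - z) * herg' z t =
    2 * cis (- t) * cis (- t) * ((z' - z) * (z' - z)) *
    ((1 - z * cis (- t))^-1 * ((1 - z * cis (- t))^-1 * (1 - z' * cis (- t))^-1)).
  by rewrite /herg /herg'; field; rewrite n1 n2.
rewrite !cnormM cnorm2 cnorm_cis !mulr1 expr2 mulrAC ler_wpM2r ?mulr_ge0 ?cnorm_ge0//.
have k1 := cnorm_den_inv t zr; have k2 := cnorm_den_inv t z'r.
have -> : d ^- 3 = d^-1 * (d^-1 * d^-1) by rewrite !exprS expr0 mulr1 !invfM.
rewrite ler_pM2l// ler_pM ?mulr_ge0 ?cnorm_ge0// ler_pM ?cnorm_ge0//.
Qed.

Lemma Re_herg_ge0 z t : cnorm z <= r -> 0 <= complex.Re (herg z t).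
Proof.
move=> zr; have n1 := herg_den_neq0 t r1 zr.
rewrite /herg; set q := z * cis (- t) in n1 *.
have q1 : cnorm q <= 1 by rewrite /q cnormM cnorm_cis mulr1 (le_trans zr)// ltW.
have : cnorm q ^+ 2 <= 1 by rewrite exprn_ile1// cnorm_ge0.
rewrite cnorm_sqr; clearbody q; case: q n1 q1 => x y _ _ /= h.
have D0 : 0 <= (1 - x) ^+ 2 + (0 - y) ^+ 2 by rewrite addr_ge0 ?sqr_ge0.
rewrite (_ : _ - _ = (1 - (x ^+ 2 + y ^+ 2)) / ((1 - x) ^+ 2 + (0 - y) ^+ 2)).
  by rewrite divr_ge0// subr_ge0.
by move: (_^-1) => w; ring.
Qed.

End Bounds.

Lemma bucC_cis n i : (i < n)%N -> bucC n (fun s => cis (- s`_i)).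
Proof.
move=> ni; split => /=.
  by apply: eq_buc (buc_coord (unif_cont_cos (-1) 0) ni) => s _; rewrite addr0 mulN1r.
by apply: eq_buc (buc_coord (unif_cont_sin (-1) 0) ni) => s _; rewrite addr0 mulN1r.
Qed.

Lemma bucC_den_inv n i (r : R) z : r < 1 -> cnorm z <= r -> (i < n)%N ->
  bucC n (fun s => (1 - z * cis (- s`_i))^-1).
Proof.
move=> r1 zr ni; apply: (@bucC_inv _ n _ (1 - r)); first by rewrite subr_gt0.
  apply: bucC_add; first exact: bucC_cst.
  by apply: bucC_opp; apply: bucC_mul; [exact: bucC_cst|exact: bucC_cis].
by move=> s _; exact: herg_den.
Qed.

Definition Herg n z s : R[i] := (n%:R)^-1 * \sum_(t <- s) herg z t.
Definition Herg' n z s : R[i] := (n%:R)^-1 * \sum_(t <- s) herg' z t.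

Lemma sumC_seq_nth (f : R -> R[i]) s n : size s = n -> \sum_(t <- s) f t = \sum_(i < n) f s`_i.
Proof. by move=> <-; rewrite (big_nth 0) big_mkord. Qed.

Lemma bucC_Herg n (r : R) z : r < 1 -> cnorm z <= r -> bucC n (Herg n z).
Proof.
move=> r1 zr; apply: bucC_mul; first exact: bucC_cst.
apply: (@eq_bucC _ n (fun s => \sum_(i < n) herg z s`_i)) => [s sn|].
  by rewrite (sumC_seq_nth _ sn).
apply: bucC_sum => i; apply: bucC_mul; last exact: bucC_den_inv r1 zr _.
apply: bucC_add; first exact: bucC_cst.
by apply: bucC_mul; [exact: bucC_cst|exact: bucC_cis].
Qed.

Lemma bucC_Herg' n (r : R) z : r < 1 -> cnorm z <= r -> bucC n (Herg' n z).
Proof.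
move=> r1 zr; apply: bucC_mul; first exact: bucC_cst.
apply: (@eq_bucC _ n (fun s => \sum_(i < n) herg' z s`_i)) => [s sn|].
  by rewrite (sumC_seq_nth _ sn).
apply: bucC_sum => i.
have bi := bucC_den_inv r1 zr (ltn_ord i).
apply: (@eq_bucC _ n (fun s => (2 * cis (- s`_i)) * ((1 - z * cis (- s`_i))^-1 * (1 - z * cis (- s`_i))^-1))).
  by move=> s _; rewrite /herg' expr2 invfM.
by apply: bucC_mul; apply: bucC_mul => //; [exact: bucC_cst|exact: bucC_cis].
Qed.

Lemma cnorm_nat n : cnorm (n%:R : R[i]) = n%:R.
Proof.
have -> : (n%:R : R[i]) = (n%:R : R)%:C by rewrite rmorph_nat.
by rewrite cnorm_real ger0_norm.
Qed.

Lemma cnorm_average n s (f : R -> R[i]) (M : R) : (0 < n)%N -> size s = n ->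
  (forall t, cnorm (f t) <= M) -> cnorm ((n%:R)^-1 * \sum_(t <- s) f t) <= M.
Proof.
move=> n0 sn fM; have n0' : (0 : R) < n%:R by rewrite ltr0n.
rewrite cnormM cnormV cnorm_nat mulrC ler_pdivrMr//.
rewrite (le_trans (cnorm_sum _ _ _))//.
apply: (@le_trans _ _ (\sum_(t <- s) M)); first by apply: ler_sum => t _; exact: fM.
by rewrite big_const_seq count_predT sn iter_addr_0 mulr_natr.
Qed.

Lemma Herg_rot n z (p : R) s : Herg n (z * cis p) s = Herg n z [seq t - p | t <- s].
Proof.
rewrite /Herg big_map; congr (_ * _); apply: eq_bigr => t _.
by rewrite /herg opprB -mulrA -cisD.
Qed.

Lemma eq_Herg n z s s' : size s = n -> size s' = n ->
  (forall i, (i < n)%N -> cos s`_i = cos s'`_i /\ sin s`_i = sin s'`_i) -> Herg n z s = Herg n z s'.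
Proof.
move=> sn s'n ss'; rewrite /Herg !(sumC_seq_nth _ (n := n))//; congr (_ * _).
apply: eq_bigr => i _; have [e1 e2] := ss' i (ltn_ord i).
by rewrite /herg /cis !cosN !sinN e1 e2.
Qed.

Lemma Herg_taylor n (r : R) z z' s : (0 < n)%N -> size s = n -> r < 1 -> cnorm z <= r -> cnorm z' <= r ->
  cnorm (Herg n z' s - Herg n z s - (z' - z) * Herg' n z s) <= 2 / (1 - r) ^+ 3 * cnorm (z' - z) ^+ 2.
Proof.
move=> n0 sn r1 zr z'r.
have -> : Herg n z' s - Herg n z s - (z' - z) * Herg' n z s =
   (n%:R)^-1 * \sum_(t <- s) (herg z' t - herg z t - (z' - z) * herg' z t).
  by rewrite !sumrB -mulr_sumr /Herg /Herg'; ring.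
by apply: cnorm_average => // t; exact: herg_taylor.
Qed.

Lemma Herg_sub n (r : R) z z' s : (0 < n)%N -> size s = n -> r < 1 -> cnorm z <= r -> cnorm z' <= r ->
  cnorm (Herg n z' s - Herg n z s) <= 2 / (1 - r) ^+ 2 * cnorm (z' - z).
Proof.
move=> n0 sn r1 zr z'r.
have -> : Herg n z' s - Herg n z s = (n%:R)^-1 * \sum_(t <- s) (herg z' t - herg z t).
  by rewrite !sumrB /Herg; ring.
by apply: cnorm_average => // t; exact: herg_sub.
Qed.

Lemma Herg'_le n (r : R) z s : (0 < n)%N -> size s = n -> r < 1 -> cnorm z <= r ->
  cnorm (Herg' n z s) <= 2 / (1 - r) ^+ 2.
Proof. by move=> n0 sn r1 zr; apply: cnorm_average => // t; exact: herg'_le. Qed.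

Lemma Re_Herg_ge0 n (r : R) z s : r < 1 -> cnorm z <= r -> 0 <= complex.Re (Herg n z s).
Proof.
move=> r1 zr; rewrite /Herg.
have -> : (n%:R : R[i])^-1 = ((n%:R : R)^-1)%:C by rewrite fmorphV rmorph_nat.
have -> w : complex.Re ((n%:R^-1 : R)%:C * w) = n%:R^-1 * complex.Re w.
  by case: w => x y /=; rewrite mul0r subr0.
rewrite mulr_ge0 ?invr_ge0// raddf_sum sumr_ge0// => t _.
exact: (Re_herg_ge0 r1 t zr).
Qed.

Lemma Herg0 n s : (0 < n)%N -> size s = n -> Herg n 0 s = 1.
Proof.
move=> n0 sn; rewrite /Herg (eq_bigr (fun=> 1)); last first.
  by move=> t _; rewrite /herg !mul0r addr0 subr0 divr1.
rewrite big_const_seq count_predT sn iter_addr_0 mulVf//.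
by rewrite pnatr_eq0 -lt0n.
Qed.

Lemma trig_inv_comp_Herg n (f : R[i] -> R) z : trig_inv n (fun s => f (Herg n z s)).
Proof. by move=> s s' sn s'n ss'; congr f; exact: eq_Herg. Qed.

Lemma cbeEC_Herg n (r : R) : (0 < n)%N -> 0 < r < 1 -> cbeEC beta n (Herg n r%:C) = 1.
Proof.
move=> n0 /andP[r0 r1].
rewrite (@cbeEC_mean_value _ _ beta0 n (Herg n) (Herg' n) r (2 / (1 - r) ^+ 3)) => //.
- apply/eqP; rewrite eq_complex/=; apply/andP; split; apply/eqP.
    by rewrite -(cbeE_cst beta0 n 1); apply: eq_cbeE => s sn; rewrite Herg0.
  by rewrite -(cbeE_cst beta0 n 0); apply: eq_cbeE => s sn; rewrite Herg0.
- by rewrite divr_ge0// exprn_ge0// subr_ge0 ltW.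
- by move=> z zr; exact: bucC_Herg zr.
- by move=> z zr; exact: bucC_Herg' zr.
- by move=> z p s _ _; exact: Herg_rot.
- move=> z _; split; first exact: (trig_inv_comp_Herg (@complex.Re R)).
  exact: (trig_inv_comp_Herg (@complex.Im R)).
- by move=> z z' s sn zr z'r; exact: Herg_taylor.
Qed.

Lemma cnorm_half z : cnorm (z / 2) = cnorm z / 2.
Proof. by rewrite cnormM cnormV cnorm2. Qed.

(** The Herglotz kernel has nonnegative real part in the disc, so adding it to w cannot bring the
    real part below that of w. *)
Lemma resolvent_ge (a : R) n (r : R) (w z : R[i]) s : r < 1 -> cnorm z <= r ->
  a <= complex.Re w -> a <= cnorm (w + Herg n z s / 2).
Proof.
move=> r1 zr aw; apply: le_trans (Re_le_cnorm _); apply: le_trans (ler_norm _).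
have h := @Re_Herg_ge0 n r z s r1 zr.
have -> : complex.Re (w + Herg n z s / 2) = complex.Re w + complex.Re (Herg n z s) / 2.
  have -> : Herg n z s / 2 = (2^-1 : R)%:C * Herg n z s by rewrite mulrC fmorphV rmorph_nat.
  by case: w {aw} => x y; case: (Herg n z s) => x' y' /=; rewrite mul0r subr0 [_ / 2]mulrC.
by rewrite (le_trans aw)// lerDl divr_ge0.
Qed.

(** The inverse is holomorphic and bounded in the disc, so [cbeEC_mean_value] moves the expectation
    from r to 0, where the Herglotz average equals 1 for every configuration. *)
Lemma cbeEC_resolvent n (r : R) (w : R[i]) : (0 < n)%N -> 0 < r < 1 -> 0 < complex.Re w ->
  cbeEC beta n (fun s => (w + Herg n r%:C s / 2)^-1) = (w + 1 / 2)^-1.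
Proof.
move=> n0 /andP[r0 r1] w0; set a := complex.Re w in w0.
pose G z s := (w + Herg n z s / 2)^-1.
pose G1 z s := - (Herg' n z s / 2) * (G z s * G z s).
pose d := 1 - r; have d0 : 0 < d by rewrite subr_gt0.
pose A := 2 / d ^+ 2; pose B := 2 / d ^+ 3.
have A0 : 0 < A by rewrite divr_gt0// exprn_gt0.
have B0 : 0 < B by rewrite divr_gt0// exprn_gt0.
have Gle z s : cnorm z <= r -> cnorm (G z s) <= a^-1.
  move=> zr; have h := resolvent_ge n s r1 zr (lexx a).
  by rewrite cnormV lef_pV2 ?posrE// (lt_le_trans w0).
have G0 z s : cnorm z <= r -> w + Herg n z s / 2 != 0.
  move=> zr; apply/eqP => e; have := resolvent_ge n s r1 zr (lexx a).
  by rewrite e cnorm0 leNgt w0.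
have bG z : cnorm z <= r -> bucC n (G z).
  move=> zr; apply: (bucC_inv w0); last by move=> s _; exact: resolvent_ge r1 zr (lexx a).
  apply: bucC_add; first exact: bucC_cst.
  by apply: bucC_mul; [exact: bucC_Herg zr|exact: bucC_cst].
rewrite -[LHS]/(cbeEC beta n (G r%:C)).
rewrite (@cbeEC_mean_value _ _ beta0 n G G1 r (B / a ^+ 2 + A ^+ 2 / a ^+ 3)) => //.
- apply/eqP; rewrite eq_complex/=; apply/andP; split; apply/eqP.
    by rewrite -[RHS](cbeE_cst beta0 n); apply: eq_cbeE => s sn; rewrite /G Herg0.
  by rewrite -[RHS](cbeE_cst beta0 n); apply: eq_cbeE => s sn; rewrite /G Herg0.
- by rewrite addr_ge0// divr_ge0 ?exprn_ge0// ltW.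
- move=> z zr; apply: bucC_mul; last by apply: bucC_mul; exact: bG.
  by apply: bucC_opp; apply: bucC_mul; [exact: bucC_Herg' zr|exact: bucC_cst].
- by move=> z p s _ _; rewrite /G Herg_rot.
- move=> z _; split; first exact: (trig_inv_comp_Herg (fun y => complex.Re (w + y / 2)^-1)).
  exact: (trig_inv_comp_Herg (fun y => complex.Im (w + y / 2)^-1)).
- move=> z z' s sn zr z'r.
  set D := Herg n z' s - Herg n z s; set E := Herg' n z s.
  have e1 : G z' s - G z s = - (D / 2) * (G z s * G z' s).
    rewrite /G /D; have h1 := G0 z s zr; have h2 := G0 z' s z'r.
    have H (X Y : R[i]) : X != 0 -> Y != 0 -> X^-1 - Y^-1 = (Y - X) * (Y^-1 * X^-1).
      by move=> X0 Y0; field; rewrite X0 Y0.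
    by rewrite H//; congr (_ * _); ring.
  (* The remainder splits into the Taylor error of [Herg] times a bounded factor and its linear term
     times the increment of G, itself linear. These account for B / a^2 and A^2 / a^3. *)
  have e2 : G z' s - G z s - (z' - z) * G1 z s =
     - (1 / 2) * G z s * ((D - (z' - z) * E) * G z' s + (z' - z) * E * (G z' s - G z s)).
    have -> : G1 z s = - (E / 2) * (G z s * G z s) by [].
    have X (g g' h v e : R[i]) : g' - g = - (D * h) * (g * g') ->
        g' - g - v * (- (e * h) * (g * g)) = - (1 * h) * g * ((D - v * e) * g' + v * e * (g' - g)).
      move=> e3; transitivity (- (D * h) * (g * g') + v * e * h * g * g); first by rewrite -e3; ring.
      by ring.
    exact: X e1.
  have hD := Herg_sub n0 sn r1 zr z'r; rewrite -/D in hD.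
  have hT := Herg_taylor n0 sn r1 zr z'r; rewrite -/D -/E in hT.
  have hE : cnorm E <= A by exact: Herg'_le n0 sn r1 zr.
  have g1 := Gle z s zr; have g2 := Gle z' s z'r.
  set v := cnorm (z' - z) in hD hT *; have v0 : 0 <= v by exact: cnorm_ge0.
  have ai : 0 < a^-1 by rewrite invr_gt0.
  have c2 : cnorm (- (1 / 2) : R[i]) = 2^-1.
    by rewrite cnormN cnormM cnormV cnorm1 cnorm2 mul1r.
  have hG : cnorm (G z' s - G z s) <= A * v * (a^-1 * a^-1).
    rewrite e1 cnormM cnormN cnorm_half cnormM; apply: ler_pM; rewrite ?mulr_ge0 ?cnorm_ge0//.
      have := cnorm_ge0 D; rewrite -/A in hD; lra.
    by apply: ler_pM; rewrite ?cnorm_ge0.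
  rewrite e2 cnormM cnormM c2.
  have -> : (B / a ^+ 2 + A ^+ 2 / a ^+ 3) * v ^+ 2 =
      a^-1 * ((B * v ^+ 2) * a^-1 + (v * A) * (A * v * (a^-1 * a^-1))).
    by rewrite -!exprVn; ring.
  apply: (@le_trans _ _ (a^-1 * cnorm ((D - (z' - z) * E) * G z' s + (z' - z) * E * (G z' s - G z s)))).
    apply: ler_wpM2r; first exact: cnorm_ge0.
    have := cnorm_ge0 (G z s); lra.
  rewrite ler_pM2l//; apply: (le_trans (cnormD_le _ _)).
  rewrite (cnormM (D - _)) (cnormM (_ * E)) (cnormM (z' - z)) -/v.
  apply: lerD; first by apply: ler_pM; rewrite ?cnorm_ge0.
  by apply: ler_pM; rewrite ?mulr_ge0 ?cnorm_ge0// ler_wpM2l.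
Qed.

Definition poissonK (r t : R) : R := (1 - r ^+ 2) / (1 - 2 * r * cos t + r ^+ 2).
(** Half the conjugate Poisson kernel. With this normalisation [conjK (1 - y / n) t / n] is close to
    x / (x^2 + y^2) at x = n t, without a factor 2. *)
Definition conjK (r t : R) : R := r * sin t / (1 - 2 * r * cos t + r ^+ 2).

Lemma herg_real (r t : R) : herg r%:C t = Complex (poissonK r t) (- (2 * conjK r t)).
Proof.
have e : (1 - r * cos t) ^+ 2 + (r * sin t) ^+ 2 = 1 - 2 * r * cos t + r ^+ 2.
  transitivity (1 - 2 * r * cos t + r ^+ 2 * (cos t ^+ 2 + sin t ^+ 2)); first by ring.
  by rewrite cos2Dsin2 mulr1.
rewrite /herg /poissonK /conjK /cis cosN sinN; apply/eqP; rewrite eq_complex/=.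
have -> : (1 - (r * cos t - 0 * - sin t)) ^+ 2 + (0 - (r * - sin t + 0 * cos t)) ^+ 2 =
    1 - 2 * r * cos t + r ^+ 2 by rewrite -e; ring.
have cs := cos2Dsin2 t.
apply/andP; split; apply/eqP.
  transitivity ((1 - r ^+ 2 * (cos t ^+ 2 + sin t ^+ 2)) / (1 - 2 * r * cos t + r ^+ 2)).
    by move: (_^-1) => w; ring.
  by rewrite cs mulr1.
by move: (_^-1) => w; ring.
Qed.

Definition statU n (r : R) s : R := (2 * n%:R)^-1 * \sum_(t <- s) poissonK r t.
Definition statV n (r : R) s : R := n%:R^-1 * \sum_(t <- s) conjK r t.

Lemma Herg_half n (r : R) s : Herg n r%:C s / 2 = Complex (statU n r s) (- statV n r s).
Proof.
have -> : Herg n r%:C s / 2 = ((2 * n%:R)^-1 : R)%:C * \sum_(t <- s) herg r%:C t.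
  by rewrite /Herg fmorphV rmorphM !rmorph_nat invfM; ring.
have -> : \sum_(t <- s) herg r%:C t = Complex (\sum_(t <- s) poissonK r t) (- (2 * \sum_(t <- s) conjK r t)).
  elim: s => [|t s IH]; first by rewrite !big_nil mulr0 oppr0.
  by rewrite !big_cons IH herg_real; apply/eqP; rewrite eq_complex/= eqxx/=; apply/eqP; ring.
apply/eqP; rewrite eq_complex/= /statU /statV !mul0r subr0 addr0 eqxx/=; apply/eqP.
have h2 : (2^-1 * 2 : R) = 1 by rewrite mulVf.
rewrite invfM; move: (2^-1 : R) h2 => h h2; move: n%:R^-1 (\sum_(_ <- _) _) => u v.
by transitivity (- (h * 2) * (u * v)); [ring|rewrite h2; ring].
Qed.

Lemma cnorm_real_le (r : R) : 0 < r -> cnorm r%:C <= r.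
Proof. by move=> r0; rewrite cnorm_real gtr0_norm. Qed.

Lemma buc_statUV n (r : R) : 0 < r < 1 -> buc n (statU n r) /\ buc n (statV n r).
Proof.
move=> /andP[r0 r1]; have [b1 b2] := bucC_Herg n r1 (cnorm_real_le r0).
have e s : Herg n r%:C s = Complex (2 * statU n r s) (- (2 * statV n r s)).
  have -> : Herg n r%:C s = (2 : R)%:C * (Herg n r%:C s / 2).
    by rewrite rmorph_nat; field.
  by rewrite Herg_half; apply/eqP; rewrite eq_complex/=; apply/andP; split; apply/eqP; ring.
split.
  by apply: eq_buc (buc_scale 2^-1 b1) => s _; rewrite e/=; field.
by apply: eq_buc (buc_scale (- 2^-1) b2) => s _; rewrite e/=; field.
Qed.

Lemma cbeE_statU n (r : R) : (0 < n)%N -> 0 < r < 1 -> cbeE beta n (statU n r) = 2^-1.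
Proof.
move=> n0 r01; have [bU bV] := buc_statUV n r01.
have := cbeEC_Herg n0 r01 => /(congr1 (@complex.Re R))/= e.
have : cbeE beta n (fun s => 2 * statU n r s) = 1.
  rewrite -[RHS]e; apply: eq_cbeE => s _.
  have -> : Herg n r%:C s = (2 : R)%:C * (Herg n r%:C s / 2) by rewrite rmorph_nat; field.
  by rewrite Herg_half/= mul0r subr0.
by rewrite cbeE_scale// => h; lra.
Qed.

Lemma Re_inv_Complex (x y : R) : complex.Re (Complex x y)^-1 = x / (x ^+ 2 + y ^+ 2).
Proof. by []. Qed.

(** The real part of [cbeEC_resolvent] at w = a + i b, for every n and every radius: the only exact
    information about the law that is passed to the limit. *)
Lemma cbeE_resolvent n (r a b : R) : (0 < n)%N -> 0 < r < 1 -> 0 < a ->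
  cbeE beta n (fun s => (a + statU n r s) / ((a + statU n r s) ^+ 2 + (statV n r s - b) ^+ 2)) =
  (a + 2^-1) / ((a + 2^-1) ^+ 2 + b ^+ 2).
Proof.
move=> n0 r01 a0; have /(congr1 (@complex.Re R)) := @cbeEC_resolvent n r (Complex a b) n0 r01 a0.
have -> : Complex a b + 1 / 2 = Complex (a + 2^-1) b.
  have -> : (1 / 2 : R[i]) = (2^-1 : R)%:C by rewrite fmorphV rmorph_nat mul1r.
  by apply/eqP; rewrite eq_complex/= addr0 !eqxx.
rewrite Re_inv_Complex => <-; rewrite [RHS]/=; apply: eq_cbeE => s _.
rewrite Herg_half -[LHS]/(_ / _) [X in complex.Re (X)^-1](_ : _ = Complex (a + statU n r s) (b - statV n r s)).
  by rewrite Re_inv_Complex -(sqrrN (b - _)) opprB.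
by apply/eqP; rewrite eq_complex/= !eqxx.
Qed.

End Herglotz.

(** * The conjugate statistic at a large scale r is small *)

Section ConjugateVariance.
Context {R : realType} (beta : R) (beta0 : 0 < beta).
Implicit Types (s : seq R) (n : nat).

Lemma conj_series (p t : R) K :
  (\sum_(k < K) p ^+ k.+1 * sin (k.+1%:R * t)) * (1 - 2 * p * cos t + p ^+ 2) =
  p * sin t - p ^+ K.+1 * sin (K.+1%:R * t) + p ^+ K.+2 * sin (K%:R * t).
Proof.
elim: K => [|K IH]; first by rewrite big_ord0 !mul0r mul1r sin0 mulr0 addr0 subrr.
rewrite big_ord_recr/= mulrDl IH.
have e1 : K.+2%:R * t = K.+1%:R * t + t by rewrite -natr1 mulrDl mul1r.
have e2 : K%:R * t = K.+1%:R * t - t by rewrite -natr1 mulrDl mul1r addrK.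
rewrite e1 e2 sinB sinD; move: (K.+1%:R * t) => x; rewrite !exprS; ring.
Qed.

Lemma conjK_series_err (p t : R) K : 0 < p < 1 ->
  `|conjK p t - \sum_(k < K) p ^+ k.+1 * sin (k.+1%:R * t)| <= 2 * p ^+ K / (1 - p) ^+ 2.
Proof.
move=> /andP[p0 p1].
have d0 : 0 < (1 - p) ^+ 2 by rewrite exprn_gt0// subr_gt0.
have den0 := lt_le_trans d0 (poisson_den_ge t (ltW p0)).
have h := conj_series p t K; have hd := poisson_den_ge t (ltW p0).
rewrite /conjK; set den := 1 - 2 * p * cos t + p ^+ 2 in h den0 hd *.
rewrite (_ : _ - _ = (p ^+ K.+1 * sin (K.+1%:R * t) - p ^+ K.+2 * sin (K%:R * t)) / den); last first.
  have -> : p ^+ K.+1 * sin (K.+1%:R * t) - p ^+ K.+2 * sin (K%:R * t) =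
     p * sin t - (\sum_(k < K) p ^+ k.+1 * sin (k.+1%:R * t)) * den by rewrite h; ring.
  by rewrite mulrBl mulfK ?gt_eqF.
have s1 x : `|sin x| <= 1 :> R by rewrite ler_norml sin_geN1 sin_le1.
have pK : 0 <= p ^+ K by rewrite exprn_ge0 ?ltW.
rewrite normrM [X in _ * X]gtr0_norm ?invr_gt0//; apply: ler_pM => //.
- by rewrite invr_ge0 ltW.
- apply: (le_trans (ler_normB _ _)); rewrite (normrM (p ^+ K.+1)) (normrM (p ^+ K.+2)).
  have a1 : `|p ^+ K.+1| <= p ^+ K.
    by rewrite ger0_norm ?exprn_ge0 ?(ltW p0)// exprS ger_pMl// ?ltW// exprn_gt0.
  have a2 : `|p ^+ K.+2| <= p ^+ K.
    rewrite ger0_norm ?exprn_ge0 ?(ltW p0)// exprS exprS mulrA.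
    by rewrite ler_piMl// mulr_ile1// ltW.
  have b1 := s1 (K.+1%:R * t); have b2 := s1 (K%:R * t).
  have := ler_pM (normr_ge0 _) (normr_ge0 _) a1 b1.
  have := ler_pM (normr_ge0 _) (normr_ge0 _) a2 b2.
  by lra.
- by rewrite lef_pV2 ?posrE.
Qed.

(** From (1 - x)^k <= e^{-kx} and y e^{-y} <= 1. *)
Lemma pow_sub_le (x : R) k : 0 <= x <= 1 -> (1 - x) ^+ k * (k%:R * x) <= 1.
Proof.
move=> /andP[x0 x1].
have h : (1 - x) ^+ k <= expR (- (k%:R * x)).
  have -> : expR (- (k%:R * x)) = expR (- x) ^+ k by rewrite -expRM_natl mulrN.
  apply: lerXn2r; rewrite ?nnegrE ?expR_ge0 ?subr_ge0//.
  by have := expR_ge1Dx (- x).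
have kx0 : 0 <= k%:R * x by rewrite mulr_ge0.
apply: (le_trans (ler_wpM2r kx0 h)).
rewrite expRN mulrC ler_pdivrMr ?expR_gt0// mul1r.
by have := expR_ge1Dx (k%:R * x); lra.
Qed.

(** The squared coefficient p^(2k) is split in two: one factor p^k is at most n / (k r) by
    [pow_sub_le], the other at most (1 - 1/n)^k because r >= 1. The product is n / r times the
    weight of the energy. *)
Lemma cbeE_conj_trunc_le n K (r : R) : (0 < n)%N -> 1 <= r -> r < n%:R ->
  cbeE beta n (fun s => (\sum_(k < K) (0 * lcos k.+1 s + (1 - r / n%:R) ^+ k.+1 * lsin k.+1 s)) ^+ 2)
  <= energyC beta * n%:R ^+ 2 / r.
Proof.
move=> n0 r1 rn; have n0' : (0 : R) < n%:R by rewrite ltr0n.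
have r0 : 0 < r by lra.
set p := 1 - r / n%:R.
have x01 : 0 <= r / n%:R <= 1 by rewrite divr_ge0 ?(ltW r0)//= ler_pdivrMr// mul1r ltW.
have p0 : 0 <= p by rewrite subr_ge0; case/andP: x01.
apply: (le_trans (@cbeE_trigpoly_sqr_le _ _ beta0 n K (fun=> 0) (fun k => p ^+ k.+1))).
have -> : energyC beta * n%:R ^+ 2 / r = n%:R / r * (energyC beta * n%:R) by rewrite expr2; ring.
have nr0 : 0 <= n%:R / r by rewrite divr_ge0// ltW.
apply: le_trans (ler_wpM2l nr0 (cbeE_energy_le beta0 K n0)).
rewrite /energy (cbeE_bigsum beta0); last by move=> i _; apply: buc_scale; exact: buc_pk2.
rewrite big_mkord mulr_sumr; apply: ler_sum => k _.
rewrite cbeE_scale//; last exact: buc_pk2.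
rewrite [leRHS]mulrA; apply: ler_wpM2r.
  by apply: cbeE_ge0 => //; [exact: buc_pk2|move=> s _ _; exact: pk2_ge0].
rewrite expr0n/= add0r expr2.
have k0 : (0 : R) < k.+1%:R by rewrite ltr0n.
have -> : n%:R / r * ((1 - n%:R^-1) ^+ k.+1 / k.+1%:R) = (n%:R / (k.+1%:R * r)) * (1 - n%:R^-1) ^+ k.+1.
  by rewrite invfM; ring.
apply: ler_pM; rewrite ?exprn_ge0//.
  rewrite ler_pdivlMr ?mulr_gt0//.
  have := pow_sub_le k.+1 x01; rewrite -/p => h.
  have -> : p ^+ k.+1 * (k.+1%:R * r) = p ^+ k.+1 * (k.+1%:R * (r / n%:R)) * n%:R.
    by rewrite -!mulrA mulVf ?gt_eqF// mulr1.
  by rewrite ler_piMl// ltW.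
apply: lerXn2r; rewrite ?nnegrE//.
  by rewrite subr_ge0 invf_le1// ler1n.
by rewrite lerB// -[leLHS]mul1r ler_wpM2r// invr_ge0 ltW.
Qed.

Lemma cbeE_statV_sqr_le n (r : R) : (0 < n)%N -> 1 <= r -> r < n%:R ->
  cbeE beta n (fun s => statV n (1 - r / n%:R) s ^+ 2) <= (2 * energyC beta + 2) / r.
Proof.
move=> n0 r1 rn; have n0' : (0 : R) < n%:R by rewrite ltr0n.
have r0 : 0 < r by lra.
set p := 1 - r / n%:R.
have p1 : p < 1 by rewrite gtrBl divr_gt0.
have p0 : 0 < p by rewrite subr_gt0 ltr_pdivrMr// mul1r.
have d0 : 0 < (1 - p) ^+ 2 by rewrite exprn_gt0// subr_gt0.
have [K HK] : exists K : nat, 2 * p ^+ K / (1 - p) ^+ 2 <= r^-1.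
  have p01 : 0 <= p < 1 by rewrite ltW.
  have e0 : 0 < r^-1 * (1 - p) ^+ 2 / 2 by rewrite divr_gt0// mulr_gt0// invr_gt0.
  have [K0 HK0] := ler_geom_small p01 e0.
  exists K0; rewrite ler_pdivrMr//; have := HK0 K0 (leqnn _); rewrite ler_pdivlMr//.
  by rewrite mulrC.
pose T s := \sum_(k < K) (0 * lcos k.+1 s + p ^+ k.+1 * lsin k.+1 s).
have [_ bV] := buc_statUV n (introT andP (conj p0 p1)).
have bT : buc n T.
  by apply: buc_sum => k _; apply: buc_add; apply: buc_scale; [exact: buc_lcos|exact: buc_lsin].
have main s : size s = n -> in_circ s -> statV n p s ^+ 2 <= 2 * n%:R ^- 2 * T s ^+ 2 + 2 / r.
  move=> sn _.
  have e : `|statV n p s - n%:R^-1 * T s| <= r^-1.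
    have -> : T s = \sum_(t <- s) \sum_(k < K) p ^+ k.+1 * sin (k.+1%:R * t).
      rewrite exchange_big/=; apply: eq_bigr => k _; rewrite mul0r add0r /lsin mulr_sumr.
      by [].
    rewrite /statV -mulrBr -sumrB normrM gtr0_norm ?invr_gt0// mulrC ler_pdivrMr//.
    apply: (le_trans (ler_norm_sum _ _ _)).
    apply: (@le_trans _ _ (\sum_(t <- s) r^-1)).
      apply: ler_sum => t _; apply: le_trans HK; apply: conjK_series_err.
      by rewrite p0.
    by rewrite big_const_seq count_predT sn iter_addr_0 mulr_natr.
  have -> : 2 * n%:R ^- 2 * T s ^+ 2 = 2 * (n%:R^-1 * T s) ^+ 2 by rewrite exprMn exprVn; ring.
  move: e; move: (statV n p s) (n%:R^-1 * T s) => x y.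
  have q1 : r^-1 <= 1 by rewrite invf_le1.
  have q0 : 0 < r^-1 by rewrite invr_gt0.
  move: r^-1 q0 q1 => q q0 q1; rewrite ler_norml => /andP[h1 h2].
  have h3 : (x - y) ^+ 2 <= q by nra.
  have := sqr_ge0 (x - 2 * y); nra.
have bsq : buc n (fun s => 2 * n%:R ^- 2 * T s ^+ 2) by apply: buc_scale; exact: buc_sqr.
apply: (le_trans (cbeE_le beta0 (buc_sqr bV) _ main)).
  by apply: buc_add => //; exact: buc_cst.
rewrite cbeE_add ?cbeE_cst ?cbeE_scale//; [|exact: buc_sqr|exact: buc_cst].
have := cbeE_conj_trunc_le K n0 r1 rn; rewrite -/p -[cbeE _ _ _]/(cbeE beta n (fun s => T s ^+ 2)) => h.
have nn : 0 < 2 * n%:R ^- 2 :> R by rewrite mulr_gt0// invr_gt0 exprn_gt0.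
rewrite [leRHS]mulrDl lerD2r; apply: le_trans (ler_wpM2l (ltW nn) h) _.
rewrite le_eqVlt; apply/orP; left; apply/eqP.
by field; rewrite !gt_eqF.
Qed.

(** The first moment follows from the second by |x| <= 1/(2q) + q x^2 / 2 with q = sqrt r. *)
Lemma cbeE_statV_norm_le n (r : R) : (0 < n)%N -> 1 <= r -> r < n%:R ->
  cbeE beta n (fun s => `|statV n (1 - r / n%:R) s|) <= (energyC beta + 2) / Num.sqrt r.
Proof.
move=> n0 r1 rn; have n0' : (0 : R) < n%:R by rewrite ltr0n.
have r0 : 0 < r by lra.
pose q := Num.sqrt r; have q0 : 0 < q by rewrite sqrtr_gt0.
have qq : q ^+ 2 = r by rewrite sqr_sqrtr// ltW.
have p1 : 1 - r / n%:R < 1 by rewrite gtrBl divr_gt0.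
have p0 : 0 < 1 - r / n%:R by rewrite subr_gt0 ltr_pdivrMr// mul1r.
have [_ bV] := buc_statUV n (introT andP (conj p0 p1)).
have main s : size s = n -> in_circ s -> `|statV n (1 - r / n%:R) s| <= q^-1 / 2 + q / 2 * statV n (1 - r / n%:R) s ^+ 2.
  move=> _ _; rewrite -[X in _ <= _ + _ * X](real_normK (num_real _)).
  move: `|_| => x; have := sqr_ge0 (x * q - 1) => h.
  have qi : 0 < q^-1 / 2 by rewrite divr_gt0// invr_gt0.
  have := mulr_ge0 (ltW qi) h.
  have -> : q^-1 / 2 * (x * q - 1) ^+ 2 = (q^-1 * q) * q / 2 * x ^+ 2 - (q^-1 * q) * x + q^-1 / 2 by field; rewrite gt_eqF.
  by rewrite mulVf ?gt_eqF// !mul1r; lra.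
have bsq : buc n (fun s => q / 2 * statV n (1 - r / n%:R) s ^+ 2) by apply: buc_scale; exact: buc_sqr.
have bn : buc n (fun s => `|statV n (1 - r / n%:R) s|).
  by apply: (buc_comp (h := fun z : R => `|z|)) => //; exact: norm_continuous.
apply: (le_trans (cbeE_le beta0 bn _ main)).
  by apply: buc_add => //; exact: buc_cst.
rewrite cbeE_add ?cbeE_cst ?cbeE_scale//; [|exact: buc_sqr|exact: buc_cst].
have q2 : 0 < q / 2 by rewrite divr_gt0.
have := ler_wpM2l (ltW q2) (cbeE_statV_sqr_le n0 r1 rn).
have -> : q / 2 * ((2 * energyC beta + 2) / r) = (energyC beta + 1) / q.
  by rewrite -qq; field; rewrite gt_eqF.
have : 0 < q^-1 by rewrite invr_gt0.
rewrite -/q !mulrDl mul1r; lra.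
Qed.

End ConjugateVariance.

(** * Domination of error terms by Cauchy kernels *)

Section Comparison.
Context {R : realType} (beta : R) (beta0 : 0 < beta).
Implicit Types (s : seq R) (n : nat).

(** pi times the Poisson kernel of the half-plane. It serves both as the family of test functions
    identifying the law and as a dominating function of bounded mean for error terms. *)
Definition cauchyK (X x : R) : R := X / (X ^+ 2 + x ^+ 2).

Lemma cauchyK_ge0 X x : 0 <= X -> 0 <= cauchyK X x.
Proof. by move=> X0; rewrite divr_ge0// addr_ge0 ?sqr_ge0. Qed.

Lemma cauchyK_lip (p q q' : R) : 0 < p ->
  `|cauchyK p q - cauchyK p q'| <= p ^- 2 * `|q - q'|.
Proof.
move=> p0; have p2 : 0 < p ^+ 2 by rewrite exprn_gt0.
have d0 : 0 < p ^+ 2 + q ^+ 2 by rewrite ltr_wpDr ?sqr_ge0.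
have d0' : 0 < p ^+ 2 + q' ^+ 2 by rewrite ltr_wpDr ?sqr_ge0.
rewrite /cauchyK (_ : _ - _ = (p * (q + q') / ((p ^+ 2 + q ^+ 2) * (p ^+ 2 + q' ^+ 2))) * (q' - q)); last first.
  by field; rewrite !gt_eqF.
rewrite normrM (distrC q'); apply: ler_wpM2r => //.
rewrite normrM [X in _ * X]gtr0_norm ?invr_gt0 ?mulr_gt0// ler_pdivrMr ?mulr_gt0//.
rewrite [leRHS]mulrC ler_pdivlMr// normrM (gtr0_norm p0).
have h : p * `|q + q'| <= p * `|q| + p * `|q'| by rewrite -mulrDr ler_pM2l// ler_normD.
have e1 : q ^+ 2 = `|q| ^+ 2 by rewrite real_normK ?num_real.
have e2 : q' ^+ 2 = `|q'| ^+ 2 by rewrite real_normK ?num_real.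
rewrite e1 e2; move: `|q| `|q'| (normr_ge0 q) (normr_ge0 q') h => u v u0 v0 h.
apply: (@le_trans _ _ ((p * u + p * v) * p ^+ 2)); first by rewrite ler_wpM2r// ltW.
have h1 : p * u <= (p ^+ 2 + u ^+ 2) / 2 by have := sqr_ge0 (p - u); nra.
have h2 : p * v <= (p ^+ 2 + v ^+ 2) / 2 by have := sqr_ge0 (p - v); nra.
have h3 : p * u * p ^+ 2 <= (p ^+ 2 + u ^+ 2) / 2 * (p ^+ 2 + v ^+ 2).
  by apply: ler_pM => //; rewrite ?mulr_ge0 ?sqr_ge0 ?(ltW p0)// lerDl sqr_ge0.
have h4 : p * v * p ^+ 2 <= (p ^+ 2 + v ^+ 2) / 2 * (p ^+ 2 + u ^+ 2).
  by apply: ler_pM => //; rewrite ?mulr_ge0 ?sqr_ge0 ?(ltW p0)// lerDl sqr_ge0.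
lra.
Qed.

Lemma cauchyK_lip_scale (a p p' q : R) : 0 < a -> a <= p -> a <= p' ->
  `|cauchyK p q - cauchyK p' q| <= a ^- 2 * `|p - p'|.
Proof.
move=> a0 ap ap'; have p0 : 0 < p by lra. have p0' : 0 < p' by lra.
have d0 : 0 < p ^+ 2 + q ^+ 2 by rewrite ltr_wpDr ?sqr_ge0// exprn_gt0.
have d0' : 0 < p' ^+ 2 + q ^+ 2 by rewrite ltr_wpDr ?sqr_ge0// exprn_gt0.
rewrite /cauchyK (_ : _ - _ = ((q ^+ 2 - p * p') / ((p ^+ 2 + q ^+ 2) * (p' ^+ 2 + q ^+ 2))) * (p - p')); last first.
  by field; rewrite !gt_eqF.
rewrite normrM; apply: ler_wpM2r => //.
rewrite normrM [X in _ * X]gtr0_norm ?invr_gt0 ?mulr_gt0// ler_pdivrMr ?mulr_gt0//.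
rewrite [leRHS]mulrC ler_pdivlMr ?exprn_gt0//.
have h : `|q ^+ 2 - p * p'| <= q ^+ 2 + p * p'.
  apply: (le_trans (ler_normB _ _)); rewrite ger0_norm ?sqr_ge0// ger0_norm// mulr_ge0// ltW//.
apply: (le_trans (ler_wpM2r (sqr_ge0 a) h)).
have q2 := sqr_ge0 q.
have pp : 0 < p * p' by rewrite mulr_gt0.
have k1 : a ^+ 2 <= p * p' by rewrite expr2 ler_pM// ltW.
have k2 : a ^+ 2 <= p ^+ 2 by rewrite !expr2 ler_pM// ltW.
have k3 := ler_wpM2l q2 k2; have k4 := ler_wpM2l (ltW pp) k1.
have k5 : 0 <= q ^+ 2 * p' ^+ 2 by rewrite mulr_ge0 ?sqr_ge0.
have k6 : 0 <= q ^+ 2 * q ^+ 2 by rewrite mulr_ge0.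
rewrite [leRHS](_ : _ = (p * p') * (p * p') + q ^+ 2 * p ^+ 2 + q ^+ 2 * p' ^+ 2 + q ^+ 2 * q ^+ 2); last by ring.
lra.
Qed.

Lemma cauchyK_le (a p q : R) : 0 < a -> a <= p -> cauchyK p q <= a^-1.
Proof.
move=> a0 ap; have p0 : 0 < p by lra.
rewrite /cauchyK ler_pdivrMr ?ltr_wpDr ?sqr_ge0 ?exprn_gt0// [leRHS]mulrC ler_pdivlMr//.
have := sqr_ge0 q; nra.
Qed.

(** [Num.min 1 U] appears instead of U because U has mean 1/2 at every scale; only its truncation
    has a small mean. The term 2 / a covers the case U > 1. *)
Lemma cauchyK_diff (a b U V V' : R) : 0 < a -> 0 <= U ->
  `|cauchyK (a + U) (V - b) - cauchyK a (V' - b)| <=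
  (a ^- 2 + 2 / a) * (Num.min 1 U + `|V - V'|).
Proof.
move=> a0 U0; have aU : a <= a + U by rewrite lerDl.
have aU0 : 0 < a + U by lra.
have h1 : `|cauchyK (a + U) (V - b) - cauchyK (a + U) (V' - b)| <= a ^- 2 * `|V - V'|.
  apply: (le_trans (cauchyK_lip _ _ aU0)).
  rewrite (_ : V - b - (V' - b) = V - V'); last by ring.
  apply: ler_wpM2r => //.
  by rewrite lef_pV2 ?posrE ?exprn_gt0// !expr2 ler_pM// ltW.
have h2 := cauchyK_lip_scale (V' - b) a0 aU (lexx a).
have h3 : `|cauchyK (a + U) (V' - b) - cauchyK a (V' - b)| <= 2 / a.
  apply: (le_trans (ler_normB _ _)); rewrite !ger0_norm ?cauchyK_ge0 ?(ltW a0) ?(ltW aU0)//.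
  have := cauchyK_le (V' - b) a0 aU; have := cauchyK_le (V' - b) a0 (lexx a); lra.
rewrite addrAC subrr add0r (ger0_norm U0) in h2.
have ai : 0 < a^-1 by rewrite invr_gt0.
have ai2 : 0 < a ^- 2 by rewrite invr_gt0 exprn_gt0.
have h4 : `|cauchyK (a + U) (V' - b) - cauchyK a (V' - b)| <= (a ^- 2 + 2 / a) * Num.min 1 U.
  rewrite /Num.min; case: ltP => h; first by rewrite mulr1; lra.
  rewrite mulrDl; have : 0 <= 2 / a * U by rewrite mulr_ge0// divr_ge0// ltW.
  lra.
have h5 : a ^- 2 * `|V - V'| <= (a ^- 2 + 2 / a) * `|V - V'|.
  by apply: ler_wpM2r => //; lra.
rewrite (_ : _ - _ = (cauchyK (a + U) (V - b) - cauchyK (a + U) (V' - b)) +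
   (cauchyK (a + U) (V' - b) - cauchyK a (V' - b))); last by ring.
apply: (le_trans (ler_normD _ _)); lra.
Qed.

Lemma unif_cont_cauchyK (X : R) : 0 < X -> unif_cont (cauchyK X).
Proof.
move=> X0; apply: (@lipschitz_unif_cont _ _ X^-1 (X ^- 2)) => [x|x y].
  by rewrite ger0_norm ?cauchyK_ge0 ?(ltW X0)// cauchyK_le.
exact: cauchyK_lip.
Qed.

Lemma poisson_denE (p t : R) : 1 - 2 * p * cos t + p ^+ 2 = (1 - p) ^+ 2 + p * (2 - 2 * cos t).
Proof. by ring. Qed.

Lemma cauchyK_le_poissonK n (X t : R) : 0 < X < n%:R ->
  cauchyK X (n%:R * t) <= n%:R^-1 * poissonK (1 - X / n%:R) t.
Proof.
move=> /andP[X0 Xn]; have n0 : (0 : R) < n%:R by lra.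
rewrite /poissonK poisson_denE; set D := X / n%:R.
have D0 : 0 < D by rewrite divr_gt0.
have D1 : D < 1 by rewrite ltr_pdivrMr// mul1r.
have S0 := chord2_ge0 t; have S1 := chord2_le t.
rewrite [1 - (1 - D)](_ : _ = D); last by ring.
have den : 0 < D ^+ 2 + (1 - D) * (2 - 2 * cos t).
  by rewrite ltr_wpDr ?exprn_gt0// mulr_ge0//; lra.
have e1 : cauchyK X (n%:R * t) = n%:R^-1 * (D / (D ^+ 2 + t ^+ 2)).
  rewrite /cauchyK /D; field; rewrite !gt_eqF// ltr_wpDr ?sqr_ge0// ?exprn_gt0//.
rewrite e1; apply: ler_wpM2l; first by rewrite invr_ge0 ltW.
apply: ler_pM; rewrite ?invr_ge0 ?(ltW D0)// ?addr_ge0 ?sqr_ge0//.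
  by nra.
rewrite lef_pV2 ?posrE//; last by rewrite ltr_wpDr ?sqr_ge0// exprn_gt0.
by rewrite lerD2l; nra.
Qed.

(** The kernel lies below the rescaled Poisson kernel, as chords are shorter than arcs, and the mean
    of [statU] is exactly 1/2. This is the intensity bound uniform in n behind all later error
    estimates. *)
Lemma cbeE_cauchyK_le n (X : R) : 0 < X < n%:R -> cbeE beta n (linst n (cauchyK X)) <= 1.
Proof.
move=> Xn; have /andP[X0 X1] := Xn; have n0' : (0 : R) < n%:R by lra.
have n0 : (0 < n)%N by rewrite -(@ltr0n R).
have p01 : 0 < 1 - X / n%:R < 1.
  by rewrite subr_gt0 ltr_pdivrMr// mul1r X1 gtrBl divr_gt0.
have [bU _] := buc_statUV n p01.
apply: (@le_trans _ _ (cbeE beta n (fun s => 2 * statU n (1 - X / n%:R) s))).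
  apply: (cbeE_le beta0) => //; [exact: buc_linst (unif_cont_cauchyK X0)|exact: buc_scale|].
  move=> s sn _; rewrite /statU mulrA invfM mulrA divff// mul1r mulr_sumr.
  by apply: ler_sum => t _; exact: cauchyK_le_poissonK.
by rewrite cbeE_scale// cbeE_statU// divff.
Qed.

Lemma min1D_le (u v : R) : 0 <= u -> 0 <= v -> Num.min 1 (u + v) <= Num.min 1 u + Num.min 1 v.
Proof.
by move=> u0 v0; rewrite /Num.min; case: ltP => h1; case: ltP => h2; case: ltP => h3; lra.
Qed.

(** Truncation at 1 is subadditive, so it may be applied to each point. One point contributes at
    most of order min(1, y / x^2), which crosses over at |x| = sqrt y and is therefore dominated by
    sqrt y times the Cauchy kernel of width sqrt y. *)
Lemma cbeE_min_statU_le n (y : R) : (1 < n)%N -> 0 < y <= 1 ->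
  cbeE beta n (fun s => Num.min 1 (statU n (1 - y / n%:R) s)) <= 36 * Num.sqrt y.
Proof.
move=> n1 /andP[y0 y1]; have n1' : (2 : R) <= n%:R by rewrite ler_nat.
have n0 : (0 : R) < n%:R by lra.
pose q := Num.sqrt y; have q0 : 0 < q by rewrite sqrtr_gt0.
have qq : q ^+ 2 = y by rewrite sqr_sqrtr// ltW.
have q1 : q <= 1 by nra.
set D := y / n%:R.
have D0 : 0 < D by rewrite divr_gt0.
have D1 : D <= 2^-1 by rewrite ler_pdivrMr//; lra.
have p01 : 0 < 1 - D < 1 by apply/andP; split; lra.
have [bU _] := buc_statUV n p01.
have point t : -pi < t <= pi -> Num.min 1 ((2 * n%:R)^-1 * poissonK (1 - D) t) <= 36 * q * cauchyK q (n%:R * t).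
  move=> tp; have tp' : `|t| <= pi by rewrite ler_norml; case/andP: tp => /ltW -> ->.
  have S1 := chord2_ge tp'.
  have e : 36 * q * cauchyK q (n%:R * t) = 36 * y / (y + (n%:R * t) ^+ 2).
    by rewrite /cauchyK -qq; field; rewrite gt_eqF// ltr_wpDr ?sqr_ge0// exprn_gt0.
  rewrite e; set x := n%:R * t.
  have yx : 0 < y + x ^+ 2 by rewrite ltr_wpDr ?sqr_ge0.
  have [h|h] := ltP (x ^+ 2) y.
    by rewrite ge_min; apply/orP; left; rewrite ler_pdivlMr//; lra.
  rewrite ge_min; apply/orP; right.
  have x0 : 0 < x ^+ 2 by lra.
  have h1 : (2 * n%:R)^-1 * poissonK (1 - D) t <= 18 * y / x ^+ 2.
    have xt : x ^+ 2 = n%:R ^+ 2 * t ^+ 2 by rewrite exprMn.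
    have t0 : 0 < t ^+ 2 by move: x0; rewrite xt pmulr_rgt0// exprn_gt0.
    rewrite /poissonK poisson_denE [1 - (1 - D)](_ : _ = D); last by ring.
    have den : t ^+ 2 / 18 <= D ^+ 2 + (1 - D) * (2 - 2 * cos t) by have := sqr_ge0 D; nra.
    have -> : 18 * y / x ^+ 2 = (2 * n%:R)^-1 * (2 * D * (t ^+ 2 / 18)^-1).
      have tn : t != 0 by rewrite -sqrf_eq0 gt_eqF.
      by rewrite xt /D; field; rewrite tn gt_eqF.
    apply: ler_wpM2l; first by rewrite invr_ge0 mulr_ge0// ltW.
    apply: ler_pM; rewrite ?invr_ge0.
    - by nra.
    - by apply: le_trans den; rewrite divr_ge0// sqr_ge0.
    - by nra.
    - rewrite lef_pV2 ?posrE ?divr_gt0//; apply: lt_le_trans den.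
      by rewrite divr_gt0.
  apply: (le_trans h1); rewrite ler_pdivrMr// mulrAC ler_pdivlMr//.
  nra.
have pK t : 0 <= (2 * n%:R)^-1 * poissonK (1 - D) t.
  apply: mulr_ge0; first by rewrite invr_ge0 mulr_ge0// ltW.
  rewrite /poissonK; apply: divr_ge0; first by nra.
  by apply: le_trans (poisson_den_ge _ _); [exact: sqr_ge0|lra].
have min_sum s : in_circ s -> Num.min 1 (statU n (1 - D) s) <= 36 * q * linst n (cauchyK q) s.
  rewrite /statU /linst !mulr_sumr.
  elim: s => [_|t s IH]; first by rewrite !big_nil ge_min lexx orbT.
  move=> sc; rewrite !big_cons.
  have tc : -pi < t <= pi by have := sc t (mem_head _ _); rewrite /circ_dom/= in_itv.
  have sc' : in_circ s by move=> u us; apply: sc; rewrite in_cons us orbT.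
  apply: le_trans (min1D_le (pK t) _) _; first exact: sumr_ge0.
  by rewrite lerD ?point ?IH.
have q01 : 0 < q < n%:R by rewrite q0; lra.
have bl := buc_linst n n (unif_cont_cauchyK q0).
apply: (@le_trans _ _ (cbeE beta n (fun s => 36 * q * linst n (cauchyK q) s))).
  apply: (cbeE_le beta0) => //; [|exact: buc_scale|by move=> s _ sc; exact: min_sum].
  apply: (buc_comp (h := fun z => Num.min 1 z)) => // z.
  by apply: (@continuous_min _ _ (fun=> 1) (fun y : R => y)); [exact: cst_continuous|exact: cvg_id].
rewrite cbeE_scale//; have := cbeE_cauchyK_le q01.
rewrite -/q; have : 0 < 36 * q by rewrite mulr_gt0.
move=> c0 c1; have := ler_wpM2l (ltW c0) c1; lra.
Qed.

End Comparison.

(** * The principal value kernel *)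

Section PrincipalValueKernel.
Context {R : realType} (beta : R) (beta0 : 0 < beta).
Implicit Types (s : seq R) (n : nat).

Definition lipcs (f : R -> R) : Prop :=
  (exists2 L : R, 0 <= L & forall x y : R, `|f x - f y| <= L * `|x - y|) /\
  (exists2 M : R, 0 <= M & forall x : R, M < `|x| -> f x = 0).

Lemma lipcs_unif_cont f : lipcs f -> unif_cont f.
Proof.
move=> [[L L0 fL] [M M0 fM]]; apply: (@lipschitz_unif_cont _ f (L * (2 * M + 1)) L) => // x.
have [xM|Mx] := leP `|x| M; last by rewrite fM// normr0 mulr_ge0//; lra.
have f1 : f (M + 1) = 0 by apply: fM; rewrite ger0_norm; lra.
rewrite -[f x]subr0 -f1; apply: le_trans (fL _ _) _; apply: ler_wpM2l => //.
apply: le_trans (ler_normB _ _) _; rewrite [X in _ + X]ger0_norm; lra.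
Qed.

Lemma lipcs_Cc_plus f : lipcs f -> (forall x, 0 <= f x) -> Cc_plus f.
Proof.
move=> lf f0; split; first exact: unif_cont_continuous (lipcs_unif_cont lf).
by split => //; case: lf => _ [M M0 fM]; exists M.
Qed.

Lemma lipcs_max0 f : lipcs f -> lipcs (fun x => Num.max 0 (f x)).
Proof.
move=> [[L L0 fL] [M M0 fM]]; split; first by exists L => // x y; apply: max_lip.
by exists M => // x /fM ->; rewrite maxxx.
Qed.

Lemma lipcs_lin (p q : R) f g : lipcs f -> lipcs g -> lipcs (fun x => p * f x + q * g x).
Proof.
move=> [[L L0 fL] [M M0 fM]] [[L' L'0 gL] [M' M'0 gM]]; split.
  exists (`|p| * L + `|q| * L') => [|x y]; first by rewrite addr_ge0 ?mulr_ge0.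
  rewrite (_ : _ - _ = p * (f x - f y) + q * (g x - g y)); last by ring.
  apply: le_trans (ler_normD _ _) _; rewrite !normrM mulrDl -!mulrA.
  by apply: lerD; apply: ler_wpM2l.
exists (M + M') => [|x xM]; first by rewrite addr_ge0.
by rewrite fM ?gM ?mulr0 ?addr0//; lra.
Qed.

Lemma lipcs_opp f : lipcs f -> lipcs (fun x => - f x).
Proof.
move=> lf; have := lipcs_lin (-1) 0 lf lf; congr lipcs.
by apply/funext => x; rewrite mul0r addr0 mulN1r.
Qed.

Lemma lipcs_trap (a b : R) : lipcs (trap a b).
Proof.
split; first by exists 1 => // x y; rewrite mul1r trap_lip.
exists (`|a| + `|b|) => [|x xM]; first by rewrite addr_ge0.
apply: trap_out; have := ler_norm (- a); have := ler_norm b; rewrite normrN => h1 h2.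
have := normr_ge0 a; have := normr_ge0 b => h3 h4.
by have [x0|x0] := leP 0 x; move: xM; [rewrite [X in _ < X]ger0_norm//|rewrite [X in _ < X]ltr0_norm//] => xM; [right|left]; lra.
Qed.

Lemma lipcs_mulr (f g : R -> R) (B L : R) : lipcs f -> (forall x, `|g x| <= B) ->
  (forall x y : R, `|g x - g y| <= L * `|x - y|) -> lipcs (fun x => f x * g x).
Proof.
move=> lf gB gL; have [[C HC] _] := lipcs_unif_cont lf.
case: lf => [[L' L'0 fL] [M M0 fM]]; split; last by exists M => // x /fM ->; rewrite mul0r.
have C0 : 0 <= C by apply: le_trans (HC 0).
have B0 : 0 <= B by apply: le_trans (gB 0).
have L0 : 0 <= L.
  by have := gL 1 0; rewrite subr0 normr1 mulr1; apply: le_trans.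
exists (C * L + L' * B) => [|x y]; first by rewrite addr_ge0 ?mulr_ge0.
rewrite (_ : _ - _ = f x * (g x - g y) + (f x - f y) * g y); last by ring.
apply: le_trans (ler_normD _ _) _; rewrite !normrM mulrDl; apply: lerD.
  by rewrite -mulrA; apply: ler_pM.
by rewrite mulrAC; apply: ler_pM.
Qed.

(** The conjugate Poisson kernel of the half-plane at height y: 1/x regularised at scale y. *)
Definition oddK (y x : R) : R := x / (x ^+ 2 + y ^+ 2).

Lemma oddK_le (y x : R) : 0 < y -> `|oddK y x| <= y^-1.
Proof.
move=> y0; have d0 : 0 < x ^+ 2 + y ^+ 2 by rewrite ltr_wpDl ?sqr_ge0// exprn_gt0.
rewrite normrM [X in _ * X]gtr0_norm ?invr_gt0// ler_pdivrMr// [leRHS]mulrC ler_pdivlMr//.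
rewrite -[X in _ <= X + _](real_normK (num_real x)).
by move: `|x| (normr_ge0 x) => u u0; have := sqr_ge0 (u - y); nra.
Qed.

Lemma oddK_lip (y x x' : R) : 0 < y -> `|oddK y x - oddK y x'| <= y ^- 2 * `|x - x'|.
Proof.
move=> y0; have y2 : 0 < y ^+ 2 by rewrite exprn_gt0.
have d0 : 0 < x ^+ 2 + y ^+ 2 by rewrite ltr_wpDl ?sqr_ge0.
have d0' : 0 < x' ^+ 2 + y ^+ 2 by rewrite ltr_wpDl ?sqr_ge0.
rewrite /oddK (_ : _ - _ = ((y ^+ 2 - x * x') / ((x ^+ 2 + y ^+ 2) * (x' ^+ 2 + y ^+ 2))) * (x - x')); last first.
  by field; rewrite !gt_eqF.
rewrite normrM; apply: ler_wpM2r => //.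
rewrite normrM [X in _ * X]gtr0_norm ?invr_gt0 ?mulr_gt0// ler_pdivrMr ?mulr_gt0//.
rewrite [leRHS]mulrC ler_pdivlMr//.
have h : `|y ^+ 2 - x * x'| <= y ^+ 2 + (x ^+ 2 + x' ^+ 2).
  rewrite ler_norml; have := sqr_ge0 (x - x'); have := sqr_ge0 (x + x').
  by have := sqr_ge0 x; have := sqr_ge0 x'; move=> *; apply/andP; split; nra.
apply: le_trans (ler_wpM2r (ltW y2) h) _.
have := mulr_ge0 (sqr_ge0 x) (sqr_ge0 x').
move: (x ^+ 2) (x' ^+ 2) (y ^+ 2) => u v w h1.
by rewrite [leRHS](_ : _ = (w + (u + v)) * w + u * v) ?lerDl//; ring.
Qed.

(** Close to 1/x for y << |x| << r. Subtracting scale r leaves a tail of order r^2 / |x|^3, small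
    enough to be cut off; the cut-off equals 1 exactly on [-r^2, r^2]. *)
Definition pvK (y r x : R) : R :=
  trap (- (r ^+ 2 + 1)) (r ^+ 2 + 1) x * (oddK y x - oddK r x).

Lemma lipcs_pvK (y r : R) : 0 < y -> 0 < r -> lipcs (pvK y r).
Proof.
move=> y0 r0; apply: (@lipcs_mulr _ _ (y^-1 + r^-1) (y ^- 2 + r ^- 2)); first exact: lipcs_trap.
  by move=> x; apply: le_trans (ler_normB _ _) _; apply: lerD; exact: oddK_le.
move=> x x'; rewrite (_ : _ - _ = (oddK y x - oddK y x') - (oddK r x - oddK r x')); last by ring.
by apply: le_trans (ler_normB _ _) _; rewrite mulrDl; apply: lerD; exact: oddK_lip.
Qed.

Lemma div_sub_le (m X e1 e2 A A' B B' : R) : 0 < m -> m <= B -> m <= B' -> `|A| <= X ->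
  `|A' - A| <= e1 -> `|B' - B| <= e2 -> `|A' / B' - A / B| <= e1 / m + X * (e2 / m ^+ 2).
Proof.
move=> m0 mB mB' AX h1 h2; have B0 : 0 < B by lra. have B'0 : 0 < B' by lra.
rewrite (_ : _ - _ = (A' - A) / B' + A * ((B - B') / (B * B'))); last first.
  by field; rewrite !gt_eqF.
apply: le_trans (ler_normD _ _) _; apply: lerD.
  rewrite normrM [X in _ * X]gtr0_norm ?invr_gt0//; apply: ler_pM => //; first by rewrite invr_ge0 ltW.
  by rewrite lef_pV2.
rewrite !normrM; apply: ler_pM => //; rewrite ?mulr_ge0//.
rewrite [X in _ * X]gtr0_norm ?invr_gt0 ?mulr_gt0// distrC; apply: ler_pM => //.
  by rewrite invr_ge0 mulr_ge0// ltW.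
by rewrite lef_pV2 ?posrE ?mulr_gt0// expr2 ler_pM// ltW.
Qed.

Lemma conjK_scaleE n (y t : R) : 0 < y -> y < n%:R ->
  n%:R^-1 * conjK (1 - y / n%:R) t =
  (n%:R - y) * sin t / (y ^+ 2 + (n%:R ^+ 2 - n%:R * y) * (2 - 2 * cos t)).
Proof.
move=> y0 yn; have n0 : 0 < n%:R :> R by lra.
rewrite /conjK poisson_denE; have S0 := chord2_ge0 t.
set D := y / n%:R; have D0 : 0 < D by rewrite divr_gt0.
have D1 : D < 1 by rewrite ltr_pdivrMr// mul1r.
rewrite [1 - (1 - D)](_ : _ = D); last by ring.
have den : 0 < D ^+ 2 + (1 - D) * (2 - 2 * cos t).
  by rewrite ltr_wpDr ?exprn_gt0// mulr_ge0//; lra.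
have yD : y = D * n%:R by rewrite /D divfK// gt_eqF.
rewrite yD; clearbody D; set S := 2 - _ in den *.
rewrite (_ : (D * n%:R) ^+ 2 + _ = n%:R ^+ 2 * (D ^+ 2 + (1 - D) * S)); last by ring.
move: (_ + _) den => d d0; field.
by rewrite !gt_eqF.
Qed.

(** Taylor bounds for sine and chord at t = O(1/n) perturb numerator and denominator by O(1/n); both
    denominators stay above y^2, so [div_sub_le] applies. *)
Lemma conjK_near (y X : R) : 0 < y -> 0 <= X -> exists2 K : R, 0 <= K &
  forall n t, 1 <= n%:R :> R -> y < n%:R -> `|n%:R * t| <= X ->
  `|n%:R^-1 * conjK (1 - y / n%:R) t - oddK y (n%:R * t)| <= K / n%:R.
Proof.
move=> y0 X0; have y2 : 0 < y ^+ 2 by rewrite exprn_gt0.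
exists ((X ^+ 3 + y * X) / y ^+ 2 + X * ((X ^+ 4 + y * X ^+ 2) / (y ^+ 2) ^+ 2)).
  have N1 : 0 <= X ^+ 3 + y * X by apply: addr_ge0; [exact: exprn_ge0|exact: mulr_ge0 (ltW y0) X0].
  have N2 : 0 <= X ^+ 4 + y * X ^+ 2.
    by apply: addr_ge0; [exact: exprn_ge0|apply: mulr_ge0; rewrite ?exprn_ge0// ltW].
  apply: addr_ge0; first exact: divr_ge0 N1 (ltW y2).
  by apply: mulr_ge0 => //; apply: divr_ge0 => //; rewrite exprn_ge0// ltW.
move=> n t n1 yn tX; have n0 : 0 < n%:R :> R by lra.
have S0 := chord2_ge0 t; have S1 := chord2_le t.
have h1 := norm_sinB_le t; have h2 := norm_chord2B_le t; have h3 := norm_sin_le t.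
rewrite conjK_scaleE//; set S := 2 - _ in S0 S1 h2 *.
set w := n%:R^-1.
have w0 : 0 < w by rewrite invr_gt0.
have w1 : w <= 1 by rewrite invf_le1.
have nw : n%:R * w = 1 by rewrite divff// gt_eqF.
have tw : `|t| <= X * w by rewrite ler_pdivlMr// mulrC -[X in X * _]ger0_norm// -normrM.
have t0 := normr_ge0 t.
rewrite /oddK [leRHS](_ : _ = ((X ^+ 3 + y * X) * w) / y ^+ 2 +
  X * (((X ^+ 4 + y * X ^+ 2) * w) / (y ^+ 2) ^+ 2)); last by ring.
apply: (@div_sub_le (y ^+ 2) X ((X ^+ 3 + y * X) * w) ((X ^+ 4 + y * X ^+ 2) * w)) => //.
- by rewrite lerDr sqr_ge0.
- by rewrite lerDl mulr_ge0//; nra.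
- rewrite (_ : _ - _ = n%:R * (sin t - t) - y * sin t); last by ring.
  apply: le_trans (ler_normB _ _) _; rewrite !normrM (ger0_norm (ltW n0)) (ger0_norm (ltW y0)).
  rewrite mulrDl; apply: lerD; last first.
    by rewrite -mulrA ler_pM2l// (le_trans h3).
  apply: le_trans (ler_wpM2l (ltW n0) h1) _.
  have t3 : `|t| ^+ 3 <= (X * w) ^+ 3 by apply: lerXn2r; rewrite ?nnegrE// (le_trans t0).
  have : n%:R * (X * w) ^+ 3 <= X ^+ 3 * w.
    rewrite (_ : n%:R * _ = (n%:R * w) * (X ^+ 3 * w * w)); last by ring.
    by rewrite nw mul1r ler_piMr// mulr_ge0 ?exprn_ge0// ltW.
  have := exprn_ge0 3 t0; nra.
- rewrite (_ : _ - _ = n%:R ^+ 2 * (S - t ^+ 2) - n%:R * y * S); last by ring.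
  apply: le_trans (ler_normB _ _) _; rewrite (normrM (n%:R ^+ 2)) (normrM (n%:R * y)) (ger0_norm S0).
  rewrite (ger0_norm (sqr_ge0 _)) (ger0_norm (mulr_ge0 (ltW n0) (ltW y0))).
  rewrite mulrDl; apply: lerD.
    apply: le_trans (ler_wpM2l (sqr_ge0 _) h2) _.
    have -> : t ^+ 4 = `|t| ^+ 4.
      by rewrite -[4%N]/(2 * 2)%N !exprM real_normK// num_real.
    have t4 : `|t| ^+ 4 <= (X * w) ^+ 4 by apply: lerXn2r; rewrite ?nnegrE// (le_trans t0).
    have : n%:R ^+ 2 * (X * w) ^+ 4 <= X ^+ 4 * w.
      rewrite (_ : n%:R ^+ 2 * _ = (n%:R * w) ^+ 2 * (X ^+ 4 * (w * w))); last by ring.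
      rewrite nw expr1n mul1r; apply: ler_wpM2l; first exact: exprn_ge0.
      by rewrite ler_piMl// ltW.
    have := ler_wpM2l (sqr_ge0 n%:R) t4; have := mulr_ge0 (sqr_ge0 (n%:R : R)) (exprn_ge0 4 t0); lra.
  have t2 : t ^+ 2 <= (X * w) ^+ 2.
    by rewrite -(real_normK (num_real t)); apply: lerXn2r; rewrite ?nnegrE// (le_trans t0).
  have : n%:R * y * S <= n%:R * y * (X * w) ^+ 2 by rewrite ler_pM2l ?mulr_gt0// (le_trans S1).
  rewrite (_ : n%:R * y * (X * w) ^+ 2 = (n%:R * w) * (y * X ^+ 2 * w)); last by ring.
  by rewrite nw mul1r.
Qed.

Lemma inv_shift_sub_le (Q S p q : R) : 0 < S -> 0 <= p <= Q -> 0 <= q <= Q ->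
  `|(p + S)^-1 - (q + S)^-1| <= Q / S ^+ 2.
Proof.
move=> S0 /andP[p0 p1] /andP[q0 q1]; have d1 : 0 < p + S by lra. have d2 : 0 < q + S by lra.
rewrite (_ : _ - _ = (q - p) / ((p + S) * (q + S))); last by field; rewrite !gt_eqF.
rewrite normrM [X in _ * X]gtr0_norm ?invr_gt0 ?mulr_gt0//; apply: ler_pM => //.
- by rewrite invr_ge0 mulr_ge0// ltW.
- by rewrite ler_norml; apply/andP; split; lra.
- by rewrite lef_pV2 ?posrE ?exprn_gt0 ?mulr_gt0// expr2; apply: ler_pM; lra.
Qed.

(** Both differences are of order r^2 / |x|^3, which X <= |x| converts into a multiple of
    [cauchyK X]. The factor w will be the value of the cut-off. Here 326 = 2 (162 + 1), and 162 = 2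
    * 9^2 stems from [chord2_ge]. *)
Lemma conjK_tail n (y r X t w : R) : 0 < y -> y <= r -> 1 <= r -> r <= X -> 2 * r <= n%:R ->
  `|t| <= pi -> X <= `|n%:R * t| -> 0 <= w <= 1 ->
  `|n%:R^-1 * (conjK (1 - y / n%:R) t - conjK (1 - r / n%:R) t) -
    w * (oddK y (n%:R * t) - oddK r (n%:R * t))| <= 326 * (r ^+ 2 / X ^+ 2) * cauchyK X (n%:R * t).
Proof.
move=> y0 yr r1 rX rn tp Xt /andP[w0 w1].
have n0 : 0 < n%:R :> R by lra.
set x := n%:R * t in Xt *.
have x0 : 0 < `|x| by lra.
have xn : `|x| = n%:R * `|t| by rewrite normrM (ger0_norm (ltW n0)).
clearbody x.
have t0 : 0 < `|t| by move: x0; rewrite xn pmulr_rgt0.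
have S1 := chord2_ge tp; rewrite -(real_normK (num_real t)) in S1.
set S := 2 - 2 * cos t in S1.
have S0 : 0 < S by apply: lt_le_trans S1; rewrite divr_gt0// exprn_gt0.
have conjE z : 0 < z -> z <= r -> conjK (1 - z / n%:R) t = sin t * ((z / n%:R) ^+ 2 / (1 - z / n%:R) + S)^-1 /\
    0 <= (z / n%:R) ^+ 2 / (1 - z / n%:R) <= 2 * r ^+ 2 / n%:R ^+ 2.
  move=> z0 zr; rewrite /conjK poisson_denE -/S; set D := z / n%:R.
  have D0 : 0 < D by rewrite divr_gt0.
  have D1 : D <= 2^-1 by rewrite ler_pdivrMr//; lra.
  have D2 : D <= r / n%:R by rewrite ler_pM2r ?invr_gt0.
  have d : 0 < 1 - D by lra.
  split.
    rewrite [1 - (1 - D)](_ : _ = D); last by ring.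
    have e0 : 0 < D ^+ 2 + (1 - D) * S by apply: addr_gt0; [exact: exprn_gt0|exact: mulr_gt0].
    have -> : D ^+ 2 / (1 - D) + S = (D ^+ 2 + (1 - D) * S) / (1 - D) by field; rewrite gt_eqF.
    by rewrite invf_div; move: (_ + _)^-1 => u; ring.
  rewrite divr_ge0 ?sqr_ge0 ?(ltW d)//=.
  rewrite ler_pdivrMr// (_ : 2 * r ^+ 2 / n%:R ^+ 2 = 2 * (r / n%:R) ^+ 2); last by rewrite exprMn exprVn; ring.
  have : D ^+ 2 <= (r / n%:R) ^+ 2 by apply: lerXn2r; rewrite ?nnegrE ?(ltW D0)// (le_trans (ltW D0)).
  have := sqr_ge0 (r / n%:R); nra.
have [-> Q1] := conjE y y0 yr.
have [|-> Q2] := conjE r _ (lexx r); first by lra.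
have r0 : 0 < r by lra.
have A1 : `|n%:R^-1 * (sin t * ((y / n%:R) ^+ 2 / (1 - y / n%:R) + S)^-1 -
     sin t * ((r / n%:R) ^+ 2 / (1 - r / n%:R) + S)^-1)| <= 162 * (r ^+ 2 / `|x| ^+ 3).
  rewrite -mulrBr !normrM [`|n%:R^-1|]gtr0_norm ?invr_gt0//.
  have h := inv_shift_sub_le S0 Q1 Q2.
  have S2 : (S ^+ 2)^-1 <= ((`|t| ^+ 2 / 9) ^+ 2)^-1.
    rewrite lef_pV2 ?posrE ?exprn_gt0 ?divr_gt0 ?exprn_gt0//.
    by apply: lerXn2r; rewrite ?nnegrE ?divr_ge0 ?sqr_ge0// ltW.
  have -> : 162 * (r ^+ 2 / `|x| ^+ 3) =
     n%:R^-1 * (`|t| * (2 * r ^+ 2 / n%:R ^+ 2 * ((`|t| ^+ 2 / 9) ^+ 2)^-1)).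
    by rewrite xn; field; rewrite !gt_eqF.
  apply: ler_wpM2l; first by rewrite invr_ge0 ltW.
  apply: ler_pM => //; first exact: norm_sin_le.
  apply: le_trans h _; apply: ler_wpM2l => //.
  by case/andP: Q1 => a1 a2; exact: le_trans a1 a2.
have A2 : `|w * (oddK y x - oddK r x)| <= r ^+ 2 / `|x| ^+ 3.
  have -> : oddK y x - oddK r x = x * ((y ^+ 2 + x ^+ 2)^-1 - (r ^+ 2 + x ^+ 2)^-1).
    by rewrite /oddK mulrBr addrC [_ + y ^+ 2]addrC [_ + r ^+ 2]addrC addrC.
  have x2 : 0 < x ^+ 2 by rewrite -(real_normK (num_real x)) exprn_gt0.
  have yy : 0 <= y ^+ 2 <= r ^+ 2 by rewrite sqr_ge0 lerXn2r// ?nnegrE ltW.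
  have rr : 0 <= r ^+ 2 <= r ^+ 2 by rewrite sqr_ge0/=.
  have h := inv_shift_sub_le x2 yy rr.
  rewrite !normrM (ger0_norm w0) -[leRHS]mul1r; apply: ler_pM; rewrite ?mulr_ge0//.
  have -> : r ^+ 2 / `|x| ^+ 3 = `|x| * (r ^+ 2 / (x ^+ 2) ^+ 2).
    by rewrite -(real_normK (num_real x)); field; rewrite gt_eqF.
  by apply: ler_wpM2l.
apply: le_trans (ler_normB _ _) _.
apply: (@le_trans _ _ (163 * r ^+ 2 * (`|x| ^+ 3)^-1)); first by move: A1 A2; lra.
have X0 : 0 < X by lra.
rewrite /cauchyK -(real_normK (num_real x)).
have -> : 326 * (r ^+ 2 / X ^+ 2) * (X / (X ^+ 2 + `|x| ^+ 2)) =
   163 * r ^+ 2 * (2 / (X * (X ^+ 2 + `|x| ^+ 2))).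
  by field; rewrite !gt_eqF// addr_gt0 ?exprn_gt0.
apply: ler_wpM2l; first by apply: mulr_ge0 => //; exact: sqr_ge0.
move: `|x| x0 Xt => u u0 Xu.
have den : 0 < X * (X ^+ 2 + u ^+ 2) by rewrite mulr_gt0// addr_gt0 ?exprn_gt0.
rewrite ler_pdivlMr// ler_pdivrMl ?exprn_gt0// mulrC.
have h1 : X * X ^+ 2 <= u * u ^+ 2.
  by apply: ler_pM; rewrite ?sqr_ge0 ?(ltW X0)// lerXn2r// ?nnegrE ltW.
have h2 : X * u ^+ 2 <= u * u ^+ 2 by rewrite ler_wpM2r// sqr_ge0.
rewrite (_ : u ^+ 3 = u * u ^+ 2); last by rewrite exprS.
lra.
Qed.

(** The threshold is X = r^2. Inside, the cut-off is 1 and [conjK_near] makes the error as small as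
    desired; outside, [conjK_tail] leaves 326 r^2 / X^2 = 326 / r^2. *)
Lemma pvK_approx (y r e : R) : 0 < y -> y <= 1 -> 1 <= r -> 0 < e ->
  exists n0, forall n, (n0 <= n)%N -> forall t, `|t| <= pi ->
  `|n%:R^-1 * (conjK (1 - y / n%:R) t - conjK (1 - r / n%:R) t) - pvK y r (n%:R * t)|
  <= (e + 326 / r ^+ 2) * cauchyK (r ^+ 2) (n%:R * t).
Proof.
move=> y0 y1 r1 e0; have r0 : 0 < r by lra.
pose X := r ^+ 2; have X0 : 0 < X by rewrite exprn_gt0.
have rX : r <= X by rewrite /X expr2 ler_pMr.
have [K1 K10 H1] := conjK_near y0 (ltW X0).
have [K2 K20 H2] := conjK_near r0 (ltW X0).
exists (Num.bound (2 * r + (K1 + K2) * (2 * X / e))) => n nn t tp.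
have c0 : 0 <= (K1 + K2) * (2 * X / e) by rewrite mulr_ge0 ?addr_ge0// divr_ge0 ?mulr_ge0// ltW.
have nb : 2 * r + (K1 + K2) * (2 * X / e) < n%:R.
  apply: lt_le_trans (archi_boundP _) _; first by rewrite addr_ge0// mulr_ge0// ltW.
  by rewrite ler_nat.
have rn : 2 * r <= n%:R by lra.
have n0 : 0 < n%:R :> R by lra.
have CK0 := cauchyK_ge0 (n%:R * t) (ltW X0).
have [xX|Xx] := leP X `|n%:R * t|.
  have tr : 0 <= trap (- (X + 1)) (X + 1) (n%:R * t) <= 1 by rewrite trap_ge0 trap_le1.
  apply: le_trans (conjK_tail y0 (le_trans y1 r1) r1 rX rn tp xX tr) _.
  rewrite -/X; apply: ler_wpM2r => //.
  rewrite (_ : 326 * (X / X ^+ 2) = 326 / X); last by field; rewrite gt_eqF.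
  lra.
rewrite /pvK -/X trap_in ?mul1r; last 2 first.
  - by move: Xx; rewrite ltr_norml; lra.
  - by move: Xx; rewrite ltr_norml; lra.
have h1 : `|n%:R^-1 * conjK (1 - y / n%:R) t - oddK y (n%:R * t)| <= K1 / n%:R.
  by apply: H1; rewrite ?(ltW Xx)//; lra.
have h2 : `|n%:R^-1 * conjK (1 - r / n%:R) t - oddK r (n%:R * t)| <= K2 / n%:R.
  by apply: H2; rewrite ?(ltW Xx)//; lra.
rewrite (_ : _ - _ = (n%:R^-1 * conjK (1 - y / n%:R) t - oddK y (n%:R * t)) -
   (n%:R^-1 * conjK (1 - r / n%:R) t - oddK r (n%:R * t))); last by ring.
apply: le_trans (ler_normB _ _) _.
apply: (@le_trans _ _ ((K1 + K2) / n%:R)); first by rewrite mulrDl; lra.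
apply: (@le_trans _ _ (e / (2 * X))).
  have h3 : (K1 + K2) * (2 * X / e) <= n%:R by lra.
  rewrite ler_pdivrMr// -ler_pdivrMl ?divr_gt0 ?mulr_gt0//.
  by rewrite invf_div mulrC.
apply: (@le_trans _ _ (e * cauchyK X (n%:R * t))); last first.
  by apply: ler_wpM2r => //; rewrite lerDl; apply: mulr_ge0; [exact: ler0n|rewrite invr_ge0; exact: sqr_ge0].
apply: ler_wpM2l; first exact: ltW.
rewrite /cauchyK -(real_normK (num_real (n%:R * t))).
move: `|n%:R * t| (normr_ge0 (n%:R * t)) Xx => u u0 uX.
have den : 0 < X ^+ 2 + u ^+ 2 by rewrite ltr_wpDr ?exprn_gt0 ?sqr_ge0.
rewrite ler_pdivlMr// ler_pdivrMl ?mulr_gt0//.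
have : u ^+ 2 <= X ^+ 2 by apply: lerXn2r; rewrite ?nnegrE ?(ltW X0) ?(ltW uX).
lra.
Qed.

Lemma buc_resolvent n (p a b : R) : 0 < p < 1 -> 0 < a ->
  buc n (fun s => cauchyK (a + statU n p s) (statV n p s - b)).
Proof.
move=> /andP[p0 p1] a0; pose w := Complex a b.
have pz := cnorm_real_le p0.
have [h _] : bucC n (fun s => (w + Herg n (real_complex R p) s / 2)^-1).
  apply: (bucC_inv a0); last by move=> s _; exact: (@resolvent_ge R a n p w _ s p1 pz (lexx a)).
  apply: bucC_add; first exact: bucC_cst.
  by apply: bucC_mul; [exact: bucC_Herg p1 pz|exact: bucC_cst].
apply: eq_buc h => s _; rewrite Herg_half.
rewrite [X in complex.Re (X)^-1](_ : _ = Complex (a + statU n p s) (b - statV n p s)).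
  by rewrite Re_inv_Complex -(sqrrN (b - _)) opprB.
by apply/eqP; rewrite eq_complex/= !eqxx.
Qed.

End PrincipalValueKernel.

(** * The resolvent identity for the truncated principal value at finite n *)

Section FiniteResolvent.
Context {R : realType} (beta : R) (beta0 : 0 < beta).
Implicit Types (s : seq R) (n : nat).

(** The real part U costs sqrt y, while replacing V by the statistic of [pvK] and discarding V at
    scale r each cost r^{-1/2}. C depends on neither y nor r, whereas the threshold on n may; this
    order allows n to go to infinity first. *)
Lemma cbeE_pvK (a b : R) : 0 < a -> exists2 C : R, 0 < C &
  forall y r : R, 0 < y -> y <= 1 -> 1 <= r -> exists n0, forall n, (n0 <= n)%N ->
  `|cbeE beta n (fun s => cauchyK a (linst n (pvK y r) s - b)) -
    (a + 2^-1) / ((a + 2^-1) ^+ 2 + b ^+ 2)| <= C * (Num.sqrt y + (Num.sqrt r)^-1).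
Proof.
move=> a0; pose Ca := a ^- 2 + 2 / a.
have Ca0 : 0 < Ca by rewrite addr_gt0 ?divr_gt0// invr_gt0 exprn_gt0.
have E0 := @energyC_ge0 _ _ beta0.
exists (Ca * (energyC beta + 400)); first by apply: mulr_gt0; [exact: Ca0|lra].
move=> y r y0 y1 r1.
pose q := (Num.sqrt r)^-1; pose v := Num.sqrt y.
have v0 : 0 < v by rewrite sqrtr_gt0.
have r0 : 0 < r by lra.
have sr1 : 1 <= Num.sqrt r by rewrite -(@sqrtr1 R); exact: ler_wsqrtr.
have q0 : 0 < q by rewrite invr_gt0; lra.
have q1 : q <= 1 by rewrite invf_le1//; lra.
have rq : (r ^+ 2)^-1 <= q.
  have -> : (r ^+ 2)^-1 = q ^+ 4.
    by rewrite /q exprVn -[4%N]/(2 * 2)%N exprM sqr_sqrtr// ltW.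
  by rewrite exprS; apply: ler_piMr; [exact: ltW|apply: exprn_ile1 => //; exact: ltW].
(* The tolerance of the kernel approximation is q = r^{-1/2}, the size of the other errors at scale
   r. *)
have [n1 Hn1] := pvK_approx y0 y1 r1 q0.
exists (maxn n1 (Num.bound (2 * r ^+ 2)).+2) => n; rewrite geq_max => /andP[nn1 nn2].
have n1' : (1 < n)%N by apply: leq_trans nn2.
have n0 : (0 < n)%N by exact: ltnW.
have n0' : (0 : R) < n%:R by rewrite ltr0n.
have nX : 2 * r ^+ 2 < n%:R.
  apply: lt_le_trans (archi_boundP _) _; first by apply: mulr_ge0 => //; exact: sqr_ge0.
  by rewrite ler_nat (leq_trans _ nn2)// leqW// leqnSn.
have r2 : r <= r ^+ 2 by rewrite expr2 ler_pMr.
have rn : r < n%:R by lra.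
have X0 : 0 < r ^+ 2 by rewrite exprn_gt0.
have Xn : 0 < r ^+ 2 < n%:R by rewrite X0/=; lra.
have py : 0 < 1 - y / n%:R < 1.
  by rewrite subr_gt0 ltr_pdivrMr// mul1r gtrBl divr_gt0// andbT; lra.
have pr : 0 < 1 - r / n%:R < 1.
  by rewrite subr_gt0 ltr_pdivrMr// mul1r gtrBl divr_gt0// rn.
have [bU bV] := buc_statUV n py; have [_ bVr] := buc_statUV n pr.
have bf := buc_linst n n (lipcs_unif_cont (lipcs_pvK y0 r0)).
have bc := buc_linst n n (unif_cont_cauchyK X0).
pose U s := statU n (1 - y / n%:R) s; pose V s := statV n (1 - y / n%:R) s.
pose Vr s := statV n (1 - r / n%:R) s; pose F s := linst n (pvK y r) s.
pose Q s := linst n (cauchyK (r ^+ 2)) s.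
have U0 s : 0 <= U s.
  rewrite /U /statU mulr_ge0 ?invr_ge0 ?mulr_ge0 ?(ltW n0')//; apply: sumr_ge0 => t _.
  rewrite /poissonK; apply: divr_ge0; first by case/andP: py; nra.
  by apply: le_trans (poisson_den_ge _ _); [exact: sqr_ge0|case/andP: py => /ltW].
have VF s : in_circ s -> `|V s - F s| <= (q + 326 / r ^+ 2) * Q s + `|Vr s|.
  move=> sc; rewrite (_ : V s - F s = (V s - Vr s - F s) + Vr s); last by ring.
  apply: le_trans (ler_normD _ _) _; rewrite lerD2r /V /Vr /statV -mulrBr -sumrB mulr_sumr.
  rewrite /F /Q /linst -sumrB mulr_sumr; apply: le_trans (ler_norm_sum _ _ _) _.
  rewrite big_seq [leRHS]big_seq; apply: ler_sum => t ts; apply: Hn1 => //.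
  have := sc t ts; rewrite /circ_dom/= in_itv/= ler_norml => /andP[/ltW -> ->].
  by [].
have bmin : buc n (fun s => Num.min 1 (U s)).
  apply: (buc_comp (h := fun z => Num.min 1 z)) => // z.
  by apply: (@continuous_min _ _ (fun=> 1) (fun y : R => y)); [exact: cst_continuous|exact: cvg_id].
have babs : buc n (fun s => `|Vr s|).
  by apply: (buc_comp (h := fun z : R => `|z|)) => //; exact: norm_continuous.
have ccont p : 0 < p -> continuous (fun v => cauchyK p (v - b)).
  move=> p0; have := unif_cont_continuous (unif_cont_cauchyK p0) => c z.
  apply: (@continuous_comp _ _ _ (fun v => v - b) (cauchyK p)); last exact: c.
  by apply: continuousB; [exact: cvg_id|exact: cst_continuous].
have bF : buc n (fun s => cauchyK a (F s - b)) by exact: (buc_comp (ccont a a0)).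
have bR : buc n (fun s => cauchyK (a + U s) (V s - b)).
  exact: buc_resolvent.
rewrite -(cbeE_resolvent beta0 b n0 py a0).
rewrite -[X in _ - X]/(cbeE beta n (fun s => cauchyK (a + U s) (V s - b))).
rewrite distrC -cbeE_sub//.
have brhs : buc n (fun s => Ca * (Num.min 1 (U s) + ((q + 326 / r ^+ 2) * Q s + `|Vr s|))).
  apply: buc_scale; apply: buc_add => //; apply: buc_add => //; exact: buc_scale.
apply: le_trans (cbeE_norm_le beta0 (buc_sub bR bF) brhs _) _.
  move=> s _ sc; apply: le_trans (cauchyK_diff b _ _ a0 (U0 s)) _.
  by apply: ler_wpM2l; rewrite ?(ltW Ca0)// lerD2l VF.
rewrite cbeE_scale ?cbeE_add ?cbeE_scale//; last 3 first.
- by apply: buc_scale.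
- by apply: buc_add => //; exact: buc_scale.
- by apply: buc_add => //; apply: buc_add => //; exact: buc_scale.
rewrite -mulrA; apply: ler_wpM2l; first exact: ltW.
have h1 := cbeE_min_statU_le beta0 n1' (introT andP (conj y0 y1)).
have h2 := cbeE_cauchyK_le beta0 Xn.
have h3 := cbeE_statV_norm_le beta0 n0 r1 rn.
rewrite -/q -/v in h1 h3 *.
rewrite -[cbeE beta n (fun s => Num.min _ _)]/(cbeE beta n (fun s => Num.min 1 (U s))) in h1.
have h4 : (q + 326 / r ^+ 2) * cbeE beta n Q <= 327 * q.
  have q3 : 0 < q + 326 / r ^+ 2.
    by apply: addr_gt0; [exact: q0|apply: divr_gt0; [rewrite ltr0n|exact: X0]].
  apply: le_trans (ler_wpM2l (ltW q3) h2) _; lra.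
have := mulr_ge0 E0 (ltW v0); have := mulr_ge0 E0 (ltW q0).
move: h1 h3 h4; rewrite -/(U _) -/(Vr _); lra.
Qed.

End FiniteResolvent.

(** * Passage to the limit of Laplace functionals *)

Section PolynomialApproximation.
Context {R : realType}.
Implicit Types (F G : R -> R -> R) (u v h : R).

Definition polyfun F : Prop := exists s : seq (R * (nat * nat)),
  forall u v, F u v = \sum_(x <- s) x.1 * (u ^+ x.2.1 * v ^+ x.2.2).

Lemma polyfun_cst (c : R) : polyfun (fun _ _ => c).
Proof. by exists [:: (c, (0%N, 0%N))] => u v; rewrite big_seq1 !expr0 !mulr1. Qed.

Lemma polyfun_add F G : polyfun F -> polyfun G -> polyfun (fun u v => F u v + G u v).
Proof. by move=> [s Hs] [s' Hs']; exists (s ++ s') => u v; rewrite big_cat Hs Hs'. Qed.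

Lemma polyfun_opp F : polyfun F -> polyfun (fun u v => - F u v).
Proof.
move=> [s Hs]; exists [seq (- x.1, x.2) | x <- s] => u v.
by rewrite Hs big_map -sumrN; apply: eq_bigr => x _; rewrite /= mulNr.
Qed.

Lemma polyfun_mulX F : polyfun F -> polyfun (fun u v => u * F u v).
Proof.
move=> [s Hs]; exists [seq (x.1, (x.2.1.+1, x.2.2)) | x <- s] => u v.
by rewrite Hs big_map mulr_sumr; apply: eq_bigr => x _; rewrite /= exprS; ring.
Qed.

Lemma polyfun_mulY F : polyfun F -> polyfun (fun u v => v * F u v).
Proof.
move=> [s Hs]; exists [seq (x.1, (x.2.1, x.2.2.+1)) | x <- s] => u v.
by rewrite Hs big_map mulr_sumr; apply: eq_bigr => x _; rewrite /= exprS; ring.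
Qed.

(* Expected value of [G] at the position reached from [(c1, c2)] after [m] steps of a walk
   whose coordinates independently advance by [h] with probabilities [u] and [v]:
   for [h = m^-1] and [c1 = c2 = 0] this is the bivariate Bernstein polynomial. *)
Fixpoint coin h G u v (m : nat) (c1 c2 : R) : R :=
  match m with
  | 0 => G c1 c2
  | m.+1 => u * (v * coin h G u v m (c1 + h) (c2 + h) + (1 - v) * coin h G u v m (c1 + h) c2) +
            (1 - u) * (v * coin h G u v m c1 (c2 + h) + (1 - v) * coin h G u v m c1 c2)
  end.

Lemma polyfun_coin h G m c1 c2 : polyfun (fun u v => coin h G u v m c1 c2).
Proof.
elim: m c1 c2 => [|m IH] c1 c2 /=; first exact: polyfun_cst.
have mY F F' : polyfun F -> polyfun F' -> polyfun (fun u v => v * F u v + (1 - v) * F' u v).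
  move=> pF pF'; have := polyfun_add (polyfun_mulY pF) (polyfun_add pF' (polyfun_opp (polyfun_mulY pF'))).
  by congr polyfun; apply/funext => u; apply/funext => v; ring.
have mX F F' : polyfun F -> polyfun F' -> polyfun (fun u v => u * F u v + (1 - u) * F' u v).
  move=> pF pF'; have := polyfun_add (polyfun_mulX pF) (polyfun_add pF' (polyfun_opp (polyfun_mulX pF'))).
  by congr polyfun; apply/funext => u; apply/funext => v; ring.
exact: (mX _ _ (mY _ _ (IH _ _) (IH _ _)) (mY _ _ (IH _ _) (IH _ _))).
Qed.

Lemma coin_le h F G m c1 c2 u v : 0 <= u <= 1 -> 0 <= v <= 1 -> (forall x y, F x y <= G x y) ->
  coin h F u v m c1 c2 <= coin h G u v m c1 c2.
Proof.
move=> /andP[u0 u1] /andP[v0 v1] FG; elim: m c1 c2 => [|m IH] c1 c2 //=.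
have v1' : 0 <= 1 - v by rewrite subr_ge0.
have u1' : 0 <= 1 - u by rewrite subr_ge0.
apply: lerD; apply: ler_wpM2l => //; apply: lerD; exact: ler_wpM2l.
Qed.

(** Mean and variance of the walk in closed form: the last summand is the sum of the two binomial
    variances. *)
Lemma coin_quad h (A B a b : R) m c1 c2 u v :
  coin h (fun x y => A + B * ((x - a) ^+ 2 + (y - b) ^+ 2)) u v m c1 c2 =
  A + B * ((c1 + m%:R * h * u - a) ^+ 2 + (c2 + m%:R * h * v - b) ^+ 2
    + m%:R * h ^+ 2 * (u * (1 - u) + v * (1 - v))).
Proof.
elim: m c1 c2 => [|m IH] c1 c2; first by rewrite /= !mul0r !addr0.
by rewrite /= !IH -natr1; move: (m%:R : R) => k; ring.
Qed.

(** The Bernstein proof with Chebyshev's inequality: G deviates from its value at (u, v) by at most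
    L d plus L/(2d) times the squared distance, and the positive operator [coin] maps the latter to
    a variance of order 1/m. Here d makes the first part at most e/2, then m the second. *)
Lemma polyfun_dense (L e : R) G : 0 <= L -> 0 < e ->
  (forall x y x' y', `|G x y - G x' y'| <= L * (`|x - x'| + `|y - y'|)) ->
  exists2 F, polyfun F & forall u v, 0 <= u <= 1 -> 0 <= v <= 1 -> `|F u v - G u v| <= e.
Proof.
move=> L0 e0 GL.
have Lp : 0 < L + 1 by rewrite ltr_wpDl.
pose d := e / (2 * (L + 1)).
have d0 : 0 < d by rewrite divr_gt0// mulr_gt0.
have dL : L * d <= e / 2.
  rewrite /d mulrA ler_pdivrMr ?mulr_gt0// (_ : e / 2 * (2 * (L + 1)) = (L + 1) * e); last by field.
  by nra.
pose m := (Num.bound (L / d / e)).+1.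
have m0 : (0 : R) < m%:R by rewrite ltr0n.
have mb : L / d / e <= m%:R.
  apply: ltW; apply: lt_le_trans (archi_boundP _) _; first exact: divr_ge0 (divr_ge0 L0 (ltW d0)) (ltW e0).
  by rewrite ler_nat.
exists (fun u v => coin m%:R^-1 G u v m 0 0) => [|u v u01 v01]; first exact: polyfun_coin.
pose Q x y := (x - u) ^+ 2 + (y - v) ^+ 2 : R.
have GQ x y : `|G x y - G u v| <= L * d + L / d / 2 * Q x y.
  apply: le_trans (GL _ _ _ _) _; rewrite (_ : _ + _ = L * (d + d^-1 / 2 * Q x y)); last by ring.
  apply: ler_wpM2l => //; rewrite /Q -(real_normK (num_real (x - u))) -(real_normK (num_real (y - v))).
  move: `|x - u| `|y - v| => s t.
  have di : d * d^-1 = 1 by rewrite divff// gt_eqF.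
  have dip : 0 < d^-1 by rewrite invr_gt0.
  have H z : z <= d / 2 + d^-1 / 2 * z ^+ 2.
    rewrite -subr_ge0 (_ : _ - z = d^-1 / 2 * (z - d) ^+ 2); first by rewrite mulr_ge0 ?sqr_ge0// divr_ge0// ltW.
    rewrite (_ : d^-1 / 2 * (z - d) ^+ 2 = d^-1 / 2 * z ^+ 2 - (d * d^-1) * z + (d * d^-1) * (d / 2)); last by field; rewrite gt_eqF.
    by rewrite di; ring.
  have := H s; have := H t; rewrite mulrDr; lra.
have quad : m%:R * m%:R^-1 ^+ 2 * (u * (1 - u) + v * (1 - v)) <= m%:R^-1.
  rewrite (_ : m%:R * m%:R^-1 ^+ 2 = m%:R^-1); last by field; rewrite gt_eqF.
  have mi : 0 < m%:R^-1 :> R by rewrite invr_gt0.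
  rewrite ler_piMr ?(ltW mi)//; have := sqr_ge0 (2 * u - 1); have := sqr_ge0 (2 * v - 1); lra.
have coinQ c : coin m%:R^-1 (fun x y => G u v + c * (L * d) + c * (L / d / 2) * ((x - u) ^+ 2 + (y - v) ^+ 2)) u v m 0 0 =
   G u v + c * (L * d) + c * (L / d / 2) * (m%:R * m%:R^-1 ^+ 2 * (u * (1 - u) + v * (1 - v))).
  rewrite coin_quad mulfV ?gt_eqF// !mul1r !add0r !subrr !expr0n/= !add0r.
  by [].
have K0 : 0 <= L / d / 2 by apply: divr_ge0 => //; exact: divr_ge0 L0 (ltW d0).
have bnd : L / d / 2 * (m%:R * m%:R^-1 ^+ 2 * (u * (1 - u) + v * (1 - v))) <= e / 2.
  apply: le_trans (ler_wpM2l K0 quad) _.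
  have : L / d <= e * m%:R by rewrite -ler_pdivrMl// mulrC.
  have mi : 0 < m%:R^-1 :> R by rewrite invr_gt0.
  move=> h; have := ler_wpM2r (ltW mi) h; rewrite mulfK ?gt_eqF//; lra.
rewrite ler_norml; apply/andP; split.
  have : coin m%:R^-1 (fun x y => G u v + (-1) * (L * d) + (-1) * (L / d / 2) * ((x - u) ^+ 2 + (y - v) ^+ 2)) u v m 0 0
     <= coin m%:R^-1 G u v m 0 0.
    apply: coin_le => // x y; have := GQ x y; rewrite ler_norml /Q => /andP[h _]; lra.
  rewrite coinQ; lra.
have : coin m%:R^-1 G u v m 0 0 <= coin m%:R^-1 (fun x y => G u v + 1 * (L * d) + 1 * (L / d / 2) * ((x - u) ^+ 2 + (y - v) ^+ 2)) u v m 0 0.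
  apply: coin_le => // x y; have := GQ x y; rewrite ler_norml /Q => /andP[_ h]; lra.
rewrite coinQ; lra.
Qed.

Lemma ln_max_lip (c a b : R) : 0 < c -> `|ln (Num.max a c) - ln (Num.max b c)| <= c^-1 * `|a - b|.
Proof.
move=> c0.
have H x y : c <= x -> x <= y -> ln y - ln x <= c^-1 * (y - x).
  move=> cx xy; have x0 : 0 < x by lra. have y0 : 0 < y by lra.
  rewrite -ln_div ?posrE//; have -> : y / x = 1 + (y - x) / x by field; rewrite gt_eqF.
  apply: le_trans (le_ln1Dx _) _.
    by apply: (@lt_le_trans _ _ 0) => //; rewrite divr_ge0 ?subr_ge0// ltW.
  by rewrite mulrC ler_wpM2r ?subr_ge0// lef_pV2.
have H2 x y : c <= x -> c <= y -> `|ln x - ln y| <= c^-1 * `|x - y|.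
  move=> cx cy; wlog xy : x y cx cy / x <= y => [hw|].
    by have [xy|/ltW yx] := leP x y; [exact: hw|rewrite distrC [`|x - y|]distrC; exact: hw].
  have x0 : 0 < x by lra.
  rewrite distrC [`|x - y|]distrC !ger0_norm ?subr_ge0 ?ler_ln ?posrE//; first exact: H.
  exact: lt_le_trans xy.
apply: le_trans (H2 _ _ _ _) _; rewrite ?le_max ?lexx ?orbT//.
apply: ler_wpM2l; first by rewrite invr_ge0 ltW.
by rewrite !(maxC _ c); exact: max_lip.
Qed.

End PolynomialApproximation.

Section BoundedExpectation.
Context {R : realType} {d : measure_display} {Omega : measurableType d} (P : probability Omega R).
Implicit Types (g h : Omega -> R).

Definition bm g : Prop := measurable_fun setT g /\ exists M : R, forall w, `|g w| <= M.

Definition EP g : R := (\int[P]_w g w)%R.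

Lemma bm_integrable g : bm g -> P.-integrable setT (EFin \o g).
Proof.
move=> [mg [M gM]]; apply: measurable_bounded_integrable => //.
  by apply: le_lt_trans (probability_le1 P measurableT) _; rewrite ltry.
exists M; split; first exact: num_real.
by move=> x Mx w _; apply: le_trans (gM w) (ltW Mx).
Qed.

Lemma bm_cst (c : R) : bm (fun=> c).
Proof. by split; [exact: measurable_cst|exists `|c|]. Qed.

Lemma bm_add g h : bm g -> bm h -> bm (fun w => g w + h w).
Proof.
move=> [mg [M gM]] [mh [M' hM]]; split; first exact: measurable_funD.
by exists (M + M') => w; rewrite (le_trans (ler_normD _ _))// lerD.
Qed.

Lemma bm_mul g h : bm g -> bm h -> bm (fun w => g w * h w).
Proof.
move=> [mg [M gM]] [mh [M' hM]]; split; first exact: measurable_funM.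
by exists (M * M') => w; rewrite normrM ler_pM.
Qed.

Lemma bm_scale (c : R) g : bm g -> bm (fun w => c * g w).
Proof. by move=> bg; apply: bm_mul => //; exact: bm_cst. Qed.

Lemma bm_sub g h : bm g -> bm h -> bm (fun w => g w - h w).
Proof.
move=> bg bh; have := bm_add bg (bm_scale (-1) bh).
by congr bm; apply/funext => w; rewrite mulN1r.
Qed.

Lemma bm_pow g k : bm g -> bm (fun w => g w ^+ k).
Proof.
move=> bg; elim: k => [|k IH]; first exact: bm_cst.
have := bm_mul bg IH; congr bm; apply/funext => w; by rewrite exprS.
Qed.

Lemma bm_sum (I : Type) (r : seq I) (G : I -> Omega -> R) :
  (forall i, bm (G i)) -> bm (fun w => \sum_(i <- r) G i w).
Proof.
move=> bG; elim: r => [|i r IH].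
  by have := bm_cst 0; congr bm; apply/funext => w; rewrite big_nil.
have := bm_add (bG i) IH; congr bm; apply/funext => w; by rewrite big_cons.
Qed.

Lemma EP_cst (c : R) : EP (fun=> c) = c.
Proof. by rewrite /EP Rintegral_cst// [X in fine X](_ : _ = 1%E) ?mulr1//; exact: probability_setT. Qed.

Lemma EP_add g h : bm g -> bm h -> EP (fun w => g w + h w) = EP g + EP h.
Proof. by move=> bg bh; rewrite /EP RintegralD//; exact: bm_integrable. Qed.

Lemma EP_sub g h : bm g -> bm h -> EP (fun w => g w - h w) = EP g - EP h.
Proof. by move=> bg bh; rewrite /EP RintegralB//; exact: bm_integrable. Qed.

Lemma EP_scale (c : R) g : bm g -> EP (fun w => c * g w) = c * EP g.
Proof. by move=> bg; rewrite /EP RintegralZl//; exact: bm_integrable. Qed.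

Lemma EP_sum (I : Type) (r : seq I) (G : I -> Omega -> R) : (forall i, bm (G i)) ->
  EP (fun w => \sum_(i <- r) G i w) = \sum_(i <- r) EP (G i).
Proof.
move=> bG; elim: r => [|i r IH].
  rewrite big_nil -[RHS](EP_cst 0); congr EP; apply/funext => w; by rewrite big_nil.
rewrite big_cons -IH -EP_add//; last exact: bm_sum.
by congr EP; apply/funext => w; rewrite big_cons.
Qed.

Lemma EP_le g h : bm g -> bm h -> (forall w, g w <= h w) -> EP g <= EP h.
Proof. by move=> bg bh gh; apply: le_Rintegral => //; exact: bm_integrable. Qed.

Lemma bm_norm g : bm g -> bm (fun w => `|g w|).
Proof.
move=> [mg [M gM]]; split; first exact: measurableT_comp.
by exists M => w; rewrite normr_id.
Qed.

Lemma EP_norm_le g h : bm g -> bm h -> (forall w, `|g w| <= h w) -> `|EP g| <= EP h.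
Proof.
move=> bg bh gh; apply: le_trans (EP_le (bm_norm bg) bh gh).
by apply: le_normr_Rintegral => //; exact: bm_integrable.
Qed.

Lemma eq_ae_EP g h : bm g -> bm h -> {ae P, forall w, g w = h w} -> EP g = EP h.
Proof.
move=> [mg _] [mh _] gh; rewrite /EP /Rintegral; congr fine.
apply: ae_eq_integral => //; [exact/measurable_EFinP|exact/measurable_EFinP|].
by apply: filterS gh => w /= -> _.
Qed.

End BoundedExpectation.

(** * Finiteness and monomial statistics of the limit process *)

Section LimitProcess.
Context {R : realType} {d : measure_display} {Omega : measurableType d} (P : probability Omega R).
Variables (beta : R) (lam : int -> Omega -> R).
Hypothesis (beta0 : 0 < beta) (HS : is_Sine_beta P beta lam).
Implicit Types (f g : R -> R) (w : Omega).

(** Extended-valued, since [is_Sine_beta] does not presuppose locally finite configurations; almost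
    sure finiteness is [NF_ae_fin]. *)
Definition NF f w : \bar R := (\esum_(k in [set: int]) (f (lam k w))%:E)%E.
Definition Nf f w : R := fine (NF f w).

Lemma NF_ge0 f w : (forall x, 0 <= f x) -> (0 <= NF f w)%E.
Proof. by move=> f0; apply: esum_ge0 => k _; rewrite lee_fin. Qed.

Lemma N_ge0 f w : (forall x, 0 <= f x) -> 0 <= Nf f w.
Proof. by move=> f0; apply: fine_ge0; exact: NF_ge0. Qed.

(** Reindexing turns the sum over all integers into a series, which gives measurability. *)
Lemma int_nat_bij : exists e : nat -> int, set_bij [set: nat] [set: int] e.
Proof.
have : ([set: int] #= [set: nat])%card.
  apply: eq_card_nat; first exact: countableP.
  move=> fi; apply: infinite_nat.
  apply: (@sub_finite_set _ _ (absz @` [set: int])); last exact: finite_image.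
  by move=> n _; exists n%:Z.
move=> /card_set_bijP[f [_ finj fsurj]].
have /choice[e fe] : forall n, exists i, f i = n by move=> n; have [i _ fi] := fsurj n I; exists i.
exists e; split => //; first by move=> m n _ _ emn; rewrite -(fe m) emn fe.
by move=> i _; exists (f i) => //; apply: finj; rewrite ?inE.
Qed.

Lemma measurable_NF f : measurable_fun setT f -> (forall x, 0 <= f x) -> measurable_fun setT (NF f).
Proof.
move=> mf f0; have [e be] := int_nat_bij.
have -> : NF f = (fun w => \sum_(0 <= n <oo | n \in predT) (f (lam (e n) w))%:E)%E.
  apply/funext => w; rewrite /NF (reindex_esum _ _ _ _ be) -nneseries_esumT => [|n]; last by rewrite lee_fin.
  by apply: eq_eseriesl.
apply: ge0_emeasurable_sum => [n w _ _|n _]; first by rewrite lee_fin.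
by apply/measurable_EFinP; apply: measurableT_comp => //; exact: HS.1.
Qed.

Lemma lipcs_measurable f : lipcs f -> measurable_fun setT f.
Proof. by move=> /lipcs_unif_cont/unif_cont_continuous cf; exact: continuous_measurable_fun. Qed.

Lemma measurable_N f : measurable_fun setT f -> (forall x, 0 <= f x) -> measurable_fun setT (Nf f).
Proof.
move=> mf f0; apply: measurableT_comp (measurable_NF mf f0).
exact: fine_measurable.
Qed.

Definition lapf f w : R := fine (expeR (- NF f w))%E.

Lemma lapfE f w : (forall x, 0 <= f x) -> expeR (- NF f w)%E = (lapf f w)%:E.
Proof. by move=> f0; rewrite /lapf; have := NF_ge0 w f0; case: (NF f w). Qed.

Lemma lapf_fin f w : (forall x, 0 <= f x) -> (NF f w < +oo)%E -> lapf f w = expR (- Nf f w).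
Proof. by move=> f0; rewrite /lapf /Nf; have := NF_ge0 w f0; case: (NF f w). Qed.

Lemma lapf_ge0_le1 f w : (forall x, 0 <= f x) -> 0 <= lapf f w <= 1.
Proof.
move=> f0; rewrite /lapf; have := NF_ge0 w f0; case: (NF f w) => [r| |]//=.
  by rewrite lee_fin => r0; rewrite expR_ge0 -[leRHS]expR0 ler_expR oppr_le0.
by rewrite lexx ler01.
Qed.

Lemma bm_lapf f : measurable_fun setT f -> (forall x, 0 <= f x) -> bm (lapf f).
Proof.
move=> mf f0; split; last first.
  by exists 1 => w; have /andP[l0 l1] := lapf_ge0_le1 w f0; rewrite ger0_norm.
(* [fine] sends +oo to 0, so [expR (- Nf f w)] equals 1 where [lapf] vanishes; the indicator of the
   complement repairs this. *)
pose A := [set w | NF f w = +oo%E].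
have mA : measurable A.
  by rewrite /A (_ : [set w | _] = setT `&` NF f @^-1` [set +oo%E]); [exact: measurable_NF|rewrite setTI].
have -> : lapf f = (fun w => expR (- Nf f w) * \1_(~` A) w).
  apply/funext => w; rewrite indicE.
  have [wA|wA] := pselect (A w).
    rewrite memNset; last by move=> /(_ wA).
    by rewrite mulr0 /lapf wA.
  rewrite mem_set// mulr1 lapf_fin// ltey; exact/eqP.
apply: measurable_funM; last by apply: measurable_indic; exact: measurableC.
apply: measurableT_comp; first exact: measurable_expR.
by apply: measurableT_comp; [exact: oppr_measurable|exact: measurable_N].
Qed.

Lemma cbeE_laplace_cvg f : lipcs f -> (forall x, 0 <= f x) ->
  (fun n => cbeE beta n (fun s => expR (- linst n f s))) @ \oo --> EP P (lapf f).
Proof.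
move=> lf f0; have uf := lipcs_unif_cont lf.
have bf := bm_lapf (lipcs_measurable lf) f0.
have := HS.2 f (lipcs_Cc_plus lf f0).
have -> : (\int[P]_w expeR (- \esum_(k in [set: int]) (f (lam k w))%:E) = (EP P (lapf f))%:E)%E.
  rewrite /EP /Rintegral fineK; last by apply: integrable_fin_num => //; exact: bm_integrable.
  by apply: eq_integral => w _; rewrite -lapfE.
move=> /fine_cvg; apply: cvg_trans; apply: near_eq_cvg; apply: nearW => n /=.
by rewrite (cbe_laplaceE beta0 n uf).
Qed.

Lemma cbeE_linst_bounded f : lipcs f -> (forall x, 0 <= f x) ->
  exists2 C : R, 0 <= C & exists n0, forall n, (n0 <= n)%N -> cbeE beta n (linst n f) <= C.
Proof.
move=> lf f0; have [[B fB] _] := lipcs_unif_cont lf.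
have [_ [M M0 fM]] := lf; pose X := M + 1; have X0 : 0 < X by rewrite /X; lra.
have B0 : 0 <= B by apply: le_trans (fB 0).
exists (B * (2 * X)); first by rewrite mulr_ge0// mulr_ge0// ltW.
exists (Num.bound X).+1 => n nn.
have Xn : 0 < X < n%:R.
  rewrite X0/=; apply: lt_le_trans (archi_boundP (ltW X0)) _.
  by rewrite ler_nat (leq_trans (leqnSn _)).
have bc := buc_linst n n (unif_cont_cauchyK X0).
apply: (@le_trans _ _ (cbeE beta n (fun s => B * (2 * X) * linst n (cauchyK X) s))).
  apply: (cbeE_le beta0); [exact: buc_linst (lipcs_unif_cont lf)|exact: buc_scale|].
  move=> s _ _; rewrite /linst mulr_sumr; apply: ler_sum => t _.
  move: (n%:R * t) => x; have [Mx|xM] := ltP M `|x|.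
    rewrite fM// mulr_ge0 ?cauchyK_ge0 ?(ltW X0)// mulr_ge0// mulr_ge0// ltW//.
  apply: le_trans (le_trans (ler_norm _) (fB x)) _.
  rewrite -mulrA ler_peMr// /cauchyK mulrA.
  have x2 : x ^+ 2 <= X ^+ 2.
    rewrite -(real_normK (num_real x)); apply: lerXn2r; rewrite ?nnegrE ?(ltW X0)//.
    by rewrite /X; lra.
  rewrite ler_pdivlMr ?ltr_wpDr ?sqr_ge0 ?exprn_gt0// mul1r; lra.
rewrite cbeE_scale//; have := cbeE_cauchyK_le beta0 Xn => h.
by rewrite -[leRHS]mulr1 ler_wpM2l// mulr_ge0// mulr_ge0// ltW.
Qed.

Lemma linstZ n (c : R) f s : linst n (fun x => c * f x) s = c * linst n f s.
Proof. by rewrite /linst mulr_sumr. Qed.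

Lemma linstD n f g s : linst n (fun x => f x + g x) s = linst n f s + linst n g s.
Proof. by rewrite /linst big_split. Qed.

Lemma lipcs_scale (c : R) f : lipcs f -> lipcs (fun x => c * f x).
Proof.
move=> lf; have := lipcs_lin c 0 lf lf; congr lipcs.
by apply/funext => x; rewrite mul0r addr0.
Qed.

Lemma bucexp n m f : lipcs f -> buc n (fun s => expR (- linst m f s)).
Proof.
move=> lf; apply: (buc_comp (h := fun z => expR (- z))).
  move=> z; apply: (@continuous_comp _ _ _ (fun z => - z) expR); first exact: opp_continuous.
  exact: continuous_expR.
exact: buc_linst (lipcs_unif_cont lf).
Qed.

(** From 1 - e^{-sN} <= s N at finite n. This replaces a first moment bound in the limit, where only
    Laplace functionals are known; a single C serves the finite ensembles and the limit. *)
Lemma one_sub_lapf_le f : lipcs f -> (forall x, 0 <= f x) ->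
  exists2 C : R, 0 <= C & (exists n0, forall n, (n0 <= n)%N -> cbeE beta n (linst n f) <= C) /\
   forall s : R, 0 < s -> EP P (fun w => 1 - lapf (fun x => s * f x) w) <= s * C.
Proof.
move=> lf f0; have [C C0 [n0 Hn0]] := cbeE_linst_bounded lf f0; exists C => //.
split; first by exists n0.
move=> c c0; have lcf := lipcs_scale c lf.
have cf0 x : 0 <= c * f x by rewrite mulr_ge0// ltW.
have bl := bm_lapf (lipcs_measurable lcf) cf0.
rewrite EP_sub ?EP_cst//; last exact: bm_cst.
rewrite lerBlDl -lerBlDr.
have h := cbeE_laplace_cvg lcf cf0.
rewrite -(cvg_lim _ h)//; apply: limr_ge; first exact: (cvgP _ h).
exists n0 => // n /= nn.
have bL := buc_linst n n (lipcs_unif_cont lf).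
apply: (@le_trans _ _ (cbeE beta n (fun s => 1 - c * linst n f s))).
  rewrite cbeE_sub ?cbeE_cst ?cbeE_scale//; [|exact: buc_cst|exact: buc_scale].
  apply: lerB => //; apply: ler_wpM2l; [exact: ltW|exact: Hn0].
apply: (cbeE_le beta0); [by apply: buc_sub; [exact: buc_cst|exact: buc_scale]|exact: bucexp|].
by move=> s _ _; rewrite linstZ; have := expR_ge1Dx (- (c * linst n f s)); lra.
Qed.

Lemma NF_natM f k w : (forall x, 0 <= f x) -> NF (fun x => k%:R * f x) w = (k%:R%:E * NF f w)%E.
Proof.
move=> f0; elim: k => [|k IH].
  by rewrite mul0e; apply: esum1 => i _; rewrite mul0r.
rewrite /NF (eq_esum (b := fun i => (k%:R * f (lam i w))%:E + (f (lam i w))%:E)%E); last first.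
  by move=> i _; rewrite -EFinD -natr1 mulrDl mul1r.
rewrite esumD => [|i _|i _]; [|by rewrite lee_fin mulr_ge0|by rewrite lee_fin].
rewrite -[X in (X + _)%E]/(NF (fun x => k%:R * f x) w) -/(NF f w) IH -natr1 EFinD.
by rewrite ge0_muleDl ?lee_fin// mul1e.
Qed.

Lemma NF_add f g w : (forall x, 0 <= f x) -> (forall x, 0 <= g x) ->
  NF (fun x => f x + g x) w = (NF f w + NF g w)%E.
Proof.
move=> f0 g0; rewrite /NF -esumD => [|i _|i _]; rewrite ?lee_fin//.
Qed.

(** Where the sum is infinite, the Laplace functional of s f vanishes for every s > 0, so that event
    has probability at most s C; let s = 1/(j + 1) tend to 0. *)
Lemma NF_ae_fin f : lipcs f -> (forall x, 0 <= f x) -> {ae P, forall w, (NF f w < +oo)%E}.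
Proof.
move=> lf f0; have [C C0 [_ HC]] := one_sub_lapf_le lf f0.
pose A := [set w | NF f w = +oo%E].
have mA : measurable A.
  rewrite /A (_ : [set w | _] = setT `&` NF f @^-1` [set +oo%E]); last by rewrite setTI.
  by apply: measurable_NF => //; exact: lipcs_measurable.
have PA : P A = 0%E.
  apply/eqP; rewrite eq_le measure_ge0 andbT.
  rewrite -(@setIT _ A) -integral_indic// -[X in (X <= _)%E]fineK; last first.
    by rewrite integral_indic// setIT fin_num_measure.
  rewrite lee_fin; apply/ler_addgt0Pr => e e0; rewrite add0r.
  have [j Hj] : exists j : nat, j.+1%:R^-1 * C <= e.
    exists (Num.bound (C / e)); rewrite ler_pdivrMl ?ltr0n// -ler_pdivrMr//.
    apply: ltW; apply: lt_le_trans (archi_boundP _) _; first by rewrite divr_ge0// ltW.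
    by rewrite ler_nat.
  have j0 : 0 < j.+1%:R^-1 :> R by rewrite invr_gt0 ltr0n.
  apply: le_trans Hj; apply: le_trans (HC _ j0).
  have lcf := lipcs_scale j.+1%:R^-1 lf.
  have cf0 x : 0 <= j.+1%:R^-1 * f x by rewrite mulr_ge0// ltW.
  have b1 : bm (\1_A : Omega -> R).
    split; first exact: measurable_indic.
    by exists 1 => w; rewrite indicE; case: (_ \in _); rewrite ?normr1 ?normr0.
  rewrite -[leLHS]/(EP P (\1_A : Omega -> R)); apply: (EP_le P b1).
    by apply: bm_sub; [exact: bm_cst|apply: bm_lapf => //; exact: lipcs_measurable].
  move=> w; have /andP[l0 l1] := lapf_ge0_le1 w cf0; rewrite indicE.
  case: (boolP (w \in A)) => [/set_mem wA|_]/=; last by rewrite subr_ge0.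
  suff -> : lapf (fun x => j.+1%:R^-1 * f x) w = 0 by rewrite subr0.
  have := NF_natM j.+1 w cf0.
  have -> : (fun x => j.+1%:R * (j.+1%:R^-1 * f x)) = f.
    by apply/funext => x; rewrite mulrA divff ?mul1r// pnatr_eq0.
  rewrite wA /lapf; have := NF_ge0 w cf0.
  by case: (NF _ w) => [r| |]//= _ /eqP.
exists A; split => // w /=; rewrite ltey => /negP; rewrite negbK => /eqP; exact.
Qed.

Lemma bm_expN f (k : nat) : lipcs f -> (forall x, 0 <= f x) -> bm (fun w => expR (- Nf f w) ^+ k).
Proof.
move=> lf f0; apply: bm_pow; split; last first.
  exists 1 => w; rewrite ger0_norm ?expR_ge0// -[leRHS]expR0 ler_expR oppr_le0.
  exact: N_ge0.
apply: measurableT_comp; first exact: measurable_expR.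
by apply: measurableT_comp; [exact: oppr_measurable|apply: measurable_N => //; exact: lipcs_measurable].
Qed.

(** A monomial in e^{-N(f)} and e^{-N(g)} is the Laplace functional of p f + q g. In the limit this
    identity holds only almost surely, where both sums are finite. *)
Lemma cbeE_mono_cvg f g (p q : nat) : lipcs f -> lipcs g -> (forall x, 0 <= f x) -> (forall x, 0 <= g x) ->
  (fun n => cbeE beta n (fun s => expR (- linst n f s) ^+ p * expR (- linst n g s) ^+ q)) @ \oo -->
  EP P (fun w => expR (- Nf f w) ^+ p * expR (- Nf g w) ^+ q).
Proof.
move=> lf lg f0 g0.
have lh := lipcs_lin p%:R q%:R lf lg.
have h0 x : 0 <= p%:R * f x + q%:R * g x by rewrite addr_ge0 ?mulr_ge0.
have e1 : EP P (fun w => expR (- Nf f w) ^+ p * expR (- Nf g w) ^+ q) = EP P (lapf (fun x => p%:R * f x + q%:R * g x)).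
  apply: eq_ae_EP; [by apply: bm_mul; exact: bm_expN|by apply: bm_lapf => //; exact: lipcs_measurable|].
  apply: filterS2 (NF_ae_fin lf f0) (NF_ae_fin lg g0) => w wf wg.
  have pf0 x : 0 <= p%:R * f x by rewrite mulr_ge0.
  have qg0 x : 0 <= q%:R * g x by rewrite mulr_ge0.
  have e : NF (fun x => p%:R * f x + q%:R * g x) w = (p%:R * Nf f w + q%:R * Nf g w)%:E.
    rewrite NF_add// !NF_natM// EFinD !EFinM /Nf !fineK//.
      by rewrite ge0_fin_numE// NF_ge0.
    by rewrite ge0_fin_numE// NF_ge0.
  by rewrite /lapf e/= opprD expRD -!mulrN !expRM_natl.
rewrite e1; apply: cvg_trans (cbeE_laplace_cvg lh h0); apply: near_eq_cvg; apply: nearW => n /=.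
congr cbeE; apply/funext => s.
by rewrite linstD !linstZ opprD expRD -!mulrN !expRM_natl.
Qed.

End LimitProcess.

(** * Convergence in law of differences of linear statistics *)

Section Transfer.
Context {R : realType} {d : measure_display} {Omega : measurableType d} (P : probability Omega R).
Variables (beta : R) (lam : int -> Omega -> R).
Hypothesis (beta0 : 0 < beta) (HS : is_Sine_beta P beta lam).
Implicit Types (f g : R -> R) (w : Omega).
Let N := Nf lam.

Lemma lip_continuous (h : R -> R) (L : R) : (forall x y : R, `|h x - h y| <= L * `|x - y|) -> continuous h.
Proof.
move=> hL x; apply/cvgrPdist_le => e e0.
have L1 : 0 < `|L| + 1 by rewrite ltr_wpDl.
near=> y; apply: le_trans (hL _ _) _.
apply: (@le_trans _ _ ((`|L| + 1) * `|x - y|)).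
  by apply: ler_wpM2r => //; apply: le_trans (ler_norm _) _; rewrite lerDl.
rewrite -ler_pdivlMl// ltW//; near: y.
apply/nbhs_ballP; exists ((`|L| + 1)^-1 * e) => [/=|y //].
by rewrite mulr_gt0// invr_gt0.
Unshelve. all: by end_near. Qed.

Lemma one_sub_expR_le (z : R) : 1 - expR (- z) <= z.
Proof. by have := expR_ge1Dx (- z); lra. Qed.

Lemma buc_polyfun n f g F : lipcs f -> lipcs g -> polyfun F ->
  buc n (fun s => F (expR (- linst n f s)) (expR (- linst n g s))).
Proof.
move=> lf lg [t Ht]; apply: (@eq_buc _ n (fun s => \sum_(x <- t) x.1 * (expR (- linst n f s) ^+ x.2.1 * expR (- linst n g s) ^+ x.2.2))).
  by move=> s _; rewrite Ht.
apply: buc_sum => x _; apply: buc_scale; apply: buc_mul.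
  by apply: (buc_comp (h := fun z => z ^+ x.2.1)); [exact: exprn_continuous|exact: bucexp].
by apply: (buc_comp (h := fun z => z ^+ x.2.2)); [exact: exprn_continuous|exact: bucexp].
Qed.

Lemma bm_polyfun f g F : lipcs f -> lipcs g -> (forall x, 0 <= f x) -> (forall x, 0 <= g x) ->
  polyfun F -> bm (fun w => F (expR (- N f w)) (expR (- N g w))).
Proof.
move=> lf lg f0 g0 [t Ht].
have -> : (fun w => F (expR (- N f w)) (expR (- N g w))) =
   (fun w => \sum_(x <- t) x.1 * (expR (- N f w) ^+ x.2.1 * expR (- N g w) ^+ x.2.2)).
  by apply/funext => w; rewrite Ht.
by apply: bm_sum => x; apply: bm_scale; apply: bm_mul; apply: (bm_expN HS).
Qed.

Lemma cbeE_polyfun_cvg f g F : lipcs f -> lipcs g -> (forall x, 0 <= f x) -> (forall x, 0 <= g x) ->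
  polyfun F ->
  (fun n => cbeE beta n (fun s => F (expR (- linst n f s)) (expR (- linst n g s)))) @ \oo -->
  EP P (fun w => F (expR (- N f w)) (expR (- N g w))).
Proof.
move=> lf lg f0 g0 [t Ht].
pose m n (x : R * (nat * nat)) (s : seq R) := expR (- linst n f s) ^+ x.2.1 * expR (- linst n g s) ^+ x.2.2.
have bm1 n x : buc n (m n x).
  by apply: buc_mul; [apply: (buc_comp (h := fun z => z ^+ x.2.1))|apply: (buc_comp (h := fun z => z ^+ x.2.2))];
    (exact: exprn_continuous || exact: bucexp).
have -> : (fun w => F (expR (- N f w)) (expR (- N g w))) =
   (fun w => \sum_(x <- t) x.1 * (expR (- N f w) ^+ x.2.1 * expR (- N g w) ^+ x.2.2)).
  by apply/funext => w; rewrite Ht.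
have b2 (x : R * (nat * nat)) : bm (fun w => expR (- N f w) ^+ x.2.1 * expR (- N g w) ^+ x.2.2).
  by apply: bm_mul; apply: (bm_expN HS).
rewrite EP_sum; last by move=> x; exact: bm_scale.
have -> : (fun n => cbeE beta n (fun s => F (expR (- linst n f s)) (expR (- linst n g s)))) =
  (fun n => \sum_(x <- t) x.1 * cbeE beta n (m n x)).
  apply/funext => n; rewrite (_ : (fun s => _) = (fun s => \sum_(x <- t) x.1 * m n x s)); last first.
    by apply/funext => s; rewrite Ht.
  rewrite (cbeE_bigsum beta0); last by move=> x _; exact: buc_scale.
  by apply: eq_bigr => x _; rewrite cbeE_scale.
elim: t {Ht} => [|x t IH].
  rewrite big_nil (_ : (fun n => _) = fun=> 0); first exact: cvg_cst.
  by apply/funext => n; rewrite big_nil.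
rewrite big_cons (_ : (fun n => _) = fun n => x.1 * cbeE beta n (m n x) + \sum_(y <- t) y.1 * cbeE beta n (m n y)); last first.
  by apply/funext => n; rewrite big_cons.
apply: cvgD => //; rewrite EP_scale//; apply: cvgM; first exact: cvg_cst.
exact: (@cbeE_mono_cvg _ _ _ _ _ _ beta0 HS f g x.2.1 x.2.2 lf lg f0 g0).
Qed.

Section Truncation.
Variables (h : R -> R) (H L : R).
Hypotheses (hH : forall x, `|h x| <= H) (L0 : 0 <= L)
  (hL : forall x y : R, `|h x - h y| <= L * `|x - y|).

Let hc : continuous h. Proof. exact: lip_continuous hL. Qed.
Let H0 : 0 <= H. Proof. exact: le_trans (hH 0). Qed.

Lemma buc_hlinst n f g : lipcs f -> lipcs g -> buc n (fun s => h (linst n f s - linst n g s)).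
Proof.
move=> lf lg; apply: (buc_comp hc); apply: buc_sub; apply: buc_linst; exact: lipcs_unif_cont.
Qed.

Lemma bm_hN f g : lipcs f -> lipcs g -> (forall x, 0 <= f x) -> (forall x, 0 <= g x) ->
  bm (fun w => h (N f w - N g w)).
Proof.
move=> lf lg f0 g0; split; last by exists H.
apply: measurableT_comp; first exact: continuous_measurable_fun.
by apply: measurable_funB; apply: (measurable_N HS) => //; exact: lipcs_measurable.
Qed.

(** When A > K = k + 1, the quantity 1 - e^{-A/K} is at least 1/2, so it dominates half the
    indicator of that event; unlike the indicator, its mean is controlled by Laplace functionals. *)
Lemma trunc_err (k : nat) (A B : R) : 0 <= A -> 0 <= B ->
  `|h (A - B) - h (Num.min A k.+1%:R - Num.min B k.+1%:R)| <=
  4 * H * ((1 - expR (- (k.+1%:R^-1 * A))) + (1 - expR (- (k.+1%:R^-1 * B)))).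
Proof.
move=> A0 B0; set K : R := k.+1%:R.
have K0 : 0 < K by rewrite ltr0n.
have Ki : 0 < K^-1 by rewrite invr_gt0.
have e0 z : 0 <= z -> 0 <= 1 - expR (- (K^-1 * z)).
  by move=> z0; rewrite subr_ge0 -[leRHS]expR0 ler_expR oppr_le0 mulr_ge0// ltW.
have e1 z : K < z -> 2^-1 <= 1 - expR (- (K^-1 * z)).
  move=> Kz; have : expR (- (K^-1 * z)) <= 2^-1.
    rewrite expRN lef_pV2 ?posrE ?expR_gt0//; apply: le_trans (expR_ge1Dx _).
    by rewrite (_ : 2 = 1 + 1)// lerD2l mulrC ler_pdivlMr// mul1r ltW.
  lra.
have h2 x y : `|h x - h y| <= 2 * H.
  by apply: le_trans (ler_normB _ _) _; have := hH x; have := hH y; lra.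
have eA := e0 A A0; have eB := e0 B B0.
have [AK|KA] := leP A K; last first.
  apply: le_trans (h2 _ _) _; have := e1 A KA => eA'.
  apply: (@le_trans _ _ (4 * H * 2^-1)); first lra.
  by apply: ler_wpM2l; [rewrite mulr_ge0|lra].
have [BK|KB] := leP B K; last first.
  apply: le_trans (h2 _ _) _; have := e1 B KB => eB'.
  apply: (@le_trans _ _ (4 * H * 2^-1)); first lra.
  by apply: ler_wpM2l; [rewrite mulr_ge0|lra].
by rewrite subrr normr0; apply: mulr_ge0; [exact: mulr_ge0|exact: addr_ge0].
Qed.

Lemma ln_max_expR (k : nat) (A : R) : ln (Num.max (expR (- A)) (expR (- k.+1%:R))) = - Num.min A k.+1%:R.
Proof.
rewrite (_ : Num.max _ _ = expR (- Num.min A k.+1%:R)) ?expRK//.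
have [h1|h1] := leP A k.+1%:R.
  by apply/max_idPl; rewrite ler_expR lerN2.
by apply/max_idPr; rewrite ler_expR lerN2 ltW.
Qed.

(** In the variables u = e^{-A} and v = e^{-B}, truncation at K keeps the logarithms away from 0, so
    the truncated function is Lipschitz and [polyfun_dense] applies to it. *)
Lemma trunc_lip (k : nat) (u v u' v' : R) :
  `|h (ln (Num.max v (expR (- k.+1%:R))) - ln (Num.max u (expR (- k.+1%:R)))) -
    h (ln (Num.max v' (expR (- k.+1%:R))) - ln (Num.max u' (expR (- k.+1%:R))))| <=
  L * (expR (- k.+1%:R))^-1 * (`|u - u'| + `|v - v'|).
Proof.
apply: le_trans (hL _ _) _; rewrite -mulrA; apply: ler_wpM2l => //.
set c := expR _; have c0 : 0 < c by exact: expR_gt0.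
rewrite (_ : _ - _ - _ = (ln (Num.max v c) - ln (Num.max v' c)) - (ln (Num.max u c) - ln (Num.max u' c))); last by ring.
apply: le_trans (ler_normB _ _) _; rewrite mulrDr addrC; apply: lerD; exact: ln_max_lip.
Qed.

(** Laplace functionals take nonnegative functions only, so a signed statistic enters as a
    difference. The values are truncated at K, the truncated function is replaced by a polynomial in
    the two exponentials, and [cbeE_polyfun_cvg] applies; the truncation error is bounded alike at
    finite n and in the limit. *)
Lemma cbeE_transfer f g : lipcs f -> lipcs g -> (forall x, 0 <= f x) -> (forall x, 0 <= g x) ->
  (fun n => cbeE beta n (fun s => h (linst n f s - linst n g s))) @ \oo -->
  EP P (fun w => h (N f w - N g w)).
Proof.
move=> lf lg f0 g0; apply/cvgrPdist_le => e e0.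
have [C1 C10 [[n1 Hn1] HC1]] := one_sub_lapf_le beta0 HS lf f0.
have [C2 C20 [[n2 Hn2] HC2]] := one_sub_lapf_le beta0 HS lg g0.
(* This level brings the truncation error 4 H (C1 + C2) / K below e / 8. *)
pose k := Num.bound (4 * H * (C1 + C2) * 8 / e); set K : R := k.+1%:R.
have K0 : 0 < K by rewrite ltr0n.
have Ki : 0 < K^-1 by rewrite invr_gt0.
have HC0 : 0 <= 4 * H * (C1 + C2) by rewrite mulr_ge0 ?mulr_ge0 ?addr_ge0.
have Kb : 4 * H * (K^-1 * C1 + K^-1 * C2) <= e / 8.
  rewrite -mulrDr mulrCA ler_pdivrMl// -ler_pdivrMr ?divr_gt0// invf_div mulrA.
  apply: ltW; apply: lt_le_trans (archi_boundP _) _; last by rewrite ler_nat.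
  by rewrite divr_ge0 ?(ltW e0)// mulr_ge0.
pose c := expR (- K); pose G (u v : R) := h (ln (Num.max v c) - ln (Num.max u c)).
have LL0 : 0 <= L * c^-1 by rewrite mulr_ge0// invr_ge0 expR_ge0.
have e8 : 0 < e / 8 by rewrite divr_gt0.
have [F pF FG] := polyfun_dense LL0 e8 (fun u v u' v' => trunc_lip k u v u' v').
rewrite -/K -/c in FG.
have u01 (A : R) : 0 <= A -> 0 <= expR (- A) <= 1.
  by move=> A0; rewrite expR_ge0 -[leRHS]expR0 ler_expR oppr_le0.
have GE A B : G (expR (- A)) (expR (- B)) = h (Num.min A K - Num.min B K).
  by rewrite /G /c !ln_max_expR; congr h; ring.
have FhE A B : 0 <= A -> 0 <= B -> `|h (A - B) - F (expR (- A)) (expR (- B))| <=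
    e / 8 + 4 * H * ((1 - expR (- (K^-1 * A))) + (1 - expR (- (K^-1 * B)))).
  move=> A0 B0; have := FG _ _ (u01 A A0) (u01 B B0); rewrite -/(G _ _) GE.
  have := trunc_err k A0 B0; rewrite -/K => h1 h2.
  rewrite (_ : h (A - B) - _ = (h (A - B) - h (Num.min A K - Num.min B K)) -
    (F (expR (- A)) (expR (- B)) - h (Num.min A K - Num.min B K))); last by ring.
  by apply: le_trans (ler_normB _ _) _; rewrite addrC lerD.
have l0 n f' s : (forall x, 0 <= f' x) -> 0 <= linst n f' s.
  by move=> f0'; apply: sumr_ge0.
have bF := bm_polyfun lf lg f0 g0 pF.
have limside : `|EP P (fun w => h (N f w - N g w)) - EP P (fun w => F (expR (- N f w)) (expR (- N g w)))| <= e / 4.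
  have bh := bm_hN lf lg f0 g0.
  pose LK f' w := lapf lam (fun x => K^-1 * f' x) w.
  have bL f' : lipcs f' -> (forall x, 0 <= f' x) -> bm (fun w => 1 - LK f' w).
    move=> lf' f0'; apply: bm_sub; first exact: bm_cst.
    apply: (bm_lapf HS); first by apply: lipcs_measurable; exact: lipcs_scale.
    by move=> x; rewrite mulr_ge0// ltW.
  have bE f' : lipcs f' -> (forall x, 0 <= f' x) -> bm (fun w => 1 - expR (- (K^-1 * N f' w))).
    move=> lf' f0'; apply: bm_sub; first exact: bm_cst.
    split; last first.
      exists 1 => w; rewrite ger0_norm ?expR_ge0// -[leRHS]expR0 ler_expR oppr_le0 mulr_ge0 ?(ltW Ki)//.
      exact: N_ge0.
    apply: measurableT_comp; first exact: measurable_expR.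
    apply: measurableT_comp; first exact: oppr_measurable.
    apply: measurable_funM; first exact: measurable_cst.
    by apply: (measurable_N HS) => //; exact: lipcs_measurable.
  have EL f' : lipcs f' -> (forall x, 0 <= f' x) ->
      EP P (fun w => 1 - expR (- (K^-1 * N f' w))) = EP P (fun w => 1 - LK f' w).
    move=> lf' f0'; apply: eq_ae_EP; [exact: bE|exact: bL|].
    apply: filterS (NF_ae_fin beta0 HS lf' f0') => w wf.
    have cf0 x : 0 <= K^-1 * f' x by rewrite mulr_ge0// ltW.
    have := NF_natM lam k.+1 w cf0.
    have -> : (fun x => k.+1%:R * (K^-1 * f' x)) = f'.
      by apply/funext => x; rewrite mulrA divff ?mul1r// gt_eqF.
    rewrite /LK /lapf /N /Nf /=.
    move: wf; have := NF_ge0 lam w cf0; have := NF_ge0 lam w f0'.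
    case: (NF lam f' w) => [a| |]//= _; case: (NF _ _ w) => [b| |]//= _ _.
      by move=> [->]; rewrite -/K mulrA mulVf ?gt_eqF// mul1r.
    by rewrite gt0_muley ?lte_fin.
  rewrite -EP_sub//; apply: le_trans (EP_norm_le _ (h := fun w => e / 8 + 4 * H * ((1 - expR (- (K^-1 * N f w))) + (1 - expR (- (K^-1 * N g w))))) _ _ _) _.
  - exact: bm_sub.
  - by apply: bm_add; [exact: bm_cst|apply: bm_scale; apply: bm_add; exact: bE].
  - by move=> w; apply: FhE; exact: N_ge0.
  have bEf := bE f lf f0; have bEg := bE g lg g0.
  have bA := bm_add bEf bEg.
  rewrite (EP_add P (bm_cst _) (bm_scale _ bA)) EP_cst (EP_scale P _ bA) (EP_add P bEf bEg) !EL//.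
  have := HC1 _ Ki; have := HC2 _ Ki => h1 h2.
  have h3 := lerD h2 h1; have H4 : 0 <= 4 * H by rewrite mulr_ge0.
  apply: (@le_trans _ _ (e / 8 + e / 8)); last by lra.
  by rewrite lerD2l; exact: le_trans (ler_wpM2l H4 h3) Kb.
have /cvgrPdist_le/(_ _ e8) := cbeE_polyfun_cvg lf lg f0 g0 pF.
have nn1 : \forall n \near \oo, (n1 <= n)%N by exact: nbhs_infty_ge.
have nn2 : \forall n \near \oo, (n2 <= n)%N by exact: nbhs_infty_ge.
move=> cF; near=> n.
have h1 : `|cbeE beta n (fun s => h (linst n f s - linst n g s)) - cbeE beta n (fun s => F (expR (- linst n f s)) (expR (- linst n g s)))| <= e / 4.
  have bh := buc_hlinst n lf lg; have bFn := buc_polyfun n lf lg pF.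
  have blf := buc_linst n n (lipcs_unif_cont lf); have blg := buc_linst n n (lipcs_unif_cont lg).
  have bB : buc n (fun s => e / 8 + 4 * H * (K^-1 * linst n f s + K^-1 * linst n g s)).
    by apply: buc_add; [exact: buc_cst|apply: buc_scale; apply: buc_add; exact: buc_scale].
  rewrite -cbeE_sub//; apply: le_trans (cbeE_norm_le beta0 (buc_sub bh bFn) bB _) _.
    move=> s _ _; apply: le_trans (FhE _ _ (l0 _ _ _ f0) (l0 _ _ _ g0)) _.
    rewrite lerD2l; apply: ler_wpM2l; first by rewrite mulr_ge0.
    by apply: lerD; exact: one_sub_expR_le.
  have b1 := buc_scale K^-1 blf; have b2 := buc_scale K^-1 blg; have bA := buc_add b1 b2.
  rewrite (cbeE_add beta0 (buc_cst _ _) (buc_scale _ bA)) cbeE_cst// (cbeE_scale beta0 _ bA).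
  rewrite (cbeE_add beta0 b1 b2) !cbeE_scale//.
  have k1 : cbeE beta n (linst n f) <= C1 by apply: Hn1; near: n.
  have k2 : cbeE beta n (linst n g) <= C2 by apply: Hn2; near: n.
  have h3 := lerD (ler_wpM2l (ltW Ki) k1) (ler_wpM2l (ltW Ki) k2).
  have H4 : 0 <= 4 * H by rewrite mulr_ge0.
  apply: (@le_trans _ _ (e / 8 + e / 8)); last by lra.
  by rewrite lerD2l; exact: le_trans (ler_wpM2l H4 h3) Kb.
have h2 : `|EP P (fun w => F (expR (- N f w)) (expR (- N g w))) - cbeE beta n (fun s => F (expR (- linst n f s)) (expR (- linst n g s)))| <= e / 8.
  by near: n.
move: h1 h2 limside; move: (cbeE _ _ _) (cbeE _ _ _) (EP _ _) (EP _ _) => a b x y.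
by rewrite !ler_norml => /andP[? ?] /andP[? ?] /andP[? ?]; apply/andP; split; lra.
Unshelve. all: by end_near. Qed.

End Truncation.
End Transfer.

(** * Almost sure convergence of the principal value *)

Section Configuration.
Context {R : realType} (Lam : (R -> R) -> R).
Implicit Types (F G : R -> R) (e : R).

(* [Lam F] is the sum of [F] over a locally finite configuration of points. *)
Hypothesis LamE : forall B : R, exists s : seq R, forall F,
  (forall x, B < `|x| -> F x = 0) -> Lam F = \sum_(x <- s) F x.

Definition bs F : Prop := exists B : R, forall x, B < `|x| -> F x = 0.

(** One finite list of points serves all functions vanishing where F and G do, so the calculus of
    [Lam] reduces to that of finite sums. *)
Lemma Lam_common F G : bs F -> bs G -> exists s : seq R, forall H,
  (forall x, F x = 0 -> G x = 0 -> H x = 0) -> Lam H = \sum_(x <- s) H x.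
Proof.
move=> [B FB] [B' GB]; have [s Hs] := LamE (Num.max B B'); exists s => H HFG; apply: Hs => x.
by rewrite gt_max => /andP[xB xB']; apply: HFG; [exact: FB|exact: GB].
Qed.

Lemma LamD F G : bs F -> bs G -> Lam (fun x => F x + G x) = Lam F + Lam G.
Proof.
move=> bF bG; have [s Hs] := Lam_common bF bG.
by rewrite (Hs F)// (Hs G)// Hs ?big_split// => x -> ->; rewrite addr0.
Qed.

Lemma LamZ (k : R) F : bs F -> Lam (fun x => k * F x) = k * Lam F.
Proof.
move=> bF; have [s Hs] := Lam_common bF bF.
by rewrite (Hs F)// Hs ?mulr_sumr// => x -> _; rewrite mulr0.
Qed.

Lemma bs_add F G : bs F -> bs G -> bs (fun x => F x + G x).
Proof.
move=> [B FB] [B' GB]; exists (Num.max B B') => x; rewrite gt_max => /andP[xB xB'].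
by rewrite FB// GB// addr0.
Qed.

Lemma bs_scale (k : R) F : bs F -> bs (fun x => k * F x).
Proof. by move=> [B FB]; exists B => x /FB ->; rewrite mulr0. Qed.

Lemma LamB F G : bs F -> bs G -> Lam (fun x => F x - G x) = Lam F - Lam G.
Proof.
move=> bF bG; rewrite -mulN1r -LamZ// -LamD//; last exact: bs_scale.
by congr Lam; apply/funext => x; rewrite mulN1r.
Qed.

Lemma Lam_le F G : bs F -> bs G -> (forall x, F x <= G x) -> Lam F <= Lam G.
Proof.
move=> bF bG FG; have [s Hs] := Lam_common bF bG.
by rewrite (Hs F)// (Hs G)//; apply: ler_sum.
Qed.

Lemma Lam_norm_le F G : bs F -> bs G -> (forall x, `|F x| <= G x) -> `|Lam F| <= Lam G.
Proof.
move=> bF bG FG; have [s Hs] := Lam_common bF bG.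
by rewrite (Hs F)// (Hs G)//; apply: le_trans (ler_norm_sum _ _ _) _; apply: ler_sum.
Qed.

Lemma bs_sum (I : Type) (r : seq I) (F : I -> R -> R) : (forall i, bs (F i)) ->
  bs (fun x => \sum_(i <- r) F i x).
Proof.
move=> bF; elim: r => [|i r [B IH]]; first by exists 0 => x _; rewrite big_nil.
have [B' FB] := bF i; exists (Num.max B B') => x; rewrite gt_max => /andP[xB xB'].
by rewrite big_cons FB// IH// addr0.
Qed.

Lemma Lam_sum (I : Type) (r : seq I) (F : I -> R -> R) : (forall i, bs (F i)) ->
  Lam (fun x => \sum_(i <- r) F i x) = \sum_(i <- r) Lam (F i).
Proof.
move=> bF; elim: r => [|i r IH].
  rewrite big_nil; have [s Hs] := LamE 0.
  rewrite Hs; first by rewrite big1// => x _; rewrite big_nil.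
  by move=> x _; rewrite big_nil.
rewrite big_cons -IH -LamD//; last exact: bs_sum.
by congr Lam; apply/funext => x; rewrite big_cons.
Qed.

Definition npos (u : R) : R := Lam (fun x => (0 < x <= u)%R%:R).
Definition nneg (u : R) : R := Lam (fun x => (- u <= x < 0)%R%:R).
Definition shell (u v x : R) : R := (u < `|x| <= v)%R%:R.

Lemma bs_pos u : bs (fun x : R => (0 < x <= u)%R%:R).
Proof.
exists u => x ux; have [x0|//] := ltP 0 x.
by move: ux; rewrite gtr0_norm// ltNge => /negbTE ->.
Qed.

Lemma bs_neg u : bs (fun x : R => (- u <= x < 0)%R%:R).
Proof.
exists u => x ux; have [x0|x0] := ltP x 0; last by rewrite andbF.
by move: ux; rewrite ltr0_norm// ltrNr ltNge => /negbTE ->.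
Qed.

Lemma bs_shell u v : bs (shell u v).
Proof. by exists v => x vx; rewrite /shell leNgt vx andbF. Qed.

Lemma bs_shellM u v F : bs (fun x => F x * shell u v x).
Proof. by exists v => x vx; rewrite /shell leNgt vx andbF mulr0. Qed.

Lemma shell_split (a b c x : R) : a <= b -> b <= c -> shell a c x = shell a b x + shell b c x.
Proof.
rewrite /shell => ab bc; case: (ltP a `|x|) => h1; case: (leP `|x| c) => h2; case: (leP `|x| b) => h3;
  rewrite ?ltNge ?h3/= ?addr0 ?add0r//; lra.
Qed.

Lemma pos_neg_shell (u v x : R) : 0 <= u -> u <= v ->
  shell u v x = ((0 < x <= v)%R%:R - (0 < x <= u)%R%:R) + ((- v <= x < 0)%R%:R - (- u <= x < 0)%R%:R) /\
  Num.sg x * shell u v x = ((0 < x <= v)%R%:R - (0 < x <= u)%R%:R) - ((- v <= x < 0)%R%:R - (- u <= x < 0)%R%:R).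
Proof.
move=> u0 uv; rewrite /shell; have [x0|x0|->] := ltgtP x 0.
- rewrite ltr0_sg// ltr0_norm//= !andbT subrr add0r sub0r mulN1r.
  suff -> : (u < - x <= v)%R%:R = (- v <= x)%R%:R - (- u <= x)%R%:R :> R by [].
  rewrite lerNl ltrNr [- u <= x]leNgt; case: (ltP x (- u)) => h1 /=; first by rewrite subr0.
  have -> : (- v <= x) by lra.
  by rewrite subrr.
- rewrite gtr0_sg// gtr0_norm//= !andbF mul1r subrr subr0 addr0.
  suff -> : (u < x <= v)%R%:R = (x <= v)%R%:R - (x <= u)%R%:R :> R by [].
  rewrite [x <= u]leNgt; case: (ltP u x) => h1 /=; first by rewrite subr0.
  have -> : (x <= v) by lra.
  by rewrite subrr.
- by rewrite sgr0 normr0/= !andbF mul0r !subrr addr0 ltNge u0.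
Qed.

Lemma Lam_shell (u v : R) : 0 <= u -> u <= v ->
  Lam (shell u v) = (npos v - npos u) + (nneg v - nneg u).
Proof.
move=> u0 uv.
have bp w := bs_pos w; have bn w := bs_neg w.
have bsub F G : bs F -> bs G -> bs (fun x => F x - G x).
  by move=> bF bG; have := bs_add bF (bs_scale (-1) bG); congr bs; apply/funext => x; rewrite mulN1r.
rewrite /npos /nneg -LamB// -LamB// -LamD; [|exact: bsub|exact: bsub].
by congr Lam; apply/funext => x; have [-> _] := pos_neg_shell x u0 uv.
Qed.

Lemma Lam_sg_shell (u v : R) : 0 <= u -> u <= v ->
  Lam (fun x => Num.sg x * shell u v x) = (npos v - nneg v) - (npos u - nneg u).
Proof.
move=> u0 uv.
have bp w := bs_pos w; have bn w := bs_neg w.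
have bsub F G : bs F -> bs G -> bs (fun x => F x - G x).
  by move=> bF bG; have := bs_add bF (bs_scale (-1) bG); congr bs; apply/funext => x; rewrite mulN1r.
rewrite [RHS](_ : _ = (npos v - npos u) - (nneg v - nneg u)); last by ring.
rewrite /npos /nneg -LamB// -LamB// -LamB; [|exact: bsub|exact: bsub].
by congr Lam; apply/funext => x; have [_ ->] := pos_neg_shell x u0 uv.
Qed.

Lemma npos_ge0 u : 0 <= npos u.
Proof.
have := @Lam_le (fun x => 0 * (0 < x <= u)%R%:R) (fun x => (0 < x <= u)%R%:R).
rewrite LamZ ?mul0r; last exact: bs_pos.
by apply; [apply: bs_scale; exact: bs_pos|exact: bs_pos|move=> x; rewrite mul0r].
Qed.

Lemma nneg_ge0 u : 0 <= nneg u.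
Proof.
have := @Lam_le (fun x => 0 * (- u <= x < 0)%R%:R) (fun x => (- u <= x < 0)%R%:R).
rewrite LamZ ?mul0r; last exact: bs_neg.
by apply; [apply: bs_scale; exact: bs_neg|exact: bs_neg|move=> x; rewrite mul0r].
Qed.

Lemma npos_le u v : u <= v -> npos u <= npos v.
Proof.
move=> uv; apply: Lam_le; [exact: bs_pos|exact: bs_pos|move=> x].
rewrite ler_nat; case: (ltP 0 x) => //= _; case: (leP x u) => // xu.
by rewrite (le_trans xu uv).
Qed.

Lemma nneg_le u v : u <= v -> nneg u <= nneg v.
Proof.
move=> uv; apply: Lam_le; [exact: bs_neg|exact: bs_neg|move=> x].
rewrite ler_nat; case: (ltP x 0) => _; rewrite ?andbF// !andbT; case: (leP (- u) x) => // xu.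
by rewrite (le_trans _ xu)// lerN2.
Qed.

End Configuration.

(** * From summable discrepancies to o(j) discrepancies *)

Section Summability.
Context {R : realType}.
Implicit Types (n w : nat -> R) (e c : R).

Lemma bounded_sum_tail w (a0 : nat) : (forall j, 0 <= w j) ->
  (exists M : R, forall J, \sum_(a0 <= j < J) w j <= M) ->
  forall e, 0 < e -> exists2 a1, (a0 <= a1)%N & forall a b, (a1 <= a)%N -> \sum_(a <= j < b) w j <= e.
Proof.
move=> w0 [M HM] e e0; pose u J := \sum_(a0 <= j < J + a0) w j.
have und : nondecreasing_seq u.
  move=> m m' mm'; rewrite /u [leRHS](@big_cat_nat _ _ _ (m + a0)%N)/= ?leq_addl ?leq_add2r//.
  by rewrite lerDl; apply: sumr_ge0.
have uM : has_ubound (range u) by exists M => _ [J _ <-]; exact: HM.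
have uc : cvgn u by apply: nondecreasing_is_cvgn.
have [m0 Hm0] : exists m0, limn u - u m0 <= e.
  have /cvgrPdist_le/(_ e e0)[m0 _ H] := uc; exists m0.
  by apply: le_trans (ler_norm _) _; exact: (H m0 (leqnn _)).
exists (m0 + a0)%N => [|a b aa]; first exact: leq_addl.
have [ab|ba] := leqP b a; first by rewrite big_geq// ltW.
have h := nondecreasing_cvgn_le und uc (b - a0)%N.
have e1 : u (b - a0)%N = \sum_(a0 <= j < a) w j + \sum_(a <= j < b) w j.
  have ab' := leq_trans (leq_addl m0 a0) aa.
  by rewrite /u subnK ?(leq_trans ab' (ltnW ba))// (@big_cat_nat _ _ _ a)//= ltnW.
have h2 : u m0 <= \sum_(a0 <= j < a) w j.
  have := und m0 (a - a0)%N; rewrite /u subnK ?(leq_trans (leq_addl m0 a0) aa)//; apply.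
  by rewrite leq_subRL ?(leq_trans (leq_addl m0 a0) aa)// addnC.
lra.
Qed.

Let block_le (p i t j : nat) : (p <= i < p + t.+1)%N -> (p + t <= 2 * j)%N -> (i <= 2 * j)%N.
Proof. lia. Qed.

Let half_block (a t j : nat) : ((2 * a).+2 <= j)%N -> (2 * t <= j)%N ->
  [/\ (a < j)%N, (j + t <= 2 * j)%N, (a < j - t)%N & (j - t + t <= 2 * j)%N].
Proof. by move=> *; split; lia. Qed.

Let block_up (i j t : nat) : (j <= i < j + t.+1)%N -> (i - j <= t)%N.
Proof. lia. Qed.

Let block_down (i j t : nat) : (j - t <= i < j - t + t.+1)%N -> (2 * t <= j)%N -> (i <= j)%N /\ (j - i <= t)%N.
Proof. by move=> *; split; lia. Qed.

(** Monotonicity makes a large deviation persist: if n(j) - c j exceeds e j, it stays above e j / 2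
    on a block to the right of j of length proportional to j, and a deficit persists on a block to
    the left. Such a block contributes a fixed amount to the convergent sum, which is impossible far
    out. *)
Lemma discrepancy_little_o n c (a0 : nat) : 0 < c -> (forall j, 0 <= n j) ->
  (forall i j, (i <= j)%N -> n i <= n j) ->
  (exists M : R, forall J, \sum_(a0 <= j < J) (`|n j - c * j%:R| / j%:R ^+ 2) <= M) ->
  forall e, 0 < e -> exists j0, forall j, (j0 <= j)%N -> `|n j - c * j%:R| <= e * j%:R.
Proof.
move=> c0 n0 nd HM e0 e00.
wlog ec : e0 e00 / e0 <= c => [hw|].
  have [//|/ltW ce] := leP e0 c; first exact: hw.
  have [j0 Hj0] := hw c c0 (lexx c); exists j0 => j jj; apply: le_trans (Hj0 j jj) _.
  by rewrite ler_wpM2r.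
set e := e0 in e00 ec *.
have w0 j : 0 <= `|n j - c * j%:R| / j%:R ^+ 2 by rewrite divr_ge0// sqr_ge0.
(* Half of the contribution of a block: more than e j / (2c) terms of size at least e / (8 j). *)
have d0 : 0 < e ^+ 2 / (32 * c) by rewrite divr_gt0 ?exprn_gt0// mulr_gt0.
have [a1 a01 Ha1] := bounded_sum_tail w0 HM d0.
exists (2 * a1).+2 => j jj.
have j0 : (0 < j)%N by apply: leq_trans jj.
have j0' : (0 : R) < j%:R by rewrite ltr0n.
rewrite leNgt; apply/negP => big.
(* Over t steps the expected growth is at most e j / 2, so half of the deviation survives; e <= c
   gives 2 t <= j and keeps the blocks between j / 2 and 2 j. *)
pose t := Num.truncn (e * j%:R / (2 * c)).
have tj0 : 0 <= e * j%:R / (2 * c) by rewrite divr_ge0 ?mulr_ge0// ltW// mulr_gt0.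
have /andP[t1 t2] := truncn_itv tj0; rewrite -/t in t1 t2.
have tc : c * t%:R <= e * j%:R / 2.
  move: t1; rewrite ler_pdivlMr ?mulr_gt0//; lra.
have tj : (2 * t <= j)%N.
  rewrite -(ler_nat R) natrM; have : e * j%:R <= c * j%:R by rewrite ler_wpM2r// ltW.
  move=> h; rewrite -(ler_pM2l c0); lra.
have [b1 b2 b3 b4] := half_block jj tj.
have block p : (a1 < p)%N -> (p + t <= 2 * j)%N ->
    (forall i, (p <= i < p + t.+1)%N -> e * j%:R / 2 <= `|n i - c * i%:R|) -> False.
  move=> ap pj Hi; have := Ha1 p (p + t.+1)%N (ltnW ap); apply/negP; rewrite -ltNge.
  apply: (@lt_le_trans _ _ (\sum_(p <= i < p + t.+1) (e / (8 * j%:R)))).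
    rewrite sumr_const_nat addKn -[_ *+ _]mulr_natr.
    have : e * j%:R / (2 * c) * (e / (8 * j%:R)) < t.+1%:R * (e / (8 * j%:R)).
      by rewrite ltr_pM2r// divr_gt0// mulr_gt0.
    rewrite (_ : e * j%:R / (2 * c) * (e / (8 * j%:R)) = 2 * (e ^+ 2 / (32 * c))); last by field; rewrite !gt_eqF.
    rewrite [t.+1%:R * _]mulrC; lra.
  rewrite big_nat [leRHS]big_nat; apply: ler_sum => i ip.
  have i2 : i%:R <= 2 * j%:R :> R by rewrite -natrM ler_nat; exact: block_le ip pj.
  have i0' : (0 : R) < i%:R by rewrite ltr0n; case/andP: ip => pi _; exact: leq_ltn_trans (leq0n a1) (leq_trans ap pi).
  rewrite ler_pdivlMr ?exprn_gt0//; apply: le_trans (Hi i ip).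
  rewrite (_ : e * j%:R / 2 = e / (8 * j%:R) * (2 * j%:R) ^+ 2); last by field; rewrite gt_eqF.
  apply: ler_wpM2l; first by rewrite divr_ge0 ?mulr_ge0// ltW.
  by apply: lerXn2r; rewrite ?nnegrE ?mulr_ge0// ltW.
have natb (i k : nat) : (i <= k)%N -> (k%:R - i%:R : R) = (k - i)%:R by move=> ik; rewrite natrB.
move: big; have [pos|neg] := leP 0 (n j - c * j%:R).
  rewrite ger0_norm// => big.
  apply: (block j) => // i ip; have /andP[ji _] := ip.
  have nij := nd j i ji.
  have h : c * (i%:R - j%:R) <= c * t%:R by rewrite natb// ler_pM2l// ler_nat; exact: block_up.
  apply: le_trans (ler_norm _); lra.
rewrite ltr0_norm// => big.
apply: (block (j - t)%N) => // i ip; have [ij' jit] := block_down ip tj.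
have nij := nd i j ij'.
have h : c * (j%:R - i%:R) <= c * t%:R by rewrite natb// ler_pM2l// ler_nat.
rewrite -normrN; apply: le_trans (ler_norm _); lra.
Qed.

End Summability.

(** * Summation by parts for a fixed regular configuration *)

Section PrincipalValue.
Context {R : realType} (Lam : (R -> R) -> R).
Hypothesis LamE : forall B : R, exists s : seq R, forall F : R -> R,
  (forall x, B < `|x| -> F x = 0) -> Lam F = \sum_(x <- s) F x.
Variable c : R.
Hypothesis c0 : 0 < c.
Hypothesis HP : exists M : R, forall J, \sum_(5 <= j < J) (`|npos Lam j%:R - c * j%:R| / j%:R ^+ 2) <= M.
Hypothesis HN : exists M : R, forall J, \sum_(5 <= j < J) (`|nneg Lam j%:R - c * j%:R| / j%:R ^+ 2) <= M.
Implicit Types (F G phi : R -> R) (e : R).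

Let dev (j : nat) : R := `|npos Lam j%:R - c * j%:R| + `|nneg Lam j%:R - c * j%:R|.

Let dev_ge0 j : 0 <= dev j. Proof. exact: addr_ge0. Qed.

Let dev_small e : 0 < e -> exists j0, forall j, (j0 <= j)%N -> dev j <= e * j%:R.
Proof.
move=> e0; have e2 : 0 < e / 2 by rewrite divr_gt0.
have [j1 H1] := discrepancy_little_o c0 (fun j => npos_ge0 LamE j%:R)
  (fun i j ij => npos_le LamE (eq_ind_r (fun b : bool => b) ij (ler_nat R i j))) HP e2.
have [j2 H2] := discrepancy_little_o c0 (fun j => nneg_ge0 LamE j%:R)
  (fun i j ij => nneg_le LamE (eq_ind_r (fun b : bool => b) ij (ler_nat R i j))) HN e2.
exists (maxn j1 j2) => j; rewrite geq_max => /andP[jj1 jj2].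
have := H1 j jj1; have := H2 j jj2; rewrite /dev; lra.
Qed.

Let dev_tail e : 0 < e -> exists2 a1, (5 <= a1)%N & forall a b, (a1 <= a)%N -> \sum_(a <= j < b) dev j / j%:R ^+ 2 <= e.
Proof.
move=> e0; apply: bounded_sum_tail => //; first by move=> j; rewrite divr_ge0// sqr_ge0.
have [M HM] := HP; have [M' HM'] := HN; exists (M + M') => J.
rewrite (eq_bigr (fun j => `|npos Lam j%:R - c * j%:R| / j%:R ^+ 2 + `|nneg Lam j%:R - c * j%:R| / j%:R ^+ 2)).
  by rewrite big_split/= lerD.
by move=> j _; rewrite /dev mulrDl.
Qed.

Let E (j : nat) : R := npos Lam j%:R - nneg Lam j%:R.
Let m (j : nat) : R := Lam (shell j%:R j.+1%:R).

Let E_le j : `|E j| <= dev j.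
Proof.
rewrite /E (_ : _ - _ = (npos Lam j%:R - c * j%:R) - (nneg Lam j%:R - c * j%:R)); last by ring.
exact: ler_normB.
Qed.

Let m_le j : m j <= dev j + dev j.+1 + 2 * c.
Proof.
rewrite /m (Lam_shell LamE)//; last by rewrite ler_nat.
rewrite /dev; have := ler_norm (npos Lam j.+1%:R - c * j.+1%:R); have := ler_norm (nneg Lam j.+1%:R - c * j.+1%:R).
have := ler_norm (- (npos Lam j%:R - c * j%:R)); have := ler_norm (- (nneg Lam j%:R - c * j%:R)).
rewrite !normrN -(@natr1 _ j); lra.
Qed.

Let m_ge0 j : 0 <= m j.
Proof.
rewrite /m (Lam_shell LamE)//; last by rewrite ler_nat.
by rewrite addr_ge0// subr_ge0; [apply: (npos_le LamE)|apply: (nneg_le LamE)]; rewrite ler_nat.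
Qed.

Lemma Lam_shell_small e : 0 < e -> exists j0, forall j, (j0 <= j)%N -> Lam (shell j%:R j.+1%:R) <= e * j%:R.
Proof.
move=> e0; have e4 : 0 < e / 4 by rewrite divr_gt0.
have [j1 H1] := dev_small e4; exists (maxn j1 (Num.bound ((4 * c + 2 * e) / e)).+1) => j.
rewrite geq_max => /andP[jj1 jj2].
have jb : (4 * c + 2 * e) / e < j%:R.
  apply: lt_le_trans (archi_boundP _) _; first by rewrite divr_ge0 ?(ltW e0)// addr_ge0 ?mulr_ge0 ?(ltW c0) ?(ltW e0).
  by rewrite ler_nat ltnW.
move: jb; rewrite ltr_pdivrMr// => jb.
apply: le_trans (m_le j) _; have := H1 j jj1; have := H1 j.+1 (leqW jj1); rewrite -(@natr1 _ j); lra.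
Qed.

(** A class containing 1/x and 1/x - [oddK r] for every r > 0 with the same constants, so that tails
    are estimated uniformly in r. *)
Definition dec_kernel phi : Prop :=
  [/\ forall x y : R, 0 < x -> x <= y -> phi y <= phi x,
      forall x : R, 0 < x -> 0 <= phi x <= x^-1 &
      forall j, (0 < j)%N -> phi j%:R - phi j.+1%:R <= 4 / j.+1%:R ^+ 2].

Let D phi (j : nat) : R := Lam (fun x : R => Num.sg x * phi `|x| * shell j%:R j.+1%:R x).

Let sg_le1 (x : R) : `|Num.sg x| <= 1.
Proof. by rewrite normr_sg; case: eqP. Qed.

Let D_bound phi j : dec_kernel phi -> (0 < j)%N ->
  `|D phi j - (phi j.+1%:R * E j.+1 - phi j%:R * E j)| <=
  4 / j.+1%:R ^+ 2 * (2 * dev j.+1 + dev j + 2 * c).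
Proof.
move=> [phid phib phil] j0; have j0' : (0 : R) < j%:R by rewrite ltr0n.
have jj : j%:R <= j.+1%:R :> R by rewrite ler_nat.
have d0 : 0 <= phi j%:R - phi j.+1%:R by rewrite subr_ge0 phid.
(* On a unit shell phi is frozen at the inner radius; the error is its decrement times the number
   [m j] of points. What remains is an increment of the imbalance [E], which is then summed by
   parts. *)
have h1 : `|D phi j - phi j%:R * (E j.+1 - E j)| <= (phi j%:R - phi j.+1%:R) * m j.
  have bsg : bs (fun x : R => Num.sg x * shell j%:R j.+1%:R x) by exact: (bs_shellM _ _ (fun x : R => _)).
  have -> : phi j%:R * (E j.+1 - E j) = Lam (fun x : R => phi j%:R * (Num.sg x * shell j%:R j.+1%:R x)).
    by rewrite (LamZ LamE)// (Lam_sg_shell LamE).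
  have bD : bs (fun x : R => Num.sg x * phi `|x| * shell j%:R j.+1%:R x) by exact: (bs_shellM _ _ (fun x : R => _)).
  have bs1 := bs_scale (phi j%:R) bsg.
  rewrite /D -(LamB LamE)// /m -(LamZ LamE); last exact: bs_shell.
  apply: (Lam_norm_le LamE).
  - by have := bs_add bD (bs_scale (-1) bs1); congr bs; apply/funext => x; rewrite mulN1r.
  - by apply: bs_scale; exact: bs_shell.
  move=> x; rewrite /shell; have [/andP[h1 h2]|_] := boolP (j%:R < `|x| <= j.+1%:R); last by rewrite !mulr0 subrr normr0.
  rewrite !mulr1 (_ : _ - _ = Num.sg x * (phi `|x| - phi j%:R)); last by ring.
  rewrite normrM -[leRHS]mul1r; apply: ler_pM => //.
  have := phid _ _ j0' (ltW h1); have := phid _ _ (lt_trans j0' h1) h2.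
  by rewrite ler_norml => *; apply/andP; split; lra.
have h2 : `|(phi j%:R - phi j.+1%:R) * E j.+1| <= (phi j%:R - phi j.+1%:R) * dev j.+1.
  by rewrite normrM ger0_norm// ler_wpM2l.
rewrite (_ : _ - _ = (D phi j - phi j%:R * (E j.+1 - E j)) + (phi j%:R - phi j.+1%:R) * E j.+1); last by ring.
apply: le_trans (ler_normD _ _) _.
apply: le_trans (lerD h1 h2) _; rewrite -mulrDr.
apply: ler_pM => //; first by rewrite addr_ge0.
  exact: phil.
have := m_le j; lra.
Qed.

(** The boundary terms phi(j) E(j) are small because E = o(j) and phi(j) <= 1/j. The remaining terms
    are dominated by the summable dev(j) / j^2 and by a telescoping tail of order 1/a. *)
Lemma Lam_tail e : 0 < e -> exists a0, forall a b phi, (a0 <= a)%N -> (a <= b)%N -> dec_kernel phi ->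
  `|Lam (fun x : R => Num.sg x * phi `|x| * shell a%:R b%:R x)| <= e.
Proof.
move=> e0; have e1 : 0 < e / 32 by rewrite divr_gt0.
have [j1 H1] := dev_small e1; have [j2 j25 H2] := dev_tail e1.
exists (maxn (maxn j1 j2) (Num.bound (32 * c / e)).+1) => a b phi.
rewrite !geq_max => /andP[/andP[aj1 aj2] ab'] ab kphi.
have a0 : (0 < a)%N by apply: leq_trans ab'.
have a0' : (0 : R) < a%:R by rewrite ltr0n.
have ca : 8 * c / a%:R <= e / 4.
  have : 32 * c / e < a%:R.
    apply: lt_le_trans (archi_boundP _) _; first by rewrite divr_ge0 ?(ltW e0)// mulr_ge0// ltW.
    by rewrite ler_nat ltnW.
  rewrite ltr_pdivrMr// ler_pdivrMr// => h; lra.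
have -> : Lam (fun x : R => Num.sg x * phi `|x| * shell a%:R b%:R x) = \sum_(a <= j < b) D phi j.
  rewrite /D -(Lam_sum LamE); last by move=> j; exact: (bs_shellM _ _ (fun x : R => _)).
  congr Lam; apply/funext => x; rewrite -mulr_sumr; congr (_ * _).
  elim: b ab => [|b IH]; first by rewrite leqn0 => /eqP ->; rewrite big_geq// /shell ltNge; case: leP.
  rewrite leq_eqVlt ltnS => /orP[/eqP <-|ab].
    by rewrite big_geq// /shell ltNge; case: leP.
  by rewrite big_nat_recr//= -IH// (@shell_split _ _ b%:R)// ler_nat.
pose psi (j : nat) := phi j%:R * E j.
have psib j : (a <= j)%N -> `|psi j| <= e / 32.
  move=> aj; have j0 : (0 : R) < j%:R by rewrite ltr0n (leq_trans a0).
  have [_ /(_ _ j0)/andP[p0 p1] _] := kphi.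
  rewrite /psi normrM ger0_norm//; apply: (@le_trans _ _ (j%:R^-1 * (e / 32 * j%:R))).
    apply: ler_pM => //; apply: le_trans (E_le j) _; apply: H1; exact: leq_trans aj.
  by rewrite mulrC mulfK// gt_eqF.
rewrite (_ : \sum_(a <= j < b) D phi j = (psi b - psi a) + \sum_(a <= j < b) (D phi j - (psi j.+1 - psi j))); last first.
  by rewrite sumrB telescope_sumr//; ring.
apply: le_trans (ler_normD _ _) _.
have t1 : `|psi b - psi a| <= e / 16.
  by apply: le_trans (ler_normB _ _) _; have := psib a (leqnn _); have := psib b ab; lra.
suff t2 : `|\sum_(a <= j < b) (D phi j - (psi j.+1 - psi j))| <= 8 * (e / 32) + 4 * (e / 32) + 8 * c / a%:R by lra.
apply: le_trans (ler_norm_sum _ _ _) _.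
apply: (@le_trans _ _ (\sum_(a <= j < b) (8 * (dev j.+1 / j.+1%:R ^+ 2) + 4 * (dev j / j%:R ^+ 2) +
   8 * c * (j%:R^-1 - j.+1%:R^-1)))).
  rewrite big_nat [leRHS]big_nat; apply: ler_sum => j /andP[aj jb].
  have j0 : (0 < j)%N by exact: leq_trans aj.
  have j0' : (0 : R) < j%:R by rewrite ltr0n.
  apply: le_trans (D_bound kphi j0) _.
  have i1 : (j.+1%:R ^+ 2)^-1 <= (j%:R ^+ 2)^-1 :> R.
    by rewrite lef_pV2 ?posrE ?exprn_gt0// lerXn2r ?nnegrE// ler_nat.
  have i2 : (j.+1%:R ^+ 2)^-1 <= j%:R^-1 - j.+1%:R^-1 :> R.
    have -> : j%:R^-1 - j.+1%:R^-1 = (j%:R * j.+1%:R)^-1 :> R.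
      by rewrite -(@natr1 _ j); field; rewrite natr1 !gt_eqF.
    rewrite lef_pV2 ?posrE ?mulr_gt0 ?exprn_gt0// expr2.
    by apply: ler_wpM2r => //; rewrite ler_nat.
  have k1 := ler_wpM2l (dev_ge0 j) i1; have k2 := ler_wpM2l (ltW c0) i2.
  move: k1 k2; move: (j.+1%:R ^+ 2)^-1 (j%:R ^+ 2)^-1 (j%:R^-1 - _) (dev j) (dev j.+1) => p q t u v k1 k2.
  rewrite (_ : 4 * p * _ = 8 * (v * p) + 4 * (u * p) + 8 * (c * p)); last by ring.
  rewrite -(mulrA 8 c); lra.
rewrite !big_split/= -!mulr_sumr.
have s1 : \sum_(a <= j < b) dev j.+1 / j.+1%:R ^+ 2 <= e / 32.
  by rewrite -(big_add1 _ _ a b.+1 xpredT (fun j => dev j / j%:R ^+ 2)); apply: H2; exact: leqW.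
have s2 : \sum_(a <= j < b) dev j / j%:R ^+ 2 <= e / 32 by exact: H2.
have s3 : \sum_(a <= j < b) (j%:R^-1 - j.+1%:R^-1) <= a%:R^-1 :> R.
  rewrite (eq_bigr (fun j => - ((j.+1%:R^-1 : R) - j%:R^-1))); last by move=> j _; rewrite opprB.
  by rewrite sumrN telescope_sumr// opprB gerBl invr_ge0.
have s4 : 8 * c * (\sum_(a <= j < b) (j%:R^-1 - j.+1%:R^-1)) <= 8 * c * a%:R^-1.
  by apply: ler_wpM2l => //; rewrite mulr_ge0// ltW.
lra.
Qed.

Lemma dec_kernel_inv : dec_kernel (fun x : R => x^-1).
Proof.
split=> [x y x0 xy|x x0|j j0].
- by rewrite lef_pV2 ?posrE//; exact: lt_le_trans xy.
- by rewrite invr_ge0 ltW//=.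
have j0' : (0 : R) < j%:R by rewrite ltr0n.
have -> : j%:R^-1 - j.+1%:R^-1 = (j%:R * j.+1%:R)^-1 :> R.
  by rewrite -(@natr1 _ j); field; rewrite natr1 !gt_eqF.
rewrite ler_pdivlMr ?exprn_gt0// mulrC ler_pdivrMr ?mulr_gt0//.
have j1 : (1 : R) <= j%:R by rewrite ler1n.
rewrite -(@natr1 _ j); nra.
Qed.

(** Increments of [oddK r] are bounded by those of -1/x, which gives a decrement bound independent
    of r. *)
Lemma oddK_sub_le (r x y : R) : 0 < r -> 0 < x -> 0 < y -> x <= y ->
  oddK r y - oddK r x <= (y - x) / (x * y).
Proof.
move=> r0 x0 y0 xy; have r2 : 0 < r ^+ 2 by rewrite exprn_gt0.
have dx : 0 < x ^+ 2 + r ^+ 2 by rewrite addr_gt0// exprn_gt0.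
have dy : 0 < y ^+ 2 + r ^+ 2 by rewrite addr_gt0// exprn_gt0.
have -> : oddK r y - oddK r x = (y - x) * ((r ^+ 2 - x * y) / ((x ^+ 2 + r ^+ 2) * (y ^+ 2 + r ^+ 2))).
  by rewrite /oddK; field; rewrite !gt_eqF.
apply: ler_wpM2l; first by rewrite subr_ge0.
rewrite ler_pdivrMr ?mulr_gt0// [leRHS]mulrC ler_pdivlMr ?mulr_gt0//.
have xy0 := mulr_gt0 x0 y0; have := sqr_ge0 (x * y); have := mulr_ge0 (ltW r2) (sqr_ge0 (x - y)).
have := mulr_ge0 (ltW r2) (ltW r2); have := mulr_gt0 r2 xy0.
move=> h1 h2 h3 h4; rewrite [leRHS](_ : _ = (x * y) ^+ 2 + r ^+ 2 * (x - y) ^+ 2 + 2 * (r ^+ 2 * (x * y)) + r ^+ 2 * r ^+ 2); last by ring.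
rewrite (_ : (r ^+ 2 - x * y) * (x * y) = r ^+ 2 * (x * y) - (x * y) ^+ 2); last by ring.
lra.
Qed.

Lemma dec_kernel_sub (r : R) : 0 < r -> dec_kernel (fun x : R => x^-1 - oddK r x).
Proof.
move=> r0; have r2 : 0 < r ^+ 2 by rewrite exprn_gt0.
have eq x : 0 < x -> x^-1 - oddK r x = r ^+ 2 / (x * (x ^+ 2 + r ^+ 2)).
  by move=> x0; rewrite /oddK; field; rewrite !gt_eqF// addr_gt0// exprn_gt0.
split=> [x y x0 xy|x x0|j j0].
- have y0 := lt_le_trans x0 xy.
  rewrite !eq//; apply: ler_wpM2l; first exact: ltW.
  have dx : 0 < x ^+ 2 + r ^+ 2 by rewrite addr_gt0// exprn_gt0.
  have dy : 0 < y ^+ 2 + r ^+ 2 by rewrite addr_gt0// exprn_gt0.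
  rewrite lef_pV2 ?posrE ?mulr_gt0//; apply: ler_pM; rewrite ?(ltW x0) ?(ltW dx)//.
  by rewrite lerD2r lerXn2r ?nnegrE// ltW.
- have dx : 0 < x ^+ 2 + r ^+ 2 by rewrite addr_gt0// exprn_gt0.
  apply/andP; split; first by rewrite eq//; exact: divr_ge0 (ltW r2) (mulr_ge0 (ltW x0) (ltW dx)).
  by rewrite gerBl; exact: divr_ge0 (ltW x0) (ltW dx).
have [_ _ /(_ j j0)] := dec_kernel_inv.
have j0' : (0 : R) < j%:R by rewrite ltr0n.
have jj : (j%:R * j.+1%:R : R) != 0 by rewrite mulf_neq0 ?gt_eqF.
have j1 : (1 : R) <= j%:R by rewrite ler1n.
have i1 : j%:R^-1 - j.+1%:R^-1 = (j%:R * j.+1%:R)^-1 :> R.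
  by rewrite -(@natr1 _ j); field; rewrite natr1 !gt_eqF.
move=> _.
have h : oddK r j.+1%:R - oddK r j%:R <= (j%:R * j.+1%:R)^-1.
  have := oddK_sub_le r0 j0' (ltr0Sn R j) (_ : j%:R <= j.+1%:R).
  by rewrite ler_nat leqnSn -(@natr1 _ j) [_ + 1 - _]addrAC subrr add0r div1r; apply.
have -> : j%:R^-1 - oddK r j%:R - (j.+1%:R^-1 - oddK r j.+1%:R) =
   (j%:R^-1 - j.+1%:R^-1) + (oddK r j.+1%:R - oddK r j%:R) by ring.
rewrite i1; apply: le_trans (lerD (lexx _) h) _.
have jj0 : 0 < j%:R * j.+1%:R :> R by rewrite mulr_gt0.
rewrite (_ : _ + _ = 2 / (j%:R * j.+1%:R)); last by field; rewrite -(@natr1 _ j) in jj *; rewrite !gt_eqF// natr1.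
rewrite ler_pdivrMr// mulrAC ler_pdivlMr ?exprn_gt0// -(@natr1 _ j); nra.
Qed.

Definition pvS (u : R) : R := Lam (fun x : R => x^-1 * (`|x| <= u)%R%:R).

Let bs_ball F u : bs (fun x : R => F x * (`|x| <= u)%R%:R).
Proof. by exists u => x ux; rewrite leNgt ux mulr0. Qed.

Let sg_inv (x : R) : x^-1 = Num.sg x * `|x|^-1.
Proof.
have [x0|x0|->] := ltgtP x 0; last by rewrite sgr0 mul0r invr0.
  by rewrite ltr0_sg// ltr0_norm// invrN mulN1r opprK.
by rewrite gtr0_sg// gtr0_norm// mul1r.
Qed.

(** [Lam_tail] handles integer radii; the leftover between the integer part of u and u is part of
    one unit shell, whose point count is o(u) by [Lam_shell_small]. *)
Lemma pvS_cauchy e : 0 < e -> exists a0, forall (a : nat) (u : R), (a0 <= a)%N -> a%:R <= u -> `|pvS u - pvS a%:R| <= e.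
Proof.
move=> e0; have e2 : 0 < e / 2 by rewrite divr_gt0.
have [a1 H1] := Lam_tail e2; have [a2 H2] := Lam_shell_small e2.
exists (maxn a1 a2).+1 => a u; rewrite gtn_max => /andP[aa1 aa2] au.
have a0 : (0 < a)%N by exact: leq_ltn_trans aa1.
have u0 : 0 <= u by apply: le_trans au.
pose b := Num.truncn u.
have /andP[b1 b2] := truncn_itv u0; rewrite -/b in b1 b2.
have ab : (a <= b)%N by rewrite -ltnS -(ltr_nat R); exact: le_lt_trans au b2.
have b0 : (0 : R) < b%:R by rewrite ltr0n (leq_trans a0).
have e1 : pvS u - pvS a%:R = Lam (fun x : R => Num.sg x * `|x|^-1 * shell a%:R b%:R x) +
    Lam (fun x : R => x^-1 * shell b%:R u x).
  rewrite /pvS -(LamB LamE); [|exact: (bs_ball (fun x : R => _) _)|exact: (bs_ball (fun x : R => _) _)].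
  rewrite -(LamD LamE); [|exact: (bs_shellM _ _ (fun x : R => _))|exact: (bs_shellM _ _ (fun x : R => _))].
  congr Lam; apply/funext => x; rewrite -sg_inv -mulrDr -mulrBr -shell_split ?ler_nat//; congr (_ * _).
  rewrite /shell; case: (ltP a%:R `|x|) => h1 /=; first by rewrite subr0.
  by rewrite (le_trans h1 au) subrr.
rewrite e1; apply: le_trans (ler_normD _ _) _.
have h1 := H1 a b _ (ltnW aa1) ab dec_kernel_inv.
have h2 : `|Lam (fun x : R => x^-1 * shell b%:R u x)| <= e / 2.
  apply: (@le_trans _ _ (b%:R^-1 * Lam (shell b%:R b.+1%:R))); last first.
    by rewrite ler_pdivrMl// mulrC; apply: H2; exact: leq_trans (ltnW aa2) ab.
  rewrite -(LamZ LamE); last exact: bs_shell.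
  apply: (Lam_norm_le LamE); [exact: (bs_shellM _ _ (fun x : R => _))|by apply: bs_scale; exact: bs_shell|move=> x].
  rewrite /shell; have [/andP[h3 h4]|_] := boolP (b%:R < `|x| <= u); last first.
    by rewrite mulr0 normr0 mulr_ge0// invr_ge0.
  rewrite h3 (ltW (le_lt_trans h4 b2))/= !mulr1 normfV lef_pV2 ?posrE ?(ltW h3)//.
  exact: lt_trans h3.
lra.
Qed.

Lemma pvS_cvg : cvg (pvS u @[u --> +oo]).
Proof.
apply: cauchy_cvg; apply: cauchy_exP => e e0; have e2 : 0 < e / 2 by rewrite divr_gt0.
have [a Ha] := pvS_cauchy e2; exists (pvS a%:R).
suff : \forall u \near +oo, ball (pvS a%:R) e (pvS u) by [].
near=> u; rewrite -ball_normE/=; rewrite distrC; apply: (@le_lt_trans _ _ (e / 2)); last by lra.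
by apply: Ha => //; near: u; exact: nbhs_pinfty_ge.
Unshelve. all: by end_near. Qed.

(** The limit of [pvK y r] as y tends to 0, pointwise in x. *)
Definition pvKz (r x : R) : R :=
  trap (- (r ^+ 2 + 1)) (r ^+ 2 + 1) x * (x^-1 - oddK r x).

Lemma Lam_pvK_cvg (r : R) : (fun k => Lam (pvK k.+1%:R^-1 r)) @ \oo --> Lam (pvKz r).
Proof.
have [M HM] : exists M : R, forall x, M < `|x| -> trap (- (r ^+ 2 + 1)) (r ^+ 2 + 1) x = 0.
  by have [_ [M _ H]] := lipcs_trap (- (r ^+ 2 + 1)) (r ^+ 2 + 1); exists M.
have [s Hs] := LamE M.
rewrite Hs; last by move=> x /HM xM; rewrite /pvKz xM mul0r.
rewrite (_ : (fun k => _) = fun k => \sum_(x <- s) pvK k.+1%:R^-1 r x); last first.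
  by apply/funext => k; rewrite Hs// => x /HM xM; rewrite /pvK xM mul0r.
elim: s {Hs} => [|x s IH].
  by rewrite big_nil (_ : (fun k => _) = fun=> 0); [exact: cvg_cst|apply/funext => k; rewrite big_nil].
rewrite big_cons (_ : (fun k => _) = fun k => pvK k.+1%:R^-1 r x + \sum_(z <- s) pvK k.+1%:R^-1 r z); last first.
  by apply/funext => k; rewrite big_cons.
apply: cvgD => //; rewrite /pvK /pvKz; apply: cvgM; first exact: cvg_cst.
apply: cvgB; last exact: cvg_cst.
(* At the origin both sides vanish because [0^-1] is 0, the convention also in force in
   [pv_partial]. *)
have [->|x0] := eqVneq x 0.
  rewrite invr0 /oddK (_ : (fun _ => _) = fun=> 0); first exact: cvg_cst.
  by apply/funext => k; rewrite mul0r.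
have -> : x^-1 = x / (x ^+ 2 + 0 ^+ 2) by rewrite expr0n/= addr0 expr2 invfM mulrA divff// mul1r.
apply: cvgM; first exact: cvg_cst.
apply: cvgV; first by rewrite expr0n/= addr0 sqrf_eq0.
by apply: cvgD; [exact: cvg_cst|apply: cvgM; exact: cvg_harmonic].
Qed.

Lemma Lam_pvKz_cvg : (fun k : nat => Lam (pvKz k%:R)) @ \oo --> lim (pvS u @[u --> +oo]).
Proof.
apply/cvgrPdist_le => e e0; set L := lim _.
have e5 : 0 < e / 5 by rewrite divr_gt0.
have [a1 H1] := Lam_tail e5; have [a2 H2] := Lam_shell_small e5; have [a3 H3] := pvS_cauchy e5.
pose a := maxn (maxn a1 a2) a3.
have aa1 : (a1 <= a)%N by rewrite /a !leq_max leqnn.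
have aa2 : (a2 <= a)%N by rewrite /a !leq_max leqnn orbT.
have aa3 : (a3 <= a)%N by rewrite /a !leq_max leqnn orbT.
have La : `|L - pvS a%:R| <= e / 5.
  have h : (fun u => `|pvS u - pvS a%:R|) u @[u --> +oo] --> `|L - pvS a%:R|.
    by apply: cvg_norm; apply: cvgB; [exact: pvS_cvg|exact: cvg_cst].
  rewrite -(cvg_lim _ h)//; apply: limr_le; first exact: (cvgP _ h).
  by near=> u; apply: H3 => //; near: u; exact: nbhs_pinfty_ge.
pose Q := Lam (fun x : R => 1 * (`|x| <= a%:R)%R%:R).
have Q0 : 0 <= Q.
  rewrite -[leLHS](mul0r Q) -(LamZ LamE); last exact: (bs_ball (fun x : R => _) _).
  apply: (Lam_le LamE); [by apply: bs_scale; exact: (bs_ball (fun x : R => _) _)|exact: (bs_ball (fun x : R => _) _)|].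
  by move=> x; rewrite mul0r mul1r.
near=> k.
have k1 : (0 < k)%N by near: k; exact: nbhs_infty_gt.
have ka : (a <= k)%N by near: k; exact: nbhs_infty_ge.
have kQ : 5 * Q / e <= k%:R.
  by near: k; apply: nbhs_infty_ger; exact: num_real.
set r : R := k%:R; have r0 : 0 < r by rewrite ltr0n.
have r1 : 1 <= r by rewrite ler1n.
(* Letting r run through integers makes the cut-off radius r^2 an integer, as [Lam_tail] expects. *)
pose X := (k ^ 2)%N; have XE : r ^+ 2 = X%:R by rewrite natrX.
have aX : (a <= X)%N by apply: leq_trans ka _; rewrite /X expnS expn1 leq_pmulr.
have kphi := dec_kernel_sub r0.
have bo : bs (fun x : R => oddK r x * (`|x| <= a%:R)%R%:R) by exact: (bs_ball (fun x : R => _) _).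
have bt1 : bs (fun x : R => Num.sg x * (`|x|^-1 - oddK r `|x|) * shell a%:R X%:R x) by exact: (bs_shellM _ _ (fun x : R => _)).
have bt2 : bs (fun x : R => pvKz r x * shell X%:R X.+1%:R x) by exact: (bs_shellM _ _ (fun x : R => _)).
have bp : bs (fun x : R => x^-1 * (`|x| <= a%:R)%R%:R) by exact: (bs_ball (fun x : R => _) _).
(* The ball of radius a carries the principal value minus a sum of order 1/r; the shell from a to
   r^2 is a uniform tail; the last unit shell contains the slope of the cut-off. *)
have dec : Lam (pvKz r) = (pvS a%:R - Lam (fun x : R => oddK r x * (`|x| <= a%:R)%R%:R)) +
   (Lam (fun x : R => Num.sg x * (`|x|^-1 - oddK r `|x|) * shell a%:R X%:R x) +
    Lam (fun x : R => pvKz r x * shell X%:R X.+1%:R x)).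
  have bsub : bs (fun x : R => x^-1 * (`|x| <= a%:R)%R%:R - oddK r x * (`|x| <= a%:R)%R%:R).
    by have := bs_add bp (bs_scale (-1) bo); congr bs; apply/funext => x; rewrite mulN1r.
  rewrite /pvS -(LamB LamE)// -(LamD LamE)// -(LamD LamE)//; last exact: bs_add.
  congr Lam; apply/funext => x; rewrite -mulrBl.
  have sgo : Num.sg x * (`|x|^-1 - oddK r `|x|) = x^-1 - oddK r x.
    rewrite mulrBr -sg_inv; congr (_ - _); rewrite /oddK mulrA real_normK ?num_real//.
    by rewrite -numEsg.
  rewrite sgo /shell; have [xa|ax] := leP `|x| a%:R.
    have aX' : (a%:R : R) <= X%:R by rewrite ler_nat.
    rewrite (ltNge X%:R) (le_trans xa aX')/= !mulr0 !addr0 mulr1 /pvKz trap_in ?mul1r//.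
      by rewrite XE; have := le_trans xa aX'; rewrite ler_norml; lra.
    by rewrite XE; have := le_trans xa aX'; rewrite ler_norml; lra.
  rewrite mulr0 add0r/=; have [xX|Xx] := leP `|x| X%:R.
    rewrite /= mulr0 addr0 mulr1 /pvKz trap_in ?mul1r//.
      by rewrite XE; move: xX; rewrite ler_norml; lra.
    by rewrite XE; move: xX; rewrite ler_norml; lra.
  rewrite mulr0 add0r/=; have [xX1|Xx1] := leP `|x| X.+1%:R; first by rewrite mulr1.
  rewrite mulr0 /pvKz trap_out ?mul0r//; move: Xx1; rewrite XE -(@natr1 _ X).
  have [x0|x0] := leP 0 x; first by rewrite ger0_norm// => h; right; lra.
  by rewrite ltr0_norm// => h; left; lra.
have b1 : `|Lam (fun x : R => oddK r x * (`|x| <= a%:R)%R%:R)| <= e / 5.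
  apply: (@le_trans _ _ (r^-1 * Q)).
    rewrite /Q -(LamZ LamE); last exact: (bs_ball (fun x : R => _) _).
    apply: (Lam_norm_le LamE) => //; first by apply: bs_scale; exact: (bs_ball (fun x : R => _) _).
    by move=> x; rewrite normrM mul1r normr_nat; apply: ler_wpM2r => //; exact: oddK_le.
  by rewrite ler_pdivrMl//; move: kQ; rewrite ler_pdivrMr// -/r; lra.
have b2 := H1 a X _ aa1 aX kphi.
have b3 : `|Lam (fun x : R => pvKz r x * shell X%:R X.+1%:R x)| <= e / 5.
  have X0 : (0 : R) < X%:R by rewrite -XE exprn_gt0.
  apply: (@le_trans _ _ (X%:R^-1 * Lam (shell X%:R X.+1%:R))); last first.
    by rewrite ler_pdivrMl// mulrC; apply: H2; exact: leq_trans aa2 aX.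
  rewrite -(LamZ LamE); last exact: bs_shell.
  apply: (Lam_norm_le LamE) => //; first by apply: bs_scale; exact: bs_shell.
  move=> x; rewrite /shell; have [/andP[h3 h4]|_] := boolP (X%:R < `|x| <= X.+1%:R); last first.
    by rewrite !mulr0 normr0.
  have x0 : 0 < `|x| by exact: lt_trans h3.
  rewrite !mulr1 /pvKz normrM -[leRHS]mul1r; apply: ler_pM => //.
    by rewrite ger0_norm ?trap_ge0// trap_le1.
  have -> : x^-1 - oddK r x = Num.sg x * (`|x|^-1 - oddK r `|x|).
    rewrite mulrBr -sg_inv; congr (_ - _); rewrite /oddK mulrA real_normK ?num_real//.
    by rewrite -numEsg.
  rewrite normrM -[leRHS]mul1r; apply: ler_pM => //.
  have [_ /(_ _ x0)/andP[p0 p1] _] := kphi; rewrite ger0_norm//; apply: le_trans p1 _.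
  by rewrite lef_pV2 ?posrE// ltW.
rewrite dec; move: La b1 b2 b3; rewrite !ler_norml => /andP[? ?] /andP[? ?] /andP[? ?] /andP[? ?].
by apply/andP; split; lra.
Unshelve. all: by end_near. Qed.

End PrincipalValue.

(** * Local finiteness and moment bounds for the limit process *)

Section AlmostSure.
Context {R : realType} {d : measure_display} {Omega : measurableType d} (P : probability Omega R).
Variables (beta : R) (lam : int -> Omega -> R).
Hypothesis (beta0 : 0 < beta) (HS : is_Sine_beta P beta lam).
Implicit Types (f g : R -> R) (w : Omega).

Definition Lamw w (F : R -> R) : R := \sum_(k \in [set: int]) F (lam k w).

Definition locfin w : Prop := forall r : R, finite_set [set k | `|lam k w| <= r].

Lemma LamwE_set w (B : R) (F : R -> R) : (forall x, B < `|x| -> F x = 0) ->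
  Lamw w F = \sum_(k \in [set k | `|lam k w| <= B]) F (lam k w).
Proof.
move=> FB; rewrite /Lamw; symmetry; apply: fsbig_widen => // k [_ /= /negP kB].
by apply: FB; rewrite ltNge.
Qed.

Lemma LamwE w : locfin w -> forall B : R, exists s : seq R, forall F : R -> R,
  (forall x, B < `|x| -> F x = 0) -> Lamw w F = \sum_(x <- s) F x.
Proof.
move=> lf B; exists [seq lam k w | k <- finmap.enum_fset (fset_set [set k | `|lam k w| <= B])] => F FB.
by rewrite (LamwE_set w FB) fsbig_finite// big_map.
Qed.

Lemma NF_Lamw w (B : R) f : locfin w -> (forall x, 0 <= f x) -> (forall x, B < `|x| -> f x = 0) ->
  NF lam f w = (Lamw w f)%:E.
Proof.
move=> lf f0 fB; rewrite (LamwE_set w fB) -fsumEFin; last exact: lf.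
rewrite -esum_fset; [|exact: lf|by move=> k _; rewrite lee_fin].
rewrite [RHS]esum_mkcond /NF; apply: eq_esum => k _.
case: ifPn => // /negP kB; rewrite fB// ltNge; apply/negP => h; apply: kB; exact: mem_set.
Qed.

Lemma Nf_Lamw w f : locfin w -> (forall x, 0 <= f x) -> lipcs f -> Nf lam f w = Lamw w f.
Proof. by move=> lf f0 [_ [B _ fB]]; rewrite /Nf (NF_Lamw lf f0 fB). Qed.

Lemma pv_partialE w (r : R) : pv_partial lam w r = pvS (Lamw w) r.
Proof.
rewrite /pvS (@LamwE_set w r); last by move=> x rx; rewrite leNgt rx mulr0.
by apply: eq_fsbigr => k /set_mem/= kr; rewrite kr mulr1.
Qed.

Lemma infinite_esum_one w (r : R) f : (forall x, 0 <= f x) -> (forall x, `|x| <= r -> 1 <= f x) ->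
  ~ finite_set [set k | `|lam k w| <= r] -> NF lam f w = +oo%E.
Proof.
move=> f0 f1 inf; have f0' := NF_ge0 lam w f0; case e : (NF lam f w) f0' => [a| |]// a0.
rewrite lee_fin in a0.
have [B BA nB] := infinite_set_fset (Num.bound a).+1 inf.
suff : ((Num.bound a).+1%:R%:E <= NF lam f w)%E.
  rewrite e lee_fin leNgt; apply: contraNP => _; apply: lt_trans (archi_boundP a0) _.
  by rewrite ltr_nat.
apply: esum_ge; eexists; first by split; [exact: (finite_fset B)|].
rewrite fsumEFin ?lee_fin; last exact: finite_fset.
rewrite fsbig_finite ?finite_fset//= set_fsetK.
apply: (@le_trans _ _ (\sum_(k <- finmap.enum_fset B) (1 : R))).
  by rewrite big_const_seq count_predT iter_addr_0 ler_nat.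
rewrite big_seq [leRHS]big_seq; apply: ler_sum => k kB; apply: f1.
exact: (BA k kB).
Qed.

(** Infinitely many points in a ball would make the statistic of a trapezoid equal to 1 on that ball
    infinite; countably many trapezoids suffice. *)
Lemma locfin_ae : {ae P, forall w, locfin w}.
Proof.
have h (M : nat) : {ae P, forall w, (NF lam (trap (- (M%:R + 1)) (M%:R + 1)) w < +oo)%E}.
  by apply: (NF_ae_fin beta0 HS); [exact: lipcs_trap|move=> x; exact: trap_ge0].
apply: filterS (ae_foralln h) => w Hw r; apply: contrapT => inf.
pose M := Num.bound `|r|.
have rM : r <= M%:R by apply: le_trans (ler_norm _) _; apply: ltW; exact: archi_boundP.
have := Hw M; rewrite (infinite_esum_one (r := r) _ _ inf) ?ltxx// => x.
  exact: trap_ge0.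
by move=> /le_trans/(_ rM); rewrite ler_norml => /andP[h1 h2]; rewrite trap_in//; lra.
Qed.

Lemma lipcs0 : lipcs (fun=> 0 : R).
Proof. by split; [exists 0 => // x y; rewrite subrr normr0 mul0r|exists 0]. Qed.

Lemma Nf0 w : Nf lam (fun=> 0) w = 0.
Proof. by rewrite /Nf /NF esum1. Qed.

(** k may be unbounded, so it is cut at level m, transferred with the zero function as second
    statistic, and recovered by monotone convergence. *)
Lemma EP_limit_le f (k : R -> R) (B : R) : lipcs f -> (forall x, 0 <= f x) ->
  (forall x, 0 <= k x) -> (forall x y, `|k x - k y| <= `|x - y|) ->
  (exists n0, forall n, (n0 <= n)%N -> cbeE beta n (fun s => k (linst n f s)) <= B) ->
  (\int[P]_w (k (Nf lam f w))%:E <= B%:E)%E.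
Proof.
move=> lf f0 k0 kL [n0 Hn0].
have kc : continuous k by apply: (@lip_continuous _ k 1) => x y; rewrite mul1r.
pose h (m : nat) x := Num.min (k x) m%:R.
have h0 m x : 0 <= h m x by rewrite le_min k0 ler0n.
have hL m x y : `|h m x - h m y| <= 1 * `|x - y|.
  by rewrite mul1r; apply: min_lip => //; rewrite subrr normr0.
have hB m x : `|h m x| <= m%:R by rewrite ger0_norm// ge_min lexx orbT.
have hc m : continuous (h m) := lip_continuous (hL m).
have mN : measurable_fun setT (Nf lam f) by apply: (measurable_N HS) => //; exact: lipcs_measurable.
have mh m : measurable_fun setT (fun w => h m (Nf lam f w)).
  by apply: measurableT_comp => //; exact: continuous_measurable_fun.
have lim m : EP P (fun w => h m (Nf lam f w)) <= B.
  have cv := cbeE_transfer beta0 HS (hB m) ler01 (hL m) lf lipcs0 f0 (fun=> lexx 0).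
  have -> : (fun w => h m (Nf lam f w)) = (fun w => h m (Nf lam f w - Nf lam (fun=> 0) w)).
    by apply/funext => w; rewrite Nf0 subr0.
  rewrite -(cvg_lim _ cv)//; apply: limr_le; first exact: (cvgP _ cv).
  exists n0 => // n /= nn; apply: le_trans (Hn0 n nn).
  have bl := buc_linst n n (lipcs_unif_cont lf).
  apply: (cbeE_le beta0); [exact: (buc_hlinst (hL m) n lf lipcs0)|exact: buc_comp kc bl|].
  move=> s _ _; rewrite (_ : linst n (fun=> 0) s = 0) ?subr0; last by rewrite /linst big1.
  by rewrite ge_min lexx.
have -> : (\int[P]_w (k (Nf lam f w))%:E = limn (fun m => \int[P]_w (h m (Nf lam f w))%:E))%E.
  rewrite -monotone_convergence//.
  - apply: eq_integral => w _; apply/esym/cvg_lim => //; apply: cvg_near_cst.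
    near=> m; congr EFin; apply/min_idPl; near: m; apply: nbhs_infty_ger; exact: num_real.
  - by move=> m; apply/measurable_EFinP.
  - by move=> m w _; rewrite lee_fin.
  - move=> w _ m m' mm'; rewrite lee_fin le_min !ge_min lexx/= ler_nat mm'/=.
    by rewrite orbT.
apply: lime_le.
  apply: ereal_nondecreasing_is_cvgn => m m' mm'; apply: ge0_le_integral => //.
  - by move=> w _; rewrite lee_fin.
  - by apply/measurable_EFinP.
  - by apply/measurable_EFinP.
  - by move=> w _; rewrite lee_fin le_min !ge_min lexx/= ler_nat mm' orbT.
apply: nearW => m.
have bh : bm (fun w => h m (Nf lam f w)) by split => //; exists m%:R.
have := lim m; rewrite /EP /Rintegral -lee_fin fineK//.
by apply: integrable_fin_num => //; exact: bm_integrable.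
Unshelve. all: by end_near. Qed.

(** Comparison with the telescoping sum of 1/sqrt j - 1/sqrt(j+1); the factor 6 comes from sqrt(j+1)
    <= 2 sqrt j. Sums start at 5 because [cbeE_count_deficit_le] concerns windows of length at least
    5. *)
Lemma sqrt_sum_le J : \sum_(5 <= j < J) (Num.sqrt (j%:R : R) / j%:R ^+ 2) <= 6.
Proof.
have [J5|J5] := leqP J 5; first by rewrite big_geq.
apply: (@le_trans _ _ (\sum_(5 <= j < J) (6 * ((Num.sqrt (j%:R : R))^-1 - (Num.sqrt (j.+1%:R : R))^-1)))).
  rewrite big_nat [leRHS]big_nat; apply: ler_sum => j /andP[j5 _].
  have j0 : (1 : R) <= j%:R by rewrite ler1n (leq_trans _ j5).
  set s := Num.sqrt _; set t := Num.sqrt _.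
  have s2 : s ^+ 2 = j%:R by rewrite sqr_sqrtr.
  have t2 : t ^+ 2 = s ^+ 2 + 1 by rewrite sqr_sqrtr// s2 natr1.
  have s1 : 1 <= s by rewrite -(@sqrtr1 R); exact: ler_wsqrtr.
  have t0 : 0 <= t by exact: sqrtr_ge0.
  have st : s < t by nra.
  have t2s : t <= 2 * s by nra.
  have e : s^-1 - t^-1 = (s * t * (s + t))^-1.
    transitivity ((t ^+ 2 - s ^+ 2) / (s * t * (s + t))); last by rewrite t2 addrAC subrr add0r div1r.
    by field; rewrite !gt_eqF//; lra.
  rewrite -s2 e (_ : s / s ^+ 2 ^+ 2 = (s ^+ 3)^-1); last by field; rewrite gt_eqF//; lra.
  have p0 : 0 < s * t * (s + t) by rewrite !mulr_gt0//; lra.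
  rewrite ler_pdivlMr// mulrC ler_pdivrMr ?exprn_gt0//; last lra.
  rewrite (_ : 6 * s ^+ 3 = (s * (2 * s)) * (3 * s)); last by ring.
  apply: ler_pM; [by rewrite mulr_ge0//; lra|lra|apply: ler_wpM2l; lra|lra].
rewrite -mulr_sumr.
rewrite (eq_bigr (fun j => - (((Num.sqrt (j.+1%:R : R))^-1) - (Num.sqrt (j%:R : R))^-1))); last by move=> j _; rewrite opprB.
rewrite sumrN telescope_sumr ?(ltnW J5)// opprB.
have h5 : (Num.sqrt (5 : R))^-1 <= 1.
  have : Num.sqrt (1 : R) <= Num.sqrt 5 by apply: ler_wsqrtr; rewrite ler1n.
  by rewrite sqrtr1 => h; rewrite invf_le1// sqrtr_gt0.
have : 0 <= (Num.sqrt (J%:R : R))^-1 by rewrite invr_ge0 sqrtr_ge0.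
lra.
Qed.

(** The series of nonnegative terms has expectation at most 6 K, so it is almost surely finite. *)
Lemma series_ae_bounded (g : nat -> Omega -> R) (K : R) : 0 <= K ->
  (forall j, measurable_fun setT (g j)) -> (forall j w, 0 <= g j w) ->
  (forall j, (5 <= j)%N -> (\int[P]_w (g j w)%:E <= (K * Num.sqrt (j%:R : R))%:E)%E) ->
  {ae P, forall w, exists M : R, forall J, \sum_(5 <= j < J) (g j w / j%:R ^+ 2) <= M}.
Proof.
move=> K0 mg g0 gK.
pose h (j : nat) w : \bar R := (g (j + 5)%N w / (j + 5)%:R ^+ 2)%:E.
have h0 j w : (0 <= h j w)%E by rewrite lee_fin divr_ge0// sqr_ge0.
have mh j : measurable_fun setT (h j).
  by apply/measurable_EFinP; apply: measurable_funM => //; exact: measurable_cst.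
have hK j : (\int[P]_w h j w <= (K * (Num.sqrt ((j + 5)%:R : R) / (j + 5)%:R ^+ 2))%:E)%E.
  have -> : (\int[P]_w h j w = ((j + 5)%:R ^- 2)%:E * \int[P]_w (g (j + 5)%N w)%:E)%E.
    have q0 : 0 <= (j + 5)%:R ^- 2 :> R by rewrite invr_ge0 sqr_ge0.
    have m0 : measurable_fun setT (EFin \o g (j + 5)%N) by exact/measurable_EFinP.
    have g0' w : [set: Omega] w -> (0 <= (g (j + 5)%N w)%:E)%E by rewrite lee_fin.
    rewrite -(ge0_integralZl_EFin P measurableT g0' m0 q0).
    by apply: eq_integral => w _; rewrite /h -EFinM mulrC.
  rewrite mulrA [X in (_ <= X%:E)%E]mulrC EFinM; apply: lee_wpmul2l.
    by rewrite lee_fin invr_ge0; exact: sqr_ge0.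
  by apply: gK; rewrite leq_addl.
pose F w := (\sum_(j <oo) h j w)%E.
have mF : measurable_fun setT F by apply: (@ge0_emeasurable_sum _ _ _ _ h xpredT).
have F0 w : (0 <= F w)%E by apply: nneseries_ge0.
have iF : (\int[P]_w F w <= (K * 6)%:E)%E.
  rewrite /F integral_nneseries//; apply: lime_le.
    by apply: is_cvg_nneseries => n _ _; exact: integral_ge0.
  apply: nearW => n; rewrite (@le_trans _ _ (\sum_(0 <= j < n) (K * (Num.sqrt ((j + 5)%:R : R) / (j + 5)%:R ^+ 2))%:E)%E)//.
    by apply: lee_sum => j _; exact: hK.
  rewrite sumEFin lee_fin -mulr_sumr; apply: ler_wpM2l => //.
  by have := sqrt_sum_le (n + 5); rewrite -{1}[5%N]add0n big_addn addnK.
have intF : P.-integrable setT F.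
  apply/integrableP; split => //; under eq_integral do rewrite gee0_abs//.
  by apply: le_lt_trans iF _; rewrite ltry.
have := integrable_ae measurableT intF; apply: filterS => w /(_ I) Fw.
exists (fine (F w)) => J; have [J5|J5] := leqP J 5; first by rewrite big_geq ?fine_ge0.
rewrite -lee_fin fineK// -{1}[5%N]add0n big_addn -sumEFin.
by apply: (@nneseries_lim_ge _ (fun j => h j w) xpredT) => j _.
Qed.

End AlmostSure.

Section CountSeries.
Context {R : realType} {d : measure_display} {Omega : measurableType d} (P : probability Omega R).
Variables (beta : R) (lam : int -> Omega -> R).
Hypothesis (beta0 : 0 < beta) (HS : is_Sine_beta P beta lam).

Lemma max0_lip (x y : R) : `|Num.max 0 x - Num.max 0 y| <= `|x - y|.
Proof. exact: max_lip. Qed.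

(** A sharp count is squeezed between trapezoids on windows of lengths j and j + 2. The outer one
    controls the excess, the inner one the deficit; the extra length shifts the mean by 2 c,
    absorbed into the term with sqrt j >= 1. *)
Lemma count_series_ae (a b : nat -> R) (n : nat -> Omega -> R) : (forall j, b j - a j = j%:R) ->
  {ae P, forall w, forall j, Nf lam (trap (a j) (b j)) w <= n j w <= Nf lam (trap (a j - 1) (b j + 1)) w} ->
  {ae P, forall w, exists M : R, forall J,
     \sum_(5 <= j < J) (`|n j w - (2 * pi)^-1 * j%:R| / j%:R ^+ 2) <= M}.
Proof.
move=> ba nae; set c : R := (2 * pi)^-1.
have c0 : 0 < c by rewrite invr_gt0 mulr_gt0// pi_gt0.
have E0 := energyC_ge0 beta0.
have dC0 : 0 <= discC beta by rewrite /discC; lra.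
pose g1 j w := Num.max 0 (Nf lam (trap (a j - 1) (b j + 1)) w - (j%:R + 2) * c).
pose g2 j w := Num.max 0 (j%:R * c - Nf lam (trap (a j) (b j)) w).
have mN (x y : R) : measurable_fun setT (Nf lam (trap x y)).
  by apply: (measurable_N HS); [apply: lipcs_measurable; exact: lipcs_trap|move=> z; exact: trap_ge0].
have m1 j : measurable_fun setT (g1 j).
  apply: (measurableT_comp (f := fun z : R => Num.max 0 (z - (j%:R + 2) * c))) => //.
  apply: continuous_measurable_fun; apply: (@lip_continuous _ _ 1) => x y.
  rewrite mul1r; apply: le_trans (max0_lip _ _) _.
  by rewrite (_ : _ - _ - _ = x - y)//; ring.
have m2 j : measurable_fun setT (g2 j).
  apply: (measurableT_comp (f := fun z : R => Num.max 0 (j%:R * c - z))) => //.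
  apply: continuous_measurable_fun; apply: (@lip_continuous _ _ 1) => x y.
  rewrite mul1r distrC; apply: le_trans (max0_lip _ _) _.
  by rewrite (_ : _ - _ - _ = x - y)//; ring.
have p1 j w : 0 <= g1 j w by rewrite le_max lexx.
have p2 j w : 0 <= g2 j w by rewrite le_max lexx.
have sq (j : nat) : (5 <= j)%N -> Num.sqrt (j%:R + 2 : R) <= 2 * Num.sqrt (j%:R : R).
  move=> j5; have j5' : (5 : R) <= j%:R by rewrite ler_nat.
  have -> : 2 * Num.sqrt (j%:R : R) = Num.sqrt (4 * j%:R).
    by rewrite sqrtrM// (_ : 4 = 2 ^+ 2 :> R) ?sqrtr_sqr ?ger0_norm//; ring.
  apply: ler_wsqrtr; lra.
have I1 j : (5 <= j)%N -> (\int[P]_w (g1 j w)%:E <= (2 * discC beta * Num.sqrt (j%:R : R))%:E)%E.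
  move=> j5; apply: (EP_limit_le beta0 HS (f := trap (a j - 1) (b j + 1)) (k := fun z => Num.max 0 (z - (j%:R + 2) * c))).
  - exact: lipcs_trap.
  - by move=> x; exact: trap_ge0.
  - by move=> x; rewrite le_max lexx.
  - move=> x y; apply: le_trans (max0_lip _ _) _.
    by rewrite (_ : _ - _ - _ = x - y)//; ring.
  have e : b j + 1 - (a j - 1) = j%:R + 2 by rewrite -ba; ring.
  have := @cbeE_count_excess_le _ _ beta0 (a j - 1) (b j + 1); rewrite e => /(_ _)[|n0 Hn0].
    by have : (0 : R) <= j%:R by []; lra.
  exists n0 => m mm; apply: le_trans (Hn0 m mm) _.
  rewrite [2 * _]mulrC -mulrA; apply: ler_wpM2l => //; exact: sq.
have I2 j : (5 <= j)%N -> (\int[P]_w (g2 j w)%:E <= ((discC beta + 2) * Num.sqrt (j%:R : R))%:E)%E.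
  move=> j5; apply: (EP_limit_le beta0 HS (f := trap (a j) (b j)) (k := fun z => Num.max 0 (j%:R * c - z))).
  - exact: lipcs_trap.
  - by move=> x; exact: trap_ge0.
  - by move=> x; rewrite le_max lexx.
  - move=> x y; rewrite [leRHS]distrC; apply: le_trans (max0_lip _ _) _.
    by rewrite (_ : _ - _ - _ = y - x)//; ring.
  have := @cbeE_count_deficit_le _ _ beta0 (a j) (b j); rewrite ba => /(_ _)[|n0 Hn0]; first by rewrite ler_nat.
  by exists n0.
have s1 := series_ae_bounded (mulr_ge0 (ler0n R 2) dC0) m1 p1 I1.
have s2 := series_ae_bounded (addr_ge0 dC0 (ler0n R 2)) m2 p2 I2.
move: nae s1 s2; apply: filterS3 => w nw [M1 H1] [M2 H2].
exists (M1 + M2 + 2 * c * 6) => J.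
apply: (@le_trans _ _ (\sum_(5 <= j < J) (g1 j w / j%:R ^+ 2 + g2 j w / j%:R ^+ 2 + 2 * c * (Num.sqrt (j%:R : R) / j%:R ^+ 2)))).
  rewrite big_nat [leRHS]big_nat; apply: ler_sum => j /andP[j5 _].
  have q0 : 0 <= (j%:R ^+ 2)^-1 :> R by rewrite invr_ge0 sqr_ge0.
  rewrite mulrA -!mulrDl; apply: ler_wpM2r => //.
  have /andP[n1 n2] := nw j.
  have sj : 1 <= Num.sqrt (j%:R : R).
    have : Num.sqrt (1 : R) <= Num.sqrt j%:R by apply: ler_wsqrtr; rewrite ler1n (leq_trans _ j5).
    by rewrite sqrtr1.
  have l1 : Nf lam (trap (a j - 1) (b j + 1)) w - (j%:R + 2) * c <= g1 j w by rewrite le_max lexx orbT.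
  have l2 : j%:R * c - Nf lam (trap (a j) (b j)) w <= g2 j w by rewrite le_max lexx orbT.
  have := ler_wpM2l (ltW c0) sj; have := p1 j w; have := p2 j w; rewrite ler_norml => *.
  by apply/andP; split; lra.
rewrite !big_split/= -mulr_sumr; apply: lerD; first by apply: lerD.
by apply: ler_wpM2l; [rewrite mulr_ge0// ltW|exact: sqrt_sum_le].
Qed.

Definition regular (w : Omega) : Prop :=
  [/\ locfin lam w,
      exists M : R, forall J, \sum_(5 <= j < J) (`|npos (Lamw lam w) j%:R - (2 * pi)^-1 * j%:R| / j%:R ^+ 2) <= M &
      exists M : R, forall J, \sum_(5 <= j < J) (`|nneg (Lamw lam w) j%:R - (2 * pi)^-1 * j%:R| / j%:R ^+ 2) <= M].

Lemma regular_ae : {ae P, forall w, regular w}.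
Proof.
have lf := locfin_ae beta0 HS.
have bt (x y : R) : bs (trap x y) by have [_ [M _ H]] := lipcs_trap x y; exists M.
have h1 : {ae P, forall w, exists M : R, forall J,
    \sum_(5 <= j < J) (`|npos (Lamw lam w) j%:R - (2 * pi)^-1 * j%:R| / j%:R ^+ 2) <= M}.
  apply: (@count_series_ae (fun=> 0) (fun j => j%:R)); first by move=> j; rewrite subr0.
  apply: filterS lf => w lw j; have LE := LamwE lw.
  rewrite !(Nf_Lamw lw (fun x => trap_ge0 _ _ x) (lipcs_trap _ _)); apply/andP; split.
    apply: (Lam_le LE); [exact: bt|exact: bs_pos|move=> x].
    have [/andP[h1 h2]|h] := boolP (0 < x <= j%:R); first exact: trap_le1.
    rewrite trap_out//; move: h; rewrite negb_and -leNgt -ltNge => /orP[h|/ltW h]; [by left|by right].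
  apply: (Lam_le LE); [exact: bs_pos|exact: bt|move=> x].
  have [/andP[h1 h2]|h] := boolP (0 < x <= j%:R); last exact: trap_ge0.
  by rewrite trap_in//; lra.
have h2 : {ae P, forall w, exists M : R, forall J,
    \sum_(5 <= j < J) (`|nneg (Lamw lam w) j%:R - (2 * pi)^-1 * j%:R| / j%:R ^+ 2) <= M}.
  apply: (@count_series_ae (fun j => - j%:R) (fun=> 0)); first by move=> j; rewrite sub0r opprK.
  apply: filterS lf => w lw j; have LE := LamwE lw.
  rewrite !(Nf_Lamw lw (fun x => trap_ge0 _ _ x) (lipcs_trap _ _)); apply/andP; split.
    apply: (Lam_le LE); [exact: bt|exact: bs_neg|move=> x].
    have [/andP[h1' h2]|h] := boolP (- j%:R <= x < 0); first exact: trap_le1.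
    rewrite trap_out//; move: h; rewrite negb_and -leNgt -ltNge => /orP[/ltW h|h]; [by left|by right].
  apply: (Lam_le LE); [exact: bs_neg|exact: bt|move=> x].
  have [/andP[h1' h2]|h] := boolP (- j%:R <= x < 0); last exact: trap_ge0.
  by rewrite trap_in//; lra.
by move: lf h1 h2; apply: filterS3.
Qed.

End CountSeries.

(** * Identification of the Cauchy law *)

Section BoundedConvergence.
Context {R : realType} {d : measure_display} {Omega : measurableType d} (P : probability Omega R).

Lemma EP_bounded_cvg (g : nat -> Omega -> R) (h : Omega -> R) (M : R) :
  (forall n, measurable_fun setT (g n)) -> (forall n w, `|g n w| <= M) -> measurable_fun setT h ->
  {ae P, forall w, g ^~ w @ \oo --> h w} -> (fun n => EP P (g n)) @ \oo --> EP P h.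
Proof.
move=> mg gM mh gh.
have [|||||ih _ H] := @dominated_convergence _ Omega R P setT measurableT (fun n => EFin \o g n) (EFin \o h) (fun=> M%:E).
- by move=> n; exact/measurable_EFinP.
- exact/measurable_EFinP.
- by apply: filterS gh => w gw _; apply: cvg_EFin => //; exact: nearW.
- exact: (bm_integrable P (bm_cst M)).
- by apply: aeW => w n _; rewrite /= lee_fin.
have e : (\int[P]_x (EFin \o h) x = (EP P h)%:E)%E by rewrite /EP /Rintegral fineK//; exact: integrable_fin_num.
by rewrite e in H; exact: fine_cvg H.
Qed.

End BoundedConvergence.

Section LimitSum.
Context {R : realType} {d : measure_display} {Omega : measurableType d} (P : probability Omega R).
Variables (beta : R) (lam : int -> Omega -> R).
Hypothesis (beta0 : 0 < beta) (HS : is_Sine_beta P beta lam).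

(** Positive and negative parts, the form of a signed kernel that [cbeE_transfer] accepts. *)
Definition pvKp (m k : nat) (x : R) : R := Num.max 0 (pvK m.+1%:R^-1 k.+1%:R x).
Definition pvKn (m k : nat) (x : R) : R := Num.max 0 (- pvK m.+1%:R^-1 k.+1%:R x).

Lemma lipcs_pvKmk (m k : nat) : lipcs (pvK (m.+1%:R^-1 : R) k.+1%:R).
Proof. by apply: lipcs_pvK; rewrite ?invr_gt0 ltr0n. Qed.

Lemma lipcs_pvKp m k : lipcs (pvKp m k). Proof. by apply: lipcs_max0; exact: lipcs_pvKmk. Qed.

Lemma lipcs_pvKn m k : lipcs (pvKn m k).
Proof. by apply: (@lipcs_max0 _ (fun x => - pvK _ _ x)); apply: lipcs_opp; exact: lipcs_pvKmk. Qed.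

Lemma pvKp_ge0 m k x : 0 <= pvKp m k x. Proof. by rewrite le_max lexx. Qed.
Lemma pvKn_ge0 m k x : 0 <= pvKn m k x. Proof. by rewrite le_max lexx. Qed.

Lemma pvKpn m k x : pvKp m k x - pvKn m k x = pvK m.+1%:R^-1 k.+1%:R x.
Proof. by rewrite /pvKp /pvKn /Num.max; case: ltP => h1; case: ltP => h2; lra. Qed.

Definition Xsum (m k : nat) (w : Omega) : R := Nf lam (pvKp m k) w - Nf lam (pvKn m k) w.
(** Limits superior are measurable without any convergence; at regular points they are true limits,
    with y = 1/(m+1) tending to 0 before r = k + 1 tends to infinity. *)
Definition Ysum (k : nat) (w : Omega) : R := fine (limn_esup (fun m => (Xsum m k w)%:E)).
Definition Lsum (w : Omega) : R := fine (limn_esup (fun k => (Ysum k w)%:E)).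

Lemma measurable_Xsum m k : measurable_fun setT (Xsum m k).
Proof.
apply: measurable_funB; apply: (measurable_N HS).
- by apply: lipcs_measurable; exact: lipcs_pvKp.
- exact: pvKp_ge0.
- by apply: lipcs_measurable; exact: lipcs_pvKn.
- exact: pvKn_ge0.
Qed.

Lemma measurable_Ysum k : measurable_fun setT (Ysum k).
Proof.
apply: measurableT_comp; first exact: fine_measurable.
apply: (@measurable_fun_limn_esup _ _ _ _ (fun m w => (Xsum m k w)%:E)) => m.
by apply/measurable_EFinP; exact: measurable_Xsum.
Qed.

Lemma measurable_Lsum : measurable_fun setT Lsum.
Proof.
apply: measurableT_comp; first exact: fine_measurable.
apply: (@measurable_fun_limn_esup _ _ _ _ (fun k w => (Ysum k w)%:E)) => k.
by apply/measurable_EFinP; exact: measurable_Ysum.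
Qed.

Lemma fine_limn_esup (u : nat -> R) (l : R) : u @ \oo --> l -> fine (limn_esup (fun n => (u n)%:E)) = l.
Proof.
move=> ul; have : (fun n => (u n)%:E) @ \oo --> l%:E by apply: cvg_EFin => //; exact: nearW.
by move=> /cvg_limn_einf_sup[_ ->].
Qed.

Lemma Xsum_Lamw w m k : locfin lam w -> Xsum m k w = Lamw lam w (pvK m.+1%:R^-1 k.+1%:R).
Proof.
move=> lw; rewrite /Xsum !Nf_Lamw//; [|exact: pvKn_ge0|exact: lipcs_pvKn|exact: pvKp_ge0|exact: lipcs_pvKp].
have bl (f : R -> R) : lipcs f -> bs f by move=> [_ [M _ fM]]; exists M.
rewrite -(LamB (LamwE lw)); [|by apply: bl; exact: lipcs_pvKp|by apply: bl; exact: lipcs_pvKn].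
by congr (Lamw lam w); apply/funext => x; exact: pvKpn.
Qed.

Let c0 : 0 < (2 * pi)^-1 :> R. Proof. by rewrite invr_gt0 mulr_gt0// pi_gt0. Qed.

Lemma Xsum_cvg w k : regular lam w -> (fun m => Xsum m k w) @ \oo --> Ysum k w.
Proof.
move=> [lw HP HN].
have h : (fun m => Xsum m k w) @ \oo --> Lamw lam w (pvKz k.+1%:R).
  rewrite (_ : (fun m => _) = fun m => Lamw lam w (pvK m.+1%:R^-1 k.+1%:R)).
    exact: (Lam_pvK_cvg (LamwE lw)).
  by apply/funext => m; exact: Xsum_Lamw.
by rewrite /Ysum (fine_limn_esup h).
Qed.

Lemma Ysum_cvg w : regular lam w -> (fun k => Ysum k w) @ \oo --> lim (pvS (Lamw lam w) u @[u --> +oo]).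
Proof.
move=> rw; have [lw HP HN] := rw.
have := Lam_pvKz_cvg (LamwE lw) c0 HP HN; rewrite -cvg_shiftS.
apply: cvg_trans; apply: near_eq_cvg; apply: nearW => k /=.
have h1 := @Xsum_cvg w k rw.
have h2 : (fun m => Xsum m k w) @ \oo --> Lamw lam w (pvKz k.+1%:R).
  rewrite (_ : (fun m => _) = fun m => Lamw lam w (pvK m.+1%:R^-1 k.+1%:R)).
    exact: (Lam_pvK_cvg (LamwE lw)).
  by apply/funext => m; exact: Xsum_Lamw.
by rewrite -(cvg_lim _ h2)// (cvg_lim _ h1).
Qed.

Lemma Lsum_regular w : regular lam w ->
  pv_partial lam w r @[r --> +oo] --> Lsum w /\ (fun k => Ysum k w) @ \oo --> Lsum w.
Proof.
move=> rw; have h := Ysum_cvg rw; have [lw HP HN] := rw.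
rewrite /Lsum (fine_limn_esup h); split => //.
rewrite (_ : (fun r => pv_partial lam w r) = pvS (Lamw lam w)); last by apply/funext => r; exact: pv_partialE.
exact: (pvS_cvg (LamwE lw) c0 HP HN).
Qed.

Lemma cauchyK_shift_props (a b : R) : 0 < a ->
  (forall x : R, `|cauchyK a (x - b)| <= a^-1) /\
  (forall x y : R, `|cauchyK a (x - b) - cauchyK a (y - b)| <= a ^- 2 * `|x - y|).
Proof.
move=> a0; split=> [x|x y].
  by rewrite ger0_norm ?cauchyK_ge0 ?(ltW a0)// cauchyK_le.
apply: le_trans (cauchyK_lip _ _ a0) _.
by rewrite (_ : x - b - (y - b) = x - y)//; ring.
Qed.

Lemma EP_resolvent_Xsum (a b : R) : 0 < a -> exists2 C : R, 0 < C & forall m k,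
  `|EP P (fun w => cauchyK a (Xsum m k w - b)) - cauchyK (a + 2^-1) b| <=
  C * (Num.sqrt (m.+1%:R^-1 : R) + Num.sqrt (k.+1%:R^-1 : R)).
Proof.
move=> a0; have [C C0 HC] := cbeE_pvK beta0 b a0; exists C => // m k.
have [hB hL] := cauchyK_shift_props b a0.
have y0 : 0 < m.+1%:R^-1 :> R by rewrite invr_gt0 ltr0n.
have y1 : m.+1%:R^-1 <= 1 :> R by rewrite invf_le1 ?ltr0n// ler1n.
have r1 : 1 <= k.+1%:R :> R by rewrite ler1n.
have [n0 Hn0] := HC _ _ y0 y1 r1.
have L0 : 0 <= a ^- 2 by rewrite invr_ge0 sqr_ge0.
have cv := cbeE_transfer beta0 HS hB L0 hL (lipcs_pvKp m k) (lipcs_pvKn m k) (pvKp_ge0 m k) (pvKn_ge0 m k).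
have cv' : (fun n => `|cbeE beta n (fun s => cauchyK a (linst n (pvKp m k) s - linst n (pvKn m k) s - b)) - cauchyK (a + 2^-1) b|)
   @ \oo --> `|EP P (fun w => cauchyK a (Xsum m k w - b)) - cauchyK (a + 2^-1) b|.
  by apply: cvg_norm; apply: cvgB; [exact: cv|exact: cvg_cst].
rewrite -(cvg_lim _ cv')//; apply: limr_le; first exact: (cvgP _ cv').
exists n0 => // n /= nn; have := Hn0 n nn; rewrite sqrtrV ?ler0n//.
rewrite [X in `|X - _|](_ : _ = cbeE beta n (fun s => cauchyK a (linst n (pvKp m k) s - linst n (pvKn m k) s - b))) ?sqrtrV ?ler0n//.
congr cbeE; apply/funext => s; congr (cauchyK a (_ - b)).
by rewrite /linst -sumrB; apply: eq_bigr => t _; rewrite pvKpn.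
Qed.

Lemma measurable_cauchyK_shift (a b : R) (X : Omega -> R) : 0 < a -> measurable_fun setT X ->
  measurable_fun setT (fun w => cauchyK a (X w - b)).
Proof.
move=> a0 mX; have [_ hL] := cauchyK_shift_props b a0.
apply: (measurableT_comp (f := fun x : R => cauchyK a (x - b))) => //.
by apply: continuous_measurable_fun; exact: lip_continuous hL.
Qed.

Lemma cauchyK_shift_cvg (a b : R) (u : nat -> R) (l : R) : 0 < a -> u @ \oo --> l ->
  (fun n => cauchyK a (u n - b)) @ \oo --> cauchyK a (l - b).
Proof.
move=> a0 ul; have [_ hL] := cauchyK_shift_props b a0.
have hc := lip_continuous hL.
exact: (cvg_comp _ _ ul (hc l)).
Qed.

Lemma sqrt_harmonic_cvg : (fun n => Num.sqrt (n.+1%:R^-1 : R)) @ \oo --> (0 : R).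
Proof. by rewrite -(@sqrtr0 R); exact: (cvg_comp _ _ cvg_harmonic (@sqrt_continuous R 0)). Qed.

(** Bounded convergence carries the estimate of [EP_resolvent_Xsum] through both limits; its error
    bound vanishes since C does not depend on m or k. *)
Lemma EP_resolvent (a b : R) : 0 < a ->
  EP P (fun w => cauchyK a (Lsum w - b)) = cauchyK (a + 2^-1) b.
Proof.
move=> a0; have [hB hL] := cauchyK_shift_props b a0.
have reg := regular_ae beta0 HS.
have [C C0 HC] := EP_resolvent_Xsum b a0.
have c1 k : (fun m => EP P (fun w => cauchyK a (Xsum m k w - b))) @ \oo --> EP P (fun w => cauchyK a (Ysum k w - b)).
  apply: (@EP_bounded_cvg _ _ _ P _ _ a^-1) => [m|m w||].
  - exact: measurable_cauchyK_shift a0 (measurable_Xsum m k).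
  - exact: hB.
  - exact: measurable_cauchyK_shift a0 (measurable_Ysum k).
  - by apply: filterS reg => w rw; apply: cauchyK_shift_cvg a0 _; exact: Xsum_cvg.
have c2 : (fun k => EP P (fun w => cauchyK a (Ysum k w - b))) @ \oo --> EP P (fun w => cauchyK a (Lsum w - b)).
  apply: (@EP_bounded_cvg _ _ _ P _ _ a^-1) => [k|k w||].
  - exact: measurable_cauchyK_shift a0 (measurable_Ysum k).
  - exact: hB.
  - exact: measurable_cauchyK_shift a0 measurable_Lsum.
  - by apply: filterS reg => w rw; apply: cauchyK_shift_cvg a0 _; exact: (Lsum_regular rw).2.
set T := cauchyK _ b.
have b1 k : `|EP P (fun w => cauchyK a (Ysum k w - b)) - T| <= C * Num.sqrt (k.+1%:R^-1 : R).
  have h1 : (fun m => `|EP P (fun w => cauchyK a (Xsum m k w - b)) - T|) @ \oo -->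
      `|EP P (fun w => cauchyK a (Ysum k w - b)) - T|.
    by apply: cvg_norm; apply: cvgB; [exact: c1|exact: cvg_cst].
  have h2 : (fun m => C * (Num.sqrt (m.+1%:R^-1 : R) + Num.sqrt (k.+1%:R^-1 : R))) @ \oo -->
      C * (0 + Num.sqrt (k.+1%:R^-1 : R)).
    by apply: cvgM; [exact: cvg_cst|apply: cvgD; [exact: sqrt_harmonic_cvg|exact: cvg_cst]].
  rewrite add0r in h2; rewrite -(cvg_lim _ h1)// -(cvg_lim _ h2)//.
  by apply: ler_lim; [exact: (cvgP _ h1)|exact: (cvgP _ h2)|apply: nearW => m; exact: HC].
have h1 : (fun k => `|EP P (fun w => cauchyK a (Ysum k w - b)) - T|) @ \oo -->
    `|EP P (fun w => cauchyK a (Lsum w - b)) - T|.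
  by apply: cvg_norm; apply: cvgB; [exact: c2|exact: cvg_cst].
have h2 : (fun k => C * Num.sqrt (k.+1%:R^-1 : R)) @ \oo --> C * 0.
  by apply: cvgM; [exact: cvg_cst|exact: sqrt_harmonic_cvg].
have : `|EP P (fun w => cauchyK a (Lsum w - b)) - T| <= 0.
  rewrite mulr0 in h2; rewrite -(cvg_lim _ h1)// -(cvg_lim _ h2)//.
  by apply: ler_lim; [exact: (cvgP _ h1)|exact: (cvgP _ h2)|apply: nearW => k; exact: b1].
by rewrite normr_le0 subr_eq0 => /eqP.
Qed.

End LimitSum.

(** * Quantitative Taylor bounds for the arctangent *)

Section Arctangent.
Context {R : realType}.
Implicit Types (x y h : R).

Lemma atan_mvt x y : x < y -> exists2 z, x < z < y & atan y - atan x = (1 + z ^+ 2)^-1 * (y - x).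
Proof.
move=> xy; have [z] := @MVT R (@atan R) (fun z => (1 + z ^+ 2)^-1) x y xy
  (fun z _ => is_derive1_atan z) (continuous_subspaceT (@continuous_atan R)).
by rewrite in_itv/= => zxy e; exists z.
Qed.

Lemma cauchyK1E x : cauchyK 1 x = (1 + x ^+ 2)^-1.
Proof. by rewrite /cauchyK expr1n div1r. Qed.

Lemma atan_taylor x h : `|atan (x + h) - atan x - h * cauchyK 1 x| <= h ^+ 2.
Proof.
have key (z : R) : `|z - x| <= `|h| -> `|h * cauchyK 1 z - h * cauchyK 1 x| <= h ^+ 2.
  move=> zx; rewrite -mulrBr normrM -(real_normK (num_real h)) expr2; apply: ler_wpM2l => //.
  by apply: le_trans (cauchyK_lip z x ltr01) _; rewrite expr1n invr1 mul1r.
have [h0|h0|->] := ltgtP h 0; last by rewrite addr0 subrr mul0r subr0 normr0 expr0n.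
  have xh : x + h < x by rewrite gtrDl.
  have [z /andP[z1 z2] e] := atan_mvt xh.
  have -> : atan (x + h) - atan x = h * cauchyK 1 z.
    rewrite cauchyK1E -[LHS]opprB e; ring.
  by apply: key; rewrite (ltr0_norm h0) ler_norml; apply/andP; split; lra.
have xh : x < x + h by rewrite ltrDl.
have [z /andP[z1 z2] e] := atan_mvt xh.
have -> : atan (x + h) - atan x = h * cauchyK 1 z by rewrite cauchyK1E e; ring.
by apply: key; rewrite (gtr0_norm h0) ler_norml; apply/andP; split; lra.
Qed.

Lemma atan_scale_taylor (a x h : R) : 0 < a ->
  `|atan ((x + h) / a) - atan (x / a) - h * cauchyK a x| <= a ^- 2 * h ^+ 2.
Proof.
move=> a0; have := atan_taylor (x / a) (h / a); rewrite -mulrDl.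
have -> : h / a * cauchyK 1 (x / a) = h * cauchyK a x.
  rewrite /cauchyK; field.
  have h1 : 0 < a ^+ 2 + x ^+ 2 by rewrite ltr_wpDr ?sqr_ge0// exprn_gt0.
  by rewrite !gt_eqF.
by rewrite exprMn exprVn [_ * h ^+ 2]mulrC.
Qed.

Lemma norm_atan_le x : `|atan x| <= pi.
Proof.
have := atan_gtNpi2 x; have := atan_ltpi2 x; have := pi_gt0 R.
rewrite ler_norml => *; apply/andP; split; lra.
Qed.

Lemma atan_lip x y : `|atan x - atan y| <= `|x - y|.
Proof.
wlog xy : x y / x < y => [hw|].
  have [xy|yx|->] := ltgtP x y; [exact: hw|rewrite distrC [leRHS]distrC; exact: hw|by rewrite !subrr].
have [z _ e] := atan_mvt xy; rewrite distrC e [leRHS]distrC normrM ler_piMl//.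
have z0 : 0 < 1 + z ^+ 2 by rewrite ltr_wpDr ?sqr_ge0.
by rewrite gtr0_norm ?invr_gt0// invf_le1// lerDl sqr_ge0.
Qed.

(** Cutting [u, v] into n steps leaves a total variation of order 1/n. This replaces differentiation
    under the expectation. *)
Lemma cst_of_quadratic (D : R -> R) (C : R) : (forall x h, `|D (x + h) - D x| <= C * h ^+ 2) ->
  forall u v, D u = D v.
Proof.
move=> HD u v; apply/eqP; rewrite eq_sym -subr_eq0 -normr_le0; apply/ler_addgt0Pr => e e0; rewrite add0r.
have C0 : 0 <= C by have := HD 0 1; rewrite expr1n mulr1; apply: le_trans.
pose K := C * (v - u) ^+ 2.
have K0 : 0 <= K by rewrite mulr_ge0 ?sqr_ge0.
pose n := (Num.bound (K / e)).+1; have n0 : (0 : R) < n%:R by rewrite ltr0n.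
pose s := (v - u) / n%:R.
have step i : `|D (u + i%:R * s) - D u| <= i%:R * (C * s ^+ 2).
  elim: i => [|i IH]; first by rewrite !mul0r addr0 subrr normr0.
  rewrite -(@natr1 _ i) !mulrDl !mul1r addrA.
  rewrite (_ : D (u + i%:R * s + s) - D u = (D (u + i%:R * s + s) - D (u + i%:R * s)) + (D (u + i%:R * s) - D u)); last by ring.
  by apply: le_trans (ler_normD _ _) _; rewrite addrC lerD.
have := step n; have -> : u + n%:R * s = v by rewrite /s mulrC divfK ?gt_eqF// addrC subrK.
move=> /le_trans; apply.
have -> : n%:R * (C * s ^+ 2) = K / n%:R by rewrite /s /K; field; rewrite gt_eqF.
rewrite ler_pdivrMr// -ler_pdivrMl// mulrC.
apply: ltW; apply: lt_le_trans (archi_boundP _) _; first by rewrite divr_ge0// ltW.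
by rewrite ler_nat.
Qed.

Lemma atan_sg_cvg (z : R) : (fun n : nat => atan (z / n.+1%:R^-1)) @ \oo --> pi / 2 * Num.sg z.
Proof.
have pos (x : R) : 0 < x -> (fun n : nat => atan (x / n.+1%:R^-1)) @ \oo --> pi / 2.
  move=> x0; apply: (cvg_comp _ _ _ (@cvgy_atan R)).
  rewrite (_ : (fun n : nat => x / n.+1%:R^-1) = (fun n : nat => x * n.+1%:R)); last first.
    by apply/funext => n; rewrite invrK.
  apply/cvgryPge => A; near=> n; rewrite -ler_pdivrMl//.
  apply: (@le_trans _ _ n%:R); last by rewrite ler_nat.
  by near: n; apply: nbhs_infty_ger; exact: num_real.
have [z0|z0|->] := ltgtP z 0.
- rewrite ltr0_sg// mulrN1 (_ : (fun n : nat => _) = (fun n : nat => - atan ((- z) / n.+1%:R^-1))); last first.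
    by apply/funext => n; rewrite -atanN mulNr opprK.
  by apply: cvgN; apply: pos; rewrite oppr_gt0.
- by rewrite gtr0_sg// mulr1; exact: pos.
- rewrite sgr0 mulr0 (_ : (fun n : nat => _) = fun=> 0); first exact: cvg_cst.
  by apply/funext => n; rewrite mul0r atan0.
Unshelve. all: by end_near. Qed.

Lemma sg_le x y : x <= y -> Num.sg x <= Num.sg y.
Proof.
by have [x0|x0|->] := ltgtP x 0; have [y0|y0|->] := ltgtP y 0;
  rewrite ?sgr0 ?(gtr0_sg x0) ?(ltr0_sg x0) ?(gtr0_sg y0) ?(ltr0_sg y0); lra.
Qed.

End Arctangent.

(** * From the resolvent identity to probabilities of intervals *)

Section Law.
Context {R : realType} {d : measure_display} {Omega : measurableType d} (P : probability Omega R).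
Variables (L : Omega -> R).
Hypothesis (mL : measurable_fun setT L).
Hypothesis (HL : forall a b : R, 0 < a -> EP P (fun w => cauchyK a (L w - b)) = cauchyK (a + 2^-1) b).

Let bm_comp (f : R -> R) (M : R) : measurable_fun setT f -> (forall x, `|f x| <= M) -> bm (fun w => f (L w)).
Proof. by move=> mf fM; split; [exact: measurableT_comp|exists M]. Qed.

Let atan_meas (a b : R) : measurable_fun setT (fun x : R => atan ((b - x) / a)).
Proof.
apply: continuous_measurable_fun; apply: (@lip_continuous _ _ `|a^-1|) => x y.
apply: le_trans (atan_lip _ _) _; rewrite -mulrBl normrM mulrC.
by rewrite (_ : b - x - (b - y) = - (x - y)) ?normrN//; ring.
Qed.

Let bm_atan (a b : R) : bm (fun w => atan ((b - L w) / a)).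
Proof. by apply: (bm_comp (f := fun x => atan ((b - x) / a)) (atan_meas a b)) => x; exact: norm_atan_le. Qed.

(** The resolvent identity integrated in b: as functions of b, the mean arctangent and the explicit
    one have the same first-order term, so their difference has quadratic increments and is
    constant. *)
Lemma EP_atan (a u v : R) : 0 < a ->
  EP P (fun w => atan ((v - L w) / a)) - EP P (fun w => atan ((u - L w) / a)) =
  atan (v / (a + 2^-1)) - atan (u / (a + 2^-1)).
Proof.
move=> a0; have a'0 : 0 < a + 2^-1 by rewrite addr_gt0.
pose D b := EP P (fun w => atan ((b - L w) / a)) - atan (b / (a + 2^-1)).
suff : D u = D v by rewrite /D; lra.
apply: (@cst_of_quadratic _ D (a ^- 2 + (a + 2^-1) ^- 2)) => b h.
have bc : bm (fun w => cauchyK a (L w - b)).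
  have [hB hL] := cauchyK_shift_props b a0.
  apply: (bm_comp (f := fun x => cauchyK a (x - b)) (M := a^-1)) => //.
  by apply: continuous_measurable_fun; exact: lip_continuous hL.
have h1 : `|EP P (fun w => atan ((b + h - L w) / a)) - EP P (fun w => atan ((b - L w) / a)) -
    h * cauchyK (a + 2^-1) b| <= a ^- 2 * h ^+ 2.
  rewrite -HL// -(EP_scale P h bc) -EP_sub// -(EP_sub P _ (bm_scale h bc)); last exact: bm_sub.
  rewrite -[leRHS](EP_cst P); apply: EP_norm_le; [by apply: bm_sub; [exact: bm_sub|exact: bm_scale]|exact: bm_cst|].
  move=> w; have := atan_scale_taylor (b - L w) h a0.
  rewrite (_ : b - L w + h = b + h - L w); last by ring.
  by rewrite (_ : cauchyK a (b - L w) = cauchyK a (L w - b))// /cauchyK -(sqrrN (b - L w)) opprB.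
have h2 := atan_scale_taylor b h a'0.
rewrite /D [leRHS]mulrDl; move: h1 h2; rewrite !ler_norml => /andP[? ?] /andP[? ?].
by apply/andP; split; lra.
Qed.

Let bm_sg (b : R) : bm (fun w => Num.sg (b - L w)).
Proof.
split; last by exists 1 => w; rewrite normr_sg; case: eqP.
have e : (fun w => Num.sg (b - L w)) = (fun w => \1_(L @^-1` `]-oo, b[) w - \1_(L @^-1` `]b, +oo[) w).
  apply/funext => w; rewrite !indicE.
  have [h|h|h] := ltgtP (L w) b.
  - rewrite mem_set ?memNset/=; [|by rewrite in_itv/= andbT; apply/negP; rewrite -leNgt ltW|by rewrite in_itv].
    by rewrite subr0 gtr0_sg// subr_gt0.
  - rewrite memNset ?mem_set/=; [|by rewrite in_itv/= andbT|by rewrite in_itv/=; apply/negP; rewrite -leNgt ltW].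
    by rewrite sub0r ltr0_sg// subr_lt0.
  - rewrite !memNset/=; [|by rewrite in_itv/= h ltxx|by rewrite in_itv/= h ltxx].
    by rewrite h !subrr sgr0.
rewrite e; apply: measurable_funB; apply: measurable_indic.
  by rewrite -[X in measurable X]setTI; apply: mL => //; exact: measurable_itv.
by rewrite -[X in measurable X]setTI; apply: mL => //; exact: measurable_itv.
Qed.

Lemma EP_sg (u v : R) :
  EP P (fun w => Num.sg (v - L w)) - EP P (fun w => Num.sg (u - L w)) =
  2 / pi * (atan (2 * v) - atan (2 * u)).
Proof.
have p0 := pi_gt0 R.
have lim b : (fun n : nat => EP P (fun w => atan ((b - L w) / n.+1%:R^-1))) @ \oo -->
    pi / 2 * EP P (fun w => Num.sg (b - L w)).
  rewrite -(EP_scale P (pi / 2) (bm_sg b)); apply: (@EP_bounded_cvg _ _ _ P _ _ pi) => [n|n w||].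
  - exact: (bm_atan _ _).1.
  - exact: norm_atan_le.
  - exact: (bm_scale (pi / 2) (bm_sg b)).1.
  - by apply: aeW => w; exact: atan_sg_cvg.
have rlim (b : R) : (fun n : nat => atan (b / (n.+1%:R^-1 + 2^-1))) @ \oo --> atan (2 * b).
  have h : (fun n : nat => b / (n.+1%:R^-1 + 2^-1)) @ \oo --> b / (0 + 2^-1).
    apply: cvgM; first exact: cvg_cst.
    apply: cvgV; first by rewrite add0r.
    by apply: cvgD; [exact: cvg_harmonic|exact: cvg_cst].
  have -> : 2 * b = b / (0 + 2^-1) by rewrite add0r invrK mulrC.
  exact: (cvg_comp _ _ h (@continuous_atan R _)).
have l1 : (fun n : nat => EP P (fun w => atan ((v - L w) / n.+1%:R^-1)) - EP P (fun w => atan ((u - L w) / n.+1%:R^-1)))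
   @ \oo --> pi / 2 * EP P (fun w => Num.sg (v - L w)) - pi / 2 * EP P (fun w => Num.sg (u - L w)).
  by apply: cvgB; exact: lim.
have l2 : (fun n : nat => EP P (fun w => atan ((v - L w) / n.+1%:R^-1)) - EP P (fun w => atan ((u - L w) / n.+1%:R^-1)))
   @ \oo --> atan (2 * v) - atan (2 * u).
  rewrite (_ : (fun n : nat => _) = (fun n : nat => atan (v / (n.+1%:R^-1 + 2^-1)) - atan (u / (n.+1%:R^-1 + 2^-1)))).
    by apply: cvgB; exact: rlim.
  by apply/funext => n; apply: EP_atan; rewrite invr_gt0 ltr0n.
have e : pi / 2 * EP P (fun w => Num.sg (v - L w)) - pi / 2 * EP P (fun w => Num.sg (u - L w)) = atan (2 * v) - atan (2 * u).
  by rewrite -(cvg_lim _ l1)// -(cvg_lim _ l2).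
have H (p : R) : p != 0 -> 2 / p * (p / 2) = 1 by move=> pn; field.
by rewrite -e -mulrBr mulrA H ?mul1r// gt_eqF.
Qed.

Let mpre (A : set R) : measurable A -> measurable (L @^-1` A).
Proof. by move=> mA; rewrite -[X in measurable X]setTI; exact: mL. Qed.

Let bm_ind (A : set Omega) : measurable A -> bm (\1_A : Omega -> R).
Proof.
move=> mA; split; first exact: measurable_indic.
by exists 1 => w; rewrite indicE; case: (_ \in _); rewrite ?normr1 ?normr0.
Qed.

Let EP_ind (A : set Omega) : measurable A -> (EP P (\1_A : Omega -> R))%:E = P A.
Proof.
move=> mA; rewrite /EP /Rintegral fineK; last first.
  by apply: integrable_fin_num => //; exact: bm_integrable (bm_ind mA).
by rewrite integral_indic// setIT.
Qed.

(** The sign of b - L jumps by 2 across an atom, whereas by [EP_sg] its mean is Lipschitz in b. *)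
Lemma EP_atom (u : R) : EP P (\1_(L @^-1` [set u]) : Omega -> R) = 0.
Proof.
have p0 := pi_gt0 R; have p2 := pi_ge2 R.
have mu := mpre (measurable_set1 u).
apply/eqP; rewrite eq_le; apply/andP; split; last first.
  by rewrite -[leLHS](EP_cst P); apply: EP_le; [exact: bm_cst|exact: bm_ind|move=> w; rewrite indicE ler0n].
apply/ler_addgt0Pr => e e0; rewrite add0r.
have e8 : 0 < e / 8 by rewrite divr_gt0.
have : EP P (fun w => 2 * \1_(L @^-1` [set u]) w) <= EP P (fun w => Num.sg (u + e / 8 - L w) - Num.sg (u - e / 8 - L w)).
  apply: EP_le; [by apply: bm_scale; exact: bm_ind|by apply: bm_sub; exact: bm_sg|move=> w].
  rewrite indicE; have [/set_mem/= ->|_]/= := boolP (w \in L @^-1` [set u]).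
    by rewrite [u + _ - u]addrAC subrr add0r [u - _ - u]addrAC subrr sub0r gtr0_sg// ltr0_sg ?oppr_lt0//; lra.
  by rewrite mulr0 subr_ge0; apply: sg_le; lra.
rewrite EP_scale; last exact: bm_ind.
rewrite (EP_sub P (bm_sg _) (bm_sg _)) EP_sg => h.
have al := atan_lip (2 * (u + e / 8)) (2 * (u - e / 8)).
have e1 : `|2 * (u + e / 8) - 2 * (u - e / 8)| = e / 2 by rewrite ger0_norm; [field|lra].
have h2 : atan (2 * (u + e / 8)) - atan (2 * (u - e / 8)) <= e / 2 by rewrite -e1; apply: le_trans al; exact: ler_norm.
have pp : 2 / pi <= 1 :> R by rewrite ler_pdivrMr// mul1r.
have pp0 : 0 <= 2 / pi :> R by rewrite divr_ge0// ltW.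
have := ler_wpM2l pp0 h2; nra.
Qed.

(** Half the difference of the two signs is the indicator of the interval up to half atoms at the
    end points, which have mean 0. *)
Lemma P_itvoc (u v : R) : u < v -> P (L @^-1` `]u, v]) = (pi^-1 * (atan (2 * v) - atan (2 * u)))%:E.
Proof.
move=> uv; have muv := mpre (measurable_itv `]u, v]); rewrite -EP_ind//; congr EFin.
have mu := mpre (measurable_set1 u); have mv := mpre (measurable_set1 v).
have b1 := bm_sub (bm_sg v) (bm_sg u); have b2 := bm_sub (bm_ind mv) (bm_ind mu).
have -> : EP P (\1_(L @^-1` `]u, v]) : Omega -> R) =
    EP P (fun w => 2^-1 * (Num.sg (v - L w) - Num.sg (u - L w)) + 2^-1 * (\1_(L @^-1` [set v]) w - \1_(L @^-1` [set u]) w)).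
  congr EP; apply/funext => w; rewrite !indicE.
  have iE (A : set R) : (w \in L @^-1` A) = (L w \in A) by apply/idP/idP => /set_mem h; exact: mem_set.
  have i1 (z x : R) : (x \in [set z]) = (x == z) by apply/idP/eqP => [/set_mem//|->]; exact: mem_set.
  rewrite !iE !i1 mem_setE in_itv/=.
  have [h1|h1|h1] := ltgtP (L w) u; have [h2|h2|h2] := ltgtP (L w) v => /=; try lra.
  - by rewrite !gtr0_sg ?subr_gt0//; lra.
  - by rewrite [Num.sg (v - _)]gtr0_sg ?subr_gt0// ltr0_sg ?subr_lt0//; lra.
  - by rewrite !ltr0_sg ?subr_lt0//; lra.
  - by rewrite h2 subrr sgr0 ltr0_sg ?subr_lt0//; lra.
  - by rewrite h1 subrr sgr0 gtr0_sg ?subr_gt0//; lra.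
rewrite EP_add; [|exact: bm_scale|exact: bm_scale].
rewrite !EP_scale// (EP_sub P (bm_sg v) (bm_sg u)) (EP_sub P (bm_ind mv) (bm_ind mu)).
rewrite !EP_atom subrr mulr0 addr0 EP_sg mulrA; congr (_ * _).
by rewrite mulrA mulVf ?mul1r.
Qed.

End Law.

Section CauchyLaw.
Context {R : realType}.

Lemma cauchy_half_densityE (x : R) : cauchy_half_density x = pi^-1 * cauchyK 2^-1 x.
Proof.
have H (p : R) : p != 0 -> 1 / (2 * p * (x ^+ 2 + 1 / 4)) = p^-1 * (2^-1 / (2^-1 ^+ 2 + x ^+ 2)).
  have d0 : x ^+ 2 + 1 / 4 != 0 :> R by rewrite gt_eqF// ltr_wpDl ?sqr_ge0// divr_gt0.
  have -> : 2^-1 ^+ 2 + x ^+ 2 = x ^+ 2 + 1 / 4 by field.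
  by move: (_ + _) d0 => d d0 p0; field; rewrite p0 d0.
by rewrite /cauchy_half_density /cauchyK H// gt_eqF// pi_gt0.
Qed.

Lemma cauchy_half_density_ge0 (x : R) : 0 <= cauchy_half_density x.
Proof. by rewrite cauchy_half_densityE mulr_ge0 ?invr_ge0 ?pi_ge0 ?cauchyK_ge0. Qed.

Lemma continuous_cauchy_half_density : continuous (@cauchy_half_density R).
Proof.
have h0 : 0 < 2^-1 :> R by rewrite invr_gt0.
have -> : @cauchy_half_density R = (fun x => pi^-1 * cauchyK 2^-1 x).
  by apply/funext => x; exact: cauchy_half_densityE.
move=> x; apply: cvgM; first exact: cvg_cst.
exact: unif_cont_continuous (unif_cont_cauchyK h0) x.
Qed.

Lemma measurable_cauchy_half_density : measurable_fun setT (EFin \o @cauchy_half_density R).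
Proof.
by apply/measurable_EFinP; apply: continuous_measurable_fun; exact: continuous_cauchy_half_density.
Qed.

Lemma integral_cauchy_half_density (u v : R) : u < v ->
  (\int[@lebesgue_measure R]_(x in `]u, v]) (cauchy_half_density x)%:E)%E =
  (pi^-1 * (atan (2 * v) - atan (2 * u)))%:E.
Proof.
move=> uv; pose F (y : R) := pi^-1 * atan (2 * y).
have dF x : is_derive x (1 : R) F (cauchy_half_density x).
  have h1 : is_derive x (1 : R) (fun y : R => 2 * y) (2 * 1) by apply: is_deriveZ.
  have h2 := @is_derive1_comp R (@atan R) (fun y : R => 2 * y) x _ _ (is_derive1_atan (2 * x)) h1.
  have h3 : is_derive x (1 : R) F (pi^-1 * ((2 * 1) * (1 + (2 * x) ^+ 2)^-1)).
    by apply: is_deriveZ; apply: is_derive_eq h2 _; rewrite /GRing.scale/= mulrC.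
  apply: is_derive_eq h3 _; rewrite cauchy_half_densityE; congr (_ * _); rewrite /cauchyK.
  have d0 : 1 + (2 * x) ^+ 2 != 0 :> R by rewrite gt_eqF// ltr_wpDr ?sqr_ge0.
  have -> : 2^-1 ^+ 2 + x ^+ 2 = (1 + (2 * x) ^+ 2) / 4 by field.
  by move: (1 + _) d0 => z z0; field.
have Fc x : {for x, continuous F} by apply: differentiable_continuous; apply/derivable1_diffP; case: (dF x).
rewrite integral_itv_obnd_cbnd; last first.
  by apply: measurable_funTS; exact: measurable_cauchy_half_density.
rewrite (@continuous_FTC2 _ _ F)//.
- by rewrite -EFinB /F mulrBr.
- exact: continuous_subspaceT continuous_cauchy_half_density.
- split.
  + by move=> x _; case: (dF x).
  + by apply: cvg_at_right_filter; exact: Fc.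
  + by apply: cvg_at_left_filter; exact: Fc.
- by move=> x _; rewrite derive1E; case: (dF x).
Qed.

Definition cauchy_half (A : set R) : \bar R := (\int[@lebesgue_measure R]_(x in A) (cauchy_half_density x)%:E)%E.

Let cauchy_half0 : cauchy_half set0 = 0%E.
Proof. by rewrite /cauchy_half integral_set0. Qed.

Let cauchy_half_ge0 A : (0 <= cauchy_half A)%E.
Proof. by apply: integral_ge0 => x _; rewrite lee_fin cauchy_half_density_ge0. Qed.

Let cauchy_half_sigma_additive : semi_sigma_additive cauchy_half.
Proof.
move=> /= F mF tF mUF; rewrite /cauchy_half; apply: cvg_toP.
  apply: ereal_nondecreasing_is_cvgn => m n mn.
  apply: lee_sum_nneg_natr => // k _ _; exact: cauchy_half_ge0.
rewrite ge0_integral_bigcup//=.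
- by apply: measurable_funTS; exact: measurable_cauchy_half_density.
- by move=> x _; rewrite lee_fin cauchy_half_density_ge0.
Qed.

HB.instance Definition _ := isMeasure.Build _ _ _
  cauchy_half cauchy_half0 cauchy_half_ge0 cauchy_half_sigma_additive.

Context {d : measure_display} {Omega : measurableType d} (P : probability Omega R).
Variables (L : Omega -> R).
Hypothesis (mL : measurable_fun setT L).
Hypothesis (HL : forall a b : R, 0 < a -> EP P (fun w => cauchyK a (L w - b)) = cauchyK (a + 2^-1) b).

Definition law (A : set R) : \bar R := P (L @^-1` A).

Let law0 : law set0 = 0%E. Proof. by rewrite /law preimage_set0 measure0. Qed.
Let law_ge0 A : (0 <= law A)%E. Proof. exact: measure_ge0. Qed.

Let law_sigma_additive : semi_sigma_additive law.
Proof.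
move=> F mF tF mUF; rewrite /law preimage_bigcup; apply: measure_semi_sigma_additive.
- by move=> n; rewrite -[X in measurable X]setTI; exact: mL.
- apply/trivIsetP => /= i j _ _ ij; rewrite -preimage_setI.
  by move/trivIsetP : tF => /(_ _ _ _ _ ij) ->//; rewrite preimage_set0.
- by rewrite -preimage_bigcup -[X in measurable X]setTI; exact: mL.
Qed.

HB.instance Definition _ := isMeasure.Build _ _ _ law law0 law_ge0 law_sigma_additive.

(** Both sides are measures agreeing on half-open intervals, a class stable under intersection that
    generates the Borel sets. *)
Lemma law_cauchy_half (A : set R) : measurable A -> law A = cauchy_half A.
Proof.
apply: (@measure_unique _ _ _ (@ocitv R) (fun k => `]- k%:R, k%:R]%classic)) => //.
- exact: ocitvI.
- by move=> k; exact: is_ocitv.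
- rewrite -subTset => x _; exists (Num.bound `|x|).+1 => //=.
  have := archi_boundP (normr_ge0 x); rewrite ltr_norml in_itv/= => /andP[x1 x2].
  by rewrite -natr1; apply/andP; split; lra.
- move=> X /ocitvP[->|[[u v] /= uv ->]]; first by rewrite !measure0.
  by rewrite /law /cauchy_half integral_cauchy_half_density// (P_itvoc mL HL uv).
- by move=> k; apply: le_lt_trans (probability_le1 P _) _; rewrite ?ltry// -[X in measurable X]setTI; apply: mL => //; exact: measurable_itv.
Qed.

End CauchyLaw.

Theorem theorem6p3 (R : realType) (d : measure_display) (Omega : measurableType d)
  (P : probability Omega R) (beta : R) (lam : int -> Omega -> R) :
  0 < beta -> is_Sine_beta P beta lam ->
  exists L : Omega -> R,
    measurable_fun setT L /\
    {ae P, forall w,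
        (forall r : R, finite_set [set k | `|lam k w| <= r]) /\
        pv_partial lam w r @[r --> +oo] --> L w} /\
    (forall A : set R, measurable A ->
       P (L @^-1` A) =
       (\int[@lebesgue_measure R]_(x in A) (cauchy_half_density x)%:E)%E).
Proof.
move=> beta0 HS; have mL := measurable_Lsum HS; exists (Lsum lam); split => //; split.
  apply: filterS (regular_ae beta0 HS) => w rw; split; first by case: rw.
  exact: (Lsum_regular rw).1.
move=> A; apply: (law_cauchy_half mL) => a b a0; exact: EP_resolvent beta0 HS a b a0.
Qed.
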